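(* $\phi$-minimal representations exist for the classical compact hermitian symmetric spaces $M_\phi=K/K_\phi$ of types AIII, BDI, DIII, CI, and they are minimal with respect to explicit chains of subalgebras, as follows. - **AIII.** $M_\phi=SU(n)/S(U(k)\times U(n-k))$, $\phi=\alpha_k$. The fundamental representation $f_{\mathfrak{su}(n)}$ is $\phi$-minimal. It decomposes under $\mathfrak{s}(\mathfrak{u}(k)\oplus\mathfrak{u}(n-k))$ as $V_+\oplus V_-$ with $V_+=(f_{\mathfrak{u}(k)},0)$, $V_-=(0,f_{\mathfrak{u}(n-k)})$, and $\Lambda_\phi=i\frac{n-k}{n}$. It is minimal with respect to the chain $$\mathfrak{su}(n)\supset\mathfrak{s}(\mathfrak{u}(n-1)\oplus\mathfrak{u}(1))\supset\dots\supset\mathfrak{s}(\mathfrak{u}(n-i)\oplus\mathfrak{u}(1)^i)\supset\dots\supset\mathfrak{u}(1)^{n-1}.$$ Under $\mathfrak{s}(\mathfrak{u}(n-i)\oplus\mathfrak{u}(1)^i)$ one has $f_{\mathfrak{su}(n)}=W^i_+\oplus W^i_-$ with $W^i_+=(f_{\mathfrak{u}(n-i)},0,\dots,0)$ ($i$ zeros), and $W_+^i$ is $\alpha_{n-1-i}$-minimal, $\alpha_{n-1-i}$ being a root of $\mathfrak{su}(n-i)$. - **BDI.** $M_\phi=SO(n+2)/SO(n)\times SO(2)$, $\phi=\alpha_1$, with $n+2=2m$ or $n+2=2m+1$. The fundamental representation is not $\phi$-minimal. The spin representation $S^{(n+2)}=\wedge\mathbb{C}^m$ is $\phi$-minimal: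 $S^{(n+2)}=V_+\oplus V_-$ with $V_+=\wedge\langle d\bar z_i,\ i=1,\dots,m-1\rangle$ and $V_-=V_+\otimes d\bar z_m$, which are respectively the representations $(S^{(n)},\pm\frac i2)$ of $\mathfrak{so}(n)\oplus\mathfrak{so}(2)$, and $\Lambda_\phi=\frac i2$. It is minimal with respect to the chains $$\mathfrak{so}(2m)\supset\dots\supset\mathfrak{so}(2m-2j)\oplus\mathfrak{so}(2)^j\supset\dots\supset\mathfrak{so}(2)^m,$$ $$\mathfrak{so}(2m+1)\supset\dots\supset\mathfrak{so}(2m+1-2j)\oplus\mathfrak{so}(2)^j\supset\dots\supset\mathfrak{so}(3)\oplus\mathfrak{so}(2)^{m-1}$$ (for $n+2=2m$ and $n+2=2m+1$ respectively). At step $j$, $W^j_+=(S^{(n+2-2j)},\frac i2,\dots,\frac i2)$ ($j$ entries $\frac i2$), and $W^j_+$ is $\alpha_1$-minimal, $\alpha_1$ being the non compact root of $\mathfrak{so}(n+2-2j)$. - **DIII.** $M_\phi=SO(2n)/U(n)$, $\phi=\alpha_n$. The fundamental representation $V=\mathbb{C}^{2n}$ is $\phi$-minimal, $V=V_+\oplus V_-$ with $V_+=\{(a,ia):a\in\mathbb{C}^n\}=f_{\mathfrak{u}(n)}$, and $\Lambda_\phi=\frac i2$. It is minimal with respect to the chain $$\mathfrak{so}(2n)\supset\mathfrak{u}(n)\supset\dots\supset\mathfrak{u}(n-i)\oplus\mathfrak{u}(1)^i\supset\dots\supset\mathfrak{u}(1)^n.$$ Under $\mathfrak{u}(n-i)\oplus\mathfrak{u}(1)^i$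 one has $V=W^i_+\oplus W^i_-$ with $W^i_+=(f_{\mathfrak{u}(n-i)},0,\dots,0)$ ($i$ zeros), and $W^i_+$ is $\alpha_{n-i-1}$-minimal, $\alpha_{n-i-1}$ being a root of $\mathfrak{su}(n-i)$. - **CI.** $\mathfrak{k}=\mathfrak{sp}(n)$ (compact, of rank $n$, with fundamental representation of dimension $2n$), $\mathfrak{k}_\phi=\mathfrak{u}(n)$, $\phi=\alpha_n$. The fundamental representation is $\phi$-minimal, equal to $V_+\oplus V_-$ with $V_+=f_{\mathfrak{u}(n)}$, and $\Lambda_\phi=\frac i2$. It is minimal with respect to the chain $$\mathfrak{sp}(n)\supset\mathfrak{u}(n)\supset\mathfrak{u}(n-1)\oplus\mathfrak{u}(1)\supset\dots\supset\mathfrak{u}(1)^n.$$ Under $\mathfrak{u}(n-i)\oplus\mathfrak{u}(1)^i$ it decomposes as $W^i_+\oplus W^i_-$ with $W^i_+=(f_{\mathfrak{u}(n-i)},0,\dots,0)$ ($i$ zeros), and $W^i_+$ is $\alpha_{n-i-1}$-minimal, $\alpha_{n-i-1}$ being a root of $\mathfrak{su}(n-i)$.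
   Context: $\mathfrak{k}$ is the Lie algebra of a compact simple Lie group $K$, $\mathfrak{g}=\mathfrak{k}\otimes\mathbb{C}$, $\mathfrak{t}\subset\mathfrak{k}$ a Cartan subalgebra, $\Delta,\Delta^+$ the roots and a choice of positive roots, $\mathfrak{g}_\alpha$ the root spaces. Simple roots are labeled in the standard order of the classical Dynkin diagrams ($\alpha_1$ is the vector node of $B_m$ and $D_m$; $\alpha_{n-1},\alpha_n$ are the two spinor nodes of $D_n$; $\alpha_n$ is the long simple root of $C_n$). A simple root $\phi$ is non compact if its coefficient in every positive root is $0$ or $1$. Given $\phi$, roots with $\phi$-coefficient $0$ are called compact ($\Delta_c$), the others non compact. The subalgebra $\mathfrak{k}_\phi=\mathfrak{t}\oplus\bigoplus_{\alpha\in\Delta_c\cap\Delta^+}(\mathfrak{g}_\alpha\oplus\mathfrak{g}_{-\alpha})\cap\mathfrak{k}$ decomposes as $\mathfrak{k}_\phi=\mathfrak{k}'_\phi\oplus\mathfrak{z}_\phi$ with $\mathfrak{k}'_\phi$ semisimple and one dimensional center $\mathfrak{z}_\phi$ generated by $\rho_\phi\in\mathfrak{t}$, where $\alpha(\rho_\phi)=0$ for $\alpha\in\Delta_c$ and $\phi(\rho_\phi)=i$. $K_\phi\subset K$ is the subgroup integrating $\mathfrak{k}_\phi$, and $M_\phi=K/K_\phi$ is the corresponding compact hermitian symmetric space. For an irreducible representation $V(\Lambda)$ of $\mathfrak{k}$ of highest weight $\Lambda$ one has $V(\Lambda)=\bigoplus_{\ell\ge0}V(\Lambda)_\ell$, where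 $V(\Lambda)_\ell$ is $\mathfrak{k}_\phi$-invariant and $\rho_\phi$ acts on it as $\Lambda_\phi-i\ell$, with $\Lambda_\phi=\Lambda(\rho_\phi)$. The representation is $\phi$-minimal if the sum runs over $\ell=0,1$ only and $V(\Lambda)_0$ is irreducible; then $V_+=V(\Lambda)_0$ and $V_-=V(\Lambda)_1$. Chains: choose a non compact root $\phi_1$ of $\mathfrak{k}$ (possibly different from $\phi$) and set $\mathfrak{k}_1=\mathfrak{k}_{\phi_1}=\mathfrak{k}'_{\phi_1}\oplus\mathfrak{z}_1$, $\mathfrak{z}_1$ being the one dimensional center; iteratively choose a non compact root $\phi_i$ of $\mathfrak{k}'_{\phi_{i-1}}$, with corresponding subalgebra $\mathfrak{k}_{\phi_i}=\mathfrak{k}'_{\phi_i}\oplus\mathfrak{z}_i\subset\mathfrak{k}'_{\phi_{i-1}}$, and set $\mathfrak{k}_i=\mathfrak{k}_{\phi_i}\oplus\mathfrak{z}_{i-1}\oplus\dots\oplus\mathfrak{z}_1$. A representation $V(\Lambda)$ is minimal with respect to the chain $\mathfrak{k}\supset\mathfrak{k}_1\supset\mathfrak{k}_2\supset\dots$ if it is $\phi_1$-minimal, $V(\Lambda)=V^1_+\oplus V^1_-$, and at each further level $V^{i-1}_+$ is $\phi_i$-minimal, $V^{i-1}_+=V^i_+\oplus V^i_-$. For each subalgebra of the chain, $W_+$ denotes the corresponding $V^i_+$ and $W_-=V^i_-\oplus V^{i-1}_-\oplus\dots\oplus V^1_-$. In the claim the superscript of $W_\pm$ is the number of abelian factors $\mathfrak{u}(1)$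 or $\mathfrak{so}(2)$ displayed in the subalgebra. Notation: $f_{\mathfrak{l}}$ is the fundamental representation of $\mathfrak{l}$, and $0$ the trivial representation. $S^{(N)}$ is the spin representation of $\mathfrak{so}(N)$: with $z_1,\dots,z_m$ coordinates on $\mathbb{C}^m$, $m=\lfloor N/2\rfloor$, the gamma matrices act on $S^{(N)}=\wedge\mathbb{C}^m$ by $\Gamma_i=d\bar z_i\wedge$, $\Gamma_{\bar i}=\iota_{\partial_{\bar z_i}}$, together with $\Gamma_0=(-1)^{\deg}$ if $N$ is odd, and $X\in\mathfrak{so}(N)$ acts as $\frac18X_{ij}[\Gamma_i,\Gamma_j]$. An entry $\pm\frac i2$ is the value by which the corresponding generator of $\mathfrak{so}(2)$ acts.
   Formalization: For even n+2 the spin representation is reducible, so its minimality is stated for each half-spin summand; the last inclusion so(4)+so(2)^(m-2) > so(2)^m uses two successive simple roots (so(4) has no vector node), and so(2)^m is read as step j=m-1. *)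

(* Defs.v *)
From HB Require Import structures.
From mathcomp Require Import all_boot all_order all_algebra.
From mathcomp Require Import all_classical reals complex.

Set Implicit Arguments.
Unset Strict Implicit.
Unset Printing Implicit Defensive.

Import Order.TTheory GRing.Theory Num.Theory.
Local Open Scope classical_set_scope.
Local Open Scope ring_scope.

(** All Lie algebras are real Lie algebras of complex matrices, i.e. sets
    k : set 'M[R[i]]_N where R is the field of real numbers.  They are algebras
    of skew-hermitian matrices, so k meets 'i k trivially and the
    complexification of k is realised as k + 'i k inside 'M_N. *)

Definition lie {R : realType} {N : nat} (X Y : 'M[R[i]]_N) : 'M[R[i]]_N :=
  X *m Y - Y *m X.

Definition real_subspace {R : realType} {N : nat} (S : set 'M[R[i]]_N) : Prop :=
  [/\ S 0, forall X Y, S X -> S Y -> S (X + Y)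
    & forall (r : R) X, S X -> S ((r%:C)%C *: X)].

Definition real_span {R : realType} {N : nat} (S : set 'M[R[i]]_N) :
    set 'M[R[i]]_N :=
  [set X | forall V, real_subspace V -> S `<=` V -> V X].

Definition lie_subalgebra {R : realType} {N : nat} (k : set 'M[R[i]]_N) : Prop :=
  real_subspace k /\ forall X Y, k X -> k Y -> k (lie X Y).

Definition abelian_set {R : realType} {N : nat} (k : set 'M[R[i]]_N) : Prop :=
  forall X Y, k X -> k Y -> lie X Y = 0.

Definition lie_ideal {R : realType} {N : nat} (k I : set 'M[R[i]]_N) : Prop :=
  [/\ real_subspace I, I `<=` k & forall X Y, k X -> I Y -> I (lie X Y)].

Definition semisimple {R : realType} {N : nat} (k : set 'M[R[i]]_N) : Prop :=
  forall I, lie_ideal k I -> abelian_set I -> I `<=` [set 0].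

Definition lie_center {R : realType} {N : nat} (k : set 'M[R[i]]_N) :
    set 'M[R[i]]_N :=
  [set X | k X /\ forall Y, k Y -> lie X Y = 0].

Definition set_dsum {R : realType} {N : nat} (k a b : set 'M[R[i]]_N) : Prop :=
  k = [set X | exists A B, [/\ a A, b B & X = A + B]] /\ a `&` b `<=` [set 0].

Definition complexification {R : realType} {N : nat} (k : set 'M[R[i]]_N) :
    set 'M[R[i]]_N :=
  [set Z | exists X Y, [/\ k X, k Y & Z = X + 'i *: Y]].

Definition adjoint_mx {R : realType} {N : nat} (X : 'M[R[i]]_N) : 'M[R[i]]_N :=
  map_mx Num.conj X^T.

(** A Lie algebra [alg], a Cartan subalgebra [tor], and simple roots
    [simp 1], ..., [simp rnk] with their Dynkin labels.  Functionals on the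
    Cartan subalgebra are functions on 'M_N of which only the values on [tor]
    matter. *)
Record rootDatum (R : realType) (N : nat) := RootDatum {
  alg : set 'M[R[i]]_N;
  tor : set 'M[R[i]]_N;
  rnk : nat;
  simp : nat -> 'M[R[i]]_N -> R[i] }.

Definition cartan {R : realType} {N : nat} (k t : set 'M[R[i]]_N) : Prop :=
  [/\ real_subspace t, t `<=` k, abelian_set t
    & forall X, k X -> (forall H, t H -> lie H X = 0) -> t X].

Definition root_space {R : realType} {N : nat} (D : rootDatum R N)
    (b : 'M[R[i]]_N -> R[i]) : set 'M[R[i]]_N :=
  [set X | complexification (alg D) X /\
           forall H, tor D H -> lie H X = b H *: X].

Definition is_root {R : realType} {N : nat} (D : rootDatum R N)
    (b : 'M[R[i]]_N -> R[i]) : Prop :=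
  (exists2 H, tor D H & b H != 0) /\ (exists2 X, root_space D b X & X != 0).

(** c lists the coefficients of b in the simple roots. *)
Definition is_coef {R : realType} {N : nat} (D : rootDatum R N)
    (b : 'M[R[i]]_N -> R[i]) (c : nat -> int) : Prop :=
  forall H, tor D H -> b H = \sum_(1 <= j < (rnk D).+1) (c j)%:~R * simp D j H.

Definition is_base {R : realType} {N : nat} (D : rootDatum R N) : Prop :=
  [/\ forall j, (1 <= j <= rnk D)%N -> is_root D (simp D j),
      forall c : nat -> R[i],
        (forall H, tor D H ->
           \sum_(1 <= j < (rnk D).+1) c j * simp D j H = 0) ->
        forall j, (1 <= j <= rnk D)%N -> c j = 0
    & forall b, is_root D b -> exists2 c, is_coef D b c &
        (forall j, (1 <= j <= rnk D)%N -> 0 <= c j) \/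
        (forall j, (1 <= j <= rnk D)%N -> c j <= 0)].

Definition positive_root {R : realType} {N : nat} (D : rootDatum R N)
    (b : 'M[R[i]]_N -> R[i]) : Prop :=
  is_root D b /\ exists2 c, is_coef D b c &
    forall j, (1 <= j <= rnk D)%N -> 0 <= c j.

Definition well_formed {R : realType} {N : nat} (D : rootDatum R N) : Prop :=
  [/\ lie_subalgebra (alg D), forall X, alg D X -> adjoint_mx X = - X,
      semisimple (alg D), cartan (alg D) (tor D) & is_base D].

Section Phi.
Context {R : realType} {N : nat} (D : rootDatum R N) (s : nat).

Definition noncompact_simple : Prop :=
  (1 <= s <= rnk D)%N /\
  forall b c, positive_root D b -> is_coef D b c -> c s = 0 \/ c s = 1.

Definition compact_root (b : 'M[R[i]]_N -> R[i]) : Prop :=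
  is_root D b /\ exists2 c, is_coef D b c & c s = 0.

Definition k_phi : set 'M[R[i]]_N :=
  real_span (tor D `|`
    [set X | alg D X /\ exists2 b, compact_root b /\ positive_root D b &
       exists A B, [/\ root_space D b A, root_space D (fun H => - b H) B
                     & X = A + B]]).

Definition z_phi : set 'M[R[i]]_N := lie_center k_phi.

Definition is_rho (rho : 'M[R[i]]_N) : Prop :=
  [/\ tor D rho, forall b, compact_root b -> b rho = 0 & simp D s rho = 'i].

Definition hermitian_pair (h : set 'M[R[i]]_N) : Prop :=
  [/\ well_formed D, noncompact_simple & k_phi = h].

(** D' is the semisimple part of k_phi, with the Cartan subalgebra and the
    simple roots inherited from D. *)
Definition semisimple_part (D' : rootDatum R N) : Prop :=
  [/\ well_formed D', lie_ideal k_phi (alg D'), set_dsum k_phi (alg D') z_phi,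
      tor D' = tor D `&` alg D'
    & forall j, (1 <= j <= rnk D')%N -> exists j',
        [/\ (1 <= j' <= rnk D)%N, j' != s
          & forall H, tor D' H -> simp D' j H = simp D j' H]].

End Phi.

Section Representations.
Context {R : realType} {N : nat} {V : vectType R[i]}.
Implicit Types (k h : set 'M[R[i]]_N) (pi : 'M[R[i]]_N -> 'End(V)).
Implicit Types (U : {vspace V}).

Definition is_rep k pi : Prop :=
  [/\ forall X Y, k X -> k Y -> pi (X + Y) = pi X + pi Y,
      forall (r : R) X, k X -> pi ((r%:C)%C *: X) = (r%:C)%C *: pi X
    & forall X Y, k X -> k Y ->
        pi (lie X Y) = (pi X \o pi Y)%VF - (pi Y \o pi X)%VF].

Definition invariant_sub h pi U : Prop :=
  forall X, h X -> (pi X @: U <= U)%VS.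

Definition irreducible_rep h pi U : Prop :=
  [/\ U <> 0%VS, invariant_sub h pi U
    & forall W, (W <= U)%VS -> invariant_sub h pi W -> W = 0%VS \/ W = U].

(** U is an irreducible representation of highest weight L. *)
Definition has_highest_weight (D : rootDatum R N) pi U
    (L : 'M[R[i]]_N -> R[i]) : Prop :=
  [/\ is_rep (alg D) pi, irreducible_rep (alg D) pi U
    & exists v, [/\ v \in U, v != 0, forall H, tor D H -> pi H v = L H *: v
      & forall b A B, positive_root D b -> alg D A -> alg D B ->
          root_space D b (A + 'i *: B) -> pi A v + 'i *: pi B v = 0]].

Definition graded_piece pi U (rho : 'M[R[i]]_N) (lam : R[i]) (l : nat) :
    {vspace V} :=
  (U :&: passmx.leigenspace (pi rho) (lam - 'i * l%:R))%VS.

Definition is_dsum U U1 U2 : Prop := U = (U1 + U2)%VS /\ (U1 :&: U2 = 0)%VS.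

(** U is phi-minimal for phi = simp D s, with pieces U_+ = Up, U_- = Um and
    L_phi = lam.  "Only l = 0, 1" is read literally: Um may vanish. *)
Definition phi_minimal (D : rootDatum R N) (s : nat) pi U Up Um (lam : R[i]) :
    Prop :=
  exists L rho,
    [/\ is_rho D s rho, has_highest_weight D pi U L & lam = L rho] /\
    [/\ Up = graded_piece pi U rho lam 0, Um = graded_piece pi U rho lam 1,
        is_dsum U Up Um & irreducible_rep (k_phi D s) pi Up].

Definition is_phi_minimal (D : rootDatum R N) (s : nat) pi U : Prop :=
  exists Up Um lam, phi_minimal D s pi U Up Um lam.

(** Vp i = V^i_+ and Vm i = V^i_- for 1 <= i <= l, while Vp 0 is the whole
    representation. *)
Definition chain_minimal (D : nat -> rootDatum R N) (s : nat -> nat) (l : nat)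
    pi U (Vp Vm : nat -> {vspace V}) : Prop :=
  Vp 0%N = U /\
  forall i, (i < l)%N ->
    exists lam, phi_minimal (D i) (s i) pi (Vp i) (Vp i.+1) (Vm i.+1) lam.

(** W^i_- = V^i_- + ... + V^1_-. *)
Definition W_minus (Vm : nat -> {vspace V}) (i : nat) : {vspace V} :=
  (\sum_(1 <= j < i.+1) Vm j)%VS.

(** As a representation of h, U is isomorphic to tau. *)
Definition rep_iso h pi U (T : vectType R[i]) (tau : 'M[R[i]]_N -> 'End(T)) :
    Prop :=
  exists J : 'Hom(T, V),
    [/\ lker J = 0%VS, limg J = U
      & forall X a, h X -> pi X (J a) = J (tau X a)].

End Representations.

(** D i and simp (D i) (s i) are k'_{phi_i} and phi_{i+1}, with k'_{phi_0} = k. *)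
Definition is_chain {R : realType} {N : nat} (D : nat -> rootDatum R N)
    (s : nat -> nat) (l : nat) : Prop :=
  well_formed (D 0%N) /\
  forall i, (i < l)%N ->
    noncompact_simple (D i) (s i) /\ semisimple_part (D i) (s i) (D i.+1).

(** For i >= 1, the i-th subalgebra k_i = k_{phi_i} + z_{i-1} + ... + z_1. *)
Definition chain_alg {R : realType} {N : nat} (D : nat -> rootDatum R N)
    (s : nat -> nat) (i : nat) : set 'M[R[i]]_N :=
  [set X | exists Y (Z : nat -> 'M[R[i]]_N),
     [/\ k_phi (D i.-1) (s i.-1) Y,
         forall j, (j < i.-1)%N -> z_phi (D j) (s j) (Z j)
       & X = Y + \sum_(j < i.-1) Z j]].

Definition std_rep {R : realType} (N : nat) (X : 'M[R[i]]_N) :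
    'End('cV[R[i]]_N) :=
  linfun (mulmx X).

(** The span of the first p coordinate vectors. *)
Definition first_coords (R : realType) (n p : nat) : {vspace 'cV[R[i]]_n} :=
  (\sum_(j < n | (j < p)%N) <[delta_mx j 0%R : 'cV[R[i]]_n]>)%VS.

(** The upper left block of size n - i. *)
Definition ul_block {R : realType} {n : nat} (i : nat) (X : 'M[R[i]]_n) :
    'M[R[i]]_(n - i) :=
  mxsub (widen_ord (leq_subr i n)) (widen_ord (leq_subr i n)) X.

(** ** u(n) and su(n) *)

Definition u_alg (R : realType) (n : nat) : set 'M[R[i]]_n :=
  [set X | adjoint_mx X = - X].
Arguments u_alg : clear implicits.

Definition su_alg (R : realType) (n : nat) : set 'M[R[i]]_n :=
  [set X | u_alg R n X /\ \tr X = 0].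
Arguments su_alg : clear implicits.

(** u(p) + u(1)^(n-p) in u(n). *)
Definition u_block (R : realType) (n p : nat) : set 'M[R[i]]_n :=
  [set X | u_alg R n X /\
     forall u v : 'I_n, u != v -> ~~ ((u < p)%N && (v < p)%N) -> X u v = 0].
Arguments u_block : clear implicits.

(** s(u(p) + u(1)^(n-p)). *)
Definition su_block (R : realType) (n p : nat) : set 'M[R[i]]_n :=
  u_block R n p `&` su_alg R n.
Arguments su_block : clear implicits.

(** s(u(k) + u(l)). *)
Definition s_uu (R : realType) (k l : nat) : set 'M[R[i]]_(k + l) :=
  [set X | [/\ su_alg R (k + l) X, ursubmx X = 0 & dlsubmx X = 0]].
Arguments s_uu : clear implicits.

(** The k-th diagonal entry, with k >= 1. *)
Definition diag_eps {R : realType} {n : nat} (k : nat) (X : 'M[R[i]]_n) : R[i] :=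
  \sum_(p < n | p.+1 == k) X p p.

(** su(p) acting on the first p coordinates of C^n. *)
Definition suD (R : realType) (n p : nat) : rootDatum R n :=
  RootDatum
    [set X | su_alg R n X /\
       forall u v : 'I_n, ~~ ((u < p)%N && (v < p)%N) -> X u v = 0]
    [set X | [/\ su_alg R n X, is_diag_mx X
       & forall u : 'I_n, (p <= u)%N -> X u u = 0]]
    p.-1
    (fun k X => diag_eps k X - diag_eps k.+1 X).

(** Transport along an embedding e of matrix algebras with left inverse pr. *)
Definition mapD {R : realType} {n N : nat} (e : 'M[R[i]]_n -> 'M[R[i]]_N)
    (pr : 'M[R[i]]_N -> 'M[R[i]]_n) (D : rootDatum R n) : rootDatum R N :=
  RootDatum (e @` alg D) (e @` tor D) (rnk D) (fun k X => simp D k (pr X)).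

(** ** so(N), for N = 2m + b with b : bool.
    R^N has coordinates x_0 (if b = true), x_1, ..., x_m, y_1, ..., y_m, in
    this order.  Plane k is the (x_k, y_k)-plane; planes are numbered from 0 in
    the code.  so(2) is generated in this plane by H = E_(x y) - E_(y x), so
    H e_y = e_x and H e_x = - e_y. *)

Definition so_alg (R : realType) (N : nat) : set 'M[R[i]]_N :=
  [set X : 'M[R[i]]_N | (forall u v, X u v \is Num.real) /\ X^T = - X].
Arguments so_alg : clear implicits.

Definition xcoord (b : bool) {m : nat} (k : 'I_m) : 'I_(b + (m + m)) :=
  rshift b (lshift m k).
Definition ycoord (b : bool) {m : nat} (k : 'I_m) : 'I_(b + (m + m)) :=
  rshift b (rshift m k).

Definition plane_of {b : bool} {m : nat} (u : 'I_(b + (m + m))) : option 'I_m :=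
  match fintype.split u with
  | inl _ => None
  | inr v => Some (match fintype.split v with inl k => k | inr k => k end)
  end.

(** x_0 or a coordinate of one of the first p planes. *)
Definition in_planes {b : bool} {m : nat} (p : nat) (u : 'I_(b + (m + m))) :
    bool :=
  if plane_of u is Some k then (k < p)%N else true.

(** so(2p + b) + so(2)^(m-p). *)
Definition so_block (R : realType) (b : bool) (m p : nat) :
    set 'M[R[i]]_(b + (m + m)) :=
  [set X | so_alg R _ X /\
     forall u v, plane_of u != plane_of v -> ~~ (in_planes p u && in_planes p v) ->
       X u v = 0].
Arguments so_block : clear implicits.

(** The weight taking the value 'i on the generator H of plane k. *)
Definition plane_eps {R : realType} {b : bool} {m : nat} (k : nat)
    (X : 'M[R[i]]_(b + (m + m))) : R[i] :=
  'i * \sum_(q < m | q == k :> nat) X (xcoord b q) (ycoord b q).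

(** so(2p + b) acting on x_0 and the first p planes; e 1, ..., e p are the
    weights usually written eps_1, ..., eps_p. *)
Definition soD (R : realType) (b : bool) (m p : nat)
    (e : nat -> 'M[R[i]]_(b + (m + m)) -> R[i]) : rootDatum R (b + (m + m)) :=
  RootDatum
    [set X | so_alg R _ X /\
       forall u v, ~~ (in_planes p u && in_planes p v) -> X u v = 0]
    [set X | so_alg R _ X /\
       forall u v, ~~ [&& in_planes p u, in_planes p v & plane_of u == plane_of v]
         -> X u v = 0]
    p
    (fun k X => if (k < p)%N then e k X - e k.+1 X
                else if b then e p X else e p.-1 X + e p X).

(** The plane split off first is the last one: eps_k is carried by the k-th
    plane counted from the end. *)
Definition so_bdi (R : realType) (b : bool) (m p : nat) :
    rootDatum R (b + (m + m)) :=
  @soD R b m p (fun k => plane_eps (p - k)).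

Definition so_diii (R : realType) (n : nat) : rootDatum R (n + n) :=
  @soD R false n n (fun k => plane_eps k.-1).

(** The coordinates x_0, x_k, y_k with k <= m - j. *)
Definition plane_incl (b : bool) (m j : nat) (u : 'I_(b + (m - j + (m - j)))) :
    'I_(b + (m + m)) :=
  match fintype.split u with
  | inl z => lshift (m + m) z
  | inr v => match fintype.split v with
             | inl k => xcoord b (widen_ord (leq_subr j m) k)
             | inr k => ycoord b (widen_ord (leq_subr j m) k)
             end
  end.

Definition so_sub {R : realType} {b : bool} {m : nat} (j : nat)
    (X : 'M[R[i]]_(b + (m + m))) : 'M[R[i]]_(b + (m - j + (m - j))) :=
  mxsub (@plane_incl b m j) (@plane_incl b m j) X.

(** *** The spin representation on the exterior algebra of C^m.
    A form is the family of its coefficients on the monomials dz_I (product of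
    the d\bar z_i, i in I, in increasing order). *)

Notation ext R m := {ffun {set 'I_m} -> R[i]^o}.

Definition dz {R : realType} {m : nat} (I : {set 'I_m}) : ext R m :=
  [ffun J => (J == I)%:R].

Definition koszul {R : realType} {m : nat} (k : 'I_m) (I : {set 'I_m}) : R[i] :=
  (-1) ^+ #|[set j in I | (j < k)%N]|.

Definition wedge {R : realType} {m : nat} (k : 'I_m) : 'End(ext R m) :=
  linfun (fun f : ext R m =>
    [ffun I : {set 'I_m} =>
       if k \in I then koszul k I * f (I :\ k)%SET else 0] : ext R m).

Definition contract {R : realType} {m : nat} (k : 'I_m) : 'End(ext R m) :=
  linfun (fun f : ext R m =>
    [ffun I : {set 'I_m} =>
       if k \in I then 0 else koszul k I * f (k |: I)%SET] : ext R m).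

Definition degree_sign {R : realType} {m : nat} : 'End(ext R m) :=
  linfun (fun f : ext R m =>
    [ffun I : {set 'I_m} => (-1) ^+ #|I| * f I] : ext R m).

(** With z = x + i y one has d/dx = d/dz + d/d\bar z and
    d/dy = i (d/dz - d/d\bar z), so the gamma matrices wedge k and contract k
    of the complex frame give the following ones in the orthonormal frame. *)
Definition gamma {R : realType} {b : bool} {m : nat} (u : 'I_(b + (m + m))) :
    'End(ext R m) :=
  match fintype.split u with
  | inl _ => degree_sign
  | inr v => match fintype.split v with
             | inl k => wedge k + contract k
             | inr k => 'i *: (wedge k - contract k)
             end
  end.

Definition spin_rep {R : realType} {b : bool} {m : nat}
    (X : 'M[R[i]]_(b + (m + m))) : 'End(ext R m) :=
  8%:R^-1 *: \sum_u \sum_v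
    X u v *: ((gamma u \o gamma v)%VF - (gamma v \o gamma u)%VF).

(** The representation (S^(N-2j), c, ..., c) of so(N-2j) + so(2)^j. *)
Definition spin_char {R : realType} {b : bool} {m : nat} (j : nat) (c : R[i])
    (X : 'M[R[i]]_(b + (m + m))) : 'End(ext R (m - j)) :=
  spin_rep (so_sub j X)
    + (c * \sum_(k < m | (m - j <= k)%N) X (xcoord b k) (ycoord b k)) *: \1%VF.

Definition ext_span (R : realType) (m : nat) (P : {set 'I_m} -> bool) :
    {vspace ext R m} :=
  (\sum_(I : {set 'I_m} | P I) <[dz I : ext R m]>)%VS.

(** The exterior algebra of <d\bar z_1, ..., d\bar z_p>. *)
Definition ext_first (R : realType) (m p : nat) : {vspace ext R m} :=
  ext_span R (fun I : {set 'I_m} => [forall k in I, (k < p)%N]).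

(** ext_first (m-1) times d\bar z_m. *)
Definition ext_last (R : realType) (m : nat) : {vspace ext R m} :=
  ext_span R (fun I : {set 'I_m} => [exists k in I, k.+1 == m]).

(** The irreducible summands of the spin representation: all of it in odd
    dimension, the even and the odd half-spin representations in even
    dimension.  Minimality of the spin representation means minimality of
    each of them. *)
Definition spin_component (R : realType) (b : bool) (m : nat)
    (U : {vspace ext R m}) : Prop :=
  if b then U = fullv
  else exists e : bool, U = ext_span R (fun I : {set 'I_m} => odd #|I| == e).

(** ** u(n) in so(2n) and in sp(n) *)

Definition u_to_so {R : realType} {n : nat} (Y : 'M[R[i]]_n) :
    'M[R[i]]_(n + n) :=
  let A := map_mx (fun z => 'Re z) Y in let B := map_mx (fun z => 'Im z) Y in
  block_mx A B (- B) A.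

Definition so_to_u {R : realType} {n : nat} (X : 'M[R[i]]_(n + n)) :
    'M[R[i]]_n :=
  ulsubmx X + 'i *: ursubmx X.

Definition u_to_sp {R : realType} {n : nat} (Y : 'M[R[i]]_n) :
    'M[R[i]]_(n + n) :=
  block_mx Y 0 0 (map_mx Num.conj Y).

Definition sp_to_u {R : realType} {n : nat} (X : 'M[R[i]]_(n + n)) :
    'M[R[i]]_n :=
  ulsubmx X.

Definition sp_alg (R : realType) (n : nat) : set 'M[R[i]]_(n + n) :=
  let J : 'M[R[i]]_(n + n) := block_mx 0 1%:M (- 1%:M) 0 in
  [set X | u_alg R (n + n) X /\ X^T *m J + J *m X = 0].
Arguments sp_alg : clear implicits.

Definition spD (R : realType) (n : nat) : rootDatum R (n + n) :=
  RootDatum (sp_alg R n) [set X | sp_alg R n X /\ is_diag_mx X] n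
    (fun k X => if (k < n)%N
                then diag_eps k (sp_to_u X) - diag_eps k.+1 (sp_to_u X)
                else 2%:R * diag_eps n (sp_to_u X)).

(** a |-> (a, i a) and a |-> (a, 0). *)
Definition diii_incl {R : realType} {n : nat} :
    'Hom('cV[R[i]]_n, 'cV[R[i]]_(n + n)) :=
  linfun (fun a : 'cV[R[i]]_n => col_mx a ('i *: a)).

Definition ci_incl {R : realType} {n : nat} :
    'Hom('cV[R[i]]_n, 'cV[R[i]]_(n + n)) :=
  linfun (fun a : 'cV[R[i]]_n => col_mx a 0).

(** The chains k > u(n) > u(n-1) + u(1) > ... for k = so(2n), sp(n): the
    semisimple part of the i-th algebra is su(n-i+1). *)
Definition unchain {R : realType} {n : nat} (D0 : rootDatum R (n + n))
    (e : 'M[R[i]]_n -> 'M[R[i]]_(n + n))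
    (pr : 'M[R[i]]_(n + n) -> 'M[R[i]]_n) (i : nat) : rootDatum R (n + n) :=
  if i is i'.+1 then mapD e pr (suD R n (n - i')) else D0.

Definition unchain_root (n i : nat) : nat := if i is i'.+1 then n - i' - 1 else n.

(* Main.v *)
Require Import Defs.
From HB Require Import structures.
From mathcomp Require Import all_boot all_order all_algebra.
From mathcomp Require Import all_classical reals complex.
From mathcomp Require Import ring zify.

Set Implicit Arguments.
Unset Strict Implicit.
Unset Printing Implicit Defensive.

Import Order.TTheory GRing.Theory Num.Theory.
Local Open Scope classical_set_scope.
Local Open Scope ring_scope.

(** Every Lie algebra in sight becomes, in a unitary frame of weight vectors, the
    algebra of skew-hermitian matrices with a prescribed block support, subject
    to a symmetry X_(v* u* ) = - X_(u v) in the orthogonal and symplectic cases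
    and to a vanishing partial trace.  In such a frame the root vectors are
    (antisymmetrized) matrix units, rho_phi is a fundamental coweight, and k_phi
    is its centralizer; the i-th algebra of a chain is the common centralizer of
    the first i coweights.  Each representation has a basis of weight vectors
    with pairwise distinct weights, so an invariant subspace is spanned by basis
    vectors, irreducibility is connectedness of the graph of root vector moves,
    and phi-minimality is read off the eigenvalues of the coweight on the basis.
    On the spin representation the root vectors act by toggling one or two of
    the d\bar z_k. *)

(** * Block algebras and their root data *)

(** No root system is classified. A root vector has a nonzero entry in the frame, so its root is a
    difference of two weights, and the fundamental coweights are written down instead of being
    derived. Evaluating on them gives the coefficients of a root, the compact roots, rho_phi and non
    compactness. Since the matrices are skew-hermitian the trace form is definite, and
    semisimplicity reduces to the simple roots separating the torus. What resists uniform treatment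
    is type D. The coweights of the spinor nodes are half-integral, and a weight vector is not
    joined to its dual by a root vector, since 2 eps_k is not a root. The even chain ends in so(4),
    which is not simple: its node 1 is a spinor node, the even half-spin representation is trivial
    on the su(2) of that node, and so(2)^2 is reached only after a second step inside the other
    su(2). *)

Section MatrixLie.
Context {R : realType} {N : nat}.
Implicit Types (X Y Z : 'M[R[i]]_N) (k t : set 'M[R[i]]_N).

Lemma conj_real_complex (r : R) : ((r%:C)%C : R[i])^* = (r%:C)%C.
Proof. by apply/CrealP/complex_realP; exists r. Qed.

Lemma conj_mul (x y : R[i]) : (x * y)^* = x^* * y^*.
Proof. exact: rmorphM. Qed.

Lemma conj_opp (x : R[i]) : (- x)^* = - x^*.
Proof. exact: rmorphN. Qed.

Lemma conj_add (x y : R[i]) : (x + y)^* = x^* + y^*.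
Proof. exact: rmorphD. Qed.

Lemma conj_sub (x y : R[i]) : (x - y)^* = x^* - y^*.
Proof. exact: rmorphB. Qed.

Lemma conj_0 : (0 : R[i])^* = 0.
Proof. exact: rmorph0. Qed.

Lemma conj_half : (2%:R^-1 : R[i])^* = 2%:R^-1.
Proof. by apply/CrealP; rewrite rpredV realn. Qed.

Lemma adjoint_mxE X u v : adjoint_mx X u v = (X v u)^*.
Proof. by rewrite /adjoint_mx !mxE. Qed.

Lemma adjoint_mxK X : adjoint_mx (adjoint_mx X) = X.
Proof. by apply/matrixP => u v; rewrite !adjoint_mxE conjCK. Qed.

Lemma adjoint_mxM X Y : adjoint_mx (X *m Y) = adjoint_mx Y *m adjoint_mx X.
Proof. by rewrite /adjoint_mx trmx_mul map_mxM. Qed.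

Lemma adjoint_mxD X Y : adjoint_mx (X + Y) = adjoint_mx X + adjoint_mx Y.
Proof. by apply/matrixP => u v; rewrite !(adjoint_mxE, mxE) conj_add. Qed.

Lemma adjoint_mxN X : adjoint_mx (- X) = - adjoint_mx X.
Proof. by apply/matrixP => u v; rewrite !(adjoint_mxE, mxE) conj_opp. Qed.

Lemma adjoint_mxZ (c : R[i]) X : adjoint_mx (c *: X) = c^* *: adjoint_mx X.
Proof. by apply/matrixP => u v; rewrite !(adjoint_mxE, mxE) conj_mul. Qed.

Lemma lieDr X Y Z : lie X (Y + Z) = lie X Y + lie X Z.
Proof. by rewrite /lie mulmxDl mulmxDr opprD addrACA. Qed.

Lemma lieZl (c : R[i]) X Y : lie (c *: X) Y = c *: lie X Y.
Proof. by rewrite /lie -scalemxAl -scalemxAr scalerBr. Qed.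

Lemma lieZr (c : R[i]) X Y : lie X (c *: Y) = c *: lie X Y.
Proof. by rewrite /lie -scalemxAl -scalemxAr scalerBr. Qed.

Lemma lieC X Y : lie X Y = - lie Y X.
Proof. by rewrite /lie opprB. Qed.

Lemma lie0r X : lie X 0 = 0.
Proof. by rewrite /lie mulmx0 mul0mx subrr. Qed.

Lemma lie_suml (I : finType) (F : I -> 'M[R[i]]_N) Y :
  lie (\sum_j F j) Y = \sum_j lie (F j) Y.
Proof. by rewrite /lie mulmx_suml mulmx_sumr -sumrB. Qed.

Lemma adjoint_mx_lie X Y : adjoint_mx X = - X -> adjoint_mx Y = - Y ->
  adjoint_mx (lie X Y) = - lie X Y.
Proof.
move=> hX hY; rewrite /lie adjoint_mxD adjoint_mxN !adjoint_mxM hX hY.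
by rewrite !(mulNmx, mulmxN) !opprK opprB.
Qed.

Lemma real_subspaceB k X Y : real_subspace k -> k X -> k Y -> k (X - Y).
Proof.
case=> _ hD hZ hX hY; apply: hD => //.
have := hZ (-1) _ hY; rewrite rmorphN rmorph1 scaleN1r //.
Qed.

Lemma real_subspace_sum k (I : finType) (F : I -> 'M[R[i]]_N) :
  real_subspace k -> (forall j, k (F j)) -> k (\sum_j F j).
Proof. by case=> h0 hD _ hF; elim/big_ind: _. Qed.

Lemma real_spanP k : real_subspace (real_span k).
Proof.
split=> [V [] //|X Y hX hY V hV hk|r X hX V hV hk].
- by case: (hV) => _ + _; apply; [exact: hX|exact: hY].
- by case: (hV) => _ _; apply; exact: hX.
Qed.

Lemma sub_real_span k : k `<=` real_span k.
Proof. by move=> X hX V _; apply. Qed.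

(** The trace form is negative definite on skew-hermitian matrices: - tr (Z Z) is the sum of the
    squared moduli of the entries. *)
Lemma skew_trace_sq0 Z : adjoint_mx Z = - Z -> \tr (Z *m Z) = 0 -> Z = 0.
Proof.
move=> hZ tr0; have h : \sum_u \sum_v `|Z u v| ^+ 2 = 0.
  apply: oppr_inj; rewrite oppr0 -[RHS]tr0 /mxtrace -sumrN.
  apply: eq_bigr => u _; rewrite mxE -sumrN; apply: eq_bigr => v _.
  rewrite normCK -mulrN; congr (_ * _).
  by have := congr1 (fun W : 'M_N => W v u) hZ; rewrite adjoint_mxE mxE => ->; rewrite opprK.
apply/matrixP => u v; rewrite mxE; apply/eqP; rewrite -normr_eq0 -sqrf_eq0.
have h2 : forall w, 0 <= \sum_v `|Z w v| ^+ 2 by move=> w; apply: sumr_ge0 => ? _; exact: exprn_ge0.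
move/eqP: h; rewrite psumr_eq0 //; move/allP/(_ u); rewrite mem_index_enum => /(_ isT) /=.
rewrite psumr_eq0; last by move=> ? _; exact: exprn_ge0.
by move/allP/(_ v); rewrite mem_index_enum => /(_ isT).
Qed.

(** Invariance of the trace form, from the cyclicity of the trace. *)
Lemma trace_lie_mul X Y Z : \tr (lie X Y *m Z) = \tr (Y *m lie Z X).
Proof.
rewrite /lie mulmxBl mulmxBr !linearB /= -!mulmxA; congr (_ - _).
by rewrite mxtrace_mulC -mulmxA.
Qed.

(* If I is an abelian ideal, X in I and Y in k, then ad(X)^2 Y = 0, so
   [X, Y] has zero norm for the invariant form. *)
Lemma abelian_ideal_central k I :
  (forall X, k X -> adjoint_mx X = - X) -> lie_ideal k I -> abelian_set I ->
  forall X Y, I X -> k Y -> lie X Y = 0.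
Proof.
move=> hk [hI sI cI] aI X Y hX hY.
have hXY : I (lie X Y).
  rewrite lieC -[- _]scaleN1r; have [_ _ /(_ (-1))] := hI.
  by rewrite rmorphN rmorph1; apply; apply: cI.
apply: skew_trace_sq0; first by apply: adjoint_mx_lie; apply: hk => //; apply: sI.
by rewrite trace_lie_mul (aI _ _ hXY hX) mulmx0 mxtrace0.
Qed.

Lemma complexification_lie0 k X Z : (forall Y, k Y -> lie X Y = 0) ->
  complexification k Z -> lie X Z = 0.
Proof.
move=> h [A [B [hA hB ->]]].
by rewrite lieDr lieZr (h _ hA) (h _ hB) scaler0 addr0.
Qed.

(** A scalar x + 'i y acts on the pair of real parts by the matrix of the multiplication by a
    complex number. *)
Lemma complexificationZ k Z (z : R[i]) : real_subspace k ->
  complexification k Z -> complexification k (z *: Z).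
Proof.
move=> hk [A [B [hA hB ->]]]; have [_ aD aZ] := hk.
exists (((complex.Re z)%:C)%C *: A - ((complex.Im z)%:C)%C *: B),
       (((complex.Im z)%:C)%C *: A + ((complex.Re z)%:C)%C *: B).
split; [by apply: real_subspaceB hk _ _; exact: aZ|by apply: aD; exact: aZ|].
have ez := complexE z; rewrite complexiE in ez.
have ii : 'i * 'i = -1 :> R[i] by rewrite -expr2 sqrCi.
move: ez; set x := (complex.Re z)%:C%C; set y := (complex.Im z)%:C%C => ->.
by apply/matrixP => u v; rewrite !mxE; ring: ii.
Qed.

(** X is skew-hermitian and 'i Y is hermitian, so comparing adjoints separates them. This is what
    lets an equation in the complexification descend to the compact algebra. *)
Lemma skew_complex_eq0 X Y : adjoint_mx X = - X -> adjoint_mx Y = - Y ->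
  X + 'i *: Y = 0 -> X = 0 /\ Y = 0.
Proof.
move=> hX hY h; have e : X = - ('i *: Y) by apply/eqP; rewrite -addr_eq0 h.
have : X = 'i *: Y.
  apply: oppr_inj; rewrite -hX e adjoint_mxN adjoint_mxZ conjCi hY.
  by rewrite scaleNr scalerN !opprK.
rewrite {1}e => /eqP; rewrite eq_sym -addr_eq0 -mulr2n -scaler_nat scalerA scaler_eq0.
rewrite mulf_eq0 pnatr_eq0 (negbTE (neq0Ci _)) /= => /eqP Y0.
by rewrite e Y0 scaler0 oppr0.
Qed.

End MatrixLie.

(** * Unitary frames, block algebras and their root vectors *)

Section Frames.
Context {R : realType} {N : nat}.
Implicit Types (X Y Z : 'M[R[i]]_N).

(* When [fdual] holds, the algebras preserve a bilinear form pairing the coordinate u with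
   [fstar u]; the signs [fsg] distinguish symmetric from alternating forms. *)
Record frame := Frame {
  fmat : 'M[R[i]]_N;
  fdual : bool;
  fstar : 'I_N -> 'I_N;
  fsg : 'I_N -> R[i];
  fmat_unitary : adjoint_mx fmat *m fmat = 1%:M;
  fstarK : involutive fstar;
  fstar_fix : fdual -> forall u v, fstar u = u -> fstar v = v -> u = v;
  fsg_real : forall u, (fsg u)^* = fsg u;
  fsg_sq : forall u, fsg u * fsg u = 1;
  fsg_star : forall u v, fsg (fstar u) * fsg (fstar v) = fsg u * fsg v }.

Variable f : frame.
Implicit Types (r : rel 'I_N) (S : pred 'I_N).

Lemma fstar_inj : injective (fstar f).
Proof. exact: inv_inj (fstarK _). Qed.

Definition tw X : 'M[R[i]]_N := locked (adjoint_mx (fmat f) *m X *m fmat f).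
Definition utw X : 'M[R[i]]_N := locked (fmat f *m X *m adjoint_mx (fmat f)).

Lemma twE X : tw X = adjoint_mx (fmat f) *m X *m fmat f.
Proof. by rewrite /tw -lock. Qed.

Lemma fmat_unitary_r : fmat f *m adjoint_mx (fmat f) = 1%:M.
Proof. by apply: mulmx1C; exact: fmat_unitary. Qed.

Lemma twK : cancel tw utw.
Proof.
by move=> X; rewrite twE /utw -lock !mulmxA fmat_unitary_r mul1mx -mulmxA fmat_unitary_r mulmx1.
Qed.

Lemma utwK : cancel utw tw.
Proof.
by move=> X; rewrite twE /utw -lock !mulmxA fmat_unitary mul1mx -mulmxA fmat_unitary mulmx1.
Qed.

Lemma tw_inj : injective tw. Proof. exact: can_inj twK. Qed.

Lemma twD X Y : tw (X + Y) = tw X + tw Y.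
Proof. by rewrite !twE mulmxDr mulmxDl. Qed.

Lemma twZ (c : R[i]) X : tw (c *: X) = c *: tw X.
Proof. by rewrite !twE -scalemxAr -scalemxAl. Qed.

Lemma tw0 : tw 0 = 0.
Proof. by rewrite !twE mulmx0 mul0mx. Qed.

Lemma twN X : tw (- X) = - tw X.
Proof. by rewrite -scaleN1r twZ scaleN1r. Qed.

Lemma tw_sum (I : finType) (P : pred I) (F : I -> 'M[R[i]]_N) :
  tw (\sum_(j | P j) F j) = \sum_(j | P j) tw (F j).
Proof. by rewrite twE mulmx_sumr mulmx_suml; apply: eq_bigr => j _; rewrite twE. Qed.

Lemma tw_mul X Y : tw (X *m Y) = tw X *m tw Y.
Proof.
rewrite !twE !mulmxA -[in RHS](mulmxA _ (fmat f) (adjoint_mx _)).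
by rewrite fmat_unitary_r mulmx1.
Qed.

Lemma tw_lie X Y : tw (lie X Y) = lie (tw X) (tw Y).
Proof. by rewrite /lie twD twN !tw_mul. Qed.

Lemma tw_adj X : tw (adjoint_mx X) = adjoint_mx (tw X).
Proof. by rewrite !twE !adjoint_mxM adjoint_mxK mulmxA. Qed.

(** Infinitesimal invariance of the bilinear form, in frame coordinates; it imposes nothing in a
    frame without a form. *)
Definition star_sym X : Prop := fdual f -> forall u v,
  tw X (fstar f v) (fstar f u) = - (fsg f u * fsg f v * tw X u v).

(** The block algebra: the blocks are the classes of the partial equivalence
    [r], and the partial trace over [S] vanishes. *)
Definition block r S : set 'M[R[i]]_N :=
  [set X | [/\ adjoint_mx X = - X, star_sym X,
     forall u v, ~~ r u v -> tw X u v = 0 & \sum_(u | S u) tw X u u = 0]].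

(** Cutting the blocks down to size one makes the Cartan subalgebra a block algebra too, so that the
    lemmas on blocks apply to it. *)
Definition torus_rel r : rel 'I_N := fun u v => r u v && (u == v).

Definition wt (u : 'I_N) X : R[i] := tw X u u.

Lemma block_skew r S X u v : block r S X -> tw X v u = - (tw X u v)^*.
Proof.
case=> hX _ _ _; have := congr1 (fun Z => tw Z v u) hX.
by rewrite tw_adj twN adjoint_mxE [in RHS]mxE => ->; rewrite opprK.
Qed.

Lemma real_subspace_block r S : real_subspace (block r S).
Proof.
split=> [|X Y [X1 X2 X3 X4] [Y1 Y2 Y3 Y4]|c X [X1 X2 X3 X4]]; split.
- by apply/matrixP => u v; rewrite adjoint_mxE !mxE conj_0 oppr0.
- by move=> _ u v; rewrite tw0 !mxE mulr0 oppr0.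
- by move=> u v _; rewrite tw0 mxE.
- by apply: big1 => u _; rewrite tw0 mxE.
- by rewrite adjoint_mxD X1 Y1 opprD.
- by move=> h u v; rewrite twD !mxE (X2 h) (Y2 h) mulrDr opprD.
- by move=> u v h; rewrite twD mxE X3 // Y3 // addr0.
- under eq_bigr do rewrite twD mxE.
  by rewrite big_split /= X4 Y4 addr0.
- by rewrite adjoint_mxZ X1 conj_real_complex scalerN.
- by move=> h u v; rewrite twZ !mxE (X2 h) mulrN mulrCA.
- by move=> u v h; rewrite twZ mxE X3 // mulr0.
- under eq_bigr do rewrite twZ mxE.
  by rewrite -mulr_sumr X4 mulr0.
Qed.

(** Products through an index outside S drop out, and what is left is antisymmetric in the two
    indices of S. *)
Lemma partial_trace_lie S X Y : (forall u v, S u != S v -> tw X u v = 0) ->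
  \sum_(u | S u) tw (lie X Y) u u = 0.
Proof.
move=> hX; rewrite tw_lie.
under eq_bigr do rewrite !mxE -sumrB.
pose F u v := tw X u v * tw Y v u.
rewrite (eq_bigr (fun u => \sum_(v | S v) (F u v - F v u))); last first.
  move=> u Su; rewrite (bigID S) /= [X in _ + X]big1 ?addr0; last first.
    move=> v Sv; rewrite (hX u v) ?(hX v u) ?mul0r ?mulr0 ?subrr //.
      by rewrite Su (negbTE Sv).
    by rewrite Su (negbTE Sv).
  by apply: eq_bigr => v _; rewrite /F [in X in _ - X]mulrC.
under eq_bigr do rewrite sumrB.
by rewrite sumrB [X in _ - X]exchange_big subrr.
Qed.

Lemma star_sym_lie X Y : star_sym X -> star_sym Y -> star_sym (lie X Y).
Proof.
move=> hX hY h u v; rewrite tw_lie !mxE -!sumrB mulr_sumr -sumrN.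
rewrite (reindex_inj fstar_inj) /=; apply: eq_bigr => w _.
rewrite !(hX h) !(hY h).
transitivity (fsg f w * fsg f w * (fsg f u * fsg f v) *
   (tw X w v * tw Y u w - tw Y w v * tw X u w)); first by ring.
by rewrite fsg_sq; ring.
Qed.

Lemma lie_block r S : transitive r -> (forall u v, r u v -> S u = S v) ->
  forall X Y, block r S X -> block r S Y -> block r S (lie X Y).
Proof.
move=> tr cl X Y [X1 X2 X3 X4] [Y1 Y2 Y3 Y4]; split.
- exact: adjoint_mx_lie.
- exact: star_sym_lie.
- move=> u v h; rewrite tw_lie !mxE -sumrB big1 // => w _.
  have [ruw|/X3 ->] := boolP (r u w); have [rwv|/Y3 ->] := boolP (r w v);
    rewrite ?mul0r ?mulr0 ?sub0r ?subr0 ?oppr0 //.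
  + by rewrite (tr _ _ _ ruw rwv) in h.
  + have [ruw'|/Y3 ->] := boolP (r u w); rewrite ?mul0r ?oppr0 //.
    by rewrite (X3 w v) ?mulr0 ?oppr0 //; apply: contra h; apply: tr.
  + have [ruw'|/Y3 ->] := boolP (r u w); rewrite ?mul0r ?oppr0 //.
    by rewrite (X3 w v) ?mulr0 ?oppr0 //; apply: contra h; apply: tr.
  + have [ruw'|/Y3 ->] := boolP (r u w); rewrite ?mul0r ?oppr0 //.
    by rewrite (X3 w v) ?mulr0 ?oppr0 //; apply: contra h; apply: tr.
- apply: partial_trace_lie => u v h; apply: X3.
  by apply: contra h => /cl ->.
Qed.

Lemma torus_diag r S X u v : block (torus_rel r) S X -> u != v -> tw X u v = 0.
Proof. by case=> _ _ h _ uv; apply: h; rewrite /torus_rel (negbTE uv) andbF. Qed.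

Lemma tw_lie_torus r S H X u v : block (torus_rel r) S H ->
  tw (lie H X) u v = (wt u H - wt v H) * tw X u v.
Proof.
move=> hH; rewrite tw_lie !mxE (bigD1 u) //= big1 ?addr0; last first.
  by move=> w wu; rewrite (torus_diag hH) ?mul0r // eq_sym.
rewrite (bigD1 v) //= big1 ?addr0; last first.
  by move=> w wv; rewrite (torus_diag hH wv) mulr0.
by rewrite /wt; ring.
Qed.

(* The only entries killed by [star_sym] are those pairing u with its dual. *)
Definition nz (u v : 'I_N) : bool :=
  ~~ [&& fdual f, v == fstar f u & fsg f u * fsg f v == 1].

Lemma star_sym_nz X u v : star_sym X -> ~~ nz u v -> tw X u v = 0.
Proof.
move=> hX /negPn/and3P[h /eqP -> /eqP e1].
have := hX h u (fstar f u); rewrite fstarK e1 mul1r => /eqP.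
by rewrite -subr_eq0 opprK -mulr2n mulrn_eq0 /= => /eqP.
Qed.

(** The image of the matrix unit at (u, v) under the projection onto the star symmetric matrices.
    The factor 1/2 makes it a projection, so that summing over all pairs in [star_sym_decomp] counts
    nothing twice. *)
Definition rvec (u v : 'I_N) : 'M[R[i]]_N :=
  locked (utw (if fdual f then
    2%:R^-1 *: (delta_mx u v - (fsg f u * fsg f v) *: delta_mx (fstar f v) (fstar f u))
    else delta_mx u v)).

Lemma tw_rvec u v a b : tw (rvec u v) a b =
  if fdual f then 2%:R^-1 * (((a == u) && (b == v))%:R -
      fsg f u * fsg f v * ((a == fstar f v) && (b == fstar f u))%:R)
  else ((a == u) && (b == v))%:R.
Proof. by rewrite /rvec -lock utwK; case: ifP => _; rewrite !mxE. Qed.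

Lemma rvec_neq0 u v : nz u v -> tw (rvec u v) u v != 0.
Proof.
rewrite /nz tw_rvec !eqxx /=; case: (fdual f) => /=; last by rewrite oner_eq0.
move=> h; rewrite mulf_neq0 ?invr_eq0 ?pnatr_eq0 //.
have [e|ne] := eqVneq v (fstar f u); last first.
  by rewrite (_ : (u == fstar f v) = false) ?mulr0 ?subr0 ?oner_eq0 //;
     apply/negbTE; apply: contra ne => /eqP ->; rewrite fstarK.
rewrite e fstarK eqxx /= mulr1 subr_eq0 eq_sym; move: h; rewrite e eqxx /=.
by [].
Qed.

Lemma tw_rvec_supp u v a b : tw (rvec u v) a b != 0 ->
  (a = u /\ b = v) \/ fdual f /\ (a = fstar f v /\ b = fstar f u).
Proof.
rewrite tw_rvec; case: (boolP (fdual f)) => hs.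
  have [/andP[/eqP -> /eqP ->]|_] := boolP ((a == u) && (b == v)); first by left.
  have [/andP[/eqP -> /eqP ->]|_] := boolP ((a == _) && (b == _)); first by right.
  by rewrite mulr0 subr0 mulr0 eqxx.
have [/andP[/eqP -> /eqP ->]|_] := boolP ((a == u) && (b == v)); first by left.
by rewrite eqxx.
Qed.

Lemma fsg_conjM u v : (fsg f u * fsg f v)^* = fsg f u * fsg f v.
Proof. by rewrite conj_mul !fsg_real. Qed.

Lemma adjoint_rvec u v : adjoint_mx (rvec u v) = rvec v u.
Proof.
apply: tw_inj; rewrite tw_adj; apply/matrixP => a b.
rewrite adjoint_mxE !tw_rvec; case: ifP => _; last first.
  by rewrite conjC_nat andbC.
rewrite conj_mul conj_sub (conj_mul (_ * _)) fsg_conjM conj_half !conjC_nat.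
rewrite [(b == u) && _]andbC [(b == fstar f v) && _]andbC [fsg f v * _]mulrC.
by [].
Qed.

Lemma star_sym_rvec u v : star_sym (rvec u v).
Proof.
move=> h a b; rewrite !tw_rvec h.
have e2 : fsg f u * fsg f v * (fsg f u * fsg f v) = 1.
  by rewrite mulrACA !fsg_sq mulr1.
have -> : (fstar f b == u) && (fstar f a == v) = (a == fstar f v) && (b == fstar f u).
  by rewrite andbC -(inj_eq fstar_inj (fstar f a)) -(inj_eq fstar_inj (fstar f b)) !fstarK.
have -> : (fstar f b == fstar f v) && (fstar f a == fstar f u) = (a == u) && (b == v).
  by rewrite !(inj_eq fstar_inj) andbC.
have hA : (a == u) && (b == v) -> fsg f a * fsg f b = fsg f u * fsg f v.
  by case/andP => /eqP -> /eqP ->.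
have hB : (a == fstar f v) && (b == fstar f u) -> fsg f a * fsg f b = fsg f u * fsg f v.
  by case/andP => /eqP -> /eqP ->; rewrite fsg_star mulrC.
case: (_ && _) hA => [->//|_]; last case: (_ && _) hB => [->//|_]; rewrite /=;
  move: (fsg f u * fsg f v) e2 => e e2; [|by ring: e2|by ring].
case: (_ && _) hB => _; by ring: e2.
Qed.

(** The skew-hermitian combinations of two opposite root vectors: they fill the part of the compact
    algebra lying in the two root spaces. *)
Definition kvec (c : R[i]) u v := c *: rvec u v - c^* *: rvec v u.

Lemma star_symZ X (c : R[i]) : star_sym X -> star_sym (c *: X).
Proof. by move=> hX h u v; rewrite twZ mxE (hX h) [in RHS]mxE; ring. Qed.

Lemma star_symB X Y : star_sym X -> star_sym Y -> star_sym (X - Y).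
Proof.
by move=> hX hY h u v; rewrite twD twN !mxE (hX h) (hY h); ring.
Qed.

Lemma kvec_block r S (c : R[i]) u v : symmetric r ->
  (fdual f -> forall a b, r a b -> r (fstar f a) (fstar f b)) ->
  r u v -> u != v -> block r S (kvec c u v).
Proof.
move=> rs rstar ruv uv.
have supp a b : tw (kvec c u v) a b != 0 ->
    ((a = u /\ b = v) \/ (a = v /\ b = u)) \/ fdual f /\
    ((a = fstar f v /\ b = fstar f u) \/ (a = fstar f u /\ b = fstar f v)).
  rewrite /kvec twD twN !twZ !mxE.
  have [->|/tw_rvec_supp h _] := eqVneq (tw (rvec u v) a b) 0; last by intuition.
  have [->|/tw_rvec_supp h _] := eqVneq (tw (rvec v u) a b) 0; last by intuition.
  by rewrite !mulr0 subr0 eqxx.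
split.
- by rewrite /kvec adjoint_mxD adjoint_mxN !adjoint_mxZ !adjoint_rvec conjCK opprB addrC.
- by apply: star_symB; apply: star_symZ; exact: star_sym_rvec.
- move=> a b; apply: contraNeq => /supp [[]|[h []]] [-> ->] //; first by rewrite rs.
    by rewrite rs; exact: rstar.
  exact: rstar.
(* As u differs from v the support avoids the diagonal, so every partial trace vanishes. *)
- apply: big1 => a _; apply/eqP; apply: contraTT uv => /supp H; apply/negPn/eqP.
  by case: H => [[]|[h []]] [e1 e2]; try exact: (fstar_inj _); try congruence;
     apply: fstar_inj; congruence.
Qed.

Lemma rvec_complexification r S u v : symmetric r ->
  (fdual f -> forall a b, r a b -> r (fstar f a) (fstar f b)) ->
  r u v -> u != v -> complexification (block r S) (rvec u v).
Proof.
(* The two constants are chosen so that in X + 'i Y the multiples of [rvec v u] cancel and those of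
   [rvec u v] add up to 1. *)
move=> rs rstar ruv uv; exists (kvec 2%:R^-1 u v), (kvec (- 'i / 2%:R) u v).
split; [exact: kvec_block|exact: kvec_block|].
rewrite /kvec conj_mul conj_opp conj_half conjCi opprK scalerBr !scalerA.
have e1 : 'i * (- 'i / 2%:R) = 2%:R^-1 :> R[i] by rewrite mulrA mulrN -expr2 sqrCi opprK mul1r.
have e2 : 'i * ('i / 2%:R) = - 2%:R^-1 :> R[i] by rewrite mulrA -expr2 sqrCi mulN1r.
rewrite e1 e2 scaleNr opprK addrACA addNr addr0 -scalerDl.
by rewrite (_ : _ + _ = 1) ?scale1r //; field.
Qed.

Lemma star_sym_decomp X : star_sym X -> X = \sum_u \sum_v tw X u v *: rvec u v.
Proof.
move=> hX; apply: tw_inj; rewrite tw_sum; apply/matrixP => a b.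
rewrite summxE (eq_bigr (fun u => \sum_v tw X u v * tw (rvec u v) a b)); last first.
  by move=> u _; rewrite tw_sum summxE; apply: eq_bigr => v _; rewrite twZ mxE.
have e1 (F : 'I_N -> 'I_N -> R[i]) c d :
    \sum_u \sum_v F u v * ((c == u) && (d == v))%:R = F c d.
  rewrite (bigD1 c) //= [X in _ + X]big1 ?addr0; last first.
    by move=> u uc; apply: big1 => v _; rewrite eq_sym (negbTE uc) mulr0.
  rewrite (bigD1 d) //= big1 ?addr0 ?eqxx ?mulr1 // => v vd.
  by rewrite [d == v]eq_sym (negbTE vd) andbF mulr0.
have [h|h] := boolP (fdual f); last first.
  by rewrite -[LHS](e1 (tw X)); apply: eq_bigr => u _; apply: eq_bigr => v _;
     rewrite tw_rvec (negbTE h).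
pose F u v := 2%:R^-1 * (tw X u v * 1).
pose G u v := 2%:R^-1 * (tw X u v * (fsg f u * fsg f v)).
transitivity (\sum_u \sum_v F u v * ((a == u) && (b == v))%:R -
   \sum_u \sum_v G u v * ((fstar f b == u) && (fstar f a == v))%:R).
  rewrite !e1 /F /G (hX h) fsg_star [fsg f b * _]mulrC.
  have : fsg f a * fsg f b * (fsg f a * fsg f b) = 1 by rewrite mulrACA !fsg_sq mulr1.
  move: (fsg f a * fsg f b) => e ee; by field: ee.
rewrite -sumrB; apply: eq_bigr => u _; rewrite -sumrB; apply: eq_bigr => v _.
rewrite tw_rvec h /F /G.
have -> : (fstar f b == u) && (fstar f a == v) = (a == fstar f v) && (b == fstar f u).
  by rewrite andbC -(inj_eq fstar_inj (fstar f a)) -(inj_eq fstar_inj (fstar f b)) !fstarK.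
by ring.
Qed.

Definition dpart X := utw (\matrix_(u, v) (if u == v then tw X u v else 0)).

Lemma tw_dpart X u v : tw (dpart X) u v = if u == v then tw X u v else 0.
Proof. by rewrite /dpart utwK mxE. Qed.

Lemma dpart_block r S X : block r S X -> block (torus_rel r) S (dpart X).
Proof.
move=> hX; have [X1 X2 X3 X4] := hX; split.
- apply: tw_inj; rewrite tw_adj twN; apply/matrixP => u v.
  rewrite adjoint_mxE tw_dpart mxE tw_dpart eq_sym.
  by case: eqP => [<-|_]; [rewrite {1}(block_skew _ _ hX) conj_opp conjCK|rewrite conj_0 oppr0].
- move=> h u v; rewrite !tw_dpart (inj_eq fstar_inj) eq_sym.
  by case: eqP => [<-|_]; [exact: X2|rewrite mulr0 oppr0].
- move=> u v; rewrite tw_dpart /torus_rel; case: eqP => [<-|//].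
  by rewrite andbT; exact: X3.
- by rewrite -[RHS]X4; apply: eq_bigr => u _; rewrite tw_dpart eqxx.
Qed.

(** Torus part plus compact root parts. Every unordered pair of indices is met twice in the double
    sum, whence half of the entry in each term. *)
Lemma block_decomp r S X : block r S X ->
  X = dpart X + \sum_u \sum_v
        kvec (if u == v then 0 else 2%:R^-1 * tw X u v) u v.
Proof.
move=> hX; have [X1 X2 X3 X4] := hX; have [_ D2 _ _] := dpart_block hX.
apply/eqP; rewrite addrC -subr_eq; apply/eqP.
rewrite (star_sym_decomp (star_symB X2 D2)).
pose Y u v := if u == v then 0 else tw X u v.
transitivity (\sum_u \sum_v (2%:R^-1 * Y u v) *: rvec u v +
              \sum_u \sum_v (2%:R^-1 * Y u v) *: rvec u v).
  rewrite -big_split; apply: eq_bigr => u _; rewrite -big_split; apply: eq_bigr => v _.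
  rewrite /= -scalerDl /Y twD twN !mxE tw_dpart; congr (_ *: _).
  by case: eqP => [<-|_]; [rewrite subrr; ring|rewrite subr0; field].
rewrite [X in _ + X]exchange_big -big_split; apply: eq_bigr => u _ /=.
rewrite -big_split; apply: eq_bigr => v _ /=; rewrite /kvec /Y [v == u]eq_sym.
case: eqP => [_|_]; first by rewrite mulr0 conj_0 !scale0r addr0 subr0.
by rewrite (block_skew u v hX) conj_mul conj_half mulrN scaleNr.
Qed.

End Frames.

Arguments block {R N}.
Arguments frame : clear implicits.

(** * Roots, coweights and centralizers in a frame *)

Section Adapted.
Context {R : realType} {N : nat}.
Implicit Types (D : rootDatum R N) (r : rel 'I_N) (S : pred 'I_N).

(** [D] is a block algebra for the frame [f], with fundamental coweights [w]. *)
Record adapted (f : frame R N) D r S (w : nat -> 'M[R[i]]_N) : Prop := Adapted {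
  ad_sym : symmetric r;
  ad_trans : transitive r;
  ad_star : fdual f -> forall u v, r u v -> r (fstar f u) (fstar f v);
  ad_cl : forall u v, r u v -> S u = S v;
  ad_alg : alg D = block f r S;
  ad_tor : tor D = block f (torus_rel r) S;
  ad_simp : forall j, (1 <= j <= rnk D)%N -> exists u v,
    [/\ r u v, u != v, nz f u v &
        forall H, tor D H -> simp D j H = wt f u H - wt f v H];
  ad_cow_tor : forall s, (1 <= s <= rnk D)%N -> tor D (w s);
  ad_cow : forall s j, (1 <= s <= rnk D)%N -> (1 <= j <= rnk D)%N ->
    simp D j (w s) = (j == s)%:R * 'i;
  ad_root : forall u v, r u v -> u != v -> nz f u v ->
    exists2 c, is_coef D (fun H => wt f u H - wt f v H) c &
      (forall j, (1 <= j <= rnk D)%N -> 0 <= c j) \/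
      (forall j, (1 <= j <= rnk D)%N -> c j <= 0);
  ad_nondeg : forall H, tor D H ->
    (forall j, (1 <= j <= rnk D)%N -> simp D j H = 0) -> H = 0 }.

Variables (f : frame R N) (D : rootDatum R N) (r : rel 'I_N) (S : pred 'I_N).
Variable (w : nat -> 'M[R[i]]_N).
Hypothesis ad : adapted f D r S w.

Lemma ad_torP X : tor D X <-> alg D X /\ forall u v, u != v -> tw f X u v = 0.
Proof.
rewrite (ad_tor ad) (ad_alg ad); split => [hX|[[X1 X2 X3 X4] h]].
  split; last by move=> u v; exact: torus_diag hX.
  have [X1 X2 X3 X4] := hX; split=> // u v ruv.
  by apply: X3; apply: contra ruv => /andP[].
split=> // u v; rewrite /torus_rel negb_and => /orP[/X3//|/h//].
Qed.

Lemma ad_tor_sub : tor D `<=` alg D.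
Proof. by move=> X /ad_torP[]. Qed.

Lemma ad_subspace : real_subspace (alg D).
Proof. by rewrite (ad_alg ad); exact: real_subspace_block. Qed.

Lemma ad_tor_subspace : real_subspace (tor D).
Proof. by rewrite (ad_tor ad); exact: real_subspace_block. Qed.

Lemma ad_subalgebra : lie_subalgebra (alg D).
Proof.
split; first exact: ad_subspace.
rewrite (ad_alg ad); apply: lie_block; [exact: ad_trans ad|exact: ad_cl ad].
Qed.

Lemma ad_skew X : alg D X -> adjoint_mx X = - X.
Proof. by rewrite (ad_alg ad); case. Qed.

Lemma ad_tw_lie H X u v : tor D H ->
  tw f (lie H X) u v = (wt f u H - wt f v H) * tw f X u v.
Proof. by rewrite (ad_tor ad); exact: tw_lie_torus. Qed.

Lemma ad_tor_abelian : abelian_set (tor D).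
Proof.
move=> H X hH hX; apply: (@tw_inj _ _ f); apply/matrixP => u v; rewrite ad_tw_lie // tw0 mxE.
have [->|uv] := eqVneq u v; first by rewrite subrr mul0r.
by case/ad_torP: hX => _ /(_ _ _ uv) ->; rewrite mulr0.
Qed.

Lemma ad_complexP Z u v : complexification (alg D) Z -> tw f Z u v != 0 ->
  r u v /\ nz f u v.
Proof.
rewrite (ad_alg ad) => -[A [B [[A1 A2 A3 A4] [B1 B2 B3 B4] ->]]] h.
split; apply: contraNT h => h; rewrite twD twZ 2!mxE.
  by rewrite A3 // B3 // mulr0 addr0.
by rewrite !star_sym_nz // mulr0 addr0.
Qed.

Lemma ad_root_space b Z u v : root_space D b Z -> tw f Z u v != 0 ->
  forall H, tor D H -> b H = wt f u H - wt f v H.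
Proof.
case=> _ h hZ H hH; have := ad_tw_lie Z u v hH.
by rewrite h // twZ mxE => /(mulIf hZ).
Qed.

(** The torus multiplies the entry (u, v) of a matrix by the difference of the weights of u and v. A
    nonzero entry of a root vector therefore identifies its root, and u = v would make the root
    vanish. *)
Lemma ad_root_pair b : is_root D b -> exists u v,
  [/\ r u v, u != v, nz f u v & forall H, tor D H -> b H = wt f u H - wt f v H].
Proof.
move=> [[H hH bH] [Z hZ Z0]].
have [[u v] /= huv] : exists p, tw f Z p.1 p.2 != 0.
  apply/existsP; apply: contraNT Z0; rewrite negb_exists => /forallP h.
  apply/eqP; apply: (@tw_inj _ _ f); apply/matrixP => u v.
  by rewrite tw0 mxE; apply/eqP; have := h (u, v); rewrite negbK.
have hb := ad_root_space hZ huv.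
have [ruv nuv] : r u v /\ nz f u v by apply: ad_complexP huv; case: hZ.
exists u, v; split=> //; apply: contraNneq bH => uv.
by rewrite hb // uv subrr.
Qed.

(* The coroot of (u, v) separates the two weights. *)
Lemma ad_separated u v : r u v -> u != v -> nz f u v ->
  exists2 H, tor D H & wt f u H != wt f v H.
Proof.
move=> ruv uv nuv; have [rs rt] := (ad_sym ad, ad_trans ad).
pose h a : R[i] := 'i * ((a == u)%:R - (a == v)%:R -
   (if fdual f then (a == fstar f u)%:R - (a == fstar f v)%:R else 0)).
have hr a : h a != 0 -> r a a.
  have ru : r u u by apply: (rt v) => //; rewrite rs.
  have rv : r v v by apply: (rt u) => //; rewrite rs.
  rewrite /h; have [-> _ //|_] := eqVneq a u; have [-> _ //|_] := eqVneq a v.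
  case: ifP => hf; last by rewrite !subr0 mulr0 eqxx.
  have [->|_] := eqVneq a (fstar f u); first by move=> _; exact: (ad_star ad).
  have [->|_] := eqVneq a (fstar f v); first by move=> _; exact: (ad_star ad).
  by rewrite !subr0 mulr0 eqxx.
pose H := utw f (\matrix_(a, b) (if a == b then h a else 0)).
have twH a b : tw f H a b = if a == b then h a else 0 by rewrite utwK mxE.
have hreal (P : bool) : ((P%:R : R[i])^*) = P%:R by rewrite conjC_nat.
have hconj a : (h a)^* = - h a.
  rewrite /h conj_mul conjCi mulNr; congr (- (_ * _)).
  rewrite !conj_sub !conjC_nat; congr (_ - _).
  by case: ifP; rewrite ?conj_sub ?conjC_nat ?conj_0.
exists H.
  rewrite (ad_tor ad); split.
  - apply: (@tw_inj _ _ f); rewrite tw_adj twN; apply/matrixP => a b.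
    rewrite adjoint_mxE mxE !twH eq_sym; case: eqP => [->//|_].
    by rewrite conj_0 oppr0.
  - move=> hf a b; rewrite !twH (inj_eq (@fstar_inj _ _ f)) eq_sym.
    case: eqP => [->|_]; last by rewrite mulr0 oppr0.
    rewrite fsg_sq mul1r /h hf.
    have es c d : (fstar f c == d) = (c == fstar f d).
      by rewrite -(inj_eq (@fstar_inj _ _ f)) fstarK.
    by rewrite !es !fstarK; ring.
  - move=> a b; rewrite /torus_rel twH; case: eqP => [<-|//]; rewrite andbT.
    by apply: contraNeq => /hr.
  - rewrite (eq_bigr h) => [|a _]; last by rewrite twH eqxx.
    rewrite /h -mulr_sumr (_ : \sum_(_ | _) _ = 0) ?mulr0 //.
    have hS a b : r a b -> \sum_(c | S c) ((c == a)%:R - (c == b)%:R) = 0 :> R[i].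
      move=> /(ad_cl ad) Sab; rewrite sumrB.
      have e d : \sum_(c | S c) (c == d)%:R = (S d)%:R :> R[i].
        rewrite big_mkcond (bigD1 d) //= eqxx big1 ?addr0 => [|c /negbTE ->].
          by case: (S d).
        by case: ifP.
      by rewrite !e Sab subrr.
    rewrite sumrB hS // sub0r; case: (boolP (fdual f)) => hf.
      by rewrite hS ?oppr0 //; exact: (ad_star ad).
    by rewrite big1 ?oppr0.
rewrite /wt !twH !eqxx /h -subr_eq0 -mulrBr mulf_neq0 ?neq0Ci //.
rewrite [v == u]eq_sym (negbTE uv) !eqxx.
(* Up to 'i, the root takes the value 2 on [H] when there is no form. With a form the value is 4 if
   u and v are dual to each other, 1 if one of them is self-dual, and 2 otherwise. *)
case: (boolP (fdual f)) => hf; last first.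
  by rewrite /= (_ : _ - _ = 2%:R) ?pnatr_eq0 //; ring.
have euv : (v == fstar f u) = (u == fstar f v).
  by rewrite -(inj_eq (@fstar_inj _ _ f)) fstarK eq_sym.
rewrite euv.
have [e|ne] := eqVneq u (fstar f v).
  have -> : (u == fstar f u) = false.
    apply/negbTE; apply: contra uv => /eqP e'; apply/eqP.
    by apply: (@fstar_inj _ _ f); rewrite -e' -e.
  have -> : (v == fstar f v) = false by rewrite -e eq_sym (negbTE uv).
  by rewrite /= (_ : _ - _ = 4%:R) ?pnatr_eq0 //; ring.
have [eu|neu] := eqVneq u (fstar f u).
  have -> : (v == fstar f v) = false.
    apply/negbTE; apply: contra uv => /eqP ev; apply/eqP.
    exact: (fstar_fix hf).
  by rewrite /= (_ : _ - _ = 1) ?oner_eq0 //; ring.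
by case: (v == fstar f v); [rewrite /= (_ : _ - _ = 1) ?oner_eq0 //|
  rewrite /= (_ : _ - _ = 2%:R) ?pnatr_eq0 //]; ring.
Qed.

Lemma ad_rvec_root_space u v : r u v -> u != v ->
  root_space D (fun H => wt f u H - wt f v H) (rvec f u v).
Proof.
move=> ruv uv; split.
  rewrite (ad_alg ad); apply: rvec_complexification => //; [exact: ad_sym ad|exact: ad_star ad].
move=> H hH; apply: (@tw_inj _ _ f); apply/matrixP => a b.
rewrite ad_tw_lie // twZ mxE.
have [->|/tw_rvec_supp h] := eqVneq (tw f (rvec f u v) a b) 0; first by rewrite !mulr0.
congr (_ * _); case: h => [[-> ->]//|[hf [-> ->]]].
have [_ h2 _ _] : block f (torus_rel r) S H by rewrite -(ad_tor ad).
by rewrite /wt !(h2 hf) !fsg_sq !mul1r opprK addrC.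
Qed.

Lemma ad_rvec_neq0 u v : nz f u v -> rvec f u v != 0.
Proof.
by move/rvec_neq0; apply: contra => /eqP ->; rewrite tw0 mxE.
Qed.

Lemma ad_is_root u v : r u v -> u != v -> nz f u v ->
  is_root D (fun H => wt f u H - wt f v H).
Proof.
move=> ruv uv nuv; split.
  by have [H hH h] := ad_separated ruv uv nuv; exists H; rewrite ?subr_eq0.
by exists (rvec f u v); [exact: ad_rvec_root_space|exact: ad_rvec_neq0].
Qed.

Lemma is_root_ext b b' : (forall H, tor D H -> b H = b' H) -> is_root D b -> is_root D b'.
Proof.
move=> e [[H hH bH] [X [X1 X2] X0]]; split; first by exists H; rewrite -?e.
by exists X => //; split=> // H' hH'; rewrite -e // X2.
Qed.

Lemma ad_sum_cow (c : nat -> R[i]) s : (1 <= s <= rnk D)%N ->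
  \sum_(1 <= j < (rnk D).+1) c j * simp D j (w s) = c s * 'i.
Proof.
move=> hs; rewrite (bigD1_seq s) ?iota_uniq //=; last by rewrite mem_index_iota ltnS.
rewrite (ad_cow ad) // eqxx mul1r big_nat_cond big1 ?addr0 // => j.
by rewrite ltnS => /andP[hj js]; rewrite (ad_cow ad) // (negbTE js) mul0r mulr0.
Qed.

(** Coefficients of roots are thus unique and computable from weights; every later condition on them
    is tested at [w s]. *)
Lemma ad_coef_cow b c s : (1 <= s <= rnk D)%N -> is_coef D b c -> b (w s) = (c s)%:~R * 'i.
Proof. by move=> hs -> ; [exact: ad_sum_cow|exact: (ad_cow_tor ad)]. Qed.

Lemma ad_is_base : is_base D.
Proof.
split=> [j hj|c hc j hj|b /ad_root_pair[u [v [ruv uv nuv hb]]]].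
- have [u [v [ruv uv nuv e]]] := ad_simp ad hj.
  by apply: is_root_ext (ad_is_root ruv uv nuv) => H hH; rewrite e.
- have := hc _ (ad_cow_tor ad hj); rewrite ad_sum_cow // => /eqP.
  by rewrite mulf_eq0 (negbTE (neq0Ci _)) orbF => /eqP.
- have [c hc cs] := ad_root ad ruv uv nuv; exists c => // H hH.
  by rewrite hb // hc.
Qed.

Lemma ad_cartan : cartan (alg D) (tor D).
Proof.
split; [exact: ad_tor_subspace|exact: ad_tor_sub|exact: ad_tor_abelian|].
move=> X hX h; apply/ad_torP; split=> // u v uv; apply/eqP/negPn/negP => huv.
have [ruv nuv] : r u v /\ nz f u v.
  apply: ad_complexP huv; exists X, 0; split=> //; last by rewrite scaler0 addr0.
  by case: ad_subspace.
have [H hH ] := ad_separated ruv uv nuv; rewrite -subr_eq0 => hw.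
have := ad_tw_lie X u v hH; rewrite h // tw0 mxE => /eqP.
by rewrite eq_sym mulf_eq0 (negbTE hw) (negbTE huv).
Qed.

Lemma ad_root_vector_comm X u v : r u v -> u != v -> nz f u v -> tor D X ->
  lie X (rvec f u v) = 0 -> wt f u X = wt f v X.
Proof.
move=> ruv uv nuv hX; have [_ ->] // := ad_rvec_root_space ruv uv.
move/eqP; rewrite scaler_eq0 (negbTE (ad_rvec_neq0 nuv)) orbF subr_eq0.
by move/eqP.
Qed.

(** An abelian ideal is central, hence contained in the torus by maximality. It commutes with all
    simple root vectors, so the simple roots vanish on it. *)
Lemma ad_semisimple : semisimple (alg D).
Proof.
move=> I hI aI X IX; have [_ sI _] := hI.
have hc := abelian_ideal_central ad_skew hI aI IX.
have hX : tor D X.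
  have [_ _ _ h] := ad_cartan; apply: h; first exact: sI.
  by move=> H hH; rewrite lieC hc ?oppr0 //; exact: ad_tor_sub.
apply: (ad_nondeg ad) => // j hj; have [u [v [ruv uv nuv ->]]] // := ad_simp ad hj.
apply/eqP; rewrite subr_eq0; apply/eqP; apply: (ad_root_vector_comm ruv) => //.
by apply: (complexification_lie0 hc); case: (ad_rvec_root_space ruv uv).
Qed.

Lemma ad_well_formed : well_formed D.
Proof.
split; [exact: ad_subalgebra|exact: ad_skew|exact: ad_semisimple|exact: ad_cartan|exact: ad_is_base].
Qed.

Section Node.
Variable s : nat.
Hypothesis hs : (1 <= s <= rnk D)%N.

Lemma ad_compact b : compact_root D s b <-> is_root D b /\ b (w s) = 0.
Proof.
split=> [[hb [c hc c0]]|[hb b0]].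
  by split=> //; rewrite (ad_coef_cow hs hc) c0 mul0r.
split=> //; have [_ _ /(_ _ hb)[c hc _]] := ad_is_base; exists c => //.
move: b0; rewrite (ad_coef_cow hs hc) => /eqP.
by rewrite mulf_eq0 (negbTE (neq0Ci _)) orbF intr_eq0 => /eqP.
Qed.

Lemma ad_is_rho : is_rho D s (w s).
Proof.
split; first exact: (ad_cow_tor ad).
- by move=> b /ad_compact[].
- by rewrite (ad_cow ad) // eqxx mul1r.
Qed.

(** The generators of k_phi are torus elements and sums of root vectors whose roots vanish at [w s];
    conversely the root parts of an element commuting with [w s] can only belong to such roots. *)
Lemma ad_k_phi : k_phi D s = [set X | alg D X /\ lie (w s) X = 0].
Proof.
have wt_s := ad_cow_tor ad hs.
apply/seteqP; split => [X|X [hX cX]].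
  apply.
    split=> [|A B [A1 A2] [B1 B2]|c A [A1 A2]].
    - by split; [case: ad_subspace|rewrite lie0r].
    - by split; [case: ad_subspace => _ + _; apply|rewrite lieDr A2 B2 addr0].
    - by split; [case: ad_subspace => _ _; apply|rewrite lieZr A2 scaler0].
  move=> A [hA|[hA [b [/ad_compact[_ b0] _] [U [V [[_ hU] [_ hV] e]]]]]].
    by split; [exact: ad_tor_sub|exact: ad_tor_abelian].
  by split=> //; rewrite e lieDr hU // hV // b0 oppr0 !scale0r addr0.
have kS := real_spanP (tor D `|` [set X | alg D X /\
  exists2 b, compact_root D s b /\ positive_root D b &
   exists A B, [/\ root_space D b A, root_space D (fun H => - b H) B & X = A + B]]).
(* Decompose X into torus and root parts. A nonzero entry (u, v) forces the weights of u and v to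
   agree at [w s], so its root is compact. *)
have hB : block f r S X by rewrite -(ad_alg ad).
rewrite (block_decomp hB); have [k0 kD _] := kS.
apply: kD.
  by apply: sub_real_span; left; rewrite (ad_tor ad); exact: dpart_block.
apply: real_subspace_sum => // u; apply: real_subspace_sum => // v.
have [->|uv] := eqVneq u v; first by rewrite /kvec conj_0 !scale0r subr0.
have [->|x0] := eqVneq (tw f X u v) 0; first by rewrite mulr0 /kvec conj_0 !scale0r subr0.
have [ruv nuv] : r u v /\ nz f u v.
  apply: ad_complexP x0; exists X, 0; split=> //; last by rewrite scaler0 addr0.
  by case: ad_subspace.
have e : wt f u (w s) = wt f v (w s).
  have := ad_tw_lie X u v wt_s; rewrite cX tw0 mxE => /esym/eqP.
  by rewrite mulf_eq0 (negbTE x0) orbF subr_eq0 => /eqP.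
have hb := ad_is_root ruv uv nuv.
have cb : compact_root D s (fun H => wt f u H - wt f v H).
  by apply/ad_compact; split=> //; rewrite e subrr.
have rvu : r v u by rewrite (ad_sym ad).
have vu : v != u by rewrite eq_sym.
have nvu : nz f v u.
  by rewrite /nz mulrC (_ : (u == fstar f v) = (v == fstar f u)) //
     -(inj_eq (@fstar_inj _ _ f)) fstarK eq_sym.
have hb' := ad_is_root rvu vu nvu.
have cb' : compact_root D s (fun H => wt f v H - wt f u H).
  by apply/ad_compact; split=> //; rewrite e subrr.
set c := 2%:R^-1 * _.
have kc : alg D (kvec f c u v).
  by rewrite (ad_alg ad); apply: kvec_block => //; [exact: ad_sym ad|exact: ad_star ad].
have rsZ b Z (z : R[i]) : root_space D b Z -> root_space D b (z *: Z).
  move=> [hZ h]; split; first exact: complexificationZ ad_subspace hZ.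
  by move=> H hH; rewrite lieZr h // !scalerA mulrC.
have rsext b b' Z : (forall H, b H = b' H) -> root_space D b Z -> root_space D b' Z.
  by move=> eb [hZ h]; split=> // H hH; rewrite -eb h.
have [cc hcc cs] := ad_root ad ruv uv nuv.
(* The generators of k_phi are indexed by positive roots: take the root of (u, v) or that of (v, u),
   according to the sign of the coefficients. *)
apply: sub_real_span; right; split=> //; case: cs => cs.
  exists (fun H => wt f u H - wt f v H).
    by split=> //; split=> //; exists cc.
  exists (c *: rvec f u v), (- c^* *: rvec f v u); split; last by rewrite scaleNr.
    by apply: rsZ; exact: ad_rvec_root_space.
  apply: rsZ; apply: rsext (ad_rvec_root_space rvu vu) => H.
  by rewrite opprB.
exists (fun H => wt f v H - wt f u H).
  split=> //; split=> //; exists (fun j => - cc j); last by move=> j hj; rewrite oppr_ge0 cs.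
  move=> H hH; rewrite -opprB hcc // -sumrN; apply: eq_bigr => j _.
  by rewrite rmorphN mulNr.
exists (- c^* *: rvec f v u), (c *: rvec f u v); split; last by rewrite scaleNr addrC.
  by apply: rsZ; exact: ad_rvec_root_space.
apply: rsZ; apply: rsext (ad_rvec_root_space ruv uv) => H.
by rewrite opprB.
Qed.

(** A central element commutes with the torus, hence lies in it. Commuting with the root vectors of
    the other simple roots kills all simple roots but the s-th, whose value is imaginary, so the
    element is a real multiple of [w s]. *)
Lemma ad_z_phi : z_phi D s = [set X | exists t : R, X = (t%:C)%C *: w s].
Proof.
have wt_s := ad_cow_tor ad hs.
rewrite /z_phi ad_k_phi; apply/seteqP; split => [X [[aX _] cX]|X [t ->]]; last first.
  split; last by move=> Y [_ cY]; rewrite lieZl cY scaler0.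
  split; last by rewrite lieZr ad_tor_abelian // scaler0.
  by apply: ad_tor_sub; case: ad_tor_subspace => _ _; apply.
have hX : tor D X.
  have [_ _ _ h] := ad_cartan; apply: h => // H hH.
  by rewrite lieC cX ?oppr0 //; split; [exact: ad_tor_sub|exact: ad_tor_abelian].
have simp_X j : (1 <= j <= rnk D)%N -> j != s -> simp D j X = 0.
  move=> hj js; have [u [v [ruv uv nuv e]]] := ad_simp ad hj; rewrite e //.
  apply/eqP; rewrite subr_eq0; apply/eqP; apply: (ad_root_vector_comm ruv) => //.
  have [Z1 Z2] := ad_rvec_root_space ruv uv.
  have e0 : lie (w s) (rvec f u v) = 0.
    by rewrite Z2 // -e // (ad_cow ad) // (negbTE js) mul0r scale0r.
  have [A [B [hA hB eZ]]] := Z1; rewrite eZ lieDr lieZr.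
  (* The root vector is only in the complexification; its two parts in the compact algebra commute
     with [w s] separately, and so belong to k_phi. *)
  have [eA eB] : lie (w s) A = 0 /\ lie (w s) B = 0.
    have kw := ad_skew (ad_tor_sub wt_s).
    apply: skew_complex_eq0; last by rewrite -lieZr -lieDr -eZ.
      by apply: adjoint_mx_lie => //; exact: ad_skew.
    by apply: adjoint_mx_lie => //; exact: ad_skew.
  by rewrite cX // cX // scaler0 addr0.
have [u [v [ruv uv nuv e]]] := ad_simp ad hs.
have im H : tor D H -> (wt f u H - wt f v H)^* = - (wt f u H - wt f v H).
  rewrite (ad_tor ad) => bH; rewrite conj_sub /wt {1}(block_skew u u bH) {1}(block_skew v v bH).
  by rewrite !conj_opp !conjCK opprB addrC opprK.
have /complex_realP[t ht] : - 'i * simp D s X \is Num.real.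
  apply/CrealP; rewrite conj_mul conj_opp conjCi e // im //; ring.
exists t; apply/eqP; rewrite -subr_eq0; apply/eqP.
have hd : tor D (X - (t%:C)%C *: w s).
  by apply: real_subspaceB => //; [exact: ad_tor_subspace|case: ad_tor_subspace => _ _; apply].
apply: (ad_nondeg ad) => // j hj.
have [u' [v' [_ _ _ e']]] := ad_simp ad hj.
have -> : simp D j (X - (t%:C)%C *: w s) = simp D j X - (t%:C)%C * simp D j (w s).
  by rewrite !e' // /wt twD twN twZ !mxE; ring.
rewrite (ad_cow ad) //; have [->|js] := eqVneq j s; last by rewrite simp_X // mul0r mulr0 subr0.
have ii : 'i * 'i = -1 :> R[i] by rewrite -expr2 sqrCi.
by rewrite mul1r -ht; ring: ii.
Qed.

(** Read at the coweight, the coefficient of the s-th simple root can only be 0, 1 or -1, and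
    positivity of the root excludes -1. *)
Lemma ad_noncompact : (forall u v, r u v -> u != v -> nz f u v ->
    [\/ wt f u (w s) = wt f v (w s), wt f u (w s) = wt f v (w s) + 'i
      | wt f v (w s) = wt f u (w s) + 'i]) ->
  noncompact_simple D s.
Proof.
move=> h; split=> // b c [hb [c' hc' c'0]] hc.
have [u [v [ruv uv nuv eb]]] := ad_root_pair hb.
have wt_s := ad_cow_tor ad hs.
have e : c s = c' s.
  have := ad_coef_cow hs hc; rewrite (ad_coef_cow hs hc').
  by move/(mulIf (neq0Ci _))/intr_inj.
have := c'0 _ hs; rewrite -e => cs0.
have := ad_coef_cow hs hc; rewrite eb //.
case: (h _ _ ruv uv nuv) => ->.
- rewrite subrr => /esym/eqP; rewrite mulf_eq0 (negbTE (neq0Ci _)) orbF intr_eq0.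
  by move/eqP; left.
- rewrite addrC addrA addNr add0r -{1}['i]mul1r => /(mulIf (neq0Ci _)) e1; right.
  by apply: (@intr_inj R[i]); rewrite -e1.
- rewrite opprD addrA subrr add0r -mulN1r => /(mulIf (neq0Ci _)) e1.
  have c1 : c s = -1 by apply: (@intr_inj R[i]); rewrite -e1.
  by move: cs0; rewrite c1.
Qed.

End Node.

Lemma ad_lie_cow_entry s X u v : (1 <= s <= rnk D)%N -> alg D X -> lie (w s) X = 0 ->
  tw f X u v != 0 -> r u v /\ wt f u (w s) = wt f v (w s).
Proof.
move=> hs hX cX x0; split.
  apply: (proj1 (ad_complexP _ x0)); exists X, 0; split=> //; last by rewrite scaler0 addr0.
  by case: ad_subspace.
have := ad_tw_lie X u v (ad_cow_tor ad hs); rewrite cX tw0 mxE => /esym/eqP.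
by rewrite mulf_eq0 (negbTE x0) orbF subr_eq0 => /eqP.
Qed.

Lemma ad_lie_cow s X : (1 <= s <= rnk D)%N ->
  (forall u v, tw f X u v != 0 -> wt f u (w s) = wt f v (w s)) -> lie (w s) X = 0.
Proof.
move=> hs h; apply: (@tw_inj _ _ f); apply/matrixP => u v.
rewrite (ad_tw_lie _ _ _ (ad_cow_tor ad hs)) tw0 mxE.
have [->|/h ->] := eqVneq (tw f X u v) 0; first by rewrite mulr0.
by rewrite subrr mul0r.
Qed.

End Adapted.

(** * Semisimple parts of centralizers, and chains as common centralizers *)

(** The conditions on [r'] say that its blocks lie in the blocks of the centralizer and absorb them
    under composition, which makes [alg D'] an ideal. Subtracting a multiple of [w s] gives the sum;
    it is direct because a common element would span an abelian ideal of the semisimple algebra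
    [alg D']. *)
Lemma ad_semisimple_part (R : realType) (N : nat) (f : frame R N) (D D' : rootDatum R N) r r' S S' w w' s :
  adapted f D r S w -> adapted f D' r' S' w' -> (1 <= s <= rnk D)%N ->
  (forall u v, r' u v -> r u v /\ wt f u (w s) = wt f v (w s)) ->
  (forall u v x, r u x -> wt f u (w s) = wt f x (w s) -> r' x v -> r' u v) ->
  (forall u v, r u v -> wt f u (w s) = wt f v (w s) -> S' u = S' v) ->
  alg D' `<=` alg D ->
  (forall X, alg D X -> lie (w s) X = 0 -> exists t : R, alg D' (X - (t%:C)%C *: w s)) ->
  (forall j, (1 <= j <= rnk D')%N -> exists j', [/\ (1 <= j' <= rnk D)%N, j' != s
     & forall H, tor D' H -> simp D' j H = simp D j' H]) ->
  semisimple_part D s D'.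
Proof.
move=> ad ad' hs rr' rr'r clS' sub split_X simps.
have wt_s := ad_cow_tor ad hs.
have sub' : alg D' `<=` k_phi D s.
  rewrite (ad_k_phi ad hs) => X hX; split; first exact: sub.
  apply: (ad_lie_cow ad hs) => u v; rewrite (ad_alg ad') in hX.
  have [_ _ h _] := hX; move=> x0; apply: (proj2 (rr' u v _)).
  by apply: contraNT x0 => /h ->.
have torE : tor D' = tor D `&` alg D'.
  apply/seteqP; split=> [X hX|X [/(ad_torP ad)[_ h] hX]].
    have [hX' h] := proj1 (ad_torP ad' X) hX; split=> //.
    by apply/(ad_torP ad); split=> //; exact: sub.
  by apply/(ad_torP ad').
have ideal : lie_ideal (k_phi D s) (alg D').
  split=> //; first exact: ad_subspace ad'.
  rewrite (ad_k_phi ad hs) => X Y [hX cX] hY.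
  have supX u v := @ad_lie_cow_entry _ _ _ _ _ _ _ ad s X u v hs hX cX.
  have hXb : block f r S X by rewrite -(ad_alg ad).
  have hYb : block f r' S' Y by rewrite -(ad_alg ad').
  have [X1 X2 X3 X4] := hXb; have [Y1 Y2 Y3 Y4] := hYb.
  rewrite (ad_alg ad'); split.
  - exact: adjoint_mx_lie.
  - exact: star_sym_lie.
  - move=> u v ruv; rewrite tw_lie !mxE -sumrB big1 // => x _.
    have -> : tw f X u x * tw f Y x v = 0.
      have [->|/supX[rux eux]] := eqVneq (tw f X u x) 0; first by rewrite mul0r.
      by rewrite Y3 ?mulr0 //; apply: contra ruv; exact: rr'r.
    have -> : tw f Y u x * tw f X x v = 0.
      have [->|/supX[rxv exv]] := eqVneq (tw f X x v) 0; first by rewrite mulr0.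
      rewrite Y3 ?mul0r //; apply: contra ruv => rux; rewrite (ad_sym ad').
      apply: (rr'r _ _ x) => //; first by rewrite (ad_sym ad).
      by rewrite (ad_sym ad').
    by rewrite subrr.
  - apply: partial_trace_lie => u v; apply: contraNeq => /supX[ruv euv].
    by rewrite (clS' u v).
split=> //.
- exact: ad_well_formed ad'.
- rewrite /set_dsum (ad_z_phi ad hs) (ad_k_phi ad hs); split.
    apply/seteqP; split=> [X [hX cX]|X [A [B [hA [t ->] ->]]]].
      have [t ht] := split_X _ hX cX.
      by exists (X - (t%:C)%C *: w s), ((t%:C)%C *: w s); split=> //;
        [exists t|rewrite subrK].
    have := sub' _ hA; rewrite (ad_k_phi ad hs) => -[aA cA]; split.
      have [_ hD hZ] := ad_subspace ad; apply: hD => //; apply: hZ.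
      exact: (ad_tor_sub ad).
    by rewrite lieDr cA lieZr (ad_tor_abelian ad) // scaler0 addr0.
  move=> X [hX [t eX]] /=.
  have cX Y : alg D' Y -> lie X Y = 0.
    move=> /sub'; rewrite (ad_k_phi ad hs) => -[_ cY].
    by rewrite eX lieZl cY scaler0.
  apply: (@ad_semisimple _ _ _ _ _ _ _ ad' [set Z | exists t : R, Z = (t%:C)%C *: X]);
    last by exists 1; rewrite rmorph1 scale1r.
    have [h0 hD hZ] := ad_subspace ad'; split.
    + split=> [|_ _ [a ->] [b ->]|a _ [b ->]].
      * by exists 0; rewrite rmorph0 scale0r.
      * by exists (a + b); rewrite rmorphD scalerDl.
      * by exists (a * b); rewrite rmorphM scalerA.
    + by move=> _ [a ->]; exact: hZ.
    + move=> Y _ hY [a ->]; exists 0.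
      by rewrite lieZr lieC cX // oppr0 scaler0 rmorph0 scale0r.
  by move=> _ _ [a ->] [b ->]; rewrite lieZl lieZr cX // !scaler0.
Qed.

(** The tori of a chain decrease, so all the coweights [om j] lie in the first torus and commute.
    Centralizing [om i] then only affects the current semisimple part, which splits into the next
    one and the line of [om i]. *)
Lemma chain_algE (R : realType) (N : nat) (E : nat -> rootDatum R N) s l
    (om : nat -> 'M[R[i]]_N) : is_chain E s l ->
  (forall j, (j < l)%N -> tor (E j) (om j)) ->
  (forall j, (j < l)%N -> k_phi (E j) (s j) = [set X | alg (E j) X /\ lie (om j) X = 0]) ->
  (forall j, (j < l)%N -> z_phi (E j) (s j) = [set X | exists t : R, X = (t%:C)%C *: om j]) ->
  forall i, (0 < i <= l)%N -> chain_alg E s i =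
    [set X | alg (E 0%N) X /\ forall j, (j < i)%N -> lie (om j) X = 0].
Proof.
move=> [wf ch] hom hk hz.
have tor_sub j : (j <= l)%N -> tor (E j) `<=` tor (E 0%N).
  elim: j => [_ X //|j IH jl X]; have [_ [_ _ _ -> _]] := ch _ jl.
  by case=> hX _; apply: IH => //; exact: ltnW.
have omT j : (j < l)%N -> tor (E 0%N) (om j).
  by move=> jl; apply: (tor_sub j (ltnW jl)); exact: hom.
have [[[_ aD aZ] _] _ _ [_ torA torC _] _] := wf.
have comm j j' (t : R) : (j < l)%N -> (j' < l)%N -> lie (om j) ((t%:C)%C *: om j') = 0.
  by move=> jl jl'; rewrite lieZr torC ?scaler0 //; exact: omT.
(* The induction needs the splitting that ends in the semisimple part [alg (E i)]; [chain_alg] ends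
   one stage earlier, in k_phi, and is recovered from it afterwards. *)
have key i : (i <= l)%N -> forall X,
    (alg (E 0%N) X /\ forall j, (j < i)%N -> lie (om j) X = 0) <->
    exists Y (Z : nat -> 'M[R[i]]_N), [/\ alg (E i) Y,
      forall j, (j < i)%N -> z_phi (E j) (s j) (Z j) & X = Y + \sum_(j < i) Z j].
  elim: i => [_ X|i IH il X].
    split=> [[hX _]|[Y [Z [hY _ ->]]]]; last by rewrite big_ord0 addr0.
    by exists X, (fun=> 0); rewrite big_ord0 addr0.
  have [_ [_ [_ sub _] [kE _] _ _]] := ch _ il.
  split=> [[hX cX]|[Y [Z [hY hZ eX]]]].
    have [Y [Z [hY hZ eX]]] : exists Y (Z : nat -> 'M[R[i]]_N), [/\ alg (E i) Y,
      forall j, (j < i)%N -> z_phi (E j) (s j) (Z j) & X = Y + \sum_(j < i) Z j].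
      by apply/IH; [exact: ltnW|split=> // j ji; apply: cX; exact: ltnW].
    have kY : k_phi (E i) (s i) Y.
      rewrite hk //; split=> //.
      have := cX i (ltnSn i); rewrite eX lieDr [X in _ + X]lieC lie_suml big1 ?oppr0 ?addr0 //.
      move=> j _; have jl : (j < l)%N by apply: ltn_trans il.
      by have := hZ j (ltn_ord j); rewrite hz // => -[t ->]; rewrite lieC comm ?oppr0.
    move: kY; rewrite kE => -[A [B [hA hB eY]]].
    exists A, (fun j => if (j < i)%N then Z j else B); split=> //.
      move=> j; rewrite ltnS leq_eqVlt => /orP[/eqP ->|ji]; first by rewrite ltnn.
      by rewrite ji; exact: hZ.
    rewrite eX eY big_ord_recr /= ltnn -addrA [B + _]addrC; congr (_ + (_ + _)).
    by apply: eq_bigr => j _; rewrite ltn_ord.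
  have kY := sub _ hY; move: (kY); rewrite hk // => -[aY cY].
  have [hX' cX'] : alg (E 0%N) (Y + \sum_(j < i) Z j) /\
      forall j, (j < i)%N -> lie (om j) (Y + \sum_(j < i) Z j) = 0.
    apply/IH; first exact: ltnW.
    by exists Y, Z; split=> // j ji; apply: hZ; exact: ltnW.
  have := hZ i (ltnSn i); rewrite hz // => -[t eZ].
  rewrite eX big_ord_recr /= addrA eZ; split.
    by apply: aD => //; apply: aZ; apply: torA; exact: omT.
  move=> j; rewrite ltnS leq_eqVlt => /orP[/eqP ->|ji]; last first.
    by rewrite lieDr cX' // comm ?addr0 //; exact: ltn_trans il.
  rewrite !lieDr cY add0r comm // addr0 lieC lie_suml big1 ?oppr0 // => k _.
  have kl : (k < l)%N by apply: ltn_trans il.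
  by have := hZ k (ltnW (ltn_ord k)); rewrite hz // => -[t' ->]; rewrite lieC comm ?oppr0.
move=> [//|i] /andP[_ il]; apply/seteqP; split=> [X [Y [Z [hY hZ eX]]]|X [hX cX]].
  have hY' := hY; move: hY'; rewrite /= hk // => -[aY cY].
  have [hX' cX'] : alg (E 0%N) X /\ forall j, (j < i)%N -> lie (om j) X = 0.
    by apply/key; [exact: ltnW|exists Y, Z].
  split=> // j; rewrite ltnS leq_eqVlt => /orP[/eqP ->|ji]; last exact: cX'.
  rewrite eX lieDr cY add0r lieC lie_suml big1 ?oppr0 // => k _.
  have kl : (k < l)%N by apply: ltn_trans il.
  by have := hZ k (ltn_ord k); rewrite hz // => -[t' ->]; rewrite lieC comm ?oppr0.
have [Y [Z [hY hZ eX]]] : exists Y (Z : nat -> 'M[R[i]]_N), [/\ alg (E i) Y,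
  forall j, (j < i)%N -> z_phi (E j) (s j) (Z j) & X = Y + \sum_(j < i) Z j].
  by apply/key; [exact: ltnW|split=> // j ji; apply: cX; exact: ltnW].
exists Y, Z; split=> //=; rewrite hk //; split=> //.
have := cX i (ltnSn i); rewrite eX lieDr [X in _ + X]lieC lie_suml big1 ?oppr0 ?addr0 //.
move=> j _; have jl : (j < l)%N by apply: ltn_trans il.
by have := hZ j (ltn_ord j); rewrite hz // => -[t ->]; rewrite lieC comm ?oppr0.
Qed.

(** * Weight modules *)

Section WeightBasis.
Context {R : realType} {N : nat} {V : vectType R[i]} {A : finType}.

(** The coordinate functions are part of the data, so that entries in a frame and coefficients of
    exterior forms can be used directly as coordinates. *)
Record wbasis := WBasis {
  wvec : A -> V;
  wcoord : A -> V -> R[i];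
  wcoordD : forall a v1 v2, wcoord a (v1 + v2) = wcoord a v1 + wcoord a v2;
  wcoordZ : forall a c v, wcoord a (c *: v) = c * wcoord a v;
  wcoord_vec : forall a b, wcoord a (wvec b) = (a == b)%:R;
  wcoord_sum : forall v, v = \sum_a wcoord a v *: wvec a }.

Variable B : wbasis.
Implicit Types (T : pred A) (W : {vspace V}).

Definition wspan T : {vspace V} := (\sum_(a | T a) <[wvec B a]>)%VS.

Lemma wcoord0 a : wcoord B a 0 = 0.
Proof. by rewrite -(scale0r 0) wcoordZ mul0r. Qed.

Lemma wcoord_bigsum (I : finType) a (F : I -> V) (P : pred I) :
  wcoord B a (\sum_(b | P b) F b) = \sum_(b | P b) wcoord B a (F b).
Proof. by elim/big_rec2: _ => [|b y x _ <-]; rewrite ?wcoord0 ?wcoordD. Qed.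

Lemma wcoord_inj v1 v2 : (forall a, wcoord B a v1 = wcoord B a v2) -> v1 = v2.
Proof.
move=> h; rewrite [v1](wcoord_sum B) [v2](wcoord_sum B).
by apply: eq_bigr => a _; rewrite h.
Qed.

Lemma mem_wvec T a : T a -> wvec B a \in wspan T.
Proof. by move=> Ta; rewrite /wspan memvE (sumv_sup a). Qed.

Lemma mem_wspan T v : reflect (forall a, ~~ T a -> wcoord B a v = 0) (v \in wspan T).
Proof.
apply: (iffP idP) => [/memv_sumP[F hF ->] a Ta|h].
  rewrite wcoord_bigsum big1 // => b Tb; have /vlineP[c ->] := hF b Tb.
  rewrite wcoordZ wcoord_vec; case: eqP => [e|_]; last by rewrite mulr0.
  by rewrite e Tb in Ta.
rewrite [v](wcoord_sum B) (bigID T) /= [X in _ + X]big1 ?addr0; last first.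
  by move=> a /h ->; rewrite scale0r.
by apply: memv_suml => a Ta; rewrite memvZ ?mem_wvec.
Qed.

Lemma sub_wspan T1 T2 : (forall a, T1 a -> T2 a) -> (wspan T1 <= wspan T2)%VS.
Proof.
move=> h; apply/subvP => v /mem_wspan hv; apply/mem_wspan => a Ta; apply: hv.
by apply: contra Ta; exact: h.
Qed.

Lemma eq_wspan T1 T2 : T1 =1 T2 -> wspan T1 = wspan T2.
Proof. by move=> e; apply: eq_bigl. Qed.

Lemma wspan_cap T1 T2 : (wspan T1 :&: wspan T2)%VS = wspan (predI T1 T2).
Proof.
apply/vspaceP => v; rewrite memv_cap; apply/andP/mem_wspan.
  move=> [/mem_wspan h1 /mem_wspan h2] a; rewrite /= negb_and.
  by case/orP => [/h1|/h2].
by move=> h; split; apply/mem_wspan => a Ta; apply: h; rewrite /= (negbTE Ta) ?andbF.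
Qed.

Lemma wspan_add T1 T2 : (wspan T1 + wspan T2)%VS = wspan (predU T1 T2).
Proof.
apply: subv_anti; rewrite subv_add !sub_wspan /= => [|a -> //|a ->]; rewrite ?orbT //.
apply/subv_sumP => a /= /orP[Ta|Ta]; rewrite -memvE.
  by apply: (subvP (addvSl _ _)); exact: mem_wvec.
by apply: (subvP (addvSr _ _)); exact: mem_wvec.
Qed.

Lemma wspan_full : wspan predT = fullv.
Proof. by apply/vspaceP => v; rewrite memvf; apply/mem_wspan. Qed.

Lemma wspan0 T : (forall a, ~~ T a) -> wspan T = 0%VS.
Proof. by move=> h; rewrite /wspan big_pred0 // => a; apply/negbTE. Qed.

Lemma wspan_dsum T T1 : (forall a, T1 a -> T a) ->
  is_dsum (wspan T) (wspan T1) (wspan (fun a => T a && ~~ T1 a)).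
Proof.
move=> h; split.
  rewrite wspan_add; apply: eq_wspan => a /=.
  by have := h a; case: (T1 a) => [->//|_]; rewrite andbT.
rewrite wspan_cap; apply/eqP; rewrite -subv0; apply/subvP => v /mem_wspan hv.
rewrite memv0; apply/eqP; apply: wcoord_inj => a; rewrite wcoord0 hv //=.
by case: (T1 a); rewrite ?andbF.
Qed.

Implicit Types (h t : set 'M[R[i]]_N) (pi : 'M[R[i]]_N -> 'End(V)).

Definition complex_linear pi : Prop :=
  forall (c : R[i]) X Y, pi (c *: X + Y) = c *: pi X + pi Y.

Section Irreducible.
Variables (pi : 'M[R[i]]_N -> 'End(V)) (lam : A -> 'M[R[i]]_N -> R[i]).
Hypothesis pi_lin : complex_linear pi.

Lemma complex_linearD X Y : pi (X + Y) = pi X + pi Y.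
Proof. by rewrite -{1}[X]scale1r pi_lin scale1r. Qed.

Lemma complex_linear0 : pi 0 = 0.
Proof. by apply: (addrI (pi 0)); rewrite -complex_linearD !addr0. Qed.

Lemma complex_linearZ (c : R[i]) X : pi (c *: X) = c *: pi X.
Proof. by rewrite -[c *: X]addr0 pi_lin complex_linear0 addr0. Qed.

Definition diag_on t : Prop := forall H a, t H -> pi H (wvec B a) = lam a H *: wvec B a.

Lemma diag_on_coord t H a v : diag_on t -> t H ->
  wcoord B a (pi H v) = lam a H * wcoord B a v.
Proof.
move=> d tH; rewrite {1}[v](wcoord_sum B) linear_sum wcoord_bigsum (bigD1 a) //=.
rewrite big1 ?addr0 => [|b ba]; rewrite linearZ /= d // !wcoordZ wcoord_vec.
  by rewrite eqxx mulr1 mulrC.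
by rewrite eq_sym (negbTE ba) !mulr0.
Qed.

Definition separated_on t T : Prop := forall a b, T a -> T b -> a != b ->
  exists2 H, t H & lam a H != lam b H.

(** The other coordinates are killed one at a time: if H separates the weights of a and b, then pi H
    minus the weight of b annihilates the coordinate b and keeps the coordinate a nonzero. What
    survives is a multiple of [wvec B a]. *)
Lemma weight_vector_mem t T W w a : diag_on t -> separated_on t T ->
  (W <= wspan T)%VS -> invariant_sub t pi W -> w \in W -> wcoord B a w != 0 ->
  wvec B a \in W.
Proof.
move=> d sep WT inv wW xa.
have Tcoord v b : v \in W -> wcoord B b v != 0 -> T b.
  by move=> /(subvP WT)/mem_wspan hv; apply: contraNT => /hv ->.
have key (s : seq A) : a \notin s ->
    exists2 v, v \in W & wcoord B a v != 0 /\ forall b, b \in s -> wcoord B b v = 0.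
  elim: s => [_|b s IH]; first by exists w.
  rewrite inE negb_or => /andP[ab /IH[v vW [va vs]]].
  have [vb|vb] := eqVneq (wcoord B b v) 0.
    by exists v => //; split=> // c; rewrite inE => /orP[/eqP ->|/vs].
  have [H tH lH] := sep a b (Tcoord _ _ vW va) (Tcoord _ _ vW vb) ab.
  have co c : wcoord B c (pi H v - lam b H *: v) = (lam c H - lam b H) * wcoord B c v.
    by rewrite wcoordD -scaleNr wcoordZ (diag_on_coord _ _ d) // mulrBl mulNr.
  exists (pi H v - lam b H *: v).
    by rewrite rpredB ?memvZ //; apply: (subvP (inv _ tH)); exact: memv_img.
  split; first by rewrite co mulf_neq0 // subr_eq0.
  move=> c; rewrite co inE => /orP[/eqP ->|/vs ->]; last by rewrite mulr0.
  by rewrite subrr mul0r.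
have [|v vW [va vs]] := key [seq b <- enum A | b != a]; first by rewrite mem_filter eqxx.
have e : v = wcoord B a v *: wvec B a.
  rewrite {1}[v](wcoord_sum B) (bigD1 a) //= big1 ?addr0 // => b ba.
  by rewrite vs ?scale0r // mem_filter ba mem_enum.
move: (wcoord B a v) e va => c e c0; rewrite e in vW.
by have := memvZ c^-1 vW; rewrite scalerA mulVf // scale1r.
Qed.

Definition step h a b : Prop := exists Z (d : R[i]),
  [/\ complexification h Z, d != 0 & pi Z (wvec B a) = d *: wvec B b].

(** Connectedness stated as an induction principle, which is the form in which an invariant subspace
    uses it: containing one weight vector, it contains them all. *)
Definition connected h T : Prop := forall Q : A -> Prop,
  (forall a b, T a -> T b -> step h a b -> Q a -> Q b) ->
  forall a b, T a -> T b -> Q a -> Q b.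

Lemma step_connected h T : (forall a b, T a -> T b -> a != b -> step h a b) ->
  connected h T.
Proof.
move=> st Q hQ a b Ta Tb; have [->//|ab] := eqVneq a b.
by apply: hQ => //; exact: st.
Qed.

Lemma invariant_complexification h W Z : invariant_sub h pi W ->
  complexification h Z -> forall v, v \in W -> pi Z v \in W.
Proof.
move=> inv [X [Y [hX hY ->]]] v vW.
rewrite complex_linearD complex_linearZ add_lfunE scale_lfunE rpredD ?memvZ //.
  by apply: (subvP (inv _ hX)); exact: memv_img.
by apply: (subvP (inv _ hY)); exact: memv_img.
Qed.

Lemma wspan_irreducible h t T a0 : diag_on t -> separated_on t T -> t `<=` h -> T a0 ->
  invariant_sub h pi (wspan T) -> connected h T -> irreducible_rep h pi (wspan T).
Proof.
move=> d sep th Ta0 inv con; split=> //.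
  move=> e; have := mem_wvec Ta0; rewrite e memv0 => /eqP e0.
  by have := wcoord_vec B a0 a0; rewrite e0 wcoord0 eqxx => /esym/eqP; rewrite oner_eq0.
move=> W WT invW; have [W0|] := eqVneq W 0%VS; first by left.
rewrite -vpick0 => w0; right; apply: subv_anti; rewrite WT /=.
have wW := memv_pick W; set w := vpick W in w0 wW.
have [a xa] : exists a, wcoord B a w != 0.
  apply/existsP; apply: contraNT w0; rewrite negb_exists => /forallP hw.
  apply/eqP; apply: wcoord_inj => a; rewrite wcoord0; apply/eqP.
  by rewrite -[_ == _]negbK.
have fa : wvec B a \in W.
  by apply: (weight_vector_mem d sep WT _ wW xa) => H tH; apply: invW; exact: th.
have Ta : T a.
  by apply: contraNT xa => Ta; move/(subvP WT)/mem_wspan: wW => /(_ _ Ta) ->.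
apply/subv_sumP => b Tb; rewrite -memvE.
apply: (con (fun b => wvec B b \in W)) Ta Tb fa => c c' _ _ [Z [x [hZ x0 e]]] fc.
have := invariant_complexification invW hZ fc; rewrite e => /(memvZ x^-1).
by rewrite scalerA mulVf // scale1r.
Qed.

End Irreducible.

Section Highest.
Variables (f : frame R N) (D : rootDatum R N) (r : rel 'I_N) (S : pred 'I_N).
Variable (w : nat -> 'M[R[i]]_N).
Hypothesis ad : adapted f D r S w.
Variables (pi : 'M[R[i]]_N -> 'End(V)) (lam : A -> 'M[R[i]]_N -> R[i]).
Hypothesis pi_lin : complex_linear pi.
Hypothesis pi_rep : is_rep (alg D) pi.
Hypothesis diag : diag_on pi lam (tor D).

Lemma complexification_bracket X Z v : alg D X -> complexification (alg D) Z ->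
  pi (lie X Z) v = pi X (pi Z v) - pi Z (pi X v).
Proof.
have [_ _ h] := pi_rep => hX [Y [Y' [hY hY' ->]]].
rewrite lieDr lieZr (complex_linearD pi_lin) (complex_linearZ pi_lin) !h //.
rewrite (complex_linearD pi_lin Y) (complex_linearZ pi_lin _ Y').
rewrite !(add_lfunE, scale_lfunE, opp_lfunE, comp_lfunE).
have -> : pi X (pi Y v + 'i *: pi Y' v) = pi X (pi Y v) + 'i *: pi X (pi Y' v).
  by rewrite linearD linearZ.
by rewrite scalerBr opprD addrACA.
Qed.

(** If a positive root vector moved a0 to a, its root would be the weight of a minus that of a0. On
    every coweight it would be nonnegative by positivity and nonpositive by dominance of a0, hence
    zero, which a root is not. *)
Lemma wspan_highest_weight T a0 : T a0 -> irreducible_rep (alg D) pi (wspan T) ->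
  (forall a j, T a -> (1 <= j <= rnk D)%N ->
     exists2 x : R[i], 0 <= x & lam a0 (w j) - lam a (w j) = x * 'i) ->
  has_highest_weight D pi (wspan T) (lam a0).
Proof.
move=> Ta0 irr dom; split=> //; exists (wvec B a0); split.
- exact: mem_wvec.
- apply/eqP => e0; have := wcoord_vec B a0 a0.
  by rewrite e0 wcoord0 eqxx => /esym/eqP; rewrite oner_eq0.
- by move=> H tH; exact: diag.
move=> b X Y [rb [c hc c0]] hX hY [cZ hZ]; set Z := X + 'i *: Y in cZ hZ.
have -> : pi X (wvec B a0) + 'i *: pi Y (wvec B a0) = pi Z (wvec B a0).
  by rewrite /Z (complex_linearD pi_lin) (complex_linearZ pi_lin) add_lfunE scale_lfunE.
have uT : pi Z (wvec B a0) \in wspan T.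
  apply: (invariant_complexification pi_lin) cZ _ _; [by case: irr|exact: mem_wvec].
apply: wcoord_inj => a; rewrite wcoord0.
have [//|xa] := eqVneq (wcoord B a (pi Z (wvec B a0))) 0.
have Ta : T a by apply: contraNT xa => Ta; move/mem_wspan: uT => /(_ _ Ta) ->.
have hb H : tor D H -> b H = lam a H - lam a0 H.
  move=> tH; have aH := ad_tor_sub ad tH.
  have := complexification_bracket (wvec B a0) aH cZ.
  rewrite hZ // (complex_linearZ pi_lin) (diag a0 tH) linearZ /= => /(congr1 (wcoord B a)).
  rewrite wcoordD -scaleN1r !wcoordZ (diag_on_coord _ _ diag) // scale_lfunE wcoordZ.
  move=> e; apply: (mulIf xa); rewrite e; ring.
have cz j : (1 <= j <= rnk D)%N -> c j = 0.
  move=> hj; apply/eqP; rewrite eq_le c0 // andbT.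
  have [x x0 ex] := dom a j Ta hj.
  have := ad_coef_cow ad hj hc; rewrite hb; last exact: (ad_cow_tor ad).
  rewrite -opprB ex -mulNr => /(mulIf (neq0Ci _)) e.
  by rewrite -(ler_int R[i]) -e oppr_le0.
case: rb => -[H tH /eqP[]]; rewrite hc // big_nat_cond big1 // => j.
by rewrite andbT ltnS => hj; rewrite cz // mul0r.
Qed.

Lemma centralizer_complexification s Z : (1 <= s <= rnk D)%N ->
  complexification (alg D) Z -> lie (w s) Z = 0 -> complexification (k_phi D s) Z.
Proof.
move=> hs [X [Y [hX hY ->]]]; rewrite lieDr lieZr => h; exists X, Y.
have hw := ad_skew ad (ad_tor_sub ad (ad_cow_tor ad hs)).
have [eX eY] : lie (w s) X = 0 /\ lie (w s) Y = 0.
  apply: skew_complex_eq0 => //; apply: adjoint_mx_lie => //; exact: (ad_skew ad).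
by split=> //; rewrite (ad_k_phi ad hs).
Qed.

Lemma rvec_alg u v : r u v -> u != v -> complexification (alg D) (rvec f u v).
Proof. by move=> ruv uv; case: (ad_rvec_root_space ad ruv uv). Qed.

Lemma rvec_k_phi s u v : (1 <= s <= rnk D)%N -> r u v -> u != v ->
  wt f u (w s) = wt f v (w s) -> complexification (k_phi D s) (rvec f u v).
Proof.
move=> hs ruv uv e; apply: centralizer_complexification => //; first exact: rvec_alg.
have [_ ->] := ad_rvec_root_space ad ruv uv; last exact: (ad_cow_tor ad).
by rewrite e subrr scale0r.
Qed.

Lemma graded_piece_wspan T T1 s (l : R[i]) k : (1 <= s <= rnk D)%N ->
  (forall a, T1 a <-> T a /\ lam a (w s) = l - 'i * k%:R) ->
  graded_piece pi (wspan T) (w s) l k = wspan T1.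
Proof.
move=> hs h; apply/vspaceP => v; rewrite /graded_piece memv_cap memv_ker.
have e a : wcoord B a ((pi (w s) - (l - 'i * k%:R) *: \1%VF) v) =
    (lam a (w s) - (l - 'i * k%:R)) * wcoord B a v.
  rewrite add_lfunE opp_lfunE scale_lfunE id_lfunE -scaleNr wcoordD wcoordZ.
  by rewrite (diag_on_coord _ _ diag) ?mulrDl //; exact: (ad_cow_tor ad).
apply/andP/mem_wspan => [[/mem_wspan vT /eqP v0] a Ta|hv].
  have := e a; rewrite v0 wcoord0 => /esym/eqP; rewrite mulf_eq0 subr_eq0.
  case/orP => /eqP // la; apply: vT; apply: contra Ta => Ta.
  by apply/h.
split.
  by apply/mem_wspan => a Ta; apply: hv; apply: contra Ta => /h[].
apply/eqP; apply: wcoord_inj => a; rewrite e wcoord0.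
have [/h[_ ->]|/hv ->] := boolP (T1 a); last by rewrite mulr0.
by rewrite subrr mul0r.
Qed.

(** Every positive minimality claim of the development ends here. What remains to be checked
    concerns only the index set: eigenvalues of the coweight, connectedness under root vectors, and
    dominance of one index. *)
Lemma wspan_phi_minimal T Tp s (l : R[i]) a0 : (1 <= s <= rnk D)%N ->
  separated_on lam (tor D) T -> invariant_sub (alg D) pi (wspan T) ->
  connected pi (alg D) T -> connected pi (k_phi D s) Tp ->
  Tp a0 -> (forall a, Tp a -> T a) ->
  (forall a, T a -> lam a (w s) = if Tp a then l else l - 'i) ->
  (forall a j, T a -> (1 <= j <= rnk D)%N ->
     exists2 x : R[i], 0 <= x & lam a0 (w j) - lam a (w j) = x * 'i) ->
  phi_minimal D s pi (wspan T) (wspan Tp) (wspan (fun a => T a && ~~ Tp a)) l.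
Proof.
move=> hs sep inv con conp Tp0 sub hl dom; exists (lam a0), (w s).
have irr : irreducible_rep (alg D) pi (wspan T).
  by apply: (wspan_irreducible pi_lin diag sep) con => //; [exact: ad_tor_sub ad|exact: sub Tp0].
have hTp a : Tp a <-> T a /\ lam a (w s) = l - 'i * 0%:R.
  rewrite mulr0 subr0; split=> [Ta|[Ta]]; first by split; [exact: sub|rewrite hl ?Ta //; exact: sub].
  rewrite hl //; case: (Tp a) => // /eqP; rewrite -subr_eq0 addrAC subrr sub0r oppr_eq0.
  by rewrite (negbTE (neq0Ci _)).
have hTm a : T a && ~~ Tp a <-> T a /\ lam a (w s) = l - 'i * 1%:R.
  rewrite mulr1; split=> [/andP[Ta nTa]|[Ta]]; first by rewrite hl // (negbTE nTa).
  rewrite hl // Ta; case: (Tp a) => // /eqP.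
  by rewrite -subr_eq0 opprB addrCA subrr addr0 (negbTE (neq0Ci _)).
split; split.
- exact: (ad_is_rho ad).
- exact: wspan_highest_weight (sub _ Tp0) irr dom.
- by rewrite hl ?Tp0 //; exact: sub.
- by rewrite (graded_piece_wspan hs hTp).
- by rewrite (graded_piece_wspan hs hTm).
- exact: wspan_dsum.
apply: (wspan_irreducible pi_lin diag (t := tor D) _ _ Tp0) => //.
- by move=> a b Ta Tb; apply: sep; exact: sub.
- rewrite (ad_k_phi ad hs) => H tH; split; first exact: (ad_tor_sub ad).
  by apply: (ad_tor_abelian ad) => //; exact: (ad_cow_tor ad).
(* k_phi commutes with [w s], hence preserves its eigenspace for l in the representation, and this
   eigenspace is spanned by [Tp]. *)
rewrite (ad_k_phi ad hs) => X [hX cX]; apply/subvP => _ /memv_imgP[v vTp ->].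
have tw := ad_cow_tor ad hs; have aw := ad_tor_sub ad tw.
have evp u : u \in wspan Tp -> pi (w s) u = l *: u.
  move=> /mem_wspan hu; apply: wcoord_inj => a; rewrite (diag_on_coord _ _ diag) // wcoordZ.
  have [Ta|/hu ->] := boolP (Tp a); last by rewrite !mulr0.
  by rewrite hl ?Ta //; exact: sub.
have cXZ : complexification (alg D) X.
  by exists X, 0; split=> //; [case: (ad_subspace ad)|rewrite scaler0 addr0].
have := complexification_bracket v aw cXZ; rewrite cX (complex_linear0 pi_lin).
rewrite zero_lfunE (evp v vTp) linearZ /= => e.
apply/mem_wspan => a; apply: contraNeq => xa.
have vT : pi X v \in wspan T.
  apply: (subvP (inv _ hX)); apply: memv_img; exact: (subvP (sub_wspan sub)).
have Ta : T a by apply: contraNT xa => Ta; move/mem_wspan: vT => /(_ _ Ta) ->.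
apply/hTp; split=> //; rewrite mulr0 subr0.
have := congr1 (wcoord B a) e; rewrite wcoord0 -scaleN1r wcoordD !wcoordZ.
rewrite (diag_on_coord _ _ diag) // => /esym/eqP.
rewrite mulrA mulN1r -mulrDl mulf_eq0 (negbTE xa) orbF subr_eq0 => /eqP //.
Qed.

End Highest.

(** The sets of indices decrease, so the pieces removed at the successive steps telescope. *)
Lemma W_minus_wspan (T : nat -> pred A) (Vm : nat -> {vspace V}) l :
  (forall i a, T i.+1 a -> T i a) ->
  (forall i, (i < l)%N -> Vm i.+1 = wspan (fun a => T i a && ~~ T i.+1 a)) ->
  forall i, (i <= l)%N -> W_minus Vm i = wspan (fun a => T 0%N a && ~~ T i a).
Proof.
move=> dec hV; have dec0 i a : T i a -> T 0%N a by elim: i => // i IH /dec.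
rewrite /W_minus; elim=> [_|i IH il].
  by rewrite big_geq // wspan0 // => a; rewrite andbN.
rewrite big_nat_recr //= IH ?(ltnW il) // hV // wspan_add; apply: eq_wspan => a /=.
move/implyP: (dec i a); move/implyP: (dec0 i a).
by case: (T 0%N a); case: (T i a); case: (T i.+1 a).
Qed.

End WeightBasis.

(** * The standard representation in a frame *)

Section StdModule.
Context {R : realType} {N : nat} (f : frame R N).

Definition std_coord (u : 'I_N) (y : 'cV[R[i]]_N) : R[i] := (adjoint_mx (fmat f) *m y) u 0.

Fact std_coordD u (y z : 'cV[R[i]]_N) : std_coord u (y + z) = std_coord u y + std_coord u z.
Proof. by rewrite /std_coord mulmxDr mxE. Qed.

Fact std_coordZ u (c : R[i]) (y : 'cV[R[i]]_N) : std_coord u (c *: y) = c * std_coord u y.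
Proof. by rewrite /std_coord -scalemxAr mxE. Qed.

Fact std_coord_vec u v : std_coord u (col v (fmat f)) = (u == v)%:R.
Proof.
have := congr1 (fun M : 'M_N => M u v) (fmat_unitary f); rewrite /= !mxE => <-.
by rewrite /std_coord !mxE; apply: eq_bigr => a _; rewrite [col _ _ _ _]mxE.
Qed.

Fact std_coord_sum (y : 'cV[R[i]]_N) : y = \sum_u std_coord u y *: col u (fmat f).
Proof.
rewrite -{1}[y]mul1mx -(fmat_unitary_r f) -mulmxA; apply/matrixP => a b.
rewrite mxE summxE; apply: eq_bigr => u _.
by rewrite /std_coord !mxE mulrC (ord1 b).
Qed.

Definition std_wb : wbasis (V := 'cV[R[i]]_N) (A := 'I_N) :=
  WBasis std_coordD std_coordZ std_coord_vec std_coord_sum.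

Lemma std_repE (X : 'M[R[i]]_N) (y : 'cV[R[i]]_N) : std_rep X y = X *m y.
Proof. by rewrite /std_rep lfunE. Qed.

Lemma std_complex_linear : complex_linear (@std_rep R N).
Proof.
move=> c X Y; apply/lfunP => y.
by rewrite add_lfunE scale_lfunE !std_repE mulmxDl -scalemxAl.
Qed.

Lemma std_is_rep (k : set 'M[R[i]]_N) : is_rep k (@std_rep R N).
Proof.
split=> [X Y _ _|c X _|X Y _ _]; apply/lfunP => y.
- by rewrite add_lfunE !std_repE mulmxDl.
- by rewrite scale_lfunE !std_repE scalemxAl.
- by rewrite add_lfunE opp_lfunE !comp_lfunE !std_repE mulmxBl !mulmxA.
Qed.

Lemma std_coord_rep (X : 'M[R[i]]_N) (y : 'cV[R[i]]_N) u :
  wcoord std_wb u (std_rep X y) = \sum_v tw f X u v * wcoord std_wb v y.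
Proof.
rewrite /= std_repE /std_coord.
have -> : adjoint_mx (fmat f) *m (X *m y) = tw f X *m (adjoint_mx (fmat f) *m y).
  rewrite twE -!mulmxA; congr (_ *m (_ *m _)).
  by rewrite mulmxA fmat_unitary_r mul1mx.
by rewrite mxE.
Qed.

Lemma std_rep_vec (X : 'M[R[i]]_N) v u :
  wcoord std_wb u (std_rep X (wvec std_wb v)) = tw f X u v.
Proof.
rewrite std_coord_rep (bigD1 v) //= std_coord_vec eqxx mulr1 big1 ?addr0 // => a av.
by rewrite std_coord_vec (negbTE av) mulr0.
Qed.

Variables (D : rootDatum R N) (r : rel 'I_N) (S : pred 'I_N) (w : nat -> 'M[R[i]]_N).
Hypothesis ad : adapted f D r S w.

Lemma std_diag : diag_on std_wb (@std_rep R N) (fun u => wt f u) (tor D).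
Proof.
move=> H v tH; apply: (wcoord_inj (B := std_wb)) => u; rewrite std_rep_vec wcoordZ wcoord_vec.
have [->|uv] := eqVneq u v; first by rewrite mulr1.
by have [_ ->] := proj1 (ad_torP ad H) tH; rewrite // mulr0.
Qed.

Lemma std_invariant (k : set 'M[R[i]]_N) (T : pred 'I_N) :
  (forall X u v, k X -> T v -> tw f X u v != 0 -> T u) ->
  invariant_sub k (@std_rep R N) (wspan std_wb T).
Proof.
move=> hT X kX; apply/subvP => _ /memv_imgP[y /mem_wspan hy ->]; apply/mem_wspan => u Tu.
rewrite std_coord_rep big1 // => v _; have [Tv|/hy ->] := boolP (T v); last by rewrite mulr0.
have [->|x0] := eqVneq (tw f X u v) 0; first by rewrite mul0r.
by rewrite (hT X u v kX Tv x0) in Tu.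
Qed.

(** The second entry of [rvec f u v] sits in the column [fstar f u]. If that column is v, its row is
    u again, so in all cases v is sent to a nonzero multiple of u alone. *)
Lemma std_step (h : set 'M[R[i]]_N) u v : complexification h (rvec f u v) -> u != v ->
  nz f u v -> step std_wb (@std_rep R N) h v u.
Proof.
move=> hZ uv nuv; exists (rvec f u v), (tw f (rvec f u v) u v); split=> //.
  exact: rvec_neq0.
apply: (wcoord_inj (B := std_wb)) => a; rewrite std_rep_vec wcoordZ wcoord_vec.
have [->|au] := eqVneq a u; first by rewrite mulr1.
rewrite mulr0; apply: contraNeq au => /tw_rvec_supp[[->]//|[_ [-> e]]].
by rewrite e fstarK.
Qed.

End StdModule.

Section StdIso.
Context {R : realType} {N : nat} (f : frame R N).

Lemma std_rep_iso q (g : 'I_q -> 'I_N) (T : pred 'I_N) (h : set 'M[R[i]]_N)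
    (tau : 'M[R[i]]_N -> 'M[R[i]]_q) :
  injective g -> (forall u, T u <-> exists k, u = g k) ->
  (forall X u k, h X -> ~~ T u -> tw f X u (g k) = 0) ->
  (forall X k k', h X -> tw f X (g k') (g k) = tau X k' k) ->
  rep_iso h (@std_rep R N) (wspan (std_wb f) T) (fun X => std_rep (tau X)).
Proof.
move=> ginj hT h0 htau.
pose Jf (a : 'cV[R[i]]_q) : 'cV[R[i]]_N := \sum_k a k 0 *: wvec (std_wb f) (g k).
have Jlin : linear Jf.
  move=> c a b; rewrite /Jf scaler_sumr -big_split; apply: eq_bigr => k _ /=.
  by rewrite !mxE scalerA -scalerDl.
pose JL : {linear 'cV[R[i]]_q -> 'cV[R[i]]_N} := HB.pack Jf (GRing.isLinear.Build _ _ _ _ Jf Jlin).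
pose J : 'Hom('cV[R[i]]_q, 'cV[R[i]]_N) := linfun JL.
have JE a : J a = Jf a by rewrite lfunE.
have co a k : wcoord (std_wb f) (g k) (Jf a) = a k 0.
  rewrite /Jf wcoord_bigsum (bigD1 k) //= big1 ?addr0 => [|k' k'k];
    rewrite std_coordZ std_coord_vec.
    by rewrite eqxx mulr1.
  by rewrite (inj_eq ginj) eq_sym (negbTE k'k) mulr0.
have co0 a u : ~~ T u -> wcoord (std_wb f) u (Jf a) = 0.
  move=> Tu; rewrite /Jf wcoord_bigsum big1 // => k _; rewrite wcoordZ wcoord_vec.
  case: eqP => [e|]; last by rewrite mulr0.
  by case/negP: Tu; apply/hT; exists k.
exists J; split.
- apply/eqP; rewrite -subv0; apply/subvP => a; rewrite memv_ker JE => /eqP a0.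
  rewrite memv0; apply/eqP/matrixP => k z; rewrite ord1 -co a0 wcoord0 mxE //.
- apply/vspaceP => y; apply/memv_imgP/mem_wspan => [[a _ ->] u Tu|hy].
    by rewrite JE co0.
  exists (\col_k wcoord (std_wb f) (g k) y); first by rewrite memvf.
  rewrite JE; apply: (wcoord_inj (B := std_wb f)) => u.
  have [/hT[k ->]|Tu] := boolP (T u); first by rewrite co mxE.
  by rewrite co0 // hy.
- move=> X a hX; rewrite !JE [std_rep (tau X) a]std_repE; apply: (wcoord_inj (B := std_wb f)) => u.
  rewrite std_coord_rep.
  have -> : \sum_v tw f X u v * wcoord (std_wb f) v (Jf a) = \sum_k tw f X u (g k) * a k 0.
    under eq_bigr => v _ do rewrite /Jf wcoord_bigsum mulr_sumr.
    rewrite exchange_big; apply: eq_bigr => k _ /=.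
    rewrite (bigD1 (g k)) //= big1 ?addr0 => [|v vk].
      by rewrite std_coordZ std_coord_vec eqxx mulr1.
    by rewrite std_coordZ std_coord_vec (negbTE vk) !mulr0.
  have [/hT[k' ->]|Tu] := boolP (T u).
    by rewrite co mxE; apply: eq_bigr => k _; rewrite htau.
  by rewrite co0 // big1 // => k _; rewrite h0 // mul0r.
Qed.

End StdIso.

(** Abel summation. It expands a weight in the differences that are simple roots in all types; the
    remainder [e p] is treated type by type. *)
Lemma abel_weight (R : realType) (e : nat -> R[i]) p k : (1 <= k <= p)%N ->
  e k = \sum_(1 <= j < p) (k <= j)%N%:R * (e j - e j.+1) + e p.
Proof.
move=> /andP[k1 kp]; rewrite (big_cat_nat _ (n := k)) //= big_nat big1 ?add0r; last first.
  by move=> j /andP[_ jk]; rewrite leqNgt jk mul0r.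
rewrite (eq_big_nat _ _ (F2 := fun j => - (e j.+1 - e j))); last first.
  by move=> j /andP[kj _]; rewrite kj mul1r opprB.
by rewrite sumrN telescope_sumr // opprB subrK.
Qed.

(** * Special unitary algebras *)

Section SpecialUnitary.
Context {R : realType} {N n : nat} (f : frame R N).
Variables (kd : 'I_N -> option ('I_n * bool)) (ku : 'I_n -> 'I_N).
Variables (e : 'M[R[i]]_n -> 'M[R[i]]_N) (pr : 'M[R[i]]_N -> 'M[R[i]]_n).

Definition unitary_entry (Y : 'M[R[i]]_n) u v : R[i] :=
  match kd u, kd v with
  | Some (a, s), Some (b, t) => if s == t then (if s then (Y a b)^* else Y a b) else 0
  | _, _ => 0
  end.

(** In weight coordinates [e Y] consists of a copy of [Y] and possibly of a
    copy of its conjugate. *)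
Record unitary_embedding : Prop := UnitaryEmbedding {
  ue_ku : forall a, kd (ku a) = Some (a, false);
  ue_inj : forall u v z, kd u = Some z -> kd v = Some z -> u = v;
  ue_star : fdual f -> forall u, kd (fstar f u) = omap (fun z => (z.1, ~~ z.2)) (kd u);
  ue_sym : forall u a, kd u = Some (a, true) -> fdual f;
  ue_sg : forall u v a b s, kd u = Some (a, s) -> kd v = Some (b, s) -> fsg f u * fsg f v = 1;
  ue_pr : forall Y, pr (e Y) = Y;
  ue_tw : forall Y u v, tw f (e Y) u v = unitary_entry Y u v }.

Hypothesis ue : unitary_embedding.

Lemma unitary_entry_kd Y u v a b s : kd u = Some (a, s) -> kd v = Some (b, s) ->
  unitary_entry Y u v = if s then (Y a b)^* else Y a b.
Proof. by rewrite /unitary_entry => -> ->; rewrite eqxx. Qed.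

Lemma ue_ent Y a b : tw f (e Y) (ku a) (ku b) = Y a b.
Proof. by rewrite (ue_tw ue) (unitary_entry_kd _ (ue_ku ue a) (ue_ku ue b)). Qed.

Lemma ue_adj Y : adjoint_mx Y = - Y -> adjoint_mx (e Y) = - e Y.
Proof.
move=> hY; have hE a b : (Y b a)^* = - Y a b.
  by have := congr1 (fun Z : 'M_n => Z a b) hY; rewrite adjoint_mxE mxE.
apply: (@tw_inj _ _ f); rewrite tw_adj twN; apply/matrixP => u v.
rewrite adjoint_mxE mxE !(ue_tw ue) /unitary_entry.
case: (kd u) => [[a s]|]; case: (kd v) => [[b t]|]; rewrite ?conj_0 ?oppr0 //.
rewrite eq_sym; case: eqP => [<-|_]; last by rewrite conj_0 oppr0.
by case: s; rewrite hE ?conj_opp ?hE.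
Qed.

Lemma ue_star_sym Y : adjoint_mx Y = - Y -> star_sym f (e Y).
Proof.
move=> hY hs u v; have hE a b : (Y b a)^* = - Y a b.
  by have := congr1 (fun Z : 'M_n => Z a b) hY; rewrite adjoint_mxE mxE.
rewrite !(ue_tw ue) /unitary_entry !(ue_star ue hs).
case ku_: (kd u) => [[a s]|]; case kv: (kd v) => [[b t]|]; rewrite /= ?mulr0 ?oppr0 //.
case: (boolP (s == t)) => [/eqP st|st]; last first.
  by rewrite (_ : (~~ t == ~~ s) = false) ?mulr0 ?oppr0 //; case: s t st {ku_ kv} => [] [].
subst t; rewrite (ue_sg ue ku_ kv) eqxx mul1r; case: (s) => /=; last by rewrite hE.
by rewrite hE opprK.
Qed.

Definition su_rel p : rel 'I_N := fun u v =>
  match kd u, kd v with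
  | Some (a, s), Some (b, t) => [&& s == t, (a < p)%N & (b < p)%N]
  | _, _ => false
  end.

(** The trace condition of su(p) has to be taken over one copy: over a copy together with its
    conjugate the trace of a skew-hermitian matrix always cancels. *)
Definition su_plus p : pred 'I_N := fun u =>
  if kd u is Some (a, false) then (a < p)%N else false.

Lemma su_relP p u v : reflect (exists a b s, [/\ kd u = Some (a, s), kd v = Some (b, s),
  (a < p)%N & (b < p)%N]) (su_rel p u v).
Proof.
rewrite /su_rel; case: (kd u) => [[a s]|]; last by constructor=> -[? [? [? []]]].
case: (kd v) => [[b t]|]; last by constructor=> -[? [? [? []]]].
apply: (iffP and3P) => [[/eqP -> h1 h2]|[? [? [? [[-> ->] [-> ->] h1 h2]]]]]; last by [].
by exists a, b, t.
Qed.

Lemma su_plusP p u : reflect (exists2 a : 'I_n, (a < p)%N & u = ku a) (su_plus p u).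
Proof.
rewrite /su_plus; case ku_: (kd u) => [[a []]|]; try constructor.
- by move=> [b _ eb]; rewrite eb (ue_ku ue) in ku_.
- by apply: (iffP idP) => [ap|[b bp eb]]; [exists a => //; exact: (ue_inj ue ku_ (ue_ku ue a))|
    move: ku_; rewrite eb (ue_ku ue) => -[<-]].
- by move=> [b _ eb]; rewrite eb (ue_ku ue) in ku_.
Qed.

Lemma sum_su_plus p (F : 'I_N -> R[i]) :
  \sum_(u | su_plus p u) F u = \sum_(a < n | (a < p)%N) F (ku a).
Proof.
have kinj : injective ku.
  by move=> a b h; have := ue_ku ue a; rewrite h (ue_ku ue) => -[].
have hk a : su_plus p (ku a) = (a < p)%N by rewrite /su_plus (ue_ku ue).
rewrite -[RHS](eq_bigl _ _ hk).
rewrite -(big_imset F (h := ku) (A := [pred a | su_plus p (ku a)])) /=; last by move=> ? ? _ _; exact: kinj.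
apply: eq_bigl => u; apply/idP/imsetP => [/su_plusP[a ap ->]|[a]].
  by exists a => //; rewrite inE hk.
by rewrite inE => h ->.
Qed.

Lemma su_rel_sym p : symmetric (su_rel p).
Proof.
move=> u v; rewrite /su_rel; case: (kd u) => [[a s]|]; case: (kd v) => [[b t]|] //.
by rewrite eq_sym [X in _ && X]andbC.
Qed.

Lemma su_rel_trans p : transitive (su_rel p).
Proof.
move=> u v x /su_relP[a [b [s [e1 e2 h1 h2]]]] /su_relP[a' [b' [s' [e1' e2' h1' h2']]]].
apply/su_relP; move: e2; rewrite e1' => -[ea es]; subst a' s'.
by exists a, b', s.
Qed.

Lemma su_rel_star p : fdual f -> forall u v, su_rel p u v -> su_rel p (fstar f u) (fstar f v).
Proof.
move=> hs u v /su_relP[a [b [s [e1 e2 h1 h2]]]]; apply/su_relP.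
by exists a, b, (~~ s); rewrite !(ue_star ue hs) e1 e2.
Qed.

Lemma su_rel_plus p u v : su_rel p u v -> su_plus p u = su_plus p v.
Proof.
by move=> /su_relP[a [b [s [e1 e2 h1 h2]]]]; rewrite /su_plus e1 e2; case: s {e1 e2}; rewrite ?h1 ?h2.
Qed.

Lemma ue_notin_rel p (Y : 'M[R[i]]_n) u v :
  (forall a b : 'I_n, ~~ ((a < p)%N && (b < p)%N) -> Y a b = 0) ->
  ~~ su_rel p u v -> unitary_entry Y u v = 0.
Proof.
move=> hY; rewrite /su_rel /unitary_entry.
case: (kd u) => [[a s]|] //; case: (kd v) => [[b t]|] //.
by case: eqP => //= _ h; case: ifP => _; rewrite hY ?conj_0.
Qed.

Lemma alg_suE p : (p <= n)%N -> alg (mapD e pr (suD R n p)) = block f (su_rel p) (su_plus p).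
Proof.
move=> pn; apply/seteqP; split=> [X [Y [[hY trY] supY] <-]|X hX].
  split.
  - exact: ue_adj.
  - exact: ue_star_sym.
  - by move=> u v h; rewrite (ue_tw ue); exact: ue_notin_rel h.
  - rewrite sum_su_plus -[RHS]trY /mxtrace big_mkcond; apply: eq_bigr => a _.
    by rewrite ue_ent; case: ifP => // ap; rewrite supY // ap.
have [X1 X2 X3 X4] := hX.
pose Y : 'M[R[i]]_n := \matrix_(a, b) tw f X (ku a) (ku b).
have nr (a b : 'I_n) : ~~ ((a < p)%N && (b < p)%N) -> ~~ su_rel p (ku a) (ku b).
  by rewrite /su_rel !(ue_ku ue).
exists Y.
  split; last by move=> a b h; rewrite mxE X3 // nr.
  split.
    by apply/matrixP => a b; rewrite adjoint_mxE !mxE (block_skew _ _ hX) conj_opp conjCK.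
  rewrite -[RHS]X4 sum_su_plus /mxtrace [RHS]big_mkcond; apply: eq_bigr => a _.
  by rewrite mxE; case: ifP => // ap; rewrite X3 // nr // ap.
apply: (@tw_inj _ _ f); apply/matrixP => u v; rewrite (ue_tw ue).
have [/su_relP[a [b [s [e1 e2 h1 h2]]]]|h] := boolP (su_rel p u v); last first.
  by rewrite X3 // (ue_notin_rel _ h) // => a b hab; rewrite mxE X3 // nr.
rewrite (unitary_entry_kd _ e1 e2); case: s e1 e2 => e1 e2; last first.
  by rewrite mxE -(ue_inj ue e1 (ue_ku ue a)) -(ue_inj ue e2 (ue_ku ue b)).
(* A conjugate copy is present only in a frame with a form, which pairs it with the first copy; star
   symmetry and skewness then determine it. *)
have hs := ue_sym ue e1.
have eu : u = fstar f (ku a) by apply: (ue_inj ue e1); rewrite (ue_star ue hs) (ue_ku ue).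
have ev : v = fstar f (ku b) by apply: (ue_inj ue e2); rewrite (ue_star ue hs) (ue_ku ue).
rewrite mxE eu ev (X2 hs) (ue_sg ue (ue_ku ue b) (ue_ku ue a)) mul1r.
by rewrite (block_skew (ku b) (ku a) hX) conj_opp conjCK.
Qed.

Lemma suD_torP p (Y : 'M[R[i]]_n) : tor (suD R n p) Y <->
  alg (suD R n p) Y /\ forall a b, a != b -> Y a b = 0.
Proof.
split=> [[hY /is_diag_mxP dY h0]|[[hY supY] dY]].
  split; last by move=> a b ab; exact: dY.
  split=> // a b h; have [eab|/dY//] := eqVneq a b.
  by subst b; move: h; rewrite andbb -leqNgt => /h0.
split=> //; first by apply/is_diag_mxP => a b ab; exact: dY.
by move=> a ap; apply: supY; rewrite andbb -leqNgt.
Qed.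

Lemma tor_suE p : (p <= n)%N ->
  tor (mapD e pr (suD R n p)) = block f (torus_rel (su_rel p)) (su_plus p).
Proof.
move=> pn; apply/seteqP; split=> [X [Y /suD_torP[hY dY] <-]|X hX].
  have [X1 X2 X3 X4] : block f (su_rel p) (su_plus p) (e Y).
    by rewrite -alg_suE //; exists Y.
  split=> // u v; rewrite /torus_rel negb_and => /orP[/X3//|uv].
  rewrite (ue_tw ue) /unitary_entry; case ku_: (kd u) => [[a s]|] //.
  case kv: (kd v) => [[b t]|] //; case: eqP => // st; subst t.
  have ab : a != b by apply: contra uv => /eqP ab; apply/eqP; apply: (ue_inj ue ku_); rewrite ab.
  by rewrite dY // conj_0 if_same.
have hX' : block f (su_rel p) (su_plus p) X.
  have [X1 X2 X3 X4] := hX; split=> // u v h; apply: X3.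
  by apply: contra h => /andP[].
move: (hX'); rewrite -alg_suE // => -[Y hY eY]; exists Y => //; apply/suD_torP; split=> // a b ab.
rewrite -ue_ent eY; apply: (torus_diag hX); apply: contra ab => /eqP h.
by have := ue_ku ue a; rewrite h (ue_ku ue) => -[->].
Qed.

End SpecialUnitary.

Section SpecialUnitaryRoots.
Context {R : realType} {n : nat}.
Implicit Types (p s : nat) (Y : 'M[R[i]]_n).

Lemma diag_eps_ord Y (a : 'I_n) : diag_eps a.+1 Y = Y a a.
Proof. by rewrite /diag_eps (big_pred1 a) // => q; rewrite eqSS. Qed.

Lemma sum_ltn (p : nat) (c : R[i]) : (p <= n)%N -> \sum_(a < n | (a < p)%N) c = p%:R * c.
Proof.
by move=> pn; rewrite -(big_ord_widen _ (fun=> c) pn) sumr_const card_ord mulr_natl.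
Qed.

(** The matrix with s ones on the diagonal, made traceless inside the first p coordinates and
    multiplied by 'i. *)
Definition su_cow p s : 'M[R[i]]_n :=
  \matrix_(a, b) if (a == b) && (a < p)%N then 'i * ((a < s)%N%:R - s%:R / p%:R) else 0.

Lemma su_cow_diag p s (a : 'I_n) : (a < p)%N ->
  su_cow p s a a = 'i * ((a < s)%N%:R - s%:R / p%:R).
Proof. by move=> ap; rewrite mxE eqxx ap. Qed.

Lemma su_cow_tor p s : (0 < p <= n)%N -> (s <= p)%N -> tor (suD R n p) (su_cow p s).
Proof.
move=> /andP[p0 pn] sp; apply/suD_torP; split; last first.
  by move=> a b ab; rewrite mxE (negbTE ab).
split; last first.
  move=> a b; rewrite mxE; case: eqP => // <-; rewrite andbb => /negbTE -> //.
split.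
  apply/matrixP => a b; rewrite adjoint_mxE !mxE eq_sym; case: eqP => [->|_] /=; last first.
    by rewrite conj_0 oppr0.
  case: ifP => _; last by rewrite conj_0 oppr0.
  rewrite conj_mul conjCi mulNr; congr (- (_ * _)); apply/CrealP.
  by rewrite rpredB ?rpred_div ?realn.
rewrite /mxtrace (eq_bigr (fun a : 'I_n => if (a < p)%N then 'i * ((a < s)%N%:R - s%:R / p%:R) else 0)); last first.
  by move=> a _; rewrite mxE eqxx.
rewrite -big_mkcond -mulr_sumr sumrB sum_ltn //.
rewrite -(big_ord_widen _ (fun a => (a < s)%N%:R) pn) (_ : \sum_(_ < p) _ = s%:R).
  by rewrite mulrCA mulfV ?mulr1 ?subrr ?mulr0 // pnatr_eq0 -lt0n.
transitivity (\sum_(a < p) if (a < s)%N then 1 else 0 : R[i]).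
  by apply: eq_bigr => a _; case: (_ < _)%N.
by rewrite -big_mkcond -(big_ord_widen _ (fun=> 1) sp) sumr_const card_ord.
Qed.

End SpecialUnitaryRoots.

Section SpecialUnitaryDatum.
Context {R : realType} {N n : nat} (f : frame R N).
Variables (kd : 'I_N -> option ('I_n * bool)) (ku : 'I_n -> 'I_N).
Variables (e : 'M[R[i]]_n -> 'M[R[i]]_N) (pr : 'M[R[i]]_N -> 'M[R[i]]_n).
Hypothesis ue : unitary_embedding f kd ku e pr.

Lemma ue_wt (Y : 'M[R[i]]_n) u a s : kd u = Some (a, s) -> adjoint_mx Y = - Y ->
  wt f u (e Y) = (-1) ^+ s * Y a a.
Proof.
move=> ku_ hY; rewrite /wt (ue_tw ue) (unitary_entry_kd _ ku_ ku_).
case: s {ku_} => /=; last by rewrite mul1r.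
have := congr1 (fun Z : 'M_n => Z a a) hY; rewrite adjoint_mxE mxE => ->.
by rewrite expr1 mulN1r.
Qed.

Variable p : nat.
Hypotheses (p_gt0 : (0 < p)%N) (p_le : (p <= n)%N).

Let D := mapD e pr (suD R n p).

Lemma su_simp j (Y : 'M[R[i]]_n) : simp D j (e Y) = diag_eps j Y - diag_eps j.+1 Y.
Proof. by rewrite /D /= (ue_pr ue). Qed.

Lemma su_cow_simp s j : (1 <= s <= p.-1)%N -> (1 <= j <= p.-1)%N ->
  simp D j (e (su_cow p s)) = (j == s)%:R * 'i.
Proof.
case: j => // j /andP[s1 sp] /andP[_ jp]; rewrite su_simp.
have j1n : (j.+1 < n)%N by lia.
have jn : (j < n)%N by lia.
have e1 := diag_eps_ord (su_cow p s : 'M[R[i]]_n) (Ordinal jn).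
have e2 := diag_eps_ord (su_cow p s : 'M[R[i]]_n) (Ordinal j1n).
rewrite /= in e1 e2; rewrite e1 e2 !su_cow_diag /=; [|lia|lia].
have [h|h|h] := ltngtP j.+1 s.
- by rewrite /=; ring.
- by rewrite /=; ring.
- by rewrite /=; ring.
Qed.

Lemma su_skew (Y : 'M[R[i]]_n) : tor (suD R n p) Y -> adjoint_mx Y = - Y.
Proof. by case=> -[]. Qed.

(** The remainders of the two Abel sums cancel, so only consecutive differences survive. On the
    conjugate copy all weights change sign, and indices are shifted by one since coordinates start
    at 0. *)
Lemma su_root_coef u v a b s : kd u = Some (a, s) -> kd v = Some (b, s) ->
  (a < p)%N -> (b < p)%N ->
  is_coef D (fun H => wt f u H - wt f v H)
    (fun j => (-1) ^+ s * ((a < j)%N%:Z - (b < j)%N%:Z)).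
Proof.
move=> e1 e2 ap bp _ [Y hY <-]; have hs := su_skew hY.
rewrite (ue_wt e1 hs) (ue_wt e2 hs) -mulrBr -!diag_eps_ord.
rewrite (@abel_weight _ (diag_eps^~ Y) p a.+1) // (@abel_weight _ (diag_eps^~ Y) p b.+1) //.
rewrite opprD addrACA subrr addr0 -sumrB mulr_sumr.
rewrite (_ : (rnk D).+1 = p); last by rewrite /D /=; lia.
apply: eq_bigr => j _; rewrite su_simp -mulrBl mulrA; congr (_ * _).
by rewrite rmorphM rmorphB /= rmorph_sign.
Qed.

Lemma su_adapted : adapted f D (su_rel kd p) (su_plus kd p) (fun s => e (su_cow p s)).
Proof.
have rnkE : rnk D = p.-1 by [].
(* Duality exchanges the two copies, so two coordinates of the same copy are never dual to each
   other. *)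
have nzD u v : su_rel kd p u v -> u != v -> nz f u v.
  move=> /su_relP[a [b [s [e1 e2 h1 h2]]]] uv; apply/negP => /and3P[hs /eqP ev _].
  by move: e2; rewrite ev (ue_star ue hs) e1 /= => -[_]; case: (s).
split.
- exact: su_rel_sym.
- exact: su_rel_trans.
- exact: (su_rel_star ue).
- exact: su_rel_plus.
- exact: (alg_suE ue p_le).
- exact: (tor_suE ue p_le).
- case=> // j /andP[_]; rewrite rnkE => jp.
  have j1n : (j.+1 < n)%N by lia.
  have jn : (j < n)%N by lia.
  have h : su_rel kd p (ku (Ordinal jn)) (ku (Ordinal j1n)).
    by rewrite /su_rel !(ue_ku ue) /=; lia.
  have uv : ku (Ordinal jn) != ku (Ordinal j1n).
    apply/eqP => h'; have := ue_ku ue (Ordinal jn); rewrite h' (ue_ku ue) => -[]; lia.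
  exists (ku (Ordinal jn)), (ku (Ordinal j1n)); split=> //; first exact: nzD.
  move=> _ [Y hY <-]; rewrite su_simp !(ue_wt (ue_ku ue _) (su_skew hY)) !mul1r.
  by rewrite -!diag_eps_ord.
- by move=> s; rewrite rnkE => hs; exists (su_cow p s) => //; apply: su_cow_tor; lia.
- by move=> s j; rewrite rnkE; exact: su_cow_simp.
- move=> u v /su_relP[a [b [s [e1 e2 h1 h2]]]] _ _.
  eexists; first exact: su_root_coef e1 e2 h1 h2.
  have [ab|ba] := leqP a b; case: s {e1 e2}; [right|left|left|right] => j _;
    rewrite ?expr0 ?expr1; have := leq_trans (n := j); lia.
move=> _ [Y hY <-] h; have hs := su_skew hY.
have [[[_ trY] supY] dY] := proj1 (suD_torP _ _) hY.
(* The simple roots vanish, so the first p diagonal entries coincide; the trace being zero, they are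
   all zero. *)
have eps j : (1 <= j <= p)%N -> diag_eps j Y = diag_eps p Y.
  move=> hj; rewrite (@abel_weight _ (diag_eps^~ Y) p j) // big_nat big1 ?add0r // => k hk.
  by have := h k; rewrite su_simp rnkE => ->; rewrite ?mulr0 //; lia.
have e0 : diag_eps p Y = 0.
  apply/eqP; move: trY; rewrite /mxtrace (bigID (fun a : 'I_n => (a < p)%N)) /=.
  rewrite [X in _ + X]big1 ?addr0 => [|a ap]; last by rewrite supY // andbb.
  rewrite (eq_bigr (fun=> diag_eps p Y)) => [|a ap]; last by rewrite -diag_eps_ord eps.
  rewrite sum_ltn // => /eqP; rewrite mulf_eq0 pnatr_eq0 => /orP[/eqP p0|//].
  by move: p_gt0; rewrite p0.
have Y0 : Y = 0.
  apply/matrixP => a b; rewrite mxE; have [<-|/dY//] := eqVneq a b.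
  have [ap|ap] := ltnP a p; first by rewrite -diag_eps_ord eps.
  by rewrite supY // andbb -leqNgt.
apply: (@tw_inj _ _ f); apply/matrixP => u v.
rewrite (ue_tw ue) Y0 tw0 mxE /unitary_entry.
case: (kd u) => [[a s]|] //; case: (kd v) => [[b t]|] //.
by rewrite mxE conj_0 if_same if_same.
Qed.

Lemma su_cow_wt u a t s : kd u = Some (a, t) -> (s <= p)%N -> (a < p)%N ->
  wt f u (e (su_cow p s)) = (-1) ^+ t * ('i * ((a < s)%N%:R - s%:R / p%:R)).
Proof.
move=> e1 sp ap; rewrite (ue_wt e1) ?su_cow_diag //.
by apply: (@su_skew (su_cow p s)); apply: su_cow_tor => //; rewrite p_gt0.
Qed.

Lemma su_cow_wt_eq u v a b t s : kd u = Some (a, t) -> kd v = Some (b, t) -> (s <= p)%N ->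
  (a < p)%N -> (b < p)%N ->
  (wt f u (e (su_cow p s)) = wt f v (e (su_cow p s))) <-> (a < s)%N = (b < s)%N.
Proof.
move=> e1 e2 sp ap bp; rewrite (su_cow_wt e1) // (su_cow_wt e2) //.
have sg0 : (-1) ^+ t != 0 :> R[i] by rewrite signr_eq0.
split=> [|->//] /(mulfI sg0)/(mulfI (neq0Ci _))/addIr/eqP; rewrite eqr_nat.
by case: (_ < _)%N; case: (_ < _)%N.
Qed.

Lemma su_noncompact s : (1 <= s <= p.-1)%N -> noncompact_simple D s.
Proof.
move=> hs; apply: (ad_noncompact su_adapted hs) => u v /su_relP[a [b [t [e1 e2 ap bp]]]] _ _.
have sp : (s <= p)%N by lia.
rewrite (su_cow_wt e1) // (su_cow_wt e2) //.
move: (s%:R / p%:R) => x; case: (_ < _)%N; case: (_ < _)%N; case: t {e1 e2};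
  rewrite ?expr0 ?expr1 ?mulN1r ?mul1r /=;
  [apply: Or31|apply: Or31|apply: Or33|apply: Or32|apply: Or32|apply: Or33|apply: Or31|apply: Or31];
  ring.
Qed.

(** The module is the span of the first p coordinates of one copy, whatever the ambient space is.
    The same lemma therefore covers type AIII and all but the first step of the chains of types DIII
    and CI. *)
Lemma su_phi_minimal s : (1 <= s <= p.-1)%N ->
  phi_minimal D s (@std_rep R N) (wspan (std_wb f) (su_plus kd p))
    (wspan (std_wb f) (su_plus kd s))
    (wspan (std_wb f) (fun u => su_plus kd p u && ~~ su_plus kd s u))
    ('i * ((p%:R - s%:R) / p%:R)).
Proof.
move=> hs; have ad := su_adapted; have sp : (s <= p)%N by lia.
have n0 : (0 < n)%N by lia.
pose a0 := ku (Ordinal n0).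
have plusE u q : su_plus kd q u -> exists2 a, kd u = Some (a, false) & (a < q)%N.
  by case/(su_plusP ue) => a aq ->; exists a => //; exact: (ue_ku ue).
have rel q u v : su_plus kd q u -> su_plus kd q v -> su_rel kd q u v.
  move=> /plusE[a ea aq] /plusE[b eb bq]; apply/su_relP.
  by exists a, b, false.
have nzr u v q : su_rel kd q u v -> nz f u v.
  move=> /su_relP[a [b [t [e1 e2 _ _]]]]; apply/negP => /and3P[hd /eqP ev _].
  by move: e2; rewrite ev (ue_star ue hd) e1 /= => -[_]; case: (t).
have nzT q u v : su_plus kd q u -> su_plus kd q v -> nz f u v.
  by move=> Tu Tv; exact: nzr (rel q u v Tu Tv).
have sub u : su_plus kd s u -> su_plus kd p u.
  by move=> /plusE[a ea as_]; rewrite /su_plus ea; lia.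
have wtE u a j : kd u = Some (a, false) -> (j <= p)%N -> (a < p)%N ->
    wt f u (e (su_cow p j)) = 'i * ((a < j)%N%:R - j%:R / p%:R).
  by move=> eu jp ap; rewrite (su_cow_wt eu) // mul1r.
apply: (wspan_phi_minimal ad (@std_complex_linear R N) (@std_is_rep R N _) (std_diag ad)
  (lam := fun u => wt f u) (a0 := a0)) => //.
- by move=> u v Tu Tv uv; apply: (ad_separated ad) => //; [exact: rel|exact: (nzT p)].
- apply: (std_invariant (f := f)) => X u v hX Tv x0.
  have [ruv _] : su_rel kd p u v /\ nz f u v.
    apply: (ad_complexP ad) x0; exists X, 0; split=> //; last by rewrite scaler0 addr0.
    by case: (ad_subspace ad).
  by rewrite (su_rel_plus ruv).
- apply: step_connected => u v Tu Tv uv; apply: std_step; last exact: (nzT p).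
    by apply: (rvec_alg ad); [exact: rel|rewrite eq_sym].
  by rewrite eq_sym.
- apply: step_connected => u v Tu Tv uv; apply: std_step; last exact: (nzT s).
    apply: (rvec_k_phi ad) => //; [by apply: rel; exact: sub|by rewrite eq_sym|].
    have [a ea as_] := plusE _ _ Tu; have [b eb bs] := plusE _ _ Tv.
    by rewrite (wtE _ _ _ ea) ?(wtE _ _ _ eb) ?as_ ?bs //; lia.
  by rewrite eq_sym.
- by rewrite /a0 /su_plus (ue_ku ue) /=; lia.
- move=> u Tu; have [a ea ap] := plusE _ _ Tu; rewrite (wtE _ _ _ ea) // /su_plus ea.
  have p0 : p%:R != 0 :> R[i] by rewrite pnatr_eq0 -lt0n.
  by case: (_ < _)%N => /=; field.
- move=> u j Tu hj; have [a ea ap] := plusE _ _ Tu.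
  have jp : (j <= p)%N by move: hj; rewrite /D /=; lia.
  have j1 : (0 < j)%N by case/andP: hj.
  exists (1 - (a < j)%N%:R); first by case: (_ < _)%N; rewrite ?subrr ?subr0.
  rewrite (wtE _ _ _ ea) // (wtE _ (Ordinal n0)) //=; last exact: (ue_ku ue).
  by rewrite j1 /=; ring.
Qed.

End SpecialUnitaryDatum.

(** * Chains of special unitary algebras through the last node *)

Section SpecialUnitaryChain.
Context {R : realType} {N n : nat} (f : frame R N).
Variables (kd : 'I_N -> option ('I_n * bool)) (ku : 'I_n -> 'I_N).
Variables (e : 'M[R[i]]_n -> 'M[R[i]]_N) (pr : 'M[R[i]]_N -> 'M[R[i]]_n).
Hypothesis ue : unitary_embedding f kd ku e pr.

Lemma ue_lin (c : R) X Y : e (X - (c%:C)%C *: Y) = e X - (c%:C)%C *: e Y.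
Proof.
apply: (@tw_inj _ _ f); apply/matrixP => u v; rewrite twD twN twZ !mxE !(ue_tw ue) /unitary_entry.
case: (kd u) => [[a s]|]; case: (kd v) => [[b t]|]; rewrite ?mulr0 ?subrr //.
case: eqP => _; last by rewrite mulr0 subr0.
by case: ifP => _; rewrite !mxE // conj_sub conj_mul conj_real_complex.
Qed.

Lemma su_semisimple_part p : (2 <= p <= n)%N ->
  semisimple_part (mapD e pr (suD R n p)) p.-1 (mapD e pr (suD R n p.-1)).
Proof.
move=> hp.
have p0 : (0 < p)%N by lia.
have pn : (p <= n)%N by lia.
have q0 : (0 < p.-1)%N by lia.
have qn : (p.-1 <= n)%N by lia.
have qp : (p.-1 <= p)%N by lia.
have ad := su_adapted ue p0 pn; have ad' := su_adapted ue q0 qn.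
have weq := su_cow_wt_eq ue p0 pn.
apply: (ad_semisimple_part ad ad').
- by rewrite /=; lia.
- move=> u v /su_relP[a [b [t [e1 e2 aq bq]]]]; split.
    by apply/su_relP; exists a, b, t; split=> //; lia.
  by apply/(weq _ _ _ _ _ _ e1 e2) => //; lia.
- move=> u v x /su_relP[a [b [t [e1 e2 ap bp]]]] /(weq _ _ _ _ _ _ e1 e2 qp ap bp) h.
  move=> /su_relP[b' [c [t' [e3 e4 b'q cq]]]]; move: e3; rewrite e2 => -[eb et]; subst b' t'.
  by apply/su_relP; exists a, c, t; rewrite h.
- move=> u v /su_relP[a [b [t [e1 e2 ap bp]]]] /(weq _ _ _ _ _ _ e1 e2 qp ap bp) h.
  by rewrite /su_plus e1 e2; case: (t).
- move=> X [Y [hY supY] <-]; exists Y => //; split=> // a b h; apply: supY.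
  by move: h; lia.
- move=> X hX cX; have [Y [[hY trY] supY] eY] := hX.
  have jn : (p.-1 < n)%N by lia.
  pose l := Ordinal jn.
  have hYl : (Y l l)^* = - Y l l.
    by have := congr1 (fun Z : 'M_n => Z l l) hY; rewrite adjoint_mxE mxE.
  (* The last diagonal entry of the coweight is - 'i (p - 1) / p, so this multiple of it cancels the
     entry [Y l l]. *)
  have /complex_realP[t ht] : 'i * (p%:R / p.-1%:R) * Y l l \is Num.real.
    apply/CrealP; rewrite conj_mul conj_mul conjCi hYl.
    have -> : (p%:R / p.-1%:R : R[i])^* = p%:R / p.-1%:R by apply/CrealP; rewrite rpred_div ?realn.
    by ring.
  exists t; exists (Y - (t%:C)%C *: su_cow p p.-1); last by rewrite ue_lin eY.
  have hp' : (0 < p <= n)%N by lia.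
  have [[[hC trC] supC] dC] := proj1 (suD_torP _ _) (@su_cow_tor R n p p.-1 hp' qp).
  split.
    split; first by rewrite /u_alg /= adjoint_mxD adjoint_mxN adjoint_mxZ conj_real_complex hY hC scalerN opprD.
    by rewrite linearB /= mxtraceZ trY trC mulr0 subrr.
  move=> a b ab; rewrite !mxE.
  have [eab|neab] := eqVneq a b; last first.
    rewrite /= mulr0 subr0; apply/eqP; apply: contraNT ab => Y0.
    have hr : (1 <= p.-1 <= rnk (mapD e pr (suD R n p)))%N by rewrite /=; lia.
    have := ad_lie_cow_entry ad (s := p.-1) (u := ku a) (v := ku b) hr hX cX.
    rewrite -eY (ue_ent ue) => /(_ Y0)[].
    move=> /su_relP[a' [b' [t' [e1 e2 ap bp]]]].
    move: (e1) (e2); rewrite !(ue_ku ue) => -[ea _] [eb _]; subst a' b'.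
    move=> /(weq _ _ _ _ _ _ e1 e2 qp ap bp).
    have : nat_of_ord a <> b by move=> h; case/eqP: neab; exact: val_inj.
    by lia.
  subst b; rewrite /=; move: ab; rewrite andbb -leqNgt => ap.
  case: ifP => [ap'|ap']; last by rewrite mulr0 subr0 supY // andbb ap'.
  have el : a = l by apply: val_inj => /=; lia.
  rewrite el /= ltnn -ht /=.
  have q00 : p.-1%:R != 0 :> R[i] by rewrite pnatr_eq0; lia.
  have p00 : p%:R != 0 :> R[i] by rewrite pnatr_eq0; lia.
  have ii : 'i * 'i = -1 :> R[i] by rewrite -expr2 sqrCi.
  move: (p%:R) (p.-1%:R) (Y l l) p00 q00 => x y z x0 y0.
  transitivity (z * (1 + 'i * 'i)); first by field; rewrite x0 y0.
  by rewrite ii subrr mulr0.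
- move=> j; rewrite /= => hj; exists j; split; [lia|lia|by []].
Qed.

End SpecialUnitaryChain.

Section UnitaryChain.
Context {R : realType} {N n : nat} (f : frame R N).
Variables (kd : 'I_N -> option ('I_n * bool)) (ku : 'I_n -> 'I_N).
Variables (e : 'M[R[i]]_n -> 'M[R[i]]_N) (pr : 'M[R[i]]_N -> 'M[R[i]]_n).
Hypothesis ue : unitary_embedding f kd ku e pr.

(** The coweight of the last node of su(p) takes one value on the first p - 1 coordinates and
    another one on the p-th. Letting p run down from n therefore isolates the last coordinates one
    after the other. *)
Lemma su_cow_commute (i : nat) (Y : 'M[R[i]]_n) : (i < n)%N ->
  (forall j, (j < i)%N -> lie (e (su_cow (n - j) (n - j).-1)) (e Y) = 0) <->
  (forall a b : 'I_n, a != b -> ~~ ((a < n - i)%N && (b < n - i)%N) -> Y a b = 0).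
Proof.
move=> in_; have torW j : (j < n)%N ->
    tor (mapD e pr (suD R n (n - j))) (e (su_cow (n - j) (n - j).-1)).
  by move=> jn; exists (su_cow (n - j) (n - j).-1) => //; apply: su_cow_tor; lia.
have lieE j u v : (j < n)%N -> tw f (lie (e (su_cow (n - j) (n - j).-1)) (e Y)) u v =
    (wt f u (e (su_cow (n - j) (n - j).-1)) - wt f v (e (su_cow (n - j) (n - j).-1))) * tw f (e Y) u v.
  move=> jn; have ad : adapted f _ _ _ _ := @su_adapted R N n f kd ku e pr ue (n - j) _ _.
  by apply: (ad_tw_lie (ad _ _)); [lia|lia|exact: torW].
split=> [h a b ab nab|h j ji].
  have key c d : (d < c)%N -> (c < n)%N -> (n - i <= c)%N -> forall u v : 'I_n,
     (u = c :> nat /\ v = d :> nat) \/ (u = d :> nat /\ v = c :> nat) -> Y u v = 0.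
    move=> dc cn ic u v huv.
    (* Here c is the larger of the two coordinates, and the step n - c - 1 concerns su(c + 1), whose
       coweight separates c from everything below it. *)
    have jn : (n - c.+1 < n)%N by lia.
    have := congr1 (fun X => tw f X (ku u) (ku v)) (h (n - c.+1)%N ltac:(lia)).
    rewrite tw0 mxE lieE // (ue_ent ue).
    have -> : (n - (n - c.+1) = c.+1)%N by lia.
    move/eqP; rewrite mulf_eq0 subr_eq0 => /orP[/eqP|/eqP //].
    have c1n : (c.+1 <= n)%N by lia.
    move/(su_cow_wt_eq ue (ltn0Sn c) c1n (ue_ku ue u) (ue_ku ue v)) => hh.
    have := hh (leqnSn c) ltac:(lia) ltac:(lia).
    by lia.
  have nab' : nat_of_ord a <> b by move=> h'; case/eqP: ab; exact: val_inj.
  have [lab|lba] := ltnP a b.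
    by apply: (key b a) => //; [lia|right].
  by apply: (key a b) => //; [lia|lia|left].
apply: (@tw_inj _ _ f); apply/matrixP => u v; rewrite tw0 mxE lieE; last by lia.
rewrite (ue_tw ue) /unitary_entry.
case eu: (kd u) => [[a s]|]; case ev: (kd v) => [[b t]|]; rewrite ?mulr0 //.
case: eqP => [st|_]; last by rewrite mulr0.
subst t; have [eab|ab] := eqVneq a b.
  by subst b; rewrite (ue_inj ue eu ev) subrr mul0r.
have [/andP[ai bi]|nab] := boolP ((a < n - i)%N && (b < n - i)%N); last first.
  by rewrite h // conj_0 if_same mulr0.
have j0 : (0 < n - j)%N by lia.
have jn : (n - j <= n)%N by lia.
have := su_cow_wt_eq ue j0 jn eu ev (leq_pred _) ltac:(lia) ltac:(lia) => hh.
rewrite (proj2 hh) ?subrr ?mul0r //; lia.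
Qed.

Lemma u_block_rep_iso (i : nat) (h : set 'M[R[i]]_N) :
  (forall X, h X -> exists2 Y, u_block R n (n - i) Y & X = e Y) ->
  rep_iso h (@std_rep R N) (wspan (std_wb f) (su_plus kd (n - i)))
    (fun X => std_rep (ul_block i (pr X))).
Proof.
move=> hh; have kinj : injective ku.
  by move=> a b hab; have := ue_ku ue a; rewrite hab (ue_ku ue) => -[].
apply: (@std_rep_iso _ _ f _ (fun k : 'I_(n - i) => ku (widen_ord (leq_subr i n) k))).
- by move=> k k' /kinj/(congr1 val) /= h'; exact: val_inj.
- move=> u; split=> [/(su_plusP ue)[a ap ->]|[k ->]].
    by exists (Ordinal ap); congr ku; exact: val_inj.
  by apply/(su_plusP ue); exists (widen_ord (leq_subr i n) k) => //=.
- move=> X u k /hh[Y [hY bY] ->] Tu; rewrite (ue_tw ue) /unitary_entry (ue_ku ue).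
  move: Tu; rewrite /su_plus; case: (kd u) => [[a []]|] //= => ak.
  rewrite bY //; last by rewrite (negbTE ak).
  by apply: contra ak => /eqP ->; rewrite /=.
- move=> X k k' /hh[Y _ ->]; rewrite (ue_ent ue) /ul_block (ue_pr ue) mxE //.
Qed.

End UnitaryChain.

(** * Type AIII *)

Section TypeA.
Context {R : realType} {n : nat}.

Fact id_unitary : adjoint_mx (1%:M : 'M[R[i]]_n) *m 1%:M = 1%:M.
Proof.
rewrite mulmx1; apply/matrixP => u v; rewrite adjoint_mxE !mxE eq_sym.
by rewrite conjC_nat.
Qed.

Definition id_frame : frame R n.
Proof.
refine (@Frame R n 1%:M false id (fun=> 1) id_unitary _ _ _ _ _) => //.
- by move=> _; rewrite conjC1.
- by move=> _; rewrite mulr1.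
Defined.

Lemma tw_id X : tw id_frame X = X.
Proof.
rewrite twE /= mulmx1; have := id_unitary; rewrite mulmx1 => ->.
by rewrite mul1mx.
Qed.

Lemma id_embedding : unitary_embedding id_frame (fun u : 'I_n => Some (u, false)) id id id.
Proof.
split=> //; last by move=> Y u v; rewrite tw_id /unitary_entry eqxx.
- by move=> u v z <- [].
- by move=> u v a b s _ _; rewrite /= mulr1.
Qed.

(** Viewing su(p) as embedded by the identity makes the lemmas on unitary embeddings applicable to
    type AIII. *)
Lemma suD_mapD p : suD R n p = mapD id id (suD R n p).
Proof. by rewrite /mapD /= !image_id. Qed.

Lemma first_coordsE p :
  first_coords R n p = wspan (std_wb id_frame) (su_plus (fun u : 'I_n => Some (u, false)) p).
Proof.
rewrite /first_coords /wspan; apply: eq_bigr => u _; congr <[_]>%VS.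
by apply/matrixP => a b; rewrite !mxE (ord1 b) eqxx andbT.
Qed.

End TypeA.

Lemma typeA_hermitian (R : realType) (k l : nat) : (0 < k)%N -> (0 < l)%N ->
  let D := suD R (k + l) (k + l) in
  hermitian_pair D k (s_uu R k l) /\
  exists Vp Vm,
    [/\ phi_minimal D k (@std_rep R (k + l)) fullv Vp Vm ('i * (l%:R / (k + l)%:R)),
        rep_iso (s_uu R k l) (@std_rep R (k + l)) Vp (fun X => std_rep (ulsubmx X))
      & rep_iso (s_uu R k l) (@std_rep R (k + l)) Vm (fun X => std_rep (drsubmx X))].
Proof.
move=> k0 l0 D; have eD : D = mapD id id D by exact: suD_mapD.
have ue := @id_embedding R (k + l).
have p0 : (0 < k + l)%N by lia.
have ad := su_adapted ue p0 (leqnn _); rewrite -suD_mapD -/D in ad.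
have hk : (1 <= k <= rnk D)%N by rewrite /D /=; lia.
have kE : k_phi D k = s_uu R k l.
  rewrite (ad_k_phi ad hk); apply/seteqP; split=> X.
    move=> [hX cX]; have hX' : su_alg R _ X by case: hX.
    have off (u v : 'I_(k + l)) : (u < k)%N != (v < k)%N -> X u v = 0.
      move=> uv; apply/eqP; apply: contraNT uv; rewrite -[X u v](congr1 (fun Z : 'M_(k + l) => Z u v) (tw_id X)).
      move=> /(ad_lie_cow_entry ad hk hX cX)[_ /(su_cow_wt_eq ue p0 (leqnn _) (u := u) (v := v) erefl erefl)].
      by move=> ->; rewrite ?ltn_ord ?leq_addr.
    split=> //; apply/matrixP => a b; rewrite !mxE off //= ?ltn_ord //; have := ltn_ord a; have := ltn_ord b; lia.
  move=> [hX ur dl]; have off (u v : 'I_(k + l)) : X u v != 0 -> (u < k)%N = (v < k)%N.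
    case: (split_ordP u) => a ->; case: (split_ordP v) => b ->; rewrite /= ?ltn_ord //.
    - by have := congr1 (fun Z : 'M_(k, l) => Z a b) ur; rewrite !mxE => ->; rewrite eqxx.
    - by have := congr1 (fun Z : 'M_(l, k) => Z a b) dl; rewrite !mxE => ->; rewrite eqxx.
  have aX : alg D X by rewrite /D; split=> // u v; rewrite !ltn_ord.
  split=> //; apply: (ad_lie_cow ad hk) => u v; rewrite tw_id => /off h.
  by apply/(su_cow_wt_eq ue p0 (leqnn _) (u := u) (v := v) erefl erefl); rewrite ?ltn_ord ?leq_addr.
split.
  split=> //; first exact: (ad_well_formed ad).
  by rewrite eD; apply: (su_noncompact ue p0 (leqnn _)); lia.
have hk' : (1 <= k <= (k + l).-1)%N by lia.
have := su_phi_minimal ue p0 (leqnn _) hk'; rewrite -suD_mapD -/D.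
have -> : wspan (std_wb (id_frame (R := R))) (su_plus (fun u : 'I_(k + l) => Some (u, false)) (k + l)) = fullv.
  by rewrite -(wspan_full (std_wb (id_frame (R := R)))); apply: eq_wspan => u; rewrite /su_plus ltn_ord.
have -> : (k + l)%:R - k%:R = l%:R :> R[i] by rewrite natrD addrC addKr.
move=> h.
eexists; eexists; split; first exact: h.
  apply: std_rep_iso => [|u|X u a [hX ur dl]|X a b _].
  - by move=> a b; exact: (@lshift_inj k l).
  - rewrite /su_plus; split=> [uk|[a ->]]; last by rewrite /=.
    by exists (Ordinal uk); exact: val_inj.
  - rewrite tw_id /su_plus /=; case: (split_ordP u) => b -> /=; rewrite ?ltn_ord // => _.
    by have := congr1 (fun Z : 'M_(l, k) => Z b a) dl; rewrite !mxE.
  - by rewrite tw_id !mxE.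
apply: std_rep_iso => [|u|X u a [hX ur dl]|X a b _].
- by move=> a b; exact: (@rshift_inj k l).
- rewrite /su_plus /= ltn_ord /=; split=> [uk|[a ->]]; last by rewrite /=; lia.
  by move: uk; case: (split_ordP u) => b -> /=; rewrite ?ltn_ord //; exists b.
- rewrite tw_id /su_plus /= ltn_ord /= negbK; case: (split_ordP u) => b -> /=; last by lia.
  by have := congr1 (fun Z : 'M_(k, l) => Z b a) ur; rewrite !mxE.
- by rewrite tw_id !mxE.
Qed.

Lemma typeA_chain (R : realType) (n : nat) : (2 <= n)%N ->
  let D i := suD R n (n - i) in
  let s i := (n - 1 - i)%N in
  [/\ is_chain D s n.-1,
      forall i, (0 < i < n)%N -> chain_alg D s i = su_block R n (n - i)
    & exists Vp Vm,
      [/\ chain_minimal D s n.-1 (@std_rep R n) fullv Vp Vm,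
          forall i, (0 < i < n)%N ->
            [/\ is_dsum fullv (Vp i) (W_minus Vm i),
                Vp i = first_coords R n (n - i)
              & rep_iso (su_block R n (n - i)) (@std_rep R n) (Vp i)
                  (fun X => std_rep (ul_block i X))]
        & forall i, (0 < i < n.-1)%N ->
            is_phi_minimal (D i) (n - 1 - i) (@std_rep R n) (Vp i)]].
Proof.
move=> n2 D s; have ue := @id_embedding R n.
have eD i : D i = mapD id id (D i) by exact: suD_mapD.
have es i : (i < n)%N -> s i = (n - i).-1 by rewrite /s; lia.
have ad i : (i < n)%N -> adapted (id_frame (R := R)) (D i) (su_rel (fun u : 'I_n => Some (u, false)) (n - i))
    (su_plus (fun u : 'I_n => Some (u, false)) (n - i)) (su_cow (n - i)).
  by move=> hi; rewrite eD; apply: (su_adapted ue); lia.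
have ch : is_chain D s n.-1.
  split; first by apply: (ad_well_formed (ad 0%N _)); lia.
  move=> i hi; rewrite es; last by lia.
  split; first by rewrite eD; apply: (su_noncompact ue); lia.
  rewrite eD [D i.+1]eD /D subnS; apply: (su_semisimple_part ue); lia.
pose T i := su_plus (fun u : 'I_n => Some (u, false)) (n - i).
pose Vp i := wspan (std_wb (id_frame (R := R))) (T i).
pose Vm i := wspan (std_wb (id_frame (R := R))) (fun u => T i.-1 u && ~~ T i u).
have cm i : (i < n.-1)%N -> phi_minimal (D i) (s i) (@std_rep R n) (Vp i) (Vp i.+1) (Vm i.+1)
    ('i * (((n - i)%N%:R - (n - i).-1%:R) / (n - i)%N%:R)).
  move=> hi; rewrite es; last by lia.
  by rewrite eD /Vp /Vm /T subnS; apply: (su_phi_minimal ue); lia.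
have full : Vp 0%N = fullv.
  rewrite -(wspan_full (std_wb (id_frame (R := R)))); apply: eq_wspan => u.
  by rewrite /T /su_plus subn0 ltn_ord.
split=> //.
- move=> i hi; rewrite (chain_algE (om := fun i => su_cow (n - i) (n - i).-1) ch) //; last by lia.
  + apply/seteqP; split=> X.
      move=> [[hX _] cX]; split=> //; split; first by case: hX.
      by apply/(su_cow_commute ue _); [lia|exact: cX].
    move=> [[uX bX] hX]; split; first by split=> // u v; rewrite subn0 !ltn_ord.
    by apply/(su_cow_commute ue _); [lia|exact: bX].
  + by move=> j hj; apply: su_cow_tor; lia.
  + by move=> j hj; rewrite es ?(ad_k_phi (ad j _)) //=; lia.
  + by move=> j hj; rewrite es ?(ad_z_phi (ad j _)) //=; lia.
exists Vp, Vm; split.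
- by split=> // i hi; eexists; exact: cm.
- move=> i hi; split.
  + have dec j a : T j.+1 a -> T j a by rewrite /T /su_plus /=; lia.
    have dec0 a : T i a -> T 0%N a by rewrite /T /su_plus /=; lia.
    have -> : W_minus Vm i = wspan (std_wb (id_frame (R := R))) (fun u => T 0%N u && ~~ T i u).
      exact: (W_minus_wspan dec (fun j _ => erefl (Vm j.+1)) (leqnn i)).
    by rewrite -full; exact: wspan_dsum.
  + by rewrite first_coordsE.
  + apply: (u_block_rep_iso ue) => X [hX _]; exact: (ex_intro2 _ _ X hX erefl).
- move=> i hi; eexists; eexists; eexists; by exact: (cm i ltac:(lia)).
Qed.

(** * Chains through u(n) *)

Definition double_kd {n : nat} (u : 'I_(n + n)) : option ('I_n * bool) :=
  Some (match fintype.split u with inl a => (a, false) | inr a => (a, true) end).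

Lemma double_kdP n (u : 'I_(n + n)) a s :
  double_kd u = Some (a, s) <-> u = if s then rshift n a else lshift n a.
Proof.
rewrite /double_kd; case: (split_ordP u) => b ->; split => [[<- <-]//|].
- by case: s => /eqP; rewrite ?eq_lrshift // eq_lshift => /eqP ->.
- by case: s => /eqP; rewrite ?eq_rlshift // eq_rshift => /eqP ->.
Qed.

Section Unchain.
Context {R : realType} {n : nat} (f : frame R (n + n)).
Variables (e : 'M[R[i]]_n -> 'M[R[i]]_(n + n)) (pr : 'M[R[i]]_(n + n) -> 'M[R[i]]_n).
Hypothesis ue : unitary_embedding f double_kd (lshift n) e pr.
Variables (D0 : rootDatum R (n + n)) (w0 : nat -> 'M[R[i]]_(n + n)).
Hypothesis n_gt0 : (0 < n)%N.
Hypothesis ad : adapted f D0 (fun _ _ => true) pred0 w0.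
Hypothesis rnkE : rnk D0 = n.
(** The coweight of the node n, as an element of u(n). Its image has the eigenvalue 'i / 2 on the
    copy and - 'i / 2 on the conjugate copy, whose difference 'i is the one required by
    minimality. *)
Let half_i : 'M[R[i]]_n := ('i / 2%:R)%:M.
Hypothesis w0E : w0 n = e half_i.
Hypothesis simpE : forall j H, (0 < j < n)%N -> tor D0 H -> alg (mapD e pr (suD R n n)) H ->
  simp D0 j H = simp (mapD e pr (suD R n n)) j H.
Hypothesis dom : forall u j, (1 <= j <= n)%N ->
  exists2 x : R[i], 0 <= x & wt f (lshift n (Ordinal n_gt0)) (w0 j) - wt f u (w0 j) = x * 'i.
Hypothesis sep : separated_on (fun u => wt f u) (tor D0) predT.
Hypothesis con : connected (std_wb f) (@std_rep R (n + n)) (alg D0) predT.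
Variable incl : 'Hom('cV[R[i]]_n, 'cV[R[i]]_(n + n)).
Hypothesis inclE : forall a, exists2 c : R[i], c != 0 &
  wvec (std_wb f) (lshift n a) = c *: incl (delta_mx a 0).

Let std := @std_rep R (n + n).
Let D := unchain D0 e pr.
Let s := unchain_root n.

Let n_node : (1 <= n <= rnk D0)%N. Proof. by rewrite rnkE n_gt0 leqnn. Qed.

Lemma half_i_skew : adjoint_mx half_i = - half_i.
Proof.
apply/matrixP => a b; rewrite adjoint_mxE !mxE eq_sym; case: eqP => _; last first.
  by rewrite mulr0n conj_0 oppr0.
by rewrite mulr1n conj_mul conj_half conjCi mulNr.
Qed.

Lemma wt_half u a t : double_kd u = Some (a, t) -> wt f u (w0 n) = (-1) ^+ t * ('i / 2%:R).
Proof. by move=> eu; rewrite w0E (ue_wt ue eu half_i_skew) !mxE eqxx. Qed.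

Lemma wt_half_eq u v a b t t' : double_kd u = Some (a, t) -> double_kd v = Some (b, t') ->
  wt f u (w0 n) = wt f v (w0 n) -> t = t'.
Proof.
have c0 : 'i / 2%:R != 0 :> R[i] by rewrite mulf_neq0 ?neq0Ci // invr_eq0 pnatr_eq0.
move=> eu ev; rewrite (wt_half eu) (wt_half ev) => /(mulIf c0).
case: t t' {eu ev} => [] [] // /eqP; rewrite ?expr1 ?expr0 -subr_eq0.
  by rewrite -opprD oppr_eq0 -mulr2n pnatr_eq0.
by rewrite opprK -mulr2n pnatr_eq0.
Qed.

Lemma ue_alg (Y : 'M[R[i]]_n) : u_alg R n Y -> alg D0 (e Y).
Proof.
move=> hY; rewrite (ad_alg ad); split=> //; [exact: (ue_adj ue)|exact: (ue_star_sym ue)|].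
by rewrite big_pred0.
Qed.

(** Commuting with the coweight forbids entries between the two copies. Of the two remaining
    diagonal blocks, star symmetry makes the second the conjugate of the first. *)
Lemma unchain_k_phi : k_phi D0 n = e @` u_alg R n.
Proof.
rewrite (ad_k_phi ad n_node); apply/seteqP; split=> [X [hX cX]|_ [Y hY <-]].
  have hXb : block f (fun _ _ => true) pred0 X by rewrite -(ad_alg ad).
  pose Y : 'M[R[i]]_n := \matrix_(a, b) tw f X (lshift n a) (lshift n b).
  exists Y.
    by apply/matrixP => a b; rewrite adjoint_mxE !mxE (block_skew _ _ hXb) conj_opp conjCK.
  apply: (@tw_inj _ _ f); apply/matrixP => u v; rewrite (ue_tw ue) /unitary_entry.
  case eu: (double_kd u) => [[a t]|]; last by [].
  case ev: (double_kd v) => [[b t']|]; last by [].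
  have [x0|x0] := eqVneq (tw f X u v) 0; last first.
    have [_ /(wt_half_eq eu ev) tt] := ad_lie_cow_entry ad n_node hX cX x0; subst t'.
    rewrite eqxx; case: t eu ev => eu ev; last first.
      by rewrite mxE (proj1 (double_kdP _ _ _) eu) (proj1 (double_kdP _ _ _) ev).
    have hs := ue_sym ue eu; have [_ X2 _ _] := hXb.
    have eu' : u = fstar f (lshift n a) by apply: (ue_inj ue eu); rewrite (ue_star ue hs) (ue_ku ue).
    have ev' : v = fstar f (lshift n b) by apply: (ue_inj ue ev); rewrite (ue_star ue hs) (ue_ku ue).
    rewrite mxE eu' ev' (X2 hs) (ue_sg ue (ue_ku ue b) (ue_ku ue a)) mul1r.
    by rewrite (block_skew (lshift n b) (lshift n a) hXb) conj_opp conjCK.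
  rewrite x0; case: eqP => // tt; subst t'.
  case: t eu ev => eu ev; last first.
    by rewrite mxE -(proj1 (double_kdP _ _ _) eu) -(proj1 (double_kdP _ _ _) ev).
  have hs := ue_sym ue eu; have [_ X2 _ _] := hXb.
  have eu' : lshift n a = fstar f u by apply: (ue_inj ue (ue_ku ue a)); rewrite (ue_star ue hs) eu.
  have ev' : lshift n b = fstar f v by apply: (ue_inj ue (ue_ku ue b)); rewrite (ue_star ue hs) ev.
  rewrite mxE eu' ev' (X2 hs) (block_skew u v hXb) x0 conj_0 oppr0 mulr0 oppr0 conj_0 //.
split; first exact: ue_alg.
apply: (ad_lie_cow ad n_node) => u v; rewrite (ue_tw ue) /unitary_entry.
case eu: (double_kd u) => [[a t]|]; last by rewrite eqxx.
case ev: (double_kd v) => [[b t']|]; last by rewrite eqxx.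
have [tt _|_] := eqVneq t t'; last by rewrite eqxx.
by subst t'; rewrite (wt_half eu) (wt_half ev).
Qed.

Lemma unchain_noncompact : noncompact_simple D0 n.
Proof.
apply: (ad_noncompact ad n_node) => u v _ _ _.
case eu: (double_kd u) => [[a t]|] //; case ev: (double_kd v) => [[b t']|] //.
rewrite (wt_half eu) (wt_half ev).
have : 'i / 2%:R + 'i / 2%:R = 'i :> R[i] by field.
move: ('i / 2%:R) => h hh.
by case: t t' {eu ev} => [] []; [apply: Or31|apply: Or33|apply: Or32|apply: Or31];
  rewrite -?hh ?expr1 ?expr0; ring.
Qed.

Lemma unchain_semisimple_part : semisimple_part D0 n (mapD e pr (suD R n n)).
Proof.
have ad' := su_adapted ue n_gt0 (leqnn n).
have sub : alg (mapD e pr (suD R n n)) `<=` alg D0.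
  by move=> _ [Y [[hY _] _] <-]; exact: ue_alg.
apply: (ad_semisimple_part ad ad' n_node) => //.
- move=> u v /su_relP[a [b [t [e1 e2 _ _]]]]; split=> //.
  by rewrite (wt_half e1) (wt_half e2).
- move=> u v x _ h /su_relP[b [c [t [e1 e2 _ _]]]].
  case eu: (double_kd u) => [[a t']|] //.
  have tt := wt_half_eq eu e1 h; subst t'.
  by apply/su_relP; exists a, c, t; rewrite !ltn_ord.
- move=> u v _ h; rewrite /su_plus.
  case eu: (double_kd u) => [[a t]|] //; case ev: (double_kd v) => [[b t']|] //.
  have tt := wt_half_eq eu ev h; subst t'.
  by rewrite !ltn_ord.
- move=> X hX cX; have : k_phi D0 n X by rewrite (ad_k_phi ad n_node).
  rewrite unchain_k_phi => -[Y hY <-].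
  have n0 : n%:R != 0 :> R[i] by rewrite pnatr_eq0 -lt0n.
  have trY : (\tr Y)^* = - \tr Y.
    have := congr1 (@mxtrace _ n) hY; rewrite linearN /= => <-.
    rewrite /mxtrace rmorph_sum; apply: eq_bigr => a _; by rewrite adjoint_mxE.
  (* This multiple of [half_i] has the same trace as Y, because the trace of [half_i] is n 'i /
     2. *)
  have /complex_realP[t ht] : - 'i * 2%:R * n%:R^-1 * \tr Y \is Num.real.
    apply/CrealP; rewrite !conj_mul conj_opp conjCi trY.
    have -> : (2%:R : R[i])^* = 2%:R by exact: conjC_nat.
    have -> : (n%:R^-1 : R[i])^* = n%:R^-1 by apply/CrealP; rewrite rpredV realn.
    by ring.
  exists t; exists (Y - (t%:C)%C *: half_i); last by rewrite (ue_lin ue) w0E.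
  split; last by move=> a b; rewrite !ltn_ord.
  split.
    rewrite /u_alg /= adjoint_mxD adjoint_mxN adjoint_mxZ conj_real_complex hY half_i_skew.
    by rewrite scalerN opprD.
  rewrite linearB /= mxtraceZ mxtrace_scalar -ht -[(_ / _) *+ n]mulr_natr.
  move: (n%:R) (\tr Y) n0 => x y x0.
  transitivity (y * (1 + 'i * 'i)); first by field.
  by rewrite -expr2 sqrCi subrr mulr0.
- rewrite /= => j hj; exists j; split; [lia|lia|] => H tH.
  apply/esym/simpE; [lia| |]; last exact: (ad_tor_sub ad').
  apply/(ad_torP ad); have [h1 h2] := proj1 (ad_torP ad' H) tH.
  by split=> //; exact: sub.
Qed.

(** The first step only removes the conjugate copy and leaves all n coordinates of the other one;
    the copy itself starts to shrink at the second step. *)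
Let T i : pred 'I_(n + n) := if i is i'.+1 then su_plus double_kd (n - i') else predT.
Let Vp i := wspan (std_wb f) (T i).
Let Vm i := wspan (std_wb f) (fun u => T i.-1 u && ~~ T i u).

(** Only lines matter, so weight vectors may differ from the images of the coordinate vectors by a
    nonzero scalar. *)
Lemma wspan_incl q : (q <= n)%N ->
  wspan (std_wb f) (su_plus double_kd q) = (incl @: first_coords R n q)%VS.
Proof.
move=> qn; have lin (a : 'I_n) : <[wvec (std_wb f) (lshift n a)]>%VS = <[incl (delta_mx a 0%R)]>%VS.
  have [c c0 ->] := inclE a; apply: subv_anti; apply/andP; split; rewrite -memvE.
    by apply: memvZ; exact: memv_line.
  apply/vlineP; exists c^-1; by rewrite scalerA mulVf // scale1r.
rewrite /first_coords limg_sum; apply: subv_anti; apply/andP; split.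
  apply/subv_sumP => u /(su_plusP ue)[a aq ->].
  by rewrite lin -limg_line; apply: (sumv_sup a).
apply/subv_sumP => a aq; rewrite limg_line -lin.
by apply: (sumv_sup (lshift n a)) => //; rewrite /su_plus (ue_ku ue).
Qed.

Lemma unchain_phi_minimal :
  phi_minimal D0 n std (Vp 0) (Vp 1) (Vm 1) ('i / 2%:R).
Proof.
have inj := ue_inj ue.
have plusE u : su_plus double_kd (n - 0) u -> exists2 a, double_kd u = Some (a, false) & u = lshift n a.
  by case/(su_plusP ue) => a _ ->; exists a => //; exact: (ue_ku ue).
apply: (wspan_phi_minimal ad (@std_complex_linear R (n + n)) (@std_is_rep R (n + n) _) (std_diag ad)
  (lam := fun u => wt f u) (a0 := lshift n (Ordinal n_gt0))) => //.
- exact: (std_invariant (f := f)).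
- apply: step_connected => u v Tu Tv uv.
  have [a ea ua] := plusE _ Tu; have [b eb vb] := plusE _ Tv.
  apply: std_step.
  + apply: (rvec_k_phi ad) => //; first by rewrite eq_sym.
    by rewrite (wt_half ea) (wt_half eb).
  + by rewrite eq_sym.
  + apply/negP => /and3P[hd /eqP ev _].
    by move: ea; rewrite ev (ue_star ue hd) eb.
- by rewrite /T /su_plus (ue_ku ue) /= subn0.
- move=> u _; rewrite /T /su_plus; case eu: (double_kd u) => [[a t]|] //.
  rewrite (wt_half eu) subn0; by case: t {eu}; rewrite ?ltn_ord ?expr0 ?expr1; field.
- by move=> u j _; rewrite rnkE; exact: dom.
Qed.

Lemma unchain_is_chain : is_chain D s n.
Proof.
split; first exact: (ad_well_formed ad).
case=> [|i] hi; first by split; [exact: unchain_noncompact|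
  rewrite /D /= subn0; exact: unchain_semisimple_part].
rewrite /s /= subn1; split; first by apply: (su_noncompact ue); lia.
by rewrite /D /= subnS; apply: (su_semisimple_part ue); lia.
Qed.

Lemma unchain_alg i : (i < n)%N -> chain_alg D s i.+1 = e @` u_block R n (n - i).
Proof.
move=> hi; pose om j := if j is j'.+1 then e (su_cow (n - j') (n - j').-1) else w0 n.
have adi j : (j < n)%N -> adapted f (D j.+1) (su_rel double_kd (n - j))
    (su_plus double_kd (n - j)) (fun q => e (su_cow (n - j) q)).
  by move=> hj; apply: (su_adapted ue); lia.
rewrite (chain_algE (om := om) unchain_is_chain); last by lia.
- apply/seteqP; split=> [X [hX cX]|_ [Y [hY bY] <-]].
    have : k_phi D0 n X by rewrite (ad_k_phi ad n_node); split=> //; exact: (cX 0%N).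
    rewrite unchain_k_phi => -[Y hY eY]; exists Y => //; split=> //.
    by apply/(su_cow_commute ue _ hi) => j ji; rewrite eY; exact: (cX j.+1).
  have : k_phi D0 n (e Y) by rewrite unchain_k_phi; exists Y.
  rewrite (ad_k_phi ad n_node) => -[aY cY]; split=> // -[_|j ji] //.
  by apply: (proj2 (su_cow_commute ue Y hi)).
- case=> [_|j hj] /=; first exact: (ad_cow_tor ad).
  by exists (su_cow (n - j) (n - j).-1) => //; apply: su_cow_tor; lia.
- case=> [_|j hj]; first exact: (ad_k_phi ad).
  by rewrite /s /= subn1 (ad_k_phi (adi j _)) //=; lia.
- case=> [_|j hj]; first exact: (ad_z_phi ad).
  by rewrite /s /= subn1 (ad_z_phi (adi j _)) //=; lia.
Qed.

Lemma unchain_minimal :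
  hermitian_pair D0 n (e @` u_alg R n) /\
  (exists Vm, phi_minimal D0 n std fullv (limg incl) Vm ('i / 2%:R)) /\
  rep_iso (e @` u_alg R n) std (limg incl) (fun X => std_rep (pr X)) /\
  [/\ is_chain D s n,
      forall i, (i < n)%N -> chain_alg D s i.+1 = e @` u_block R n (n - i)
    & exists Vp Vm,
      [/\ chain_minimal D s n std fullv Vp Vm,
          forall i, (i < n)%N ->
            [/\ is_dsum fullv (Vp i.+1) (W_minus Vm i.+1),
                Vp i.+1 = (incl @: first_coords R n (n - i))%VS
              & rep_iso (e @` u_block R n (n - i)) std (Vp i.+1)
                  (fun X => std_rep (ul_block i (pr X)))]
        & forall i, (i < n.-1)%N -> is_phi_minimal (D i.+1) (n - i - 1) std (Vp i.+1)]].
Proof.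
have full : Vp 0 = fullv by exact: wspan_full.
have first : Vp 1 = limg incl.
  rewrite /Vp /T subn0 wspan_incl // first_coordsE; congr (_ @: _)%VS.
  rewrite -(wspan_full (std_wb (id_frame (R := R)))); apply: eq_wspan => u.
  by rewrite /su_plus ltn_ord.
have cm i : (i < n)%N -> exists lam, phi_minimal (D i) (s i) std (Vp i) (Vp i.+1) (Vm i.+1) lam.
  case: i => [_|i hi]; first by eexists; exact: unchain_phi_minimal.
  eexists; rewrite /s /= subn1 /Vp /Vm /T /= subnS.
  by apply: (su_phi_minimal ue); lia.
split; first by split; [exact: (ad_well_formed ad)|exact: unchain_noncompact|exact: unchain_k_phi].
split; first by exists (Vm 1); rewrite -full -first; exact: unchain_phi_minimal.
split.
  rewrite -first; apply: std_rep_iso => [|u|X u a [Y hY <-]|X a b [Y hY <-]].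
  - by move=> a b; exact: (@lshift_inj n n).
  - rewrite /T subn0; split=> [/(su_plusP ue)[a _ ->]|[a ->]]; first by exists a.
    by apply/(su_plusP ue); exists a.
  - rewrite (ue_tw ue) /unitary_entry (ue_ku ue) /T /su_plus subn0.
    by case: (double_kd u) => [[b []]|] //=; rewrite ltn_ord.
  - by rewrite (ue_ent ue) (ue_pr ue).
split; [exact: unchain_is_chain|exact: unchain_alg|exists Vp, Vm; split].
- by split=> // i; exact: cm.
- move=> i hi; split.
  + have dec j a : T j.+1 a -> T j a.
      by case: j => [//|j]; rewrite /T /su_plus; case: (double_kd a) => [[b []]|] //; lia.
    have -> : W_minus Vm i.+1 = wspan (std_wb f) (fun u => T 0%N u && ~~ T i.+1 u).
      exact: (W_minus_wspan dec (fun j _ => erefl (Vm j.+1)) (leqnn i.+1)).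
    by rewrite -full; exact: wspan_dsum.
  + by apply: wspan_incl; exact: leq_subr.
  + by apply: (u_block_rep_iso ue) => X [Y hY <-]; exists Y.
- move=> i hi; have [lam h] := cm i.+1 ltac:(lia); eexists; eexists; exists lam; exact: h.
Qed.

End Unchain.

(** * Orthogonal algebras *)

Lemma tw_skew (R : realType) (N : nat) (f : frame R N) X u v :
  adjoint_mx X = - X -> tw f X v u = - (tw f X u v)^*.
Proof.
move=> hX; have := congr1 (fun Z => tw f Z v u) hX.
by rewrite tw_adj twN adjoint_mxE [in RHS]mxE => ->; rewrite opprK.
Qed.

Section OrthogonalFrame.
Context {R : realType} {b : bool} {m : nat}.
Let N := (b + (m + m))%N.

Definition so_kd (u : 'I_N) : option ('I_m * bool) :=
  match fintype.split u with
  | inl _ => None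
  | inr v => Some (match fintype.split v with inl k => (k, false) | inr k => (k, true) end)
  end.

Definition so_coord (k : 'I_m) (s : bool) : 'I_N := if s then ycoord b k else xcoord b k.

Lemma so_kd_coord k s : so_kd (so_coord k s) = Some (k, s).
Proof. by rewrite /so_kd /so_coord; case: s; rewrite /xcoord /ycoord !(unsplitK (inr _), unsplitK (inl _)). Qed.

Lemma so_kdP u k s : so_kd u = Some (k, s) -> u = so_coord k s.
Proof.
rewrite /so_kd /so_coord; case: (split_ordP u) => // v ->.
by case: (split_ordP v) => a -> [<- <-].
Qed.

Lemma so_kd_inj u v : so_kd u = so_kd v -> u = v.
Proof.
case eu: (so_kd u) => [[k s]|] ev; first by rewrite (so_kdP eu) (so_kdP (esym ev)).
move: eu ev; rewrite /so_kd; case: (split_ordP u) => // z -> _; case: (split_ordP v) => // z' -> _.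
have z0 (x : 'I_b) : nat_of_ord x = 0%N.
  by case: x => x /= hx; have : (x < 1)%N by [apply: leq_trans hx _; case: (b)]; case: x {hx}.
by congr lshift; apply: val_inj; rewrite /= !z0.
Qed.

Lemma plane_of_kd u : plane_of u = omap fst (so_kd u).
Proof. by rewrite /plane_of /so_kd; case: (fintype.split u) => // v; case: (fintype.split v). Qed.

Lemma sum_so_coord (V : nmodType) (F : 'I_N -> V) :
  \sum_u F u = \sum_(z < b) F (lshift (m + m) z) +
     (\sum_k F (xcoord b k) + \sum_k F (ycoord b k)).
Proof. by rewrite big_split_ord /= [X in _ + X]big_split_ord. Qed.

Lemma so_kd_None (z : 'I_b) : so_kd (lshift (m + m) z) = None.
Proof. by rewrite /so_kd (unsplitK (inl _)). Qed.

(* The weight vectors in the plane k are zeta (e_x + 'i e_y) and its conjugate;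
   zeta = (1 + 'i) / 2 has norm 1 / sqrt 2. *)
Definition so_coef (s t : bool) : R[i] :=
  (if t then (1 - 'i) / 2%:R else (1 + 'i) / 2%:R) * (if s then (if t then - 'i else 'i) else 1).

Definition so_mat : 'M[R[i]]_N := \matrix_(u, v)
  match so_kd u, so_kd v with
  | None, None => 1
  | Some (k, s), Some (l, t) => if k == l then so_coef s t else 0
  | _, _ => 0
  end.

Lemma so_mat_sum (g : 'I_N -> R[i]) v : \sum_a g a * so_mat a v =
  match so_kd v with
  | None => g v
  | Some (l, t) => g (xcoord b l) * so_coef false t + g (ycoord b l) * so_coef true t
  end.
Proof.
case ev: (so_kd v) => [[l t]|].
  rewrite sum_so_coord big1 ?add0r => [|z _]; last by rewrite mxE so_kd_None ev mulr0.
  congr (_ + _).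
    rewrite (bigD1 l) //= big1 ?addr0 => [|k kl]; rewrite mxE ev (so_kd_coord _ false) ?eqxx //.
    by rewrite (negbTE kl) mulr0.
  rewrite (bigD1 l) //= big1 ?addr0 => [|k kl]; rewrite mxE ev (so_kd_coord _ true) ?eqxx //.
  by rewrite (negbTE kl) mulr0.
rewrite (bigD1 v) //= mxE ev mulr1 big1 ?addr0 // => a av; rewrite mxE ev.
case ea: (so_kd a) => [[k s]|]; first by rewrite mulr0.
by case/eqP: av; apply: so_kd_inj; rewrite ea.
Qed.

Lemma ii : 'i * 'i = -1 :> R[i]. Proof. by rewrite -expr2 sqrCi. Qed.

Lemma so_coef_conj s t : (so_coef s t)^* = so_coef s (~~ t).
Proof.
have h : (1 - 'i : R[i])^* = 1 + 'i by rewrite conj_sub conjC1 conjCi opprK.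
have h' : (1 + 'i : R[i])^* = 1 - 'i by rewrite conj_add conjC1 conjCi.
by rewrite /so_coef; case: s; case: t; rewrite /= !conj_mul conj_half ?h ?h' ?conj_opp ?conjCi ?opprK ?conjC1.
Qed.

(** Complex conjugation of the weight vectors. The complexified scalar product pairs each of them
    with its conjugate, and x_0 is the only self-conjugate one. *)
Definition so_star (u : 'I_N) : 'I_N :=
  if so_kd u is Some (k, s) then so_coord k (~~ s) else u.

Lemma so_kd_star u : so_kd (so_star u) = omap (fun z => (z.1, ~~ z.2)) (so_kd u).
Proof. by rewrite /so_star; case eu: (so_kd u) => [[k s]|] //=; rewrite so_kd_coord. Qed.

Lemma so_starK : involutive so_star.
Proof.
move=> u; apply: so_kd_inj; rewrite !so_kd_star.
by case: (so_kd u) => [[k s]|] //=; rewrite negbK.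
Qed.

Lemma so_mat_star u v : so_mat u (so_star v) = (so_mat u v)^*.
Proof.
rewrite !mxE so_kd_star; case: (so_kd u) => [[k s]|]; case: (so_kd v) => [[l t]|] /=;
  rewrite ?conj_0 ?conjC1 //.
by case: eqP => _; rewrite ?conj_0 // so_coef_conj.
Qed.

Lemma so_unitary : adjoint_mx so_mat *m so_mat = 1%:M.
Proof.
apply/matrixP => u v; rewrite mxE so_mat_sum !adjoint_mxE.
have hc s t : so_coef false (~~ s) * so_coef false t + so_coef true (~~ s) * so_coef true t = (s == t)%:R.
  rewrite /so_coef; case: s; case: t => /=.
  - by field: ii.
  - by field: ii.
  - by field: ii.
  - by field: ii.
rewrite [RHS]mxE; case ev: (so_kd v) => [[l t]|].
  rewrite !mxE (so_kd_coord _ false) (so_kd_coord _ true); case eu: (so_kd u) => [[k s]|].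
    have [lk|lk] := eqVneq l k.
      rewrite !so_coef_conj hc; congr (_%:R); congr nat_of_bool; apply/eqP/eqP => [st|uv].
        by apply: so_kd_inj; rewrite eu ev lk st.
      by move: eu; rewrite uv ev => -[].
    rewrite conj_0 !mul0r addr0; case: eqP => // uv; move: eu; rewrite uv ev => -[e1 _].
    by rewrite e1 eqxx in lk.
  by rewrite conj_0 !mul0r addr0; case: eqP => // uv; rewrite -uv eu in ev.
rewrite mxE ev; case eu: (so_kd u) => [[k s]|].
  by rewrite conj_0; case: eqP => // uv; rewrite uv ev in eu.
by rewrite conjC1 (so_kd_inj (etrans eu (esym ev))) eqxx.
Qed.

Definition so_frame : frame R N.
Proof.
refine (@Frame R N so_mat true so_star (fun=> 1) so_unitary so_starK _ _ _ _).
- move=> _ u v hu hv; apply: so_kd_inj; have := so_kd_star u; have := so_kd_star v.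
  rewrite hu hv; case: (so_kd u) => [[k []]|]; case: (so_kd v) => [[l []]|] //.
- by move=> _; rewrite conjC1.
- by move=> _; rewrite mulr1.
- by move=> _ _.
Defined.

Lemma tw_so_frameE X u v :
  tw so_frame X u v = \sum_c \sum_a (so_mat a u)^* * X a c * so_mat c v.
Proof.
rewrite twE mxE; apply: eq_bigr => c _; rewrite mxE mulr_suml.
by apply: eq_bigr => a _; rewrite adjoint_mxE.
Qed.

Lemma tw_conj X u v : tw so_frame (map_mx Num.conj X) u v = (tw so_frame X (so_star u) (so_star v))^*.
Proof.
rewrite !tw_so_frameE rmorph_sum; apply: eq_bigr => c _; rewrite rmorph_sum; apply: eq_bigr => a _.
by rewrite /= !conj_mul !so_mat_star !conjCK [map_mx _ _ _ _]mxE.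
Qed.

(** A matrix is real when conjugation fixes it, and in the frame conjugation also applies [so_star]
    to both indices. Combined with skewness this is exactly star symmetry. *)
Lemma so_algP X : so_alg R N X <-> adjoint_mx X = - X /\ star_sym so_frame X.
Proof.
split=> [[rX tX]|[aX sX]].
  have cX : map_mx Num.conj X = X.
    by apply/matrixP => u v; rewrite mxE; apply/CrealP; exact: rX.
  have hX : adjoint_mx X = - X.
    apply/matrixP => u v; rewrite adjoint_mxE (CrealP (rX v u)).
    by have := congr1 (fun Z : 'M_N => Z u v) tX; rewrite /= [in LHS]mxE.
  split=> // _ u v; rewrite /= !mulr1 mul1r.
  rewrite -{1}cX tw_conj !so_starK (tw_skew so_frame u v hX).
  by rewrite conj_opp conjCK.
have cX : map_mx Num.conj X = X.
  apply: (@tw_inj _ _ so_frame); apply/matrixP => u v; rewrite tw_conj.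
  have := sX isT v u; rewrite /= mulr1 mul1r => ->.
  by rewrite (tw_skew so_frame u v aX) opprK conjCK.
have rX u v : X u v \is Num.real.
  apply/CrealP; have := congr1 (fun Z : 'M_N => Z u v) cX; by rewrite mxE.
split=> //; apply/matrixP => u v; rewrite mxE.
by have := congr1 (fun Z : 'M_N => Z u v) aX; rewrite adjoint_mxE (CrealP (rX v u)).
Qed.

Lemma so_mat_plane (a u : 'I_N) : so_mat a u != 0 -> plane_of a = plane_of u.
Proof.
rewrite mxE !plane_of_kd; case: (so_kd a) => [[k s]|]; case: (so_kd u) => [[l t]|];
  rewrite ?eqxx //=.
by have [-> //|_] := eqVneq k l; rewrite eqxx.
Qed.

(* Conditions on the planes of the two indices may be read in either basis. *)
Lemma so_support (P : rel 'I_N) (X : 'M[R[i]]_N) :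
  (forall a a' c c', plane_of a = plane_of a' -> plane_of c = plane_of c' -> P a c = P a' c') ->
  (forall u v, ~~ P u v -> X u v = 0) <-> (forall u v, ~~ P u v -> tw so_frame X u v = 0).
Proof.
move=> hP; split=> h u v Puv.
  rewrite tw_so_frameE big1 // => c _; rewrite big1 // => a _.
  have [->|/so_mat_plane ea] := eqVneq (so_mat a u) 0; first by rewrite conj_0 !mul0r.
  have [->|/so_mat_plane ec] := eqVneq (so_mat c v) 0; first by rewrite mulr0.
  by rewrite (h a c) ?mulr0 ?mul0r // (hP _ _ _ _ ea ec).
rewrite -[X](twK so_frame) /utw -lock !mxE big1 // => c _; rewrite mxE.
rewrite mulr_suml big1 // => a _; rewrite adjoint_mxE.
have [->|/so_mat_plane ea] := eqVneq (so_mat u a) 0; first by rewrite !mul0r.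
have [->|/so_mat_plane ec] := eqVneq (so_mat v c) 0; first by rewrite conj_0 mulr0.
by rewrite (h a c) ?mulr0 ?mul0r // -(hP _ _ _ _ ea ec).
Qed.

Lemma wt_so_None u X : so_alg R N X -> so_kd u = None -> wt so_frame u X = 0.
Proof.
move=> /so_algP[_ sX] eu; have := sX isT u u; rewrite /= /so_star eu mulr1 mul1r => /eqP.
by rewrite -subr_eq0 opprK -mulr2n mulrn_eq0 /= => /eqP.
Qed.

Lemma wt_so_star u X : so_alg R N X -> wt so_frame (so_star u) X = - wt so_frame u X.
Proof. by move=> /so_algP[_ sX]; rewrite /wt (sX isT) /= mulr1 mul1r. Qed.

Lemma plane_eps_ord (k : 'I_m) (X : 'M[R[i]]_N) :
  plane_eps k X = 'i * X (xcoord b k) (ycoord b k).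
Proof. by rewrite /plane_eps (big_pred1 k). Qed.

Lemma tw_so_entry (X : 'M[R[i]]_N) k s l t :
  tw so_frame X (so_coord k s) (so_coord l t) =
    (X (xcoord b k) (xcoord b l) * so_coef false t + X (xcoord b k) (ycoord b l) * so_coef true t)
       * so_coef false (~~ s) +
    (X (ycoord b k) (xcoord b l) * so_coef false t + X (ycoord b k) (ycoord b l) * so_coef true t)
       * so_coef true (~~ s).
Proof.
rewrite tw_so_frameE exchange_big /=.
have -> : \sum_a \sum_c (so_mat a (so_coord k s))^* * X a c * so_mat c (so_coord l t) =
    \sum_a (\sum_c X a c * so_mat c (so_coord l t)) * so_mat a (so_coord k (~~ s)).
  apply: eq_bigr => a _; rewrite mulr_suml; apply: eq_bigr => c _.
  have -> : so_mat a (so_coord k (~~ s)) = (so_mat a (so_coord k s))^*.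
    by rewrite -so_mat_star /so_star so_kd_coord.
  by ring.
by rewrite so_mat_sum so_kd_coord !so_mat_sum !so_kd_coord.
Qed.

Lemma wt_so (k : 'I_m) s X : so_alg R N X ->
  wt so_frame (so_coord k s) X = (-1) ^+ s * plane_eps k X.
Proof.
move=> hX; have [rX tX] := hX.
have anti u v : X v u = - X u v.
  by have := congr1 (fun Z : 'M_N => Z u v) tX; rewrite !mxE.
have diag0 u : X u u = 0.
  by have := anti u u => /eqP; rewrite -subr_eq0 opprK -mulr2n mulrn_eq0 /= => /eqP.
have hx : wt so_frame (so_coord k false) X = plane_eps k X.
  rewrite /wt tw_so_entry plane_eps_ord !diag0.
  rewrite (anti (xcoord b k) (ycoord b k)) /so_coef /=.
  by move: (X _ _) => x; field: ii.
case: s => //; last by rewrite mul1r.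
have -> : so_coord k true = so_star (so_coord k false) by rewrite /so_star so_kd_coord.
by rewrite wt_so_star // hx expr1 mulN1r.
Qed.

End OrthogonalFrame.

(** In type D the last two simple roots are the difference and the sum of E_q and E_(q+1). Here [s]
    lists the partial sums of the coefficients of a root, h is half of their total and a is the
    coefficient of E_(q+1). *)
Lemma typeD_abel (R : realType) (E : nat -> R[i]) q (s : nat -> int) (h a : int) : (0 < q)%N ->
  s q.+1 = h + h -> s q = h + h - a ->
  \sum_(1 <= j < q.+1) (s j)%:~R * (E j - E j.+1) + (s q.+1)%:~R * E q.+1 =
  \sum_(1 <= j < q) (s j)%:~R * (E j - E j.+1) + (h - a)%:~R * (E q - E q.+1)
     + h%:~R * (E q + E q.+1).
Proof.
move=> q0 e1 e2; rewrite big_nat_recr //= e1 e2 -!addrA; congr (_ + _).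
by rewrite !rmorphB !rmorphD /=; ring.
Qed.

(** As j grows, the first nonzero jump fixes the sign and the second one can at most cancel it.
    Simultaneous nonzero jumps are allowed only when they add up. *)
Lemma sign_steps (a c : int) (x y : nat) :
  [\/ a = 0, a = 1 | a = -1] -> [\/ c = 0, c = 1 | c = -1] ->
  (a = 0 /\ c <> 0) \/ (c = 0 /\ a <> 0) \/ x <> y \/ a = - c ->
  (forall j, 0 <= a * (x <= j)%N%:Z - c * (y <= j)%N%:Z) \/
  (forall j, a * (x <= j)%N%:Z - c * (y <= j)%N%:Z <= 0).
Proof.
have tac (d e : int) j : ((x <= j)%N -> (y <= j)%N -> 0 <= d - e) ->
   ((x <= j)%N -> (j < y)%N -> 0 <= d) -> ((j < x)%N -> (y <= j)%N -> 0 <= - e) ->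
   0 <= d * (x <= j)%N%:Z - e * (y <= j)%N%:Z.
  case: (leqP x j) => h1; case: (leqP y j) => h2; rewrite /= ?mulr1 ?mulr0 ?subr0 ?sub0r //.
    by move=> h _ _; exact: h.
    by move=> _ h _; exact: h.
  by move=> _ _ h; exact: h.
have tac' (d e : int) j : ((x <= j)%N -> (y <= j)%N -> d - e <= 0) ->
   ((x <= j)%N -> (j < y)%N -> d <= 0) -> ((j < x)%N -> (y <= j)%N -> - e <= 0) ->
   d * (x <= j)%N%:Z - e * (y <= j)%N%:Z <= 0.
  case: (leqP x j) => h1; case: (leqP y j) => h2; rewrite /= ?mulr1 ?mulr0 ?subr0 ?sub0r //.
    by move=> h _ _; exact: h.
    by move=> _ h _; exact: h.
  by move=> _ _ h; exact: h.
by case=> ->; case=> -> H; have [xy|xy] := ltnP x y;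
  first [by left=> j; apply: tac; lia|by right=> j; apply: tac'; lia].
Qed.

(** * Root data of so(2p + b), for any numbering of the planes by the labels of the weights *)

Section OrthogonalDatum.
Context {R : realType} {b : bool} {m : nat}.
Variables (p : nat) (pl posn : nat -> nat).
Hypothesis p_le : (p <= m)%N.
Hypothesis p_gt : (2 <= p + b)%N.
Hypothesis plP : forall j, (1 <= j <= p)%N -> (pl j < p)%N /\ posn (pl j) = j.
Hypothesis posnP : forall k, (k < p)%N -> (1 <= posn k <= p)%N /\ pl (posn k) = k.
Local Notation N := (b + (m + m))%N.
Implicit Types (u v : 'I_N) (X H : 'M[R[i]]_N).

Let e (j : nat) H : R[i] := plane_eps (pl j) H.
Let D : rootDatum R N := @soD R b m p e.
Let f := so_frame (R := R) (b := b) (m := m).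

Definition so_rel : rel 'I_N := fun u v => in_planes p u && in_planes p v.

Let p_gt0 : (0 < p)%N. Proof. by move: p_gt; case: (b) => /=; lia. Qed.

Lemma in_planes_kd u : in_planes p u = if so_kd u is Some (k, _) then (k < p)%N else true.
Proof. by rewrite /in_planes plane_of_kd; case: (so_kd u) => [[]|]. Qed.

Lemma in_planes_star u : in_planes p (so_star u) = in_planes p u.
Proof. by rewrite !in_planes_kd so_kd_star; case: (so_kd u) => [[]|]. Qed.

Lemma so_algE : alg D = block f so_rel pred0.
Proof.
have hP a a' c c' : plane_of a = plane_of a' -> plane_of c = plane_of c' -> so_rel a c = so_rel a' c'.
  by rewrite /so_rel /in_planes => -> ->.
apply/seteqP; split=> X.
  move=> [/so_algP[aX sX] /(so_support _ hP) h]; split=> //.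
  by rewrite big_pred0.
move=> [aX sX h _]; split; first by apply/so_algP.
by apply/(so_support _ hP).
Qed.

(** Inside one plane the two weight vectors are dual to each other, so star symmetry kills the
    off-diagonal entries: rotations of the planes become diagonal in the frame. *)
Lemma so_torE : tor D = block f (torus_rel so_rel) pred0.
Proof.
pose P : rel 'I_N := fun u v => [&& in_planes p u, in_planes p v & plane_of u == plane_of v].
have hP a a' c c' : plane_of a = plane_of a' -> plane_of c = plane_of c' -> P a c = P a' c'.
  by rewrite /P /in_planes => -> ->.
apply/seteqP; split=> X.
  move=> [/so_algP[aX sX] /(so_support _ hP) h]; split=> //; last by rewrite big_pred0.
  move=> u v; have [uv|uv] := eqVneq u v; last first.
    move=> _; have [|/h//] := boolP (P u v); rewrite /P => /and3P[_ _].
    rewrite !plane_of_kd => /eqP e1; apply: (star_sym_nz sX); apply/negPn/and3P; split=> //=.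
      apply/eqP; apply: so_kd_inj; rewrite so_kd_star; move: e1 uv.
      case eu: (so_kd u) => [[k s]|]; case ev: (so_kd v) => [[l t]|] //=.
        move=> [kl]; subst l; have [st|st] := eqVneq s t.
          by subst t; rewrite (so_kdP eu) (so_kdP ev) eqxx.
        by move=> _; congr (Some (_, _)); case: s t st {eu ev} => [] [].
    by rewrite mulr1 eqxx.
  by move=> nr; apply: h; apply: contra nr => /and3P[h1 h2 _];
     rewrite /torus_rel /so_rel h1 h2 uv eqxx.
move=> [aX sX h _]; split; first by apply/so_algP.
apply/(so_support _ hP) => u v nP; apply: h; apply: contra nP => /andP[/andP[h1 h2] /eqP uv].
by rewrite /P h1 h2 uv eqxx.
Qed.

Definition so_tor (th : nat -> R[i]) : 'M[R[i]]_N := utw f (\matrix_(u, v)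
  if u == v then (if so_kd u is Some (k, s) then
    (if (k < p)%N then 'i * ((-1) ^+ s * th k) else 0) else 0) else 0).

Lemma wt_so_tor th u : wt f u (so_tor th) =
  if so_kd u is Some (k, s) then (if (k < p)%N then 'i * ((-1) ^+ s * th k) else 0) else 0.
Proof. by rewrite /wt /so_tor utwK mxE eqxx. Qed.

Lemma so_tor_mem th : (forall k, (th k)^* = th k) -> tor D (so_tor th).
Proof.
move=> hth; have tt u v : tw f (so_tor th) u v = if u == v then wt f u (so_tor th) else 0.
  by rewrite wt_so_tor utwK mxE.
have cw u : (wt f u (so_tor th))^* = - wt f u (so_tor th).
  rewrite wt_so_tor; case: (so_kd u) => [[k s]|]; rewrite ?conj_0 ?oppr0 //.
  case: ifP => _; rewrite ?conj_0 ?oppr0 // !conj_mul conjCi hth mulNr.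
  by congr (- (_ * (_ * _))); apply/CrealP; rewrite rpredX // rpredN rpred1.
rewrite so_torE; split.
- apply: (@tw_inj _ _ f); rewrite tw_adj twN; apply/matrixP => u v.
  rewrite adjoint_mxE [in RHS]mxE !tt eq_sym; case: eqP => [->|_]; rewrite ?conj_0 ?oppr0 //.
- move=> _ u v; rewrite !tt /= (inj_eq (can_inj (@so_starK b m))) eq_sym mulr1 mul1r.
  case: eqP => [->|_]; last by rewrite oppr0.
  rewrite !wt_so_tor so_kd_star; case: (so_kd v) => [[k s]|] /=; rewrite ?oppr0 //.
  by case: ifP => _; rewrite ?oppr0 //; case: s => /=; ring.
- move=> u v; rewrite tt /torus_rel; case: eqP => [<-|//]; rewrite andbT /so_rel andbb.
  by rewrite in_planes_kd wt_so_tor; case: (so_kd u) => [[k s]|] // /negbTE ->.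
- by rewrite big_pred0.
Qed.

Lemma e_so_tor th j : (forall k, (th k)^* = th k) -> (1 <= j <= p)%N ->
  e j (so_tor th) = 'i * th (pl j).
Proof.
move=> hth hj; have [pj _] := plP hj; have pm : (pl j < m)%N by exact: leq_trans p_le.
have [hso _] := so_tor_mem hth.
have h := wt_so (Ordinal pm) false hso; rewrite expr0 mul1r in h.
rewrite /e -[LHS]/(plane_eps (Ordinal pm) (so_tor th)) -h.
by rewrite wt_so_tor so_kd_coord /= pj mul1r.
Qed.

(** Up to 'i, the value of eps_j on the s-th fundamental coweight. In even dimension the nodes p - 1
    and p are the two spinor nodes, whose coweights are half-integral. *)
Definition so_cow_val (s j : nat) : R[i] :=
  if b || (s < p.-1)%N then (j <= s)%N%:R
  else if (s == p.-1) && (j == p) then - 2%:R^-1 else 2%:R^-1.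

Definition so_cow s := so_tor (fun k => so_cow_val s (posn k)).

Lemma so_cow_val_real s j : (so_cow_val s j)^* = so_cow_val s j.
Proof.
rewrite /so_cow_val; case: ifP => _; first by rewrite conjC_nat.
by case: ifP => _; rewrite ?conj_opp conj_half.
Qed.

Lemma so_cow_tor s : tor D (so_cow s).
Proof. by apply: so_tor_mem => k; exact: so_cow_val_real. Qed.

Lemma e_so_cow s j : (1 <= j <= p)%N -> e j (so_cow s) = 'i * so_cow_val s j.
Proof.
move=> hj; rewrite /so_cow e_so_tor //; last by move=> k; exact: so_cow_val_real.
by have [_ ->] := plP hj.
Qed.

Lemma simp_soD j H : simp D j H =
  if (j < p)%N then e j H - e j.+1 H else if b then e p H else e p.-1 H + e p H.
Proof. by []. Qed.

Lemma so_cow_simp s j : (1 <= s <= p)%N -> (1 <= j <= p)%N ->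
  simp D j (so_cow s) = (j == s)%:R * 'i.
Proof.
move=> hs hj; rewrite simp_soD.
have pp : (1 <= p <= p)%N by rewrite p_gt0 leqnn.
have [jp|jp] := ltnP j p.
  rewrite !e_so_cow; [|lia|lia]; rewrite -mulrBr mulrC; congr (_ * _); rewrite /so_cow_val.
  case hb: b => /=.
    have [jl|jl|jl] := ltngtP j s; rewrite /=; ring.
  have [sp|sp] := ltnP s p.-1.
    by have [jl|jl|jl] := ltngtP j s; rewrite /=; ring.
  have -> : (j == p) = false by lia.
  rewrite andbF; have [es|ns] := eqVneq s p.-1.
    have -> : (j.+1 == p) = (j == s) by lia.
    by case: (j == s); rewrite /=; field.
  have -> : (j == s) = false by lia.
  by rewrite /= subrr.
have -> : j = p by lia.
case hb: b; rewrite /=.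
  rewrite e_so_cow // mulrC; congr (_ * _); rewrite /so_cow_val hb /=.
  by congr (_%:R); congr nat_of_bool; lia.
have p2 : (2 <= p)%N by move: p_gt; rewrite hb; lia.
rewrite !e_so_cow //; last by lia.
rewrite -mulrDr mulrC; congr (_ * _); rewrite /so_cow_val hb /=.
have [sp|sp] := ltnP s p.-1.
  have -> : (p <= s)%N = false by lia.
  have -> : (p == s) = false by lia.
  by rewrite addr0.
have -> : (p.-1 == p) = false by lia.
rewrite andbF eqxx andbT; have [es|ns] := eqVneq s p.-1.
  have -> : (p == s) = false by lia.
  by rewrite subrr.
have -> : (p == s) by lia.
by rewrite /=; field.
Qed.

Definition so_sgz u : int := if so_kd u is Some (_, s) then (if s then -1 else 1) else 0.
(** The coordinate x_0 has sign 0; position 1 is a default that keeps [so_posP] true for it. *)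
Definition so_pos u : nat := if so_kd u is Some (k, _) then posn k else 1%N.

Lemma so_posP u : in_planes p u -> (1 <= so_pos u <= p)%N.
Proof.
rewrite in_planes_kd /so_pos; case: (so_kd u) => [[k s]|]; last by move=> _; exact: p_gt0.
by move=> /posnP[].
Qed.

Lemma wt_so_e u H : tor D H -> in_planes p u -> wt f u H = (so_sgz u)%:~R * e (so_pos u) H.
Proof.
move=> [hH _]; rewrite in_planes_kd /so_sgz /so_pos; case eu: (so_kd u) => [[k s]|] //; last first.
  by rewrite (wt_so_None hH eu) mul0r.
move=> /posnP[_ pk]; rewrite (so_kdP eu) (wt_so _ _ hH) /e pk; congr (_ * _).
by case: s {eu}; rewrite ?expr1 ?expr0 ?rmorphN ?rmorph1.
Qed.

Definition so_step u v (j : nat) : int :=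
  so_sgz u * (so_pos u <= j)%N%:Z - so_sgz v * (so_pos v <= j)%N%:Z.

Lemma so_wt_abel u v H : tor D H -> in_planes p u -> in_planes p v ->
  wt f u H - wt f v H = \sum_(1 <= j < p) (so_step u v j)%:~R * (e j H - e j.+1 H)
     + (so_step u v p)%:~R * e p H.
Proof.
move=> hH pu pv; rewrite !wt_so_e //.
rewrite (abel_weight (e^~ H) (so_posP pu)) (abel_weight (e^~ H) (so_posP pv)).
rewrite /so_step; have /andP[_ ->] := so_posP pu; have /andP[_ ->] := so_posP pv.
rewrite !mulrDr opprD addrACA !mulr_sumr -sumrB !mulr1 rmorphB /= mulrBl; congr (_ + _).
by apply: eq_bigr => j _; rewrite rmorphB !rmorphM /=; ring.
Qed.

(** Two distinct indices of the same plane carry opposite weights and are dual. Since 2 eps_k is not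
    a root of an orthogonal algebra, [nz] excludes them. *)
Lemma so_distinct u v : in_planes p u -> in_planes p v -> u != v -> nz f u v ->
  (so_sgz u = 0 /\ so_sgz v <> 0) \/ (so_sgz v = 0 /\ so_sgz u <> 0) \/
  so_pos u <> so_pos v.
Proof.
rewrite !in_planes_kd /so_sgz /so_pos.
case eu: (so_kd u) => [[k s]|]; case ev: (so_kd v) => [[l t]|] pu pv uv nuv.
- right; right => kl; have [_ ek] := posnP pu; have [_ el] := posnP pv.
  have ekl : k = l by apply: val_inj; rewrite /= -ek kl el.
  subst l; have st : s != t by apply: contra uv => /eqP st; rewrite (so_kdP eu) (so_kdP ev) st.
  case/negP: nuv; rewrite /= mulr1 eqxx andbT; apply/eqP; apply: so_kd_inj.
  by rewrite so_kd_star eu ev /=; congr (Some (_, _)); case: s t st {eu ev} => [] [].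
- by right; left; case: (s).
- by left; case: (t).
- by case/eqP: uv; apply: so_kd_inj; rewrite eu ev.
Qed.

Lemma so_sgzP u : [\/ so_sgz u = 0, so_sgz u = 1 | so_sgz u = -1].
Proof. by rewrite /so_sgz; case: (so_kd u) => [[k []]|]; [apply: Or33|apply: Or32|apply: Or31]. Qed.

Lemma so_root u v : so_rel u v -> u != v -> nz f u v ->
  exists2 c, is_coef D (fun H => wt f u H - wt f v H) c &
    (forall j, (1 <= j <= p)%N -> 0 <= c j) \/ (forall j, (1 <= j <= p)%N -> c j <= 0).
Proof.
move=> /andP[pu pv] uv nuv; have hd := so_distinct pu pv uv nuv.
have hu := so_posP pu; have hv := so_posP pv.
have su := so_sgzP u; have sv := so_sgzP v.
have [hb|hb] : b = true \/ b = false by case: (b); [left|right].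
  exists (so_step u v) => [H hH|].
    rewrite (so_wt_abel hH pu pv) /= big_nat_recr //= ltnn (ifT _ _ hb); congr (_ + _).
    by rewrite big_nat [RHS]big_nat; apply: eq_bigr => j /andP[_ ->].
  have hd' : (so_sgz u = 0 /\ so_sgz v <> 0) \/ (so_sgz v = 0 /\ so_sgz u <> 0) \/
    so_pos u <> so_pos v \/ so_sgz u = - so_sgz v by tauto.
  by have [h|h] := sign_steps su sv hd'; [left|right] => j _; exact: h.
have none w : so_sgz w <> 0.
  rewrite /so_sgz; case ew: (so_kd w) => [[k []]|] //.
  move: ew; rewrite /so_kd; case: (split_ordP w) => // z.
  have h0 : nat_of_bool b = 0%N by rewrite hb.
  by have := leq_trans (ltn_ord z) (eq_leq h0).
have p2 : (2 <= p)%N by move: p_gt; rewrite hb; lia.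
(* In even dimension every index has a sign 1 or -1, so the coefficients of the root sum to twice
   [h]; [a] is its coefficient at eps_p. These are the data of [typeD_abel]. *)
pose h : int := (0 < so_sgz u)%R%:Z - (0 < so_sgz v)%R%:Z.
pose a : int := so_sgz u * (so_pos u == p)%:Z - so_sgz v * (so_pos v == p)%:Z.
exists (fun j => if (j < p.-1)%N then so_step u v j else if j == p.-1 then h - a else h).
  move=> H hH; rewrite (so_wt_abel hH pu pv) /=.
  have ep : p = p.-1.+1 by lia.
  have q0 : (0 < p.-1)%N by lia.
  have e1 : so_step u v p.-1.+1 = h + h.
    rewrite -ep /so_step /h; have /andP[_ ->] := hu; have /andP[_ ->] := hv.
    by case: su => [/none//|->|->]; case: sv => [/none//|->|->]; lia.
  have e2 : so_step u v p.-1 = h + h - a.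
    rewrite /so_step /h /a.
    have -> : (so_pos u <= p.-1)%N = ~~ (so_pos u == p) by lia.
    have -> : (so_pos v <= p.-1)%N = ~~ (so_pos v == p) by lia.
    by case: su => [/none//|->|->]; case: sv => [/none//|->|->];
      case: (_ == _); case: (_ == _); lia.
  have := typeD_abel (e^~ H) q0 e1 e2; rewrite -ep => ->.
  have split1 (F : nat -> R[i]) : \sum_(1 <= j < p) F j = \sum_(1 <= j < p.-1) F j + F p.-1.
    by rewrite {1}ep big_nat_recr.
  rewrite big_nat_recr //= split1 ltnn (ifF _ _ hb) !eqxx /=.
  rewrite (_ : (p.-1 < p)%N); last by lia.
  rewrite (_ : (p < p.-1)%N = false); last by lia.
  rewrite (_ : (p == p.-1) = false); last by lia.
  rewrite ltnn -ep; congr (_ + _ + _).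
  rewrite big_nat [RHS]big_nat; apply: eq_bigr => j /andP[_ hj].
  by rewrite hj (_ : (j < p)%N) //; lia.
have hlt : so_pos u <> so_pos v by case: hd => [[/none//]|[[/none//]|]].
rewrite /so_step /h /a; move: (so_sgz u) (so_sgz v) (so_pos u) (so_pos v) hlt hu hv su sv (none u) (none v) => a' c x y.
move=> {}hlt {}hu {}hv {}su {}sv a0 c0.
(* A root is positive when its term of smallest position has a positive coefficient, as in the
   lexicographic order. *)
have [hs|hs] : ((x < y)%N && (a' == 1) || (y < x)%N && (c == -1)) \/
  ((x < y)%N && (a' == -1) || (y < x)%N && (c == 1)) 
  by case: su a0 => [//|->|->] _; case: sv c0 => [//|->|->] _; lia.
  left=> j hj; case: su hs a0 => [//|->|->]; case: sv c0 => [//|->|->] _ hs _; rewrite ?ltr01 ?ltr0N1 /=;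
    (case: (ltnP j p.-1) => hjp; [case: (leqP x j) => ?; case: (leqP y j) => ?|
    case: (j == p.-1); case: (eqVneq x p) => ?; case: (eqVneq y p) => ?]); lia.
right=> j hj; case: su hs a0 => [//|->|->]; case: sv c0 => [//|->|->] _ hs _; rewrite ?ltr01 ?ltr0N1 /=;
  (case: (ltnP j p.-1) => hjp; [case: (leqP x j) => ?; case: (leqP y j) => ?|
  case: (j == p.-1); case: (eqVneq x p) => ?; case: (eqVneq y p) => ?]); lia.
Qed.

Lemma so_nondeg H : tor D H -> (forall j, (1 <= j <= p)%N -> simp D j H = 0) -> H = 0.
Proof.
move=> hH h0; have pp : (1 <= p <= p)%N by rewrite p_gt0 leqnn.
have step_e j : (1 <= j < p)%N -> e j H - e j.+1 H = 0.
  by move=> /andP[j1 jp]; have := h0 j; rewrite simp_soD jp => -> //; rewrite j1 ltnW.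
have ej j : (1 <= j <= p)%N -> e j H = e p H.
  move=> hj; rewrite (abel_weight (e^~ H) hj) big_nat big1 ?add0r // => k hk.
  by rewrite step_e ?mulr0.
have ep : e p H = 0.
  have := h0 p pp; rewrite simp_soD ltnn; have [hb|hb] : b = true \/ b = false by case: (b); [left|right].
    by rewrite (ifT _ _ hb).
  rewrite (ifF _ _ hb) ej; last by move: p_gt; rewrite hb; lia.
  by rewrite -mulr2n => /eqP; rewrite mulrn_eq0 /= => /eqP.
apply: (@tw_inj _ _ f); apply/matrixP => u v; rewrite tw0 mxE.
have [<-|uv] := eqVneq u v; last first.
  by move: hH; rewrite so_torE => hH'; exact: torus_diag hH' uv.
have [pu|pu] := boolP (in_planes p u).
  by rewrite -/(wt f u H) (wt_so_e hH pu) (ej _ (so_posP pu)) ep mulr0.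
by move: hH; rewrite so_torE => -[_ _ -> //]; rewrite /torus_rel /so_rel (negbTE pu).
Qed.

Lemma so_adapted : adapted f D so_rel pred0 so_cow.
Proof.
have pp : (1 <= p <= p)%N by rewrite p_gt0 leqnn.
split.
- by move=> u v; rewrite /so_rel andbC.
- by move=> u v x /andP[h1 h2] /andP[h3 h4]; rewrite /so_rel h1.
- by move=> _ u v; rewrite /so_rel /= !in_planes_star.
- by [].
- exact: so_algE.
- exact: so_torE.
- move=> j; rewrite [rnk D]/= => hj.
  have [pj ej] := plP hj.
  pose o k (pk : (pl k < p)%N) := Ordinal (leq_trans pk p_le).
  have in_o k (pk : (pl k < p)%N) t : in_planes p (so_coord (b := b) (o k pk) t).
    by rewrite in_planes_kd so_kd_coord.
  have wo k (pk : (pl k < p)%N) t H : tor D H -> wt f (so_coord (o k pk) t) H = (-1) ^+ t * e k H.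
    by case=> hH _; rewrite (wt_so _ _ hH).
  have oneq k l (pk : (pl k < p)%N) (lk : (pl l < p)%N) : (1 <= k <= p)%N -> (1 <= l <= p)%N ->
      k <> l -> o k pk != o l lk.
    move=> hk hl kl; apply/eqP => /(congr1 val) /= ekl; apply: kl.
    by have [_ <-] := plP hk; have [_ <-] := plP hl; rewrite ekl.
  have two k l (pk : (pl k < p)%N) (lk : (pl l < p)%N) t : (1 <= k <= p)%N -> (1 <= l <= p)%N ->
      k <> l -> [/\ so_rel (so_coord (o k pk) false) (so_coord (o l lk) t),
        so_coord (b := b) (o k pk) false != so_coord (o l lk) t &
        nz f (so_coord (o k pk) false) (so_coord (o l lk) t)].
    move=> hk hl kl; split.
    - by rewrite /so_rel !in_o.
    - apply/eqP => /(congr1 so_kd); rewrite !so_kd_coord => -[/eqP h _].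
      by move: (oneq k l pk lk hk hl kl); rewrite -val_eqE /= h.
    - apply/negP => /and3P[_ /eqP /(congr1 so_kd)]; rewrite so_kd_star !so_kd_coord /=.
      move=> [h _] _; have /eqP[] := oneq k l pk lk hk hl kl.
      by apply: val_inj => /=; congruence.
  have [jp|jp] := ltnP j p.
    have hj1 : (1 <= j.+1 <= p)%N by [].
    have [pj1 _] := plP hj1.
    have [h1 h2 h3] := two _ _ pj pj1 false hj hj1 ltac:(lia).
    exists (so_coord (o j pj) false), (so_coord (o j.+1 pj1) false); split=> // H hH.
    by rewrite simp_soD jp !wo // !mul1r.
  have ejp : j = p by lia.
  (* In odd dimension the last simple root eps_p is the weight of the plane labelled p minus the
     zero weight of x_0. In even dimension eps_(p-1) + eps_p is obtained by taking the conjugate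
     vector of the plane labelled p. *)
  subst j; have [hb|hb] : b = true \/ b = false by case: (b); [left|right].
    have z0 : (0 < b)%N by rewrite hb.
    exists (so_coord (o p pj) false), (lshift (m + m) (Ordinal z0)); split.
    + by rewrite /so_rel in_o in_planes_kd so_kd_None.
    + by apply/eqP => /(congr1 so_kd); rewrite so_kd_coord so_kd_None.
    + by apply/negP => /and3P[_ /eqP /(congr1 so_kd)]; rewrite so_kd_star so_kd_coord so_kd_None.
    + move=> H hH; rewrite simp_soD ltnn (ifT _ _ hb) wo // mul1r.
      by have [hs _] := hH; rewrite (wt_so_None hs (so_kd_None _)) subr0.
  have hp1 : (1 <= p.-1 <= p)%N by move: p_gt; rewrite hb; lia.
  have [pp1 _] := plP hp1.
  have [h1 h2 h3] := two _ _ pp1 pj true hp1 hj ltac:(lia).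
  exists (so_coord (o p.-1 pp1) false), (so_coord (o p pj) true); split=> // H hH.
  by rewrite simp_soD ltnn (ifF _ _ hb) !wo // expr1 mul1r mulN1r opprK.
- by move=> s _; exact: so_cow_tor.
- by move=> s j; exact: so_cow_simp.
- exact: so_root.
- exact: so_nondeg.
Qed.

End OrthogonalDatum.

Lemma linfunE (F : fieldType) (V W : vectType F) (g : V -> W) : linear g ->
  forall v, linfun g v = g v.
Proof.
move=> gl v; pose gL : {linear V -> W} := HB.pack g (GRing.isLinear.Build _ _ _ _ g gl).
exact: (lfunE gL).
Qed.

Lemma col_mx_linear (R : realType) (n : nat) (c d : R[i]) :
  linear (fun a : 'cV[R[i]]_n => col_mx (c *: a) (d *: a)).
Proof.
move=> x a b; apply/matrixP => u z; case: (split_ordP u) => k ->; rewrite !mxE.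
  by rewrite !(unsplitK (inl k)) /= !mxE; ring.
by rewrite !(unsplitK (inr k)) /= !mxE; ring.
Qed.

Lemma signed_le (R : realType) (x y : R[i]) (s : bool) : - x <= y -> y <= x -> (-1) ^+ s * y <= x.
Proof. by case: s => h1 h2; rewrite ?expr1 ?expr0 ?mulN1r ?mul1r // lerNl. Qed.

(** * Type DIII: so(2n) and u(n) *)

Section TypeDIII.
Context {R : realType} {n : nat}.
Hypothesis n3 : (3 <= n)%N.
Let f : frame R (n + n) := @so_frame R false n.
Let D0 : rootDatum R (n + n) := so_diii R n.
Let pl (k : nat) := k.-1.
Let posn (k : nat) := k.+1.

Lemma so_kd_double (u : 'I_(n + n)) : so_kd (b := false) (m := n) u = double_kd u.
Proof.
case: (split_ordP u) => a ->.
  have -> : lshift n a = so_coord (b := false) a false by apply: val_inj.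
  rewrite so_kd_coord; symmetry; apply/double_kdP; exact: val_inj.
have -> : rshift n a = so_coord (b := false) a true by apply: val_inj.
rewrite so_kd_coord; symmetry; apply/double_kdP; exact: val_inj.
Qed.

Lemma so_coord_double (a : 'I_n) s :
  so_coord (b := false) a s = (if s then rshift n a else lshift n a) :> 'I_(n + n).
Proof. by case: s; apply: val_inj. Qed.

Lemma u_to_so_entry (Y : 'M[R[i]]_n) k s l t :
  u_to_so Y (so_coord (b := false) k s) (so_coord (b := false) l t) =
  if s == t then 'Re (Y k l) else if s then - 'Im (Y k l) else 'Im (Y k l).
Proof.
rewrite !so_coord_double /u_to_so; case: s; case: t => /=;
  by rewrite ?(block_mxEul, block_mxEur, block_mxEdl, block_mxEdr) !mxE.
Qed.

(** In the isotropic basis of weight vectors the real matrix built from Y becomes block diagonal,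
    with blocks Y and its conjugate. *)
Lemma so_unitary_embedding : unitary_embedding f double_kd (lshift n) u_to_so so_to_u.
Proof.
split.
- by move=> a; apply/double_kdP.
- by move=> u v [a s] /double_kdP -> /double_kdP ->.
- by move=> _ u; rewrite -!so_kd_double -so_kd_star.
- by [].
- by move=> u v a c s _ _; rewrite /= mulr1.
- move=> Y; rewrite /so_to_u /u_to_so block_mxKul block_mxKur.
  by apply/matrixP => a c; rewrite !mxE -Crect.
move=> Y u v; rewrite /unitary_entry.
case eu: (double_kd u) => [[k s]|] //; case ev: (double_kd v) => [[l t]|] //.
rewrite (@so_kdP false n u k s (etrans (so_kd_double u) eu)).
rewrite (@so_kdP false n v l t (etrans (so_kd_double v) ev)).
have := tw_so_entry (b := false) (u_to_so Y) k s l t.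
rewrite -!/(so_coord (b := false) _ false) -!/(so_coord (b := false) _ true) !u_to_so_entry /= => ->.
have eY := Crect (Y k l).
have eYc : (Y k l)^* = 'Re (Y k l) - 'i * 'Im (Y k l).
  by rewrite {1}eY conj_add conj_mul conjCi (CrealP (Creal_Re _)) (CrealP (Creal_Im _)) mulNr.
have ii := @ii R.
rewrite eYc /so_coef; case: s {eu}; case: t {ev} => /=; [| | |rewrite [RHS]eY];
  by move: ('Re (Y k l)) ('Im (Y k l)) => x y; field: ii.
Qed.

Lemma so_diii_adapted : adapted f D0 (fun _ _ => true) pred0 (so_cow (R := R) (b := false) (m := n) n posn).
Proof.
have pm : (n <= n)%N by [].
have pg : (2 <= n + false)%N by rewrite addn0; lia.
have h1 j : (1 <= j <= n)%N -> (pl j < n)%N /\ posn (pl j) = j by rewrite /pl /posn; lia.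
have h2 k : (k < n)%N -> (1 <= posn k <= n)%N /\ pl (posn k) = k by rewrite /pl /posn; lia.
have := @so_adapted R false n n pl posn pm pg h1 h2.
have -> : so_rel (b := false) (m := n) n = (fun _ _ => true) => //.
apply/funext => u; apply/funext => v; rewrite /so_rel !in_planes_kd.
by case: (so_kd u) => [[a s]|]; case: (so_kd v) => [[c t]|]; rewrite ?ltn_ord.
Qed.

Lemma so_diii_cow_wt j (u : 'I_(n + n)) a s : double_kd u = Some (a, s) ->
  wt f u (so_cow (b := false) (m := n) n posn j) = 'i * ((-1) ^+ s * so_cow_val (R := R) (b := false) n j a.+1).
Proof. by move=> eu; apply: etrans (@wt_so_tor R false n n _ u) _; rewrite so_kd_double eu ltn_ord. Qed.

Lemma so_cow_val_half j : so_cow_val (R := R) (b := false) n n j = 2%:R^-1.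
Proof.
rewrite /so_cow_val /= (_ : (n < n.-1)%N = false); last by lia.
by rewrite (_ : (n == n.-1) = false) //; lia.
Qed.

Lemma typeDIII_minimal :
  let std := @std_rep R (n + n) in
  let D := unchain (so_diii R n) u_to_so so_to_u in
  let s := unchain_root n in
  hermitian_pair (so_diii R n) n (u_to_so @` u_alg R n) /\
  (exists Vm, phi_minimal (so_diii R n) n std fullv (limg diii_incl) Vm ('i / 2%:R)) /\
  rep_iso (u_to_so @` u_alg R n) std (limg diii_incl) (fun X => std_rep (so_to_u X)) /\
  [/\ is_chain D s n,
      forall i, (i < n)%N -> chain_alg D s i.+1 = u_to_so @` u_block R n (n - i)
    & exists Vp Vm,
      [/\ chain_minimal D s n std fullv Vp Vm,
          forall i, (i < n)%N ->
            [/\ is_dsum fullv (Vp i.+1) (W_minus Vm i.+1),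
                Vp i.+1 = (diii_incl @: first_coords R n (n - i))%VS
              & rep_iso (u_to_so @` u_block R n (n - i)) std (Vp i.+1)
                  (fun X => std_rep (ul_block i (so_to_u X)))]
        & forall i, (i < n.-1)%N -> is_phi_minimal (D i.+1) (n - i - 1) std (Vp i.+1)]].
Proof.
have n0 : (0 < n)%N by lia.
have ad := so_diii_adapted; have ue := so_unitary_embedding.
have nznz (u v : 'I_(n + n)) a s c t : double_kd u = Some (a, s) -> double_kd v = Some (c, t) ->
    a != c -> nz f u v.
  move=> eu ev ac; apply/negP => /and3P[_ /eqP ev' _].
  by move: ev; rewrite ev' (ue_star ue) // eu => -[e1]; rewrite e1 eqxx in ac.
apply: (unchain_minimal ue (n_gt0 := n0) ad) => //.
- apply: (@tw_inj _ _ f); apply/matrixP => u v; rewrite (ue_tw ue) /unitary_entry /so_cow /so_tor utwK mxE.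
  rewrite so_kd_double; case eu: (double_kd u) => [[a s]|] //; case ev: (double_kd v) => [[c t]|] //.
  have [uv|uv] := eqVneq u v.
    move: ev; rewrite -uv eu => -[<- <-]; rewrite !eqxx ltn_ord so_cow_val_half !mxE eqxx mulr1n.
    by case: s {eu}; rewrite ?expr1 ?expr0 ?conj_mul ?conj_half ?conjCi; ring.
  case: eqP => // st; subst t; have ac : a != c.
    by apply: contra uv => /eqP ac; apply/eqP; apply: (ue_inj ue eu); rewrite ac.
  by rewrite !mxE (negbTE ac) mulr0n conj_0 if_same.
- move=> j H /andP[j0 jn] tH [Y [[hY _] _] eY].
  have j1n : (j.-1 < n)%N by lia.
  have eps k (kn : (k < n)%N) : plane_eps (b := false) (m := n) k H = Y (Ordinal kn) (Ordinal kn).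
    have [hso _] := tH.
    have := wt_so (b := false) (Ordinal kn) false hso; rewrite expr0 mul1r => <-.
    by rewrite so_coord_double -eY /wt (ue_ent ue).
  rewrite -eY (su_simp ue) /= jn eY (eps _ j1n) (eps _ jn).
  have -> : diag_eps j Y = diag_eps (Ordinal j1n).+1 Y by rewrite /= prednK.
  have -> : diag_eps j.+1 Y = diag_eps (Ordinal jn).+1 Y by [].
  by rewrite !diag_eps_ord.
- move=> u j hj; case eu: (double_kd u) => [[a s]|] //.
  rewrite (so_diii_cow_wt _ (ue_ku ue _)) (so_diii_cow_wt _ eu) mul1r /=.
  exists (so_cow_val (R := R) (b := false) n j 1 - (-1) ^+ s * so_cow_val (R := R) (b := false) n j a.+1); last by ring.
  have h0 : 0 <= 2%:R^-1 :> R[i] by rewrite invr_ge0 ler0n.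
  have h1 : - 2%:R^-1 <= 2%:R^-1 :> R[i] by rewrite -subr_ge0 opprK addr_ge0.
  rewrite subr_ge0; apply: signed_le; rewrite /so_cow_val /=; case: ifP => [jn|jn].
  + rewrite (_ : (1 <= j)%N); last by lia.
    by apply: le_trans (ler0n _ _); rewrite oppr_le0.
  + rewrite (_ : (1 == n) = false); last by lia.
    by rewrite andbF; case: ifP => _.
  + rewrite (_ : (1 <= j)%N); last by lia.
    by rewrite ler_nat; case: (a < j)%N.
  + rewrite (_ : (1 == n) = false); last by lia.
    by rewrite andbF; case: ifP => _.
- move=> u v _ _ uv; have [nuv|nuv] := boolP (nz f u v); first exact: (ad_separated ad).
  (* A pair excluded by [nz] consists of dual coordinates. Their weights are opposite, and the
     coweight of the node n makes them nonzero. *)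
  exists (so_cow (b := false) (m := n) n posn n); first by apply: (ad_cow_tor ad); rewrite /= n0 leqnn.
  case eu: (double_kd u) => [[a s]|] //; case ev: (double_kd v) => [[c t]|] //.
  rewrite (so_diii_cow_wt _ eu) (so_diii_cow_wt _ ev) !so_cow_val_half.
  have ac : a = c by apply/eqP; apply: contraNT nuv; exact: nznz eu ev.
  have st : s != t.
    by apply: contra uv => /eqP st; apply/eqP; apply: (ue_inj ue eu); rewrite ac st.
  rewrite -subr_eq0 -mulrBr -mulrBl !mulf_eq0 invr_eq0 pnatr_eq0 orbF (negbTE (neq0Ci _)) /=.
  by case: s t st {eu ev} => [] [] //= _; rewrite ?expr1 ?expr0 ?opprK -?opprD ?oppr_eq0 -mulr2n pnatr_eq0.
- have st1 u v : u != v -> nz f u v -> step (std_wb f) (@std_rep R (n + n)) (alg D0) v u.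
    by move=> uv nuv; apply: std_step => //; exact: (rvec_alg ad).
  move=> Q hQ u v _ _ Qu.
  case eu: (double_kd u) => [[a s]|] //; case ev: (double_kd v) => [[c t]|] //.
  (* No root vector joins a coordinate to its dual; passing through a third plane avoids the
     difficulty, and n >= 3 provides one. *)
  have [d /andP[da dc]] : exists d : 'I_n, (d != a) && (d != c).
    apply/existsP; apply: contraTT n3; rewrite negb_exists => /forallP h; rewrite -ltnNge.
    have hc : (#|[set: 'I_n]%SET| <= #|[set a; c]%SET|)%N.
      apply: subset_leq_card; apply/fintype.subsetP => d _; rewrite !inE.
      by have := h d; case: (d == a); case: (d == c).
    move: hc; rewrite cardsT card_ord cards2; case: (_ != _) => /=; lia.
  have ed := ue_ku ue d.
  have ud : u != lshift n d.
    by apply/eqP => h; move: eu; rewrite h ed => -[e1 _]; rewrite e1 eqxx in da.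
  have vd : v != lshift n d.
    by apply/eqP => h; move: ev; rewrite h ed => -[e1 _]; rewrite e1 eqxx in dc.
  have Qd : Q (lshift n d).
    apply: (hQ u) => //; apply: st1; first by rewrite eq_sym.
    exact: nznz ed eu da.
  apply: (hQ (lshift n d)) => //; apply: st1 => //.
  by apply: nznz ev ed _; rewrite eq_sym.
(* The scalar is the normalization zeta of the weight vectors in [so_mat]. *)
- move=> a; exists ((1 + 'i) / 2%:R).
    rewrite mulf_neq0 ?invr_eq0 ?pnatr_eq0 //; apply/eqP => h.
    have := congr1 (fun z : R[i] => z * (1 - 'i)) h; rewrite mul0r.
    rewrite (_ : _ * _ = 1 - 'i * 'i); last by ring.
    by rewrite (@ii R) opprK -mulr2n => /eqP; rewrite pnatr_eq0.
  rewrite /diii_incl linfunE; last first.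
    by move=> x y z; have := col_mx_linear 1 'i x y z; rewrite !scale1r.
  apply/matrixP => u z; rewrite mxE [in RHS]mxE.
  rewrite [fmat f]/= [LHS]mxE (so_kd_double (lshift n a)) (ue_ku ue a) (so_kd_double u).
  case eu: (double_kd u) => [[c t]|] //; rewrite (proj1 (double_kdP _ _ _) eu) (ord1 z).
  by case: t {eu}; rewrite ?col_mxEd ?col_mxEu !mxE eqxx andbT /so_coef /=; case: (c == a);
    rewrite /= ?mulr1 ?mulr0 ?mul0r.
Qed.

End TypeDIII.

(** * Symplectic algebras *)

Section TypeCI.
Context {R : realType} {n : nat}.
Hypothesis n0 : (0 < n)%N.

Definition sp_star (u : 'I_(n + n)) : 'I_(n + n) :=
  match fintype.split u with inl a => rshift n a | inr a => lshift n a end.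

Definition sp_sg (u : 'I_(n + n)) : R[i] :=
  match fintype.split u with inl _ => 1 | inr _ => -1 end.

Lemma sp_starK : involutive sp_star.
Proof.
by move=> u; rewrite /sp_star; case: (split_ordP u) => a ->;
  rewrite ?(unsplitK (inl a)) ?(unsplitK (inr a)).
Qed.

Lemma sp_sg_star u : sp_sg (sp_star u) = - sp_sg u.
Proof.
by rewrite /sp_sg /sp_star; case: (split_ordP u) => a _;
  rewrite ?(unsplitK (inl a)) ?(unsplitK (inr a)) ?opprK.
Qed.

Lemma sp_sg_sq u : sp_sg u * sp_sg u = 1.
Proof. by rewrite /sp_sg; case: (fintype.split u) => _; rewrite ?mulr1 ?mulrNN ?mulr1. Qed.

Definition sp_frame : frame R (n + n).
Proof.
refine (@Frame R (n + n) 1%:M true sp_star sp_sg (@id_unitary R (n + n)) sp_starK _ _ sp_sg_sq _).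
- move=> _ u v hu; have := sp_sg_star u; rewrite hu => /eqP.
  rewrite -subr_eq0 opprK -mulr2n mulrn_eq0 /= => /eqP h.
  by have := sp_sg_sq u; rewrite h mul0r => /esym/eqP; rewrite oner_eq0.
- by move=> u; rewrite /sp_sg; case: (fintype.split u) => _; rewrite ?conj_opp conjC1.
- by move=> u v; rewrite !sp_sg_star mulrNN.
Defined.

Lemma tw_sp X : tw sp_frame X = X.
Proof. by rewrite twE /=; have := tw_id X; rewrite twE. Qed.

Lemma double_kd_star (u : 'I_(n + n)) :
  double_kd (sp_star u) = omap (fun z => (z.1, ~~ z.2)) (double_kd u).
Proof.
by rewrite /double_kd /sp_star; case: (split_ordP u) => a _;
  rewrite ?(unsplitK (inl a)) ?(unsplitK (inr a)).
Qed.

Lemma sp_algE : sp_alg R n = block sp_frame (fun _ _ => true) pred0.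
Proof.
pose J : 'M[R[i]]_(n + n) := block_mx 0 1%:M (- 1%:M) 0.
have JE u v : J u v = if v == sp_star u then sp_sg u else 0.
  rewrite /J /sp_star /sp_sg; case: (split_ordP u) => a ->; case: (split_ordP v) => c ->;
    rewrite ?(unsplitK (inl a)) ?(unsplitK (inr a));
    rewrite ?(block_mxEul, block_mxEur, block_mxEdl, block_mxEdr) !mxE.
  - by rewrite eq_lrshift.
  - by rewrite eq_rshift eq_sym; case: eqP.
  - by rewrite eq_lshift eq_sym; case: eqP => _; rewrite ?oppr0.
  - by rewrite eq_rlshift.
have key (X : 'M[R[i]]_(n + n)) u v : (X^T *m J + J *m X) (sp_star u) v =
    - sp_sg v * X (sp_star v) (sp_star u) - sp_sg u * X u v.
  rewrite mxE; congr (_ + _).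
    rewrite mxE (bigD1 (sp_star v)) //= big1 ?addr0 => [|w wv].
      by rewrite mxE JE sp_starK eqxx sp_sg_star mulrC.
    rewrite JE; case: eqP => [e|_]; last by rewrite mulr0.
    by rewrite e sp_starK eqxx in wv.
  rewrite mxE (bigD1 u) //= big1 ?addr0 => [|w wv].
    by rewrite JE sp_starK eqxx sp_sg_star mulNr.
  by rewrite JE sp_starK (negbTE wv) mul0r.
apply/seteqP; split=> X.
  move=> [uX h]; split=> //; last by rewrite big_pred0.
  move=> _ u v; rewrite tw_sp.
  have := key X u v; rewrite -/J in h; rewrite h mxE => /esym/eqP.
  rewrite subr_eq0 => /eqP e.
  have := congr1 (fun z => - sp_sg v * z) e; rewrite mulrA mulrNN sp_sg_sq mul1r => ->.
  by rewrite /=; ring.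
move=> [aX sX _ _]; split=> //; apply/matrixP => u v; rewrite -[u]sp_starK key [RHS]mxE.
have := sX isT (sp_star u) v; rewrite tw_sp /= => ->.
have := sp_sg_sq v; move: (sp_sg v) => x xx; ring: xx.
Qed.

(** The last coweight is half-integral because the last simple root is 2 eps_n. *)
Definition sp_cow_val (s j : nat) : R[i] := if (s < n)%N then (j <= s)%N%:R else 2%:R^-1.

Definition sp_cow s : 'M[R[i]]_(n + n) := \matrix_(u, v)
  if u == v then (if double_kd u is Some (a, t) then 'i * ((-1) ^+ t * sp_cow_val s a.+1) else 0)
  else 0.

Lemma sp_cowE s u v : sp_cow s u v =
  if u == v then (if double_kd u is Some (a, t) then 'i * ((-1) ^+ t * sp_cow_val s a.+1) else 0)
  else 0.
Proof. exact: mxE. Qed.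

Let D := spD R n.
Let e (j : nat) (H : 'M[R[i]]_(n + n)) : R[i] := diag_eps j (sp_to_u H).

Lemma sp_torE : tor D = block sp_frame (torus_rel (fun _ _ => true)) pred0.
Proof.
apply/seteqP; split=> X.
  rewrite /D /= sp_algE => -[[aX sX _ s0] /is_diag_mxP dX]; split=> // u v uv.
  by rewrite tw_sp dX.
move=> hX; have [aX sX X3 s0] := hX; split; first by rewrite sp_algE; split.
by apply/is_diag_mxP => u v uv; rewrite -[X]tw_sp; exact: torus_diag hX uv.
Qed.

Lemma e_ord (a : 'I_n) H : e a.+1 H = H (lshift n a) (lshift n a).
Proof. by rewrite /e diag_eps_ord /sp_to_u !mxE. Qed.

Lemma wt_sp_e u a s H : tor D H -> double_kd u = Some (a, s) ->
  wt sp_frame u H = (-1) ^+ s * e a.+1 H.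
Proof.
rewrite sp_torE => -[_ sH _ _] /double_kdP ->; rewrite e_ord /wt tw_sp.
case: s; last by rewrite mul1r.
have es : sp_star (lshift n a) = rshift n a by rewrite /sp_star (unsplitK (inl a)).
have := sH isT (lshift n a) (lshift n a); rewrite tw_sp /= es => ->.
by rewrite sp_sg_sq mul1r expr1 mulN1r.
Qed.

Lemma sp_cow_tor s : tor D (sp_cow s).
Proof.
have hv j : (sp_cow_val s j)^* = sp_cow_val s j.
  by rewrite /sp_cow_val; case: ifP => _; rewrite ?conjC_nat ?conj_half.
rewrite sp_torE; split.
- apply/matrixP => u v; rewrite adjoint_mxE [in RHS]mxE !sp_cowE eq_sym; case: eqP => [->|_]; last first.
    by rewrite conj_0 oppr0.
  case: (double_kd v) => [[a t]|]; last by rewrite conj_0 oppr0.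
  rewrite !conj_mul conjCi hv mulNr; congr (- (_ * (_ * _))).
  by apply/CrealP; rewrite rpredX // rpredN rpred1.
- move=> _ u v; rewrite tw_sp.
  rewrite -[LHS]/(sp_cow s (sp_star v) (sp_star u)) -[fsg _ u]/(sp_sg u) -[fsg _ v]/(sp_sg v).
  rewrite !sp_cowE (inj_eq (can_inj sp_starK)) eq_sym.
  case: eqP => [->|_]; last by rewrite mulr0 oppr0.
  rewrite sp_sg_sq mul1r double_kd_star /double_kd; case: (fintype.split v) => a /=;
    by rewrite ?expr1 ?expr0; ring.
- by move=> u v; rewrite /torus_rel /= tw_sp sp_cowE => /negbTE ->.
- by rewrite big_pred0.
Qed.

Lemma e_sp_cow s j : (1 <= j <= n)%N -> e j (sp_cow s) = 'i * sp_cow_val s j.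
Proof.
case: j => // j /andP[_ jn]; rewrite -[j]/(nat_of_ord (Ordinal jn)) e_ord sp_cowE eqxx.
have -> : double_kd (lshift n (Ordinal jn)) = Some (Ordinal jn, false) by apply/double_kdP.
by rewrite expr0 mul1r.
Qed.

Lemma simp_spD j H : simp D j H = if (j < n)%N then e j H - e j.+1 H else 2%:R * e n H.
Proof. by []. Qed.

Lemma sp_cow_simp s j : (1 <= s <= n)%N -> (1 <= j <= n)%N ->
  simp D j (sp_cow s) = (j == s)%:R * 'i.
Proof.
move=> hs hj; rewrite simp_spD; have [jn|jn] := ltnP j n.
  rewrite !e_sp_cow; [|lia|lia]; rewrite -mulrBr mulrC; congr (_ * _); rewrite /sp_cow_val.
  have [sn|sn] := ltnP s n; first by have [jl|jl|jl] := ltngtP j s; rewrite /=; ring.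
  by rewrite (_ : (j == s) = false) ?subrr //; lia.
have ej : j = n by lia.
rewrite ej e_sp_cow ?n0 ?leqnn // /sp_cow_val; have [sn|sn] := ltnP s n.
  rewrite (_ : (n == s) = false); last by lia.
  by rewrite mulr0 !mul0r mulr0.
rewrite (_ : (n == s)); last by lia.
by rewrite /=; field.
Qed.

Lemma sp_nondeg H : tor D H -> (forall j, (1 <= j <= n)%N -> simp D j H = 0) -> H = 0.
Proof.
move=> hH h0; have nn : (1 <= n <= n)%N by rewrite n0 leqnn.
have step_e j : (1 <= j < n)%N -> e j H - e j.+1 H = 0.
  by move=> /andP[j1 jp]; have := h0 j; rewrite simp_spD jp => -> //; rewrite j1 ltnW.
have ej j : (1 <= j <= n)%N -> e j H = e n H.
  move=> hj; rewrite (abel_weight (e^~ H) hj) big_nat big1 ?add0r // => k hk.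
  by rewrite step_e ?mulr0.
have en : e n H = 0.
  have := h0 n nn; rewrite simp_spD ltnn => /eqP.
  by rewrite mulf_eq0 pnatr_eq0 /= => /eqP.
apply: (@tw_inj _ _ sp_frame); apply/matrixP => u v; rewrite tw0 mxE.
have [<-|uv] := eqVneq u v; last first.
  by move: hH; rewrite sp_torE => hH'; exact: torus_diag hH' uv.
case eu: (double_kd u) => [[a s]|] //.
by rewrite -/(wt sp_frame u H) (wt_sp_e hH eu) ej ?en ?mulr0 //=.
Qed.

Lemma sp_root u v : u != v -> exists2 c, is_coef D (fun H => wt sp_frame u H - wt sp_frame v H) c &
    (forall j, (1 <= j <= n)%N -> 0 <= c j) \/ (forall j, (1 <= j <= n)%N -> c j <= 0).
Proof.
move=> uv; case eu: (double_kd u) => [[a s]|] //; case ev: (double_kd v) => [[c t]|] //.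
pose sg (s : bool) : int := if s then -1 else 1.
have sgE s' : (-1) ^+ nat_of_bool s' = (sg s')%:~R :> R[i].
  by case: s'; rewrite /sg ?expr1 ?expr0 ?rmorphN ?rmorph1.
have sgP s' : [\/ sg s' = 0, sg s' = 1 | sg s' = -1] by case: s'; [apply: Or33|apply: Or32].
pose st j : int := sg s * (a.+1 <= j)%N%:Z - sg t * (c.+1 <= j)%N%:Z.
(* The two signs being 1 or -1, the sum of the coefficients of the root is twice [h], so that 2
   eps_n receives an integral coefficient. *)
pose h : int := (~~ s)%:Z - (~~ t)%:Z.
have stn : st n = h + h by rewrite /st !ltn_ord /h /sg; case: (s); case: (t).
exists (fun j => if (j < n)%N then st j else h).
  move=> H hH; rewrite (wt_sp_e hH eu) (wt_sp_e hH ev) !sgE.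
  have ea := @abel_weight _ (e^~ H) n a.+1 (ltn_ord a).
  have ec := @abel_weight _ (e^~ H) n c.+1 (ltn_ord c).
  transitivity (\sum_(1 <= j < n) (st j)%:~R * (e j H - e j.+1 H) + (h + h)%:~R * e n H).
    rewrite ea ec !mulrDr opprD addrACA; congr (_ + _).
      rewrite !mulr_sumr -sumrB; apply: eq_bigr => j _.
      by rewrite /st rmorphB !rmorphM /=; ring.
    by rewrite -mulrBl -rmorphB -stn /st !ltn_ord !mulr1.
  rewrite -[(rnk D).+1]/(n.+1) big_nat_recr //; congr (_ + _).
    by apply: eq_big_nat => j /andP[_ jn]; rewrite jn simp_spD jn.
  by rewrite ltnn simp_spD ltnn rmorphD /=; ring.
have hd : (sg s = 0 /\ sg t <> 0) \/ (sg t = 0 /\ sg s <> 0) \/ a.+1 <> c.+1 \/ sg s = - sg t.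
  right; right; have [ac|ac] := eqVneq a c; last first.
    by left=> -[] h'; case/eqP: ac; exact: val_inj.
  right; subst c; have st' : s != t.
    apply: contra uv => /eqP st'; rewrite (proj1 (double_kdP _ _ _) eu) (proj1 (double_kdP _ _ _) ev).
    by rewrite st'.
  by case: s t st' {eu ev stn st h} => [] [].
have [hs|hs] := sign_steps (sgP s) (sgP t) hd; [left|right] => j hj; case: ifP => _; try exact: hs.
  by have := hs n; rewrite -/(st n) stn; lia.
by have := hs n; rewrite -/(st n) stn; lia.
Qed.

(** The form is alternating, so dual coordinates carry opposite signs and the entries between them
    survive: they are the long roots 2 eps_k. *)
Lemma sp_nz u v : nz sp_frame u v.
Proof.
apply/negP => /and3P[_ /eqP -> /=]; rewrite sp_sg_star mulrN sp_sg_sq => /eqP h.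
have : (1 + 1 : R[i]) = 0 by rewrite -{1}h addNr.
by move/eqP; rewrite -mulr2n pnatr_eq0.
Qed.

Lemma sp_adapted : adapted sp_frame D (fun _ _ => true) pred0 sp_cow.
Proof.
split=> //; [exact: sp_algE|exact: sp_torE| |by move=> s _; exact: sp_cow_tor|exact: sp_cow_simp
  |by move=> u v _ uv _; exact: sp_root|exact: sp_nondeg].
case=> // j /= jn; have kd a s : double_kd (if s then rshift n a else lshift n a) = Some (a, s).
  by apply/double_kdP.
have [j1|j1] := ltnP j.+1 n.
  exists (lshift n (Ordinal jn)), (lshift n (Ordinal j1)); split=> //; [|exact: sp_nz|].
    by rewrite eq_lshift -val_eqE /=; lia.
  move=> H hH; rewrite (wt_sp_e hH (kd _ false)) (wt_sp_e hH (kd _ false)) !mul1r /= -/(e _ _).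
  by rewrite -!/(e _ _).
exists (lshift n (Ordinal jn)), (rshift n (Ordinal jn)); split=> //; [|exact: sp_nz|].
  by rewrite eq_lrshift.
move=> H hH; rewrite (wt_sp_e hH (kd _ false)) (wt_sp_e hH (kd _ true)) mul1r expr1 mulN1r opprK /=.
rewrite -/(e n H) (_ : n = j.+1); last by lia.
by rewrite mulr_natl mulr2n.
Qed.

Lemma sp_unitary_embedding : unitary_embedding sp_frame double_kd (lshift n) u_to_sp sp_to_u.
Proof.
split.
- by move=> a; apply/double_kdP.
- by move=> u v [a s] /double_kdP -> /double_kdP ->.
- by move=> _ u; exact: double_kd_star.
- by [].
- move=> u v a c s /double_kdP -> /double_kdP ->; case: s; rewrite /= /sp_sg.
    by rewrite !(unsplitK (inr _)) mulrNN mulr1.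
  by rewrite !(unsplitK (inl _)) mulr1.
- by move=> Y; rewrite /sp_to_u /u_to_sp block_mxKul.
move=> Y u v; rewrite tw_sp /unitary_entry /u_to_sp.
case eu: (double_kd u) => [[k s]|] //; case ev: (double_kd v) => [[l t]|] //.
rewrite (proj1 (double_kdP _ _ _) eu) (proj1 (double_kdP _ _ _) ev).
by case: s {eu}; case: t {ev}; rewrite ?(block_mxEul, block_mxEur, block_mxEdl, block_mxEdr) ?mxE.
Qed.

Lemma sp_cow_wt j (u : 'I_(n + n)) a s : double_kd u = Some (a, s) ->
  wt sp_frame u (sp_cow j) = 'i * ((-1) ^+ s * sp_cow_val j a.+1).
Proof. by move=> eu; rewrite /wt tw_sp sp_cowE eqxx eu. Qed.

Lemma typeCI_minimal :
  let std := @std_rep R (n + n) in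
  let D := unchain (spD R n) u_to_sp sp_to_u in
  let s := unchain_root n in
  hermitian_pair (spD R n) n (u_to_sp @` u_alg R n) /\
  (exists Vm, phi_minimal (spD R n) n std fullv (limg ci_incl) Vm ('i / 2%:R)) /\
  rep_iso (u_to_sp @` u_alg R n) std (limg ci_incl) (fun X => std_rep (sp_to_u X)) /\
  [/\ is_chain D s n,
      forall i, (i < n)%N -> chain_alg D s i.+1 = u_to_sp @` u_block R n (n - i)
    & exists Vp Vm,
      [/\ chain_minimal D s n std fullv Vp Vm,
          forall i, (i < n)%N ->
            [/\ is_dsum fullv (Vp i.+1) (W_minus Vm i.+1),
                Vp i.+1 = (ci_incl @: first_coords R n (n - i))%VS
              & rep_iso (u_to_sp @` u_block R n (n - i)) std (Vp i.+1)
                  (fun X => std_rep (ul_block i (sp_to_u X)))]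
        & forall i, (i < n.-1)%N -> is_phi_minimal (D i.+1) (n - i - 1) std (Vp i.+1)]].
Proof.
have ad := sp_adapted; have ue := sp_unitary_embedding.
apply: (unchain_minimal ue (n_gt0 := n0) ad) => //.
- apply/matrixP => u v; rewrite sp_cowE -[RHS](congr1 (fun Z : 'M_(n + n) => Z u v) (tw_sp _)).
  rewrite (ue_tw ue) /unitary_entry.
  case eu: (double_kd u) => [[a s]|] //; case ev: (double_kd v) => [[c t]|] //.
  have [uv|uv] := eqVneq u v.
    move: ev; rewrite -uv eu => -[<- <-]; rewrite !eqxx /sp_cow_val ltnn !mxE eqxx mulr1n.
    by case: s {eu}; rewrite ?expr1 ?expr0 ?conj_mul ?conj_half ?conjCi; ring.
  case: eqP => // st; subst t; have ac : a != c.
    by apply: contra uv => /eqP ac; apply/eqP; apply: (ue_inj ue eu); rewrite ac.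
  by rewrite !mxE (negbTE ac) mulr0n conj_0 if_same.
- move=> j H /andP[j0 jn] tH [Y [[hY _] _] eY].
  by rewrite -eY (su_simp ue) simp_spD jn /e /sp_to_u /u_to_sp block_mxKul.
- move=> u j hj; case eu: (double_kd u) => [[a s]|] //.
  rewrite (sp_cow_wt _ (ue_ku ue _)) (sp_cow_wt _ eu) mul1r /=.
  exists (sp_cow_val j 1 - (-1) ^+ s * sp_cow_val j a.+1); last by ring.
  have h0 : 0 <= 2%:R^-1 :> R[i] by rewrite invr_ge0 ler0n.
  have h1 : - 2%:R^-1 <= 2%:R^-1 :> R[i] by rewrite -subr_ge0 opprK addr_ge0.
  rewrite subr_ge0; apply: signed_le; rewrite /sp_cow_val; case: ifP => [jn|jn] //.
    rewrite (_ : (1 <= j)%N); last by lia.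
    by apply: le_trans (ler0n _ _); rewrite oppr_le0.
  rewrite (_ : (1 <= j)%N); last by lia.
  by rewrite ler_nat; case: (a < j)%N.
- by move=> u v _ _ uv; apply: (ad_separated ad) => //; exact: sp_nz.
- apply: step_connected => u v _ _ uv; apply: std_step; last exact: sp_nz.
    by apply: (rvec_alg ad) => //; rewrite eq_sym.
  by rewrite eq_sym.
- move=> a; exists 1; first exact: oner_neq0.
  rewrite scale1r /ci_incl linfunE; last first.
    by move=> x y z; have := col_mx_linear 1 0 x y z; rewrite !scale0r !scale1r.
  apply/matrixP => u z; rewrite mxE [LHS]mxE (ord1 z).
  case: (split_ordP u) => k ->; rewrite ?col_mxEd ?col_mxEu !mxE.
    by rewrite eqxx andbT eq_lshift.
  by rewrite eq_rlshift.
Qed.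

End TypeCI.

(** * The spin representation *)

Section ExteriorAlgebra.
Context {R : realType} {m : nat}.
Implicit Types (k l : 'I_m) (I J : {set 'I_m}) (g h : ext R m).

Lemma ext_scaleE (c : R[i]) g I : (c *: g) I = c * g I :> R[i].
Proof. by rewrite ffunE. Qed.

Lemma ext_addE g h I : (g + h) I = (g I : R[i]) + (h I : R[i]) :> R[i].
Proof. by rewrite ffunE. Qed.

Lemma ext_oppE g I : (- g) I = - (g I : R[i]) :> R[i].
Proof. by rewrite ffunE. Qed.

Lemma ext_ext g h : (forall I, g I = h I :> R[i]) -> g = h.
Proof. by move=> e; apply/ffunP. Qed.

Fact dz_coord I J : (dz J : ext R m) I = (I == J)%:R.
Proof. by rewrite ffunE. Qed.

Fact dz_sum g : g = \sum_I g I *: (dz I : ext R m).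
Proof.
apply/ffunP => I; rewrite sum_ffunE (bigD1 I) //= big1 ?addr0 => [|J JI].
  by rewrite ext_scaleE dz_coord eqxx mulr1.
by rewrite ext_scaleE dz_coord eq_sym (negbTE JI) mulr0.
Qed.

Definition ext_wb : wbasis (V := ext R m) (A := {set 'I_m}) :=
  WBasis (wvec := fun I => dz I : ext R m) (wcoord := fun I g => g I)
    (fun I g h => ext_addE g h I) (fun I c g => ext_scaleE c g I) dz_coord dz_sum.

Lemma wedgeE k g I : wedge k g I = if k \in I then koszul k I * g (I :\ k)%SET else 0.
Proof.
rewrite /wedge linfunE ?ffunE // => c g1 g2; apply/ffunP => J.
rewrite ext_addE ext_scaleE !ffunE.
by case: ifP => _; rewrite ?mulr0 ?addr0 // mulrDr mulrCA.
Qed.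

Lemma contractE k g I : contract k g I = if k \in I then 0 else koszul k I * g (k |: I)%SET.
Proof.
rewrite /contract linfunE ?ffunE // => c g1 g2; apply/ffunP => J.
rewrite ext_addE ext_scaleE !ffunE.
by case: ifP => _; rewrite ?mulr0 ?addr0 // mulrDr mulrCA.
Qed.

Lemma degree_signE g I : degree_sign g I = (-1) ^+ #|I| * g I.
Proof.
rewrite /degree_sign linfunE ?ffunE // => c g1 g2; apply/ffunP => J.
by rewrite ext_addE ext_scaleE !ffunE mulrDr mulrCA.
Qed.

(** Symmetric difference with {k}: it treats exterior multiplication and contraction by d\bar z_k as
    one operation. *)
Definition toggle k I : {set 'I_m} := if k \in I then (I :\ k)%SET else (k |: I)%SET.

Lemma in_toggle j k I : (j \in toggle k I) = (j \in I) (+) (j == k).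
Proof.
rewrite /toggle; case: ifP => kI; rewrite !inE; have [->|jk] := eqVneq j k; rewrite ?kI //= ?addbF //.
Qed.

Lemma toggleK k : involutive (toggle k).
Proof. by move=> I; apply/setP => j; rewrite !in_toggle -addbA addbb addbF. Qed.

Lemma toggleC k l I : toggle k (toggle l I) = toggle l (toggle k I).
Proof. by apply/setP => j; rewrite !in_toggle addbAC. Qed.

Lemma card_toggle k I : odd #|toggle k I| = ~~ odd #|I|.
Proof.
rewrite /toggle; case: ifP => kI; last by rewrite cardsU1 kI.
by rewrite [in RHS](cardsD1 k I) kI /= negbK.
Qed.

Lemma koszul_toggle k l I : koszul k (toggle l I) = (-1) ^+ (l < k)%N * koszul k I :> R[i].
Proof.
rewrite /koszul -[in LHS]signr_odd -[(-1) ^+ #|_|]signr_odd.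
set A := [set j in I | (j < k)%N]%SET; set B := [set j in toggle l I | (j < k)%N]%SET.
have [lk|lk] := boolP (l < k)%N; last first.
  have -> : B = A; last by rewrite mul1r.
  apply/setP => j; rewrite !inE in_toggle; have [->|_] := eqVneq j l; last by rewrite addbF.
  by rewrite (negbTE lk) !andbF.
have -> : B = toggle l A.
  apply/setP => j; rewrite !inE !in_toggle !inE; have [->|_] := eqVneq j l; last by rewrite !addbF.
  by rewrite lk !andbT.
by rewrite card_toggle signrN expr1 mulN1r.
Qed.

Lemma koszul_sq k I : koszul k I * koszul k I = 1 :> R[i].
Proof. by rewrite /koszul -expr2 sqrr_sign. Qed.

End ExteriorAlgebra.

Lemma lfun_commutatorE (K : fieldType) (V : vectType K) (f g : 'End(V)) v :
  ((f \o g)%VF - (g \o f)%VF) v = f (g v) - g (f v).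
Proof. by rewrite add_lfunE opp_lfunE !comp_lfunE. Qed.

(** * Clifford relations, and why the spin representation is a representation *)

Section Clifford.
Context {R : realType} {b : bool} {m : nat}.
Local Notation N := (b + (m + m))%N.
Implicit Types (u v : 'I_N) (I J : {set 'I_m}) (g h : ext R m) (X Y : 'M[R[i]]_N).

(* On coefficients every gamma matrix acts by a phase and a toggle. *)
Definition gamma_phase u I : R[i] :=
  match so_kd u with
  | None => (-1) ^+ #|I|
  | Some (k, s) => (if s then (if k \in I then 'i else - 'i) else 1) * koszul k I
  end.

Definition gamma_toggle u I : {set 'I_m} := if so_kd u is Some (k, _) then toggle k I else I.

Lemma gammaE u g I : gamma u g I = gamma_phase u I * g (gamma_toggle u I) :> R[i].
Proof.
rewrite /gamma /gamma_phase /gamma_toggle /so_kd.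
case: (fintype.split u) => [_|v]; first by rewrite degree_signE.
case: (fintype.split v) => k; rewrite /toggle ?scale_lfunE ?add_lfunE ?opp_lfunE.
  by rewrite ext_addE wedgeE contractE; case: ifP => _; rewrite ?addr0 ?add0r mul1r.
rewrite ext_scaleE ext_addE ext_oppE wedgeE contractE.
by case: ifP => _; rewrite ?subr0 ?sub0r ?mulrN ?mulNr mulrA.
Qed.

Lemma gamma_sq u g : gamma u (gamma u g) = g.
Proof.
apply: ext_ext => I; rewrite !gammaE /gamma_phase /gamma_toggle.
case: (so_kd u) => [[k s]|]; last by rewrite mulrA -expr2 sqrr_sign mul1r.
rewrite toggleK in_toggle eqxx addbT koszul_toggle ltnn expr0 mul1r.
have := koszul_sq (R := R) k I; move: (koszul k I) => x xx.
have ii := @ii R.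
by case: s; case: (k \in I); rewrite /=; ring: xx ii.
Qed.

(** For distinct planes exactly one of the two Koszul signs notices the other toggle. Inside one
    plane the sign comes from the factor 'i or - 'i, and against x_0 from the change of degree. *)
Lemma gamma_anti u v g : u != v -> gamma u (gamma v g) = - gamma v (gamma u g).
Proof.
move=> uv; apply: ext_ext => I; rewrite ext_oppE !gammaE /gamma_phase /gamma_toggle.
case eu: (so_kd u) => [[k s]|]; case ev: (so_kd v) => [[l t]|]; last first.
- by case/eqP: uv; apply: so_kd_inj; rewrite eu ev.
- by rewrite -[(-1) ^+ #|toggle l I|]signr_odd card_toggle signrN signr_odd; ring.
- by rewrite -[(-1) ^+ #|toggle k I|]signr_odd card_toggle signrN signr_odd; ring.
rewrite toggleC !koszul_toggle !in_toggle [k == l]eq_sym.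
have [kl|kl] := eqVneq l k.
  subst l; have st : s != t by apply: contra uv => /eqP st; rewrite (so_kdP eu) (so_kdP ev) st.
  rewrite ltnn expr0 addbT.
  by case: s t st {eu ev} => [] [] //= _; case: (k \in I) => /=; ring.
rewrite !addbF; set p : R[i] := if s then _ else _; set q : R[i] := if t then _ else _.
set y : R[i] := g _; move: p q y (koszul k I) (koszul l I) => p q y x z.
have [lk|lk|/val_inj e] := ltngtP l k; last by rewrite e eqxx in kl.
  by rewrite /= expr0 expr1; ring.
by rewrite /= expr0 expr1; ring.
Qed.

Lemma gamma_comm u v g : gamma u (gamma v g) + gamma v (gamma u g) = (2%:R * (u == v)%:R) *: g.
Proof.
have [->|uv] := eqVneq u v; first by rewrite !gamma_sq mulr1 scaler_nat mulr2n.
by rewrite gamma_anti // addNr mulr0 scale0r.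
Qed.

Lemma spin_repE X g : spin_rep X g = 8%:R^-1 *: \sum_u \sum_v
  X u v *: (gamma u (gamma v g) - gamma v (gamma u g)).
Proof.
rewrite /spin_rep scale_lfunE sum_lfunE; congr (_ *: _); apply: eq_bigr => u _.
rewrite sum_lfunE; apply: eq_bigr => v _.
by rewrite scale_lfunE add_lfunE opp_lfunE !comp_lfunE.
Qed.

Lemma lfun_spin_rep (V : vectType R[i]) (f : 'Hom(ext R m, V)) X g : f (spin_rep X g) = 8%:R^-1 *: \sum_u \sum_v
  X u v *: f (gamma u (gamma v g) - gamma v (gamma u g)).
Proof.
rewrite spin_repE (linearZ_LR f); congr (_ *: _); rewrite (linear_sum f); apply: eq_bigr => u _.
by rewrite (linear_sum f); apply: eq_bigr => v _; rewrite (linearZ_LR f).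
Qed.

Lemma spin_complex_linear : complex_linear (@spin_rep R b m).
Proof.
move=> c X Y; rewrite /spin_rep scalerA [c * _]mulrC -scalerA -scalerDr; congr (_ *: _).
rewrite scaler_sumr -big_split; apply: eq_bigr => u _ /=.
rewrite scaler_sumr -big_split; apply: eq_bigr => v _ /=.
by rewrite !mxE scalerDl scalerA.
Qed.

#[local] Opaque gamma spin_rep.

(** Bivectors act on gamma matrices by the vector representation. Moving gamma u through a
    commutator by the Clifford relations leaves two terms with the factor 4; antisymmetry of X makes
    their contributions equal, and the total 8 cancels the normalization 1/8. *)
Lemma spin_gamma X u g : X^T = - X ->
  spin_rep X (gamma u g) = gamma u (spin_rep X g) + \sum_a X a u *: gamma a g.
Proof.
move=> tX; have anti a c : X c a = - X a c.
  by have := congr1 (fun Z : 'M_N => Z a c) tX; rewrite !mxE.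
rewrite (spin_repE X (gamma u g)) (spin_repE X g) (linearZ_LR (gamma u)) /=.
pose dl (a c : 'I_N) : R[i] := (a == c)%:R.
have key a c : gamma a (gamma c (gamma u g)) - gamma c (gamma a (gamma u g)) =
   gamma u (gamma a (gamma c g) - gamma c (gamma a g)) +
   (4%:R * dl c u) *: gamma a g - (4%:R * dl a u) *: gamma c g.
  have e1 x y : gamma x (gamma y g) = (2%:R * dl x y) *: g - gamma y (gamma x g).
    by rewrite -gamma_comm addrK.
  have e2 x y : gamma x (gamma y (gamma u g)) = gamma u (gamma x (gamma y g)) +
      (2%:R * dl y u) *: gamma x g - (2%:R * dl x u) *: gamma y g.
    rewrite (e1 y u) linearB linearZ /=.
    have := gamma_comm x u (gamma y g); rewrite -/(dl x u) => /eqP; rewrite addrC eq_sym -subr_eq => /eqP <-.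
    by apply: ext_ext => I; rewrite !(ext_addE, ext_oppE, ext_scaleE); ring.
  rewrite (e2 a c) (e2 c a) [in RHS](linearB (gamma u)) /=.
  move: (gamma u (gamma a (gamma c g))) (gamma u (gamma c (gamma a g))) => A B.
  move: (gamma a g) (gamma c g) (dl c u) (dl a u) => A' B' x y.
  have q z (C : ext R m) : (4%:R * z) *: C = (2%:R * z) *: C + (2%:R * z) *: C.
    by rewrite -scalerDl; congr (_ *: _); ring.
  by rewrite !q !opprD !opprK (AC (3*3) ((1*4)*(2*6)*(3*5))).
transitivity (8%:R^-1 *: \sum_a \sum_c (X a c *: gamma u (gamma a (gamma c g) - gamma c (gamma a g))
    + ((X a c * (4%:R * dl c u)) *: gamma a g - (X a c * (4%:R * dl a u)) *: gamma c g))).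
  congr (_ *: _); apply: eq_bigr => a _; apply: eq_bigr => c _.
  by rewrite key -addrA scalerDr scalerBr !scalerA.
pose s1 := \sum_a \sum_c (X a c * (4%:R * dl c u)) *: gamma a g.
pose s2 := \sum_a \sum_c (X a c * (4%:R * dl a u)) *: gamma c g.
have e1 : s1 = 4%:R *: \sum_a X a u *: gamma a g.
  rewrite /s1 scaler_sumr; apply: eq_bigr => a _; rewrite (bigD1 u) //= big1 ?addr0 => [|c cu].
    by rewrite /dl eqxx scalerA mulr1 mulrC.
  by rewrite /dl (negbTE cu) !mulr0 scale0r.
have e2 : s2 = - (4%:R *: \sum_a X a u *: gamma a g).
  rewrite /s2 (bigD1 u) //= [X in _ + X]big1 ?addr0 => [|a au]; last first.
    by apply: big1 => c _; rewrite /dl (negbTE au) !mulr0 scale0r.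
  rewrite scaler_sumr -sumrN; apply: eq_bigr => c _.
  by rewrite /dl eqxx mulr1 (anti c u) scalerA -scaleNr; congr (_ *: _); ring.
have -> : \sum_a \sum_c (X a c *: gamma u (gamma a (gamma c g) - gamma c (gamma a g))
    + ((X a c * (4%:R * dl c u)) *: gamma a g - (X a c * (4%:R * dl a u)) *: gamma c g)) =
   \sum_a \sum_c X a c *: gamma u (gamma a (gamma c g) - gamma c (gamma a g)) +(s1 - s2).
  rewrite /s1 /s2 -sumrB -big_split; apply: eq_bigr => a _ /=.
  by rewrite -sumrB -big_split.
rewrite e1 e2 opprK -scalerDl [LHS](scalerDr 8%:R^-1) scalerA; congr (_ + _).
  congr (_ *: _); rewrite (linear_sum (gamma u)); apply: eq_bigr => a _.
  by rewrite (linear_sum (gamma u)); apply: eq_bigr => c _; rewrite (linearZ_LR (gamma u)).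
by rewrite (_ : _ * _ = 1) ?scale1r //; field.
Qed.

(** By [spin_gamma] the commutator with [spin_rep X] is a derivation on products of gamma matrices,
    acting through X on each index. Contracting with the coefficients of Y gives XY from one index
    and, by antisymmetry of X, - YX from the other. *)
Lemma spin_is_rep (k : set 'M[R[i]]_N) : (forall X, k X -> X^T = - X) -> is_rep k (@spin_rep R b m).
Proof.
move=> hk; have lin := spin_complex_linear; split=> [X Y _ _|c X _|X Y hX hY].
- exact: complex_linearD.
- exact: complex_linearZ.
have tX := hk X hX; have anti a c : X c a = - X a c.
  by have := congr1 (fun Z : 'M_N => Z a c) tX; rewrite !mxE.
apply/lfunP => g; rewrite (lfun_commutatorE (spin_rep X) (spin_rep Y) g).
pose C u v := gamma u (gamma v g) - gamma v (gamma u g).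
have eg u v : spin_rep X (gamma u (gamma v g)) = gamma u (gamma v (spin_rep X g)) +
    (\sum_a X a v *: gamma u (gamma a g) + \sum_a X a u *: gamma a (gamma v g)).
  rewrite (spin_gamma u (gamma v g) tX) (spin_gamma v g tX) (linearD (gamma u)) (linear_sum (gamma u)) -addrA.
  by congr (_ + (_ + _)); apply: eq_bigr => a _; rewrite (linearZ_LR (gamma u)).
have eC u v : spin_rep X (C u v) = (gamma u (gamma v (spin_rep X g)) - gamma v (gamma u (spin_rep X g)))
    + (\sum_a X a v *: C u a + \sum_a X a u *: C a v).
  have q1 : \sum_a X a v *: C u a =
    \sum_a X a v *: gamma u (gamma a g) - \sum_a X a v *: gamma a (gamma u g).
    by rewrite -sumrB; apply: eq_bigr => a _; rewrite scalerBr.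
  have q2 : \sum_a X a u *: C a v =
    \sum_a X a u *: gamma a (gamma v g) - \sum_a X a u *: gamma v (gamma a g).
    by rewrite -sumrB; apply: eq_bigr => a _; rewrite scalerBr.
  have -> : spin_rep X (C u v) = spin_rep X (gamma u (gamma v g)) - spin_rep X (gamma v (gamma u g)).
    exact: (linearB (spin_rep X)).
  rewrite [X in _ = _ + (X + _)]q1 [X in _ = _ + (_ + X)]q2 (eg u v) (eg v u).
  by rewrite !opprD (AC ((1*2)*(1*2)) ((1*4)*((2*6)*(3*5)))).
have l1 := lfun_spin_rep (spin_rep X) Y g; have l2 := spin_repE Y (spin_rep X g).
have l3 := etrans (congr2 (fun A B : ext R m => A - B) l1 l2) (esym (scalerBr _ _ _)).
apply: (etrans (spin_repE (lie X Y) g)); apply: (etrans _ (esym l3)); congr (_ *: _).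
rewrite -sumrB.
transitivity (\sum_u \sum_v (Y u v *: (\sum_a X a v *: C u a) + Y u v *: (\sum_a X a u *: C a v))); last first.
  apply: eq_bigr => u _; rewrite -sumrB; apply: eq_bigr => v _.
  by rewrite -/(C u v) eC -scalerDr -scalerBr addrAC subrr add0r.
under [RHS]eq_bigr do rewrite big_split /=.
rewrite big_split /=.
have e1 : \sum_u \sum_v Y u v *: (\sum_a X a v *: C u a) = - \sum_u \sum_v (Y *m X) u v *: C u v.
  rewrite -sumrN; apply: eq_bigr => u _; rewrite -sumrN.
  under eq_bigr => v _ do rewrite scaler_sumr.
  rewrite exchange_big; apply: eq_bigr => a _; rewrite /= mxE scaler_suml -sumrN.
  by apply: eq_bigr => v _; rewrite scalerA (anti v a) mulrN scaleNr.
have e2 : \sum_u \sum_v Y u v *: (\sum_a X a u *: C a v) = \sum_u \sum_v (X *m Y) u v *: C u v.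
  transitivity (\sum_u \sum_v \sum_a (X a u * Y u v) *: C a v).
    apply: eq_bigr => u _; apply: eq_bigr => v _; rewrite scaler_sumr; apply: eq_bigr => a _.
    by rewrite scalerA mulrC.
  transitivity (\sum_u \sum_a \sum_v (X a u * Y u v) *: C a v).
    by apply: eq_bigr => u _; exact: exchange_big.
  rewrite exchange_big; apply: eq_bigr => a _ /=; rewrite exchange_big; apply: eq_bigr => v _ /=.
  by rewrite mxE scaler_suml.
apply: (etrans _ (congr2 (fun A B : ext R m => A + B) (esym e1) (esym e2))).
rewrite -sumrN -big_split; apply: eq_bigr => u _ /=; rewrite -sumrN -big_split.
apply: eq_bigr => v _ /=; rewrite addrC -scalerBl; congr (_ *: _).
by rewrite /lie mxE [(- (Y *m X)) u v]mxE.
Qed.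

End Clifford.

(** * Weights and root vectors in the spin representation *)

Section SpinWeights.
Context {R : realType} {b : bool} {m : nat}.
Local Notation N := (b + (m + m))%N.
Local Notation f := (so_frame (R := R) (b := b) (m := m)).
Local Notation spin := (@spin_rep R b m).
Implicit Types (u v : 'I_N) (k l : 'I_m) (I J : {set 'I_m}) (g h : ext R m) (X Y H : 'M[R[i]]_N).

Definition spin_wt I H : R[i] := 2%:R^-1 * \sum_(k < m) (-1) ^+ (k \in I) * plane_eps k H.

Lemma spin_rep_coord X g I : spin X g I =
  8%:R^-1 * \sum_u \sum_v X u v * (gamma u (gamma v g) I - gamma v (gamma u g) I) :> R[i].
Proof.
rewrite spin_repE; have := wcoord_bigsum ext_wb I; rewrite /= => cs.
rewrite ext_scaleE cs; congr (_ * _); apply: eq_bigr => u _.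
rewrite cs; apply: eq_bigr => v _.
by rewrite ext_scaleE ext_addE ext_oppE.
Qed.

(** Only the two entries coupling x_k and y_k contribute, and the product of the two gamma matrices
    of a plane toggles k twice, hence is diagonal on monomials. *)
Lemma spin_torus H g I : H^T = - H -> (forall u v, plane_of u != plane_of v -> H u v = 0) ->
  spin H g I = spin_wt I H * g I :> R[i].
Proof.
move=> tH Hp; have anti a c : H c a = - H a c.
  by have := congr1 (fun Z : 'M_N => Z a c) tH; rewrite !mxE.
have H0 a : H a a = 0.
  have /eqP := anti a a; rewrite -addr_eq0 -mulr2n mulrn_eq0 /= => /eqP; exact.
have row u (F : 'I_N -> R[i]) : \sum_v H u v * F v =
    if so_kd u is Some (k, s) then H u (so_coord k (~~ s)) * F (so_coord k (~~ s)) else 0.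
  case eu: (so_kd u) => [[k s]|].
    rewrite (bigD1 (so_coord k (~~ s))) //= big1 ?addr0 // => v vk.
    have [->|uv] := eqVneq v u; first by rewrite H0 mul0r.
    rewrite Hp ?mul0r //; rewrite !plane_of_kd eu; case ev: (so_kd v) => [[l t]|] //=.
    apply/eqP => -[kl]; subst l; case/eqP: vk; rewrite (so_kdP ev); congr so_coord.
    by case: s t eu ev => [] [] // eu ev; case/eqP: uv; apply: so_kd_inj; rewrite eu ev.
  apply: big1 => v _; have [->|uv] := eqVneq v u; first by rewrite H0 mul0r.
  rewrite Hp ?mul0r // !plane_of_kd eu; case ev: (so_kd v) => [[l t]|] //.
  by case/eqP: uv; apply: so_kd_inj; rewrite eu ev.
rewrite spin_rep_coord; under eq_bigr do rewrite row.
rewrite sum_so_coord big1 ?add0r => [|z _]; last by rewrite so_kd_None.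
rewrite -big_split /spin_wt /= mulr_sumr mulr_sumr mulr_suml; apply: eq_bigr => k _.
have ex := so_kd_coord (b := b) k false; have ey := so_kd_coord (b := b) k true.
rewrite -![xcoord b k]/(so_coord k false) -![ycoord b k]/(so_coord k true) ex ey /=.
rewrite -![xcoord b k]/(so_coord k false) -![ycoord b k]/(so_coord k true).
rewrite plane_eps_ord -![xcoord b k]/(so_coord k false) -![ycoord b k]/(so_coord k true).
rewrite (anti (so_coord k false)) !gammaE /gamma_phase /gamma_toggle ex ey !toggleK.
rewrite in_toggle eqxx addbT koszul_toggle ltnn expr0 mul1r.
have := koszul_sq (R := R) k I; move: (koszul k I) (g I : R[i]) (H _ _) => x y z xx.
by case: (k \in I) => /=; rewrite ?expr0 ?expr1; field: xx.
Qed.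

Lemma spin_torus_dz H I : H^T = - H -> (forall u v, plane_of u != plane_of v -> H u v = 0) ->
  spin H (dz I) = spin_wt I H *: (dz I : ext R m).
Proof.
move=> tH Hp; apply: ext_ext => J; rewrite ext_scaleE spin_torus // dz_coord.
by have [->|_] := eqVneq J I; rewrite // !mulr0.
Qed.

(* The gamma matrices of the isotropic frame [so_mat]: up to a scalar, contraction and exterior
   multiplication. *)
Definition frame_gamma u g : ext R m := \sum_a so_mat (R := R) a u *: gamma a g.

(** The scalars 1 + 'i and 1 - 'i are twice the normalizations of the two weight vectors of a plane.
    The condition on k tells the contraction from the exterior multiplication. *)
Definition frame_phase u I : R[i] :=
  if so_kd u is Some (k, s) then
    (if s then 1 - 'i else 1 + 'i) * ((k \in I) == s)%:R * koszul k I
  else (-1) ^+ #|I|.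

Lemma frame_gammaE u g I : frame_gamma u g I = frame_phase u I * g (gamma_toggle u I) :> R[i].
Proof.
have := wcoord_bigsum ext_wb I; rewrite /frame_gamma /= => ->.
have e a : (so_mat (R := R) a u *: gamma a g) I = gamma a g I * so_mat (R := R) a u :> R[i].
  by rewrite ext_scaleE mulrC.
under eq_bigr do rewrite e.
rewrite so_mat_sum /frame_phase /gamma_toggle; case eu: (so_kd u) => [[k s]|]; last first.
  by rewrite gammaE /gamma_phase /gamma_toggle eu.
rewrite -![xcoord b k]/(so_coord k false) -![ycoord b k]/(so_coord k true).
rewrite !gammaE /gamma_phase /gamma_toggle !so_kd_coord /so_coef.
have ii := @ii R.
by move: (g _ : R[i]) (koszul k I) => x y; case: s eu => _; case: (k \in I) => /=; field: ii.
Qed.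

Lemma frame_gamma_dz u I : frame_gamma u (dz I) =
  frame_phase u (gamma_toggle u I) *: (dz (gamma_toggle u I) : ext R m).
Proof.
have tK J : gamma_toggle u (gamma_toggle u J) = J.
  by rewrite /gamma_toggle; case: (so_kd u) => [[k s]|] //; rewrite toggleK.
apply: ext_ext => J; rewrite ext_scaleE frame_gammaE !dz_coord.
have [e|e] := eqVneq J (gamma_toggle u I); first by rewrite e tK eqxx.
by rewrite (_ : _ == I = false) ?mulr0 //; apply: contraNF e => /eqP <-; rewrite tK.
Qed.

Lemma frame_gamma2 u w g I : frame_gamma u (frame_gamma w g) I =
  \sum_x \sum_y so_mat (R := R) x u * so_mat (R := R) y w * gamma x (gamma y g) I :> R[i].
Proof.
have cs := wcoord_bigsum (ext_wb (R := R) (m := m)); rewrite /= in cs.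
rewrite {1}/frame_gamma cs; apply: eq_bigr => x _.
rewrite ext_scaleE /frame_gamma (linear_sum (gamma x)) cs mulr_sumr; apply: eq_bigr => y _.
by rewrite (linearZ_LR (gamma x)) ext_scaleE mulrA.
Qed.

(** In the original coordinates the root vector is the bivector of the weight vectors u and
    [so_star v]. Hence its spin action is a commutator of two frame gamma matrices. *)
Lemma so_rvec_entry u v x y : rvec f u v x y =
  2%:R^-1 * (so_mat x u * so_mat y (so_star v) - so_mat x (so_star v) * so_mat y u).
Proof.
rewrite /rvec -lock /= /utw -lock.
have dl a c : (so_mat *m delta_mx a c *m adjoint_mx so_mat) x y = so_mat x a * (so_mat (R := R) y c)^*.
  rewrite -mulmxA mxE (bigD1 a) //= big1 ?addr0 => [|z za]; last first.
    by rewrite [X in _ * X]mxE big1 ?mulr0 // => t _; rewrite mxE (negbTE za) mul0r.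
  congr (_ * _); rewrite mxE (bigD1 c) //= big1 ?addr0 => [|t tc]; last first.
    by rewrite mxE (negbTE tc) andbF mul0r.
  by rewrite mxE !eqxx mul1r adjoint_mxE.
rewrite -scalemxAr -scalemxAl mulmxBr mulmxBl mxE; congr (_ * _).
rewrite mxE dl; congr (_ + _); first by rewrite so_mat_star.
by rewrite mxE mulr1 scale1r dl -so_mat_star so_starK.
Qed.

Lemma spin_rvec u v g : spin (rvec f u v) g =
  8%:R^-1 *: (frame_gamma u (frame_gamma (so_star v) g) - frame_gamma (so_star v) (frame_gamma u g)).
Proof.
apply: ext_ext => I; set w := so_star v.
rewrite [RHS]ext_scaleE [X in _ = _ * X]ext_addE [X in _ = _ * (_ + X)]ext_oppE.
apply: (etrans (spin_rep_coord _ g I)); congr (_ * _).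
apply: (etrans _ (congr2 (fun x y : R[i] => x - y) (esym (frame_gamma2 u w g I)) (esym (frame_gamma2 w u g I)))).
pose a x y := so_mat (R := R) x u * so_mat (R := R) y w.
pose A (x y : 'I_N) : R[i] := gamma x (gamma y g) I.
transitivity (\sum_x \sum_y (2%:R^-1 * (a x y * A x y + a y x * A y x) - 2%:R^-1 * (a x y * A y x + a y x * A x y))).
  apply: eq_bigr => x _; apply: eq_bigr => y _; rewrite so_rvec_entry -/w -!/(A _ _) /a.
  by move: (A x y) (A y x) => s t; ring.
have tr (F : 'I_N -> 'I_N -> R[i]) : \sum_x \sum_y 2%:R^-1 * (F x y + F y x) = \sum_x \sum_y F x y.
  transitivity (2%:R^-1 * (\sum_x \sum_y F x y + \sum_x \sum_y F y x)).
    rewrite -big_split mulr_sumr; apply: eq_bigr => x _; rewrite -big_split mulr_sumr.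
    by apply: eq_bigr => y _.
  by rewrite [X in _ + X]exchange_big /=; move: (\sum_x _) => s; field.
transitivity (\sum_x \sum_y a x y * A x y - \sum_x \sum_y a y x * A x y).
  rewrite -(tr (fun x y => a x y * A x y)) -(tr (fun x y => a y x * A x y)) -sumrB.
  by apply: eq_bigr => x _; rewrite -sumrB; apply: eq_bigr => y _; congr (_ - _ * _); rewrite addrC.
congr (_ - _); apply: eq_bigr => x _; apply: eq_bigr => y _ //.
by rewrite /a [_ * so_mat x w]mulrC.
Qed.

End SpinWeights.

Section SpinSteps.
Context {R : realType} {b : bool} {m : nat}.
Local Notation N := (b + (m + m))%N.
Local Notation f := (so_frame (R := R) (b := b) (m := m)).
Local Notation spin := (@spin_rep R b m).
Local Notation B := (ext_wb (R := R) (m := m)).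
Implicit Types (u v : 'I_N) (k l : 'I_m) (I J : {set 'I_m}).

Lemma spin_rvec_dz u v I : let w := so_star v in
  gamma_toggle u (gamma_toggle w I) = gamma_toggle w (gamma_toggle u I) ->
  spin (rvec f u v) (dz I) =
  (8%:R^-1 * (frame_phase w (gamma_toggle w I) * frame_phase u (gamma_toggle u (gamma_toggle w I))
     - frame_phase u (gamma_toggle u I) * frame_phase w (gamma_toggle w (gamma_toggle u I))))
  *: (dz (gamma_toggle u (gamma_toggle w I)) : ext R m).
Proof.
move=> w tC; apply: (etrans (spin_rvec u v (dz I))); rewrite -/w.
have fgZ (u' : 'I_N) c (g : ext R m) : frame_gamma u' (c *: g) = c *: frame_gamma u' g.
  rewrite /frame_gamma scaler_sumr; apply: eq_bigr => a _.
  by rewrite (linearZ_LR (gamma a)) !scalerA mulrC.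
have fg2 (x y : 'I_N) : frame_gamma x (frame_gamma y (dz I)) =
   (frame_phase y (gamma_toggle y I) * frame_phase x (gamma_toggle x (gamma_toggle y I)))
     *: (dz (gamma_toggle x (gamma_toggle y I)) : ext R m).
  rewrite (frame_gamma_dz y I) fgZ.
  by rewrite (frame_gamma_dz x) scalerA.
rewrite (fg2 u w) (fg2 w u) -tC.
by rewrite -[RHS]scalerA scalerBl.
Qed.

Lemma frame_scalar_neq0 (s : bool) : (if s then 1 - 'i else 1 + 'i) != 0 :> R[i].
Proof.
apply/eqP => h; have := congr1 (fun z : R[i] => z * (if s then 1 + 'i else 1 - 'i)) h.
rewrite mul0r (_ : _ * _ = 1 - 'i * 'i); last by case: s {h}; ring.
by rewrite (@ii R) opprK -mulr2n => /eqP; rewrite pnatr_eq0.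
Qed.

Lemma koszul_neq0 k I : koszul k I != 0 :> R[i].
Proof. by rewrite /koszul signr_eq0. Qed.

(** Each weight vector is chosen so that its gamma matrix does not kill [dz I]: it creates the
    variable if absent and contracts it if present. The condition on l is reversed because v acts
    through its dual. The two orders of the product differ by a sign, so the commutator does not
    vanish. *)
Lemma spin_step2 h I k l : k != l ->
  complexification h (rvec f (so_coord k (k \notin I)) (so_coord l (l \in I))) ->
  step B spin h I (toggle k (toggle l I)).
Proof.
move=> kl hZ; set u := so_coord k _ in hZ; set v := so_coord l _ in hZ.
have eu : so_kd u = Some (k, k \notin I) by rewrite so_kd_coord.
have ew : so_kd (so_star v) = Some (l, l \notin I) by rewrite so_kd_star so_kd_coord.
have e := @spin_rvec_dz u v I; rewrite /= /gamma_toggle eu ew in e.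
exists (rvec f u v); eexists; split; [exact: hZ| |exact: e (toggleC _ _ _)].
rewrite /frame_phase eu ew !in_toggle !eqxx !koszul_toggle !ltnn (negbTE kl) [l == k]eq_sym (negbTE kl).
rewrite !addbT !addbF /= !eqxx !expr0 !mulr1 !mul1r.
set x : R[i] := if _ then _ else _; set y : R[i] := if _ then _ else _.
have x0 : x != 0 := frame_scalar_neq0 _; have y0 : y != 0 := frame_scalar_neq0 _.
have := koszul_neq0 k I; have := koszul_neq0 l I; move: (koszul k I) (koszul l I) => z t t0 z0.
have -> : 8%:R^-1 * (x * t * (y * ((-1) ^+ (l < k) * z)) - y * z * (x * ((-1) ^+ (k < l) * t))) =
  (8%:R^-1 * ((-1) ^+ (l < k)%N - (-1) ^+ (k < l)%N)) * (x * y * z * t) by ring.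
rewrite !mulf_neq0 ?invr_eq0 ?pnatr_eq0 //.
have [lk|kl'|/val_inj e'] := ltngtP l k; last by rewrite e' eqxx in kl.
  by rewrite /= expr0 expr1 -opprD oppr_eq0 -mulr2n pnatr_eq0.
by rewrite /= expr0 expr1 opprK -mulr2n pnatr_eq0.
Qed.

(** In odd dimension x_0 acts by the sign of the degree, which anticommutes with a single toggle; a
    short root vector therefore moves one variable. *)
Lemma spin_step1 h I k v : so_kd v = None ->
  complexification h (rvec f (so_coord k (k \notin I)) v) ->
  step B spin h I (toggle k I).
Proof.
move=> ev hZ; set u := so_coord k _ in hZ.
have eu : so_kd u = Some (k, k \notin I) by rewrite so_kd_coord.
have ew : so_kd (so_star v) = None by rewrite so_kd_star ev.
have e := @spin_rvec_dz u v I; rewrite /= /gamma_toggle eu ew in e.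
exists (rvec f u v); eexists; split; [exact: hZ| |exact: e erefl].
rewrite /frame_phase eu ew in_toggle eqxx koszul_toggle ltnn addbT /= eqxx expr0 mulr1 mul1r.
set x : R[i] := if _ then _ else _; have x0 : x != 0 := frame_scalar_neq0 _.
have := koszul_neq0 k I; move: (koszul k I) => z z0.
rewrite -[(-1) ^+ #|toggle k I|]signr_odd card_toggle signrN signr_odd.
have := signr_eq0 R[i] #|I|; move: ((-1) ^+ #|I|) => y y0.
rewrite (_ : _ * _ = (8%:R^-1 * 2%:R) * (x * y * z)); last by ring.
by rewrite !mulf_neq0 ?invr_eq0 ?pnatr_eq0 // y0.
Qed.

(** The parity e constrains I only in even dimension. The spin representation and the two half-spin
    representations are thus handled together. *)
Definition spin_set (e : bool) (p : nat) I : bool :=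
  [forall k in I, (k < p)%N] && (b || (odd #|I| == e)).

Lemma below_toggle p k I : (k < p)%N ->
  [forall j in toggle k I, (j < p)%N] = [forall j in I, (j < p)%N].
Proof.
move=> kp; apply/forall_inP/forall_inP => h j; have [->|jk] := eqVneq j k => //; move=> hj; apply: h.
  by rewrite in_toggle (negbTE jk) addbF.
by move: hj; rewrite in_toggle (negbTE jk) addbF.
Qed.

Lemma spin_set_below e p I k : spin_set e p I -> k \in I -> (k < p)%N.
Proof. by move=> /andP[/forall_inP h _]; exact: h. Qed.

(** Induction on the size of the symmetric difference of I and J. In odd dimension one of its
    elements is toggled. In even dimension equal parities make that size even, so there is a second
    element to toggle along with the first. *)
Lemma spin_connected h e p : (p <= m)%N ->
  (forall I k v, b -> so_kd v = None -> (k < p)%N ->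
     complexification h (rvec f (so_coord k (k \notin I)) v)) ->
  (forall I k l, ~~ b -> k != l -> (k < p)%N -> (l < p)%N -> spin_set e p I ->
     complexification h (rvec f (so_coord k (k \notin I)) (so_coord l (l \in I)))) ->
  connected B spin h (spin_set e p).
Proof.
move=> pm h1 h2 Q hQ I J TI TJ QI.
pose dif I' := [set k | (k \in I') != (k \in J)]%SET.
have [n] := ubnP #|dif I|; elim: n I TI QI => // n IH I TI QI hn.
have [->//|IJ] := eqVneq J I.
have [k kd] : exists k, k \in dif I.
  apply/existsP; apply: contraNT IJ; rewrite negb_exists => /forallP hh; apply/eqP/setP => k.
  by apply/eqP; have := hh k; rewrite inE negbK eq_sym.
have below j : j \in dif I -> (j < p)%N.
  rewrite inE; have [jI _|_] := boolP (j \in I); first exact: spin_set_below TI jI.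
  by case: (boolP (j \in J)) => // jJ _; exact: spin_set_below TJ jJ.
have kp := below k kd.
have dif_t j I' : j \in dif I' -> dif (toggle j I') = (dif I' :\ j)%SET.
  move=> jd; apply/setP => i; rewrite !inE in_toggle; have [->|ij] := eqVneq i j.
    by move: jd; rewrite inE addbT /=; case: (j \in I'); case: (j \in J).
  by rewrite addbF.
have cd j I' : j \in dif I' -> (#|dif (toggle j I')| < #|dif I'|)%N.
  by move=> jd; rewrite dif_t // [#|dif I'|](cardsD1 j) jd.
have [hb|hb] : b = true \/ b = false by case: (b); [left|right].
  have TI' : spin_set e p (toggle k I).
    by move: TI; rewrite /spin_set below_toggle // hb.
  apply: (IH (toggle k I)) => //; last by apply: leq_trans (cd _ _ kd) _.
  apply: (hQ I) => //.
  apply: (@spin_step1 _ _ _ (lshift (m + m) (cast_ord (esym (congr1 nat_of_bool hb)) ord0))).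
    exact: so_kd_None.
  by apply: h1 => //; exact: so_kd_None.
have oc : odd #|I| = odd #|J|.
  by move: TI TJ; rewrite /spin_set hb /= => /andP[_ /eqP ->] /andP[_ /eqP ->].
have od : ~~ odd #|dif I|.
  have -> : dif I = (I :\: J :|: J :\: I)%SET.
    by apply/setP => j; rewrite !inE; case: (j \in I); case: (j \in J).
  rewrite cardsU (_ : (_ :&: _)%SET = finset.set0) ?cards0 ?subn0; last first.
    by apply/setP => j; rewrite !inE; case: (j \in I); case: (j \in J).
  rewrite oddD; move: oc; rewrite -(cardsID J I) -[in RHS](cardsID I J) finset.setIC !oddD.
  by case: (odd _); case: (odd _); case: (odd _).
have [l ld] : exists l, l \in (dif I :\ k)%SET.
  apply/set0Pn; apply: contra od => /eqP hh.
  by rewrite (cardsD1 k) kd hh cards0.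
have /andP[lk ld'] : (l != k) && (l \in dif I) by move: ld; rewrite !inE.
have lp := below l ld'.
have kl : k != l by rewrite eq_sym.
have TI' : spin_set e p (toggle k (toggle l I)).
  by move: TI; rewrite /spin_set !below_toggle // !card_toggle negbK hb.
apply: (IH (toggle k (toggle l I))) => //; last first.
  have kd' : k \in dif (toggle l I) by rewrite dif_t // !inE kl /=; move: kd; rewrite inE.
  exact: leq_trans (cd _ _ kd') (leq_trans (ltnW (cd _ _ ld')) hn).
apply: (hQ I) => //; apply: spin_step2 => //.
by apply: h2 => //; rewrite hb.
Qed.

End SpinSteps.

(** * Highest weights and minimality of the spin components *)

Section SpinMinimal.
Context {R : realType} {b : bool} {m : nat}.
Variable p : nat.
Hypothesis p_le : (p <= m)%N.
Hypothesis p_gt : (2 <= p + b)%N.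
Local Notation N := (b + (m + m))%N.
Local Notation f := (so_frame (R := R) (b := b) (m := m)).
Local Notation spin := (@spin_rep R b m).
Local Notation B := (ext_wb (R := R) (m := m)).
Local Notation D := (so_bdi R b m p).
Definition bdi_cow (q : nat) : nat -> 'M[R[i]]_N := so_cow q (fun k => q - k)%N.
Local Notation w := (bdi_cow p).
Implicit Types (u v : 'I_N) (k l : 'I_m) (I J : {set 'I_m}).

Lemma so_bdi_adapted : adapted f D (so_rel p) pred0 w.
Proof.
have h1 j : (1 <= j <= p)%N -> (p - j < p)%N /\ (p - (p - j))%N = j by lia.
have h2 (k : nat) : (k < p)%N -> (1 <= p - k <= p)%N /\ (p - (p - k))%N = k by lia.
exact: (@so_adapted R b m p _ _ p_le p_gt h1 h2).
Qed.
Let ad := so_bdi_adapted.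

Lemma so_bdi_antisym X : alg D X -> X^T = - X.
Proof. by case=> -[_]. Qed.

Lemma so_bdi_tor_support H u v : tor D H -> plane_of u != plane_of v -> H u v = 0.
Proof. by case=> _ h uv; apply: h; rewrite (negbTE uv) !andbF. Qed.

Definition bdi_theta (j : nat) k : R[i] :=
  if (k < p)%N then so_cow_val (R := R) (b := b) p j (p - k) else 0.

Lemma wt_bdi_cow j u : wt f u (w j) =
  if so_kd u is Some (k, s) then 'i * ((-1) ^+ s * bdi_theta j k) else 0.
Proof.
apply: (etrans (wt_so_tor _ _ _)); case: (so_kd u) => [[k s]|] //.
by rewrite /bdi_theta; case: ifP => // _; rewrite !mulr0.
Qed.

Lemma so_bdi_tor_so H : tor D H -> so_alg R N H.
Proof. by case. Qed.

Lemma plane_eps_bdi_cow j k : (1 <= j <= p)%N -> plane_eps k (w j) = 'i * bdi_theta j k.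
Proof.
move=> hj; have tw := ad_cow_tor ad hj.
have := wt_so k false (so_bdi_tor_so tw); rewrite expr0 mul1r => <-.
by rewrite wt_bdi_cow so_kd_coord expr0 mul1r.
Qed.

Lemma spin_wt_cow j I : (1 <= j <= p)%N ->
  spin_wt (b := b) I (w j) = 2%:R^-1 * \sum_k (-1) ^+ (k \in I) * ('i * bdi_theta j k).
Proof. by move=> hj; congr (_ * _); apply: eq_bigr => k _; rewrite plane_eps_bdi_cow. Qed.

Lemma spin_diag : diag_on B spin (spin_wt (R := R) (b := b) (m := m)) (tor D).
Proof.
move=> H I tH; apply: spin_torus_dz.
  by apply: so_bdi_antisym; exact: (ad_tor_sub ad).
by move=> u v; exact: so_bdi_tor_support.
Qed.

Lemma spin_set_toggle (e : bool) u v I : in_planes p u -> in_planes p v ->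
  spin_set (b := b) e p (gamma_toggle v (gamma_toggle u I)) = spin_set (b := b) e p I.
Proof.
have nkd : ~~ b -> forall u', so_kd (b := b) (m := m) u' != None.
  move=> nb u'; rewrite /so_kd; case: (fintype.split u') => // -[z hz]; exfalso.
  by move: hz nb; case: (b).
rewrite !in_planes_kd /spin_set /gamma_toggle; have := nkd^~ u; have := nkd^~ v.
case: (so_kd u) => [[k s]|] nv nu hu; case: (so_kd v) nv => [[l t]|] nv hv;
  rewrite ?below_toggle // ?card_toggle ?negbK //; case: (b) nu nv => //.
- by move=> _ nv; have := nv isT.
- by move=> nu _; have := nu isT.
Qed.

Lemma spin_invariant e : invariant_sub (alg D) spin (wspan B (spin_set (b := b) e p)).
Proof.
move=> X [_ hX]; apply/subvP => _ /memv_imgP[g /mem_wspan hg ->]; apply/mem_wspan => I nI.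
rewrite [wcoord _ _ _]/= spin_rep_coord big1 ?mulr0 // => u _; apply: big1 => v _.
have [/andP[hu hv]|nuv] := boolP (in_planes p u && in_planes p v); last by rewrite hX ?mul0r.
have z (x y : 'I_N) : in_planes p x -> in_planes p y -> gamma x (gamma y g) I = 0 :> R[i].
  move=> hx hy; rewrite !gammaE; have := hg (gamma_toggle y (gamma_toggle x I)).
  by rewrite spin_set_toggle // => /(_ nI) /= ->; rewrite !mulr0.
by rewrite (z u v) // (z v u) // subrr mulr0.
Qed.

(** If k lies in exactly one of the two sets, the rotation of the plane k alone tells the two
    weights apart. *)
Lemma spin_separated e : separated_on (spin_wt (R := R) (b := b) (m := m)) (tor D) (spin_set (b := b) e p).
Proof.
move=> I J TI TJ IJ.
have [k kd] : exists k, (k \in I) != (k \in J).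
  apply/existsP; apply: contraNT IJ; rewrite negb_exists => /forallP hh; apply/eqP/setP => k.
  by apply/eqP; have := hh k; rewrite negbK.
have kp : (k < p)%N.
  have [kI|nI] := boolP (k \in I); first exact: spin_set_below TI kI.
  by apply: spin_set_below TJ _; move: kd; rewrite (negbTE nI); case: (k \in J).
pose th (l : nat) : R[i] := (l == k)%:R.
have thR (l : nat) : (th l)^* = th l by rewrite /th conjC_nat.
have tH : tor D (so_tor p th) by exact: (so_tor_mem p (subn p) thR).
exists (so_tor p th) => //.
have pe (l : 'I_m) : plane_eps l (so_tor (b := b) (m := m) p th) = 'i * (l == k)%:R.
  have := wt_so l false (so_bdi_tor_so tH); rewrite expr0 mul1r => <-.
  rewrite wt_so_tor so_kd_coord expr0 mul1r /th; case: ifP => // lp.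
  by have [lk|] := eqVneq l k; rewrite ?mulr0 //; rewrite lk kp in lp.
have sw I' : spin_wt (b := b) I' (so_tor (b := b) (m := m) p th) = 2%:R^-1 * ((-1) ^+ (k \in I') * 'i).
  rewrite /spin_wt (bigD1 k) //= big1 ?addr0 => [|l lk]; first by rewrite pe eqxx mulr1.
  by rewrite pe (negbTE lk) !mulr0.
rewrite !sw -subr_eq0 -mulrBr -mulrBl !mulf_neq0 ?invr_eq0 ?pnatr_eq0 ?neq0Ci //.
by move: kd; case: (k \in I); case: (k \in J) => //= _;
  rewrite expr0 expr1 ?opprK -?opprD ?oppr_eq0 -mulr2n pnatr_eq0.
Qed.

Lemma spin_alg_connected e : connected B spin (alg D) (spin_set (b := b) e p).
Proof.
apply: spin_connected => // [I k v _ ev kp|I k l _ kl kp lp _]; apply: (rvec_alg ad).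
- by rewrite /so_rel !in_planes_kd so_kd_coord ev kp.
- by apply/eqP => e'; move: ev; rewrite -e' so_kd_coord.
- by rewrite /so_rel !in_planes_kd !so_kd_coord kp lp.
- by apply: contra kl => /eqP e'; have := congr1 so_kd e'; rewrite !so_kd_coord => -[->].
Qed.

(** The highest weight is half of the sum of all eps_j, carried by the empty monomial. In the odd
    half-spin representation the sign of eps_p is reversed, and eps_p is carried by the plane 0. *)
Definition spin_top (e : bool) : {set 'I_m} :=
  (if b || ~~ e then finset.set0 else [set k : 'I_m | val k == 0%N])%SET.

Lemma card_spin_top e : #|spin_top e| = (~~ b && e)%N.
Proof.
rewrite /spin_top; case: ifP => [h|/norP[nb ne]].
  by rewrite cards0; case: (b) h; case: e.
have m0 : (0 < m)%N by move: p_gt p_le; rewrite (negbTE nb); lia.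
rewrite (_ : [set k | _]%SET = [set Ordinal m0]%SET) ?cards1; last first.
  by apply/setP => k; rewrite !inE.
by rewrite nb; move: ne; case: e.
Qed.

Lemma spin_top_mem e q : (1 <= q + b)%N -> spin_set (b := b) e q (spin_top e).
Proof.
move=> q1; rewrite /spin_set card_spin_top; apply/andP; split; last by case: (b); case: e.
apply/forall_inP => k; rewrite /spin_top; case: ifP => [|/norP[nb _]]; rewrite inE // => /eqP ->.
by move: q1; rewrite (negbTE nb); lia.
Qed.

(** At an integral coweight every term is nonnegative. At the two spinor coweights the sum is half
    of a difference of cardinalities, and the parity of I is what makes it nonnegative. *)
Lemma spin_dominant e I j : spin_set (b := b) e p I -> (1 <= j <= p)%N ->
  0 <= \sum_k ((k \in I)%:R - (k \in spin_top e)%:R) * bdi_theta j k.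
Proof.
move=> TI hj.
have [hb|/norP[nb njp]] := boolP (b || (j < p.-1)%N).
  apply: sumr_ge0 => k _; rewrite /bdi_theta /so_cow_val hb; case: ifP => kp; last by rewrite mulr0.
  rewrite /spin_top; case: ifP => [_|/norP[nb ne]].
    by rewrite inE subr0 mulr_ge0 ?ler0n.
  rewrite inE; have [k0|k0] := eqVneq (k : nat) 0%N; last by rewrite subr0 mulr_ge0 ?ler0n.
  rewrite k0 subn0 (_ : (p <= j)%N = false) ?mulr0 //.
  by move: hb; rewrite (negbTE nb) /=; lia.
have p2 : (1 < p)%N by move: p_gt; rewrite (negbTE nb); lia.
have m0 : (0 < m)%N by lia.
pose k0 := Ordinal m0; pose d := (j == p.-1).
have th k : (k < p)%N -> bdi_theta j k = 2%:R^-1 - (d && (k == k0))%:R.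
  move=> kp; rewrite /bdi_theta kp /so_cow_val (negbTE nb) /= (negbTE njp) -/d.
  have -> : (p - k == p)%N = (k == k0) by rewrite -val_eqE /=; apply/eqP/eqP; lia.
  by case: (d && (k == k0)) => /=; field.
have sumI (A : {set 'I_m}) : \sum_k (k \in A)%:R = #|A|%:R :> R[i].
  by rewrite -sum1_card natr_sum [RHS]big_mkcond /=; apply: eq_bigr => k _; case: (k \in A).
have top0 : (k0 \in spin_top e) = e.
  by rewrite /spin_top (negbTE nb) /=; case: e {TI}; rewrite /= inE.
have ct : #|spin_top e| = e :> nat by rewrite card_spin_top nb; case: (e).
have -> : \sum_k ((k \in I)%:R - (k \in spin_top e)%:R) * bdi_theta j k =
   2%:R^-1 * ((#|I| + 2 * d * e)%:R - (e + 2 * d * (k0 \in I))%:R).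
  transitivity (2%:R^-1 * (\sum_k (k \in I)%:R - \sum_k (k \in spin_top e)%:R)
      - (d%:R * ((k0 \in I)%:R - (k0 \in spin_top e)%:R)) :> R[i]); last first.
    by rewrite !sumI ct top0 !natrD !natrM; field.
  rewrite -sumrB mulr_sumr.
  have -> : d%:R * ((k0 \in I)%:R - (k0 \in spin_top e)%:R) =
     \sum_k d%:R * (((k \in I)%:R - (k \in spin_top e)%:R) * (k == k0)%:R) :> R[i].
    rewrite (bigD1 k0) //= [X in _ = _ + X]big1 ?addr0 ?eqxx ?mulr1 // => k kk.
    by rewrite (negbTE kk) !mulr0.
  rewrite -sumrB; apply: eq_bigr => k _; have [kp|kp] := boolP (k < p)%N.
    by rewrite th // -mulnb natrM; ring.
  have -> : (k \in I) = false by apply: contraNF kp; exact: spin_set_below TI.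
  have -> : (k \in spin_top e) = false.
    by apply: contraNF kp; apply: (@spin_set_below b m e); apply: spin_top_mem; lia.
  by rewrite subrr mul0r !mulr0 mul0r mulr0 subrr.
rewrite mulr_ge0 ?invr_ge0 ?ler0n // subr_ge0 ler_nat.
have zI : ((k0 \in I) <= #|I|)%N by case: (boolP (k0 \in I)) => // h; apply/card_gt0P; exists k0.
have /andP[_] := TI; rewrite (negbTE nb) /= => /eqP.
by case: (d); case: (k0 \in I) zI; case: (e); rewrite /=; move: #|I| => [|[|n]] //=; lia.
Qed.

Lemma bdi_spin_minimal e (Tp : pred {set 'I_m}) (l : R[i]) :
  connected B spin (k_phi D 1) Tp -> Tp (spin_top e) ->
  (forall I, Tp I -> spin_set (b := b) e p I) ->
  (forall I, spin_set (b := b) e p I ->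
     spin_wt (b := b) I (w 1%N) = if Tp I then l else l - 'i) ->
  phi_minimal D 1 spin (wspan B (spin_set (b := b) e p)) (wspan B Tp)
    (wspan B (fun I => spin_set (b := b) e p I && ~~ Tp I)) l.
Proof.
move=> cTp top sub wts.
have rep : is_rep (alg D) spin by exact: spin_is_rep so_bdi_antisym.
have h1 : (1 <= 1 <= rnk D)%N by rewrite /=; move: p_gt; case: (b) => /=; lia.
have dom I j : spin_set (b := b) e p I -> (1 <= j <= rnk D)%N ->
    exists2 x : R[i], 0 <= x & spin_wt (b := b) (spin_top e) (w j) - spin_wt (b := b) I (w j) = x * 'i.
  move=> TI hj; exists (\sum_k ((k \in I)%:R - (k \in spin_top e)%:R) * bdi_theta j k).
    exact: spin_dominant.
  rewrite !spin_wt_cow // -mulrBr -sumrB mulr_sumr mulr_suml; apply: eq_bigr => k _.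
  by move: (bdi_theta j k) => x; case: (k \in I); case: (k \in spin_top e) => /=; field.
exact: (wspan_phi_minimal ad spin_complex_linear rep spin_diag h1 (@spin_separated e)
   (@spin_invariant e) (@spin_alg_connected e) cTp top sub wts dom).
Qed.

End SpinMinimal.

(** The conditions on rho fix its values on all simple roots, which separate the torus. A refutation
    of minimality can then use the explicit coweight. *)
Lemma ad_rho_unique (R : realType) (N : nat) (f : frame R N) D r S w s rho :
  adapted f D r S w -> (1 <= s <= rnk D)%N -> is_rho D s rho -> rho = w s.
Proof.
move=> ad hs [tr cr sr]; have [tw' cw sw] := ad_is_rho ad hs.
have [roots _ _] := ad_is_base ad.
have val j rho' : (1 <= j <= rnk D)%N -> (forall b', compact_root D s b' -> b' rho' = 0) ->
    simp D s rho' = 'i -> simp D j rho' = (j == s)%:R * 'i.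
  move=> hj c0 s1; have [->|js] := eqVneq j s; first by rewrite mul1r.
  rewrite mul0r; apply: c0; split; first exact: roots.
  exists (fun k => (k == j)%:Z); last by rewrite eq_sym (negbTE js).
  move=> H _; have jr : j \in index_iota 1 (rnk D).+1 by rewrite mem_index_iota; lia.
  rewrite (bigD1_seq j) ?iota_uniq //= eqxx mul1r big1 ?addr0 // => k kj.
  by rewrite (negbTE kj) mul0r.
apply/eqP; rewrite -subr_eq0; apply/eqP; apply: (ad_nondeg ad).
  exact: real_subspaceB (ad_tor_subspace ad) tr tw'.
have tB : tor D (rho - w s) by exact: real_subspaceB (ad_tor_subspace ad) tr tw'.
move=> j hj; have [u [v [_ _ _ e]]] := ad_simp ad hj.
have := val j rho hj cr sr; have := val j (w s) hj cw sw.
rewrite !e // => h1 h2; have wB x : wt f x (rho - w s) = wt f x rho - wt f x (w s).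
  by rewrite /wt twD twN !mxE.
rewrite !wB; move: h1 h2; move: (wt f u rho) (wt f v rho) (wt f u (w s)) (wt f v (w s)).
move=> x y z t e1 e2; have -> : x - z - (y - t) = (x - y) - (z - t) by ring.
by rewrite e1 e2 subrr.
Qed.

(** On a sum of two eigenspaces the operator (f - a)(f - c) vanishes. *)
Lemma dsum_eigenvalue (K : fieldType) (V : vectType K) (f : 'End(V)) a c mu (v : V) :
  (fullv : {vspace V}) = (passmx.leigenspace f a + passmx.leigenspace f c)%VS ->
  f v = mu *: v -> v != 0 -> mu = a \/ mu = c.
Proof.
move=> full fv v0.
have eig x l : x \in passmx.leigenspace f l -> f x = l *: x.
  by rewrite memv_ker add_lfunE opp_lfunE scale_lfunE id_lfunE subr_eq0 => /eqP.
have := memvf v; rewrite full => /memv_addP[x /eig fx [y /eig fy vxy]].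
have [->|ma] := eqVneq mu a; [by left|right].
have e1 : (mu - a) *: x = (c - mu) *: y.
  move: fv; rewrite vxy linearD /= fx fy scalerDr => e.
  by rewrite !scalerBl; apply/eqP; rewrite subr_eq addrAC eq_sym subr_eq eq_sym addrC -e addrC.
have /eqP : (mu - c) *: ((mu - a) *: v) = 0.
  have fe : f ((mu - a) *: x) = f ((c - mu) *: y) by rewrite e1.
  rewrite vxy [(mu - a) *: _]scalerDr e1 -scalerDl scalerA.
  have : a *: ((mu - a) *: x) = c *: ((c - mu) *: y).
    by move: fe; rewrite !linearZ /= fx fy !scalerA ![_ * a]mulrC ![_ * c]mulrC.
  rewrite e1 => /eqP; rewrite -subr_eq0 -scalerBl scalerA => /eqP e2.
  by rewrite (_ : _ * _ = (a - c) * (c - mu)) // ; ring.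
rewrite !scaler_eq0 (negbTE v0) orbF !subr_eq0 (negbTE ma) orbF => /eqP; exact.
Qed.

(** * The node 1 of so(2p + b) *)

Section NodeOne.
Context {R : realType} {b : bool} {m : nat}.
Variable p : nat.
Hypothesis p_le : (p <= m)%N.
Hypothesis p_gt : (2 <= p + b)%N.
Local Notation N := (b + (m + m))%N.
Local Notation f := (so_frame (R := R) (b := b) (m := m)).
Local Notation spin := (@spin_rep R b m).
Local Notation B := (ext_wb (R := R) (m := m)).
Local Notation D := (so_bdi R b m p).
Local Notation w := (bdi_cow (R := R) (b := b) (m := m) p).
Implicit Types (u v : 'I_N) (k l : 'I_m) (I J : {set 'I_m}).

Let p0 : (0 < p)%N. Proof. by move: p_gt; case: (b) => /=; lia. Qed.
Let hp : (p.-1 < m)%N. Proof. by move: p_le p0; lia. Qed.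
Definition last_plane : 'I_m := Ordinal hp.

Let ad := so_bdi_adapted (R := R) p_le p_gt.

Let h1 : (1 <= 1 <= p)%N. Proof. by rewrite p0. Qed.

Lemma bdi_theta_one k : b || (2 < p)%N ->
  bdi_theta (R := R) (b := b) p 1 k = (k == last_plane)%:R.
Proof.
move=> g; rewrite /bdi_theta /so_cow_val.
have -> : b || (1 < p.-1)%N by move: g; case: (b) => //=; lia.
have -> : (k == last_plane) = (k == p.-1 :> nat) by [].
have [kp|kp] := boolP (k < p)%N; first by congr (_%:R); lia.
by rewrite (_ : (k == p.-1 :> nat) = false) //; move: p0; lia.
Qed.

(** For so(4) the node 1 is itself a spinor node, so its coweight involves both planes, with
    opposite half-integral values. *)
Lemma bdi_theta_four k : ~~ b -> p = 2%N ->
  bdi_theta (R := R) (b := b) p 1 k =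
    if (k < 2)%N then (if k == 0%N :> nat then - 2%:R^-1 else 2%:R^-1) else 0.
Proof.
move=> nb p2; rewrite /bdi_theta /so_cow_val (negbTE nb) p2 /=; case: ifP => // k2.
by have -> : (2 - k == 2)%N = (k == 0%N :> nat) by lia.
Qed.

Lemma so_bdi_noncompact : noncompact_simple D 1.
Proof.
apply: (ad_noncompact ad) => // u v ruv uv nuv; rewrite !wt_bdi_cow.
have [g|g] := boolP (b || (2 < p)%N).
  case eu: (so_kd u) => [[k s]|]; case ev: (so_kd v) => [[l t]|]; rewrite ?bdi_theta_one //.
  - have [kp|kp] := eqVneq k last_plane; have [lp|lp] := eqVneq l last_plane.
    + have st : s != t by apply: contra uv => /eqP st; apply/eqP/so_kd_inj; rewrite eu ev kp lp st.
      case/negP: nuv; apply/and3P; split=> //=; last by rewrite mulr1.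
      apply/eqP/so_kd_inj; rewrite so_kd_star eu ev kp lp /=; congr (Some (_, _)).
      by case: s t st {eu ev} => [] [].
    + rewrite mulr1 !mulr0; case: s {eu}; rewrite ?expr1 ?expr0 ?mulr1 ?mulrN1.
        by apply: Or33; rewrite addNr.
      by apply: Or32; rewrite add0r.
    + rewrite mulr1 !mulr0; case: t {ev}; rewrite ?expr1 ?expr0 ?mulr1 ?mulrN1.
        by apply: Or32; rewrite addNr.
      by apply: Or33; rewrite add0r.
    + by rewrite !mulr0; apply: Or31.
  - have [kp|kp] := eqVneq k last_plane; last by rewrite !mulr0; apply: Or31.
    rewrite mulr1; case: s {eu}; rewrite ?expr1 ?expr0 ?mulr1 ?mulrN1.
      by apply: Or33; rewrite addNr.
    by apply: Or32; rewrite add0r.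
  - have [lp|lp] := eqVneq l last_plane; last by rewrite !mulr0; apply: Or31.
    rewrite mulr1; case: t {ev}; rewrite ?expr1 ?expr0 ?mulr1 ?mulrN1.
      by apply: Or32; rewrite addNr.
    by apply: Or33; rewrite add0r.
  - by apply: Or31.
have /norP[nb np] := g; have p2 : p = 2%N by move: p_gt; rewrite (negbTE nb) /=; lia.
have nkd u' : so_kd (b := b) (m := m) u' != None.
  rewrite /so_kd; case: (fintype.split u') => // -[z hz]; exfalso.
  by move: hz nb; case: (b).
have half u' : in_planes p u' -> exists s : bool,
    (if so_kd u' is Some (k, s) then 'i * ((-1) ^+ s * bdi_theta (b := b) p 1 k) else 0) =
    (-1) ^+ s * ('i / 2%:R) :> R[i].
  rewrite in_planes_kd; have := nkd u'; case: (so_kd u') => [[k s]|] // _ kp.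
  rewrite bdi_theta_four // -p2 kp; case: ifP => _; [exists (~~ s)|exists s].
    by rewrite signrN; ring.
  by ring.
have /andP[/half[s ->] /half[t ->]] := ruv.
case: s; case: t; rewrite ?expr1 ?expr0 ?mul1r ?mulN1r;
  [by apply: Or31|by apply: Or33; field|by apply: Or32; field|by apply: Or31].
Qed.

Lemma spin_set_pred e I : spin_set (b := b) e p I ->
  spin_set (b := b) e p.-1 I = (last_plane \notin I).
Proof.
move=> /andP[/forall_inP h hb]; rewrite /spin_set hb andbT; apply/forall_inP/idP => [h2|nI k kI].
  by apply/negP => /h2; rewrite ltnn.
have := h k kI; have : k != last_plane by apply: contraNneq nI => <-.
by rewrite -val_eqE /=; lia.
Qed.

Lemma spin_set_sub e I : spin_set (b := b) e p.-1 I -> spin_set (b := b) e p I.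
Proof.
move=> /andP[/forall_inP h hb]; rewrite /spin_set hb andbT; apply/forall_inP => k /h.
by move=> /leq_trans; apply; exact: leq_pred.
Qed.

Lemma bdi_spin_minimal_split e : b || (2 < p)%N ->
  phi_minimal D 1 spin (wspan B (spin_set (b := b) e p)) (wspan B (spin_set (b := b) e p.-1))
    (wspan B (fun I => spin_set (b := b) e p I && ~~ spin_set (b := b) e p.-1 I)) ('i / 2%:R).
Proof.
move=> g; apply: (bdi_spin_minimal p_le p_gt).
- have wt0 k s : (k < p.-1)%N -> wt f (so_coord k s) (w 1%N) = 0.
    move=> kp; rewrite wt_bdi_cow so_kd_coord bdi_theta_one //.
    by rewrite (_ : k == last_plane = false) ?mulr0 //; rewrite -val_eqE /=; lia.
  apply: spin_connected => [|I k v _ ev kp|I k l _ kl kp lp _]; first by move: p_le; lia.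
    apply: (rvec_k_phi ad) => //.
    + rewrite /so_rel !in_planes_kd so_kd_coord ev andbT; lia.
    + by apply/eqP => e'; move: ev; rewrite -e' so_kd_coord.
    + by rewrite wt0 // wt_bdi_cow ev.
  apply: (rvec_k_phi ad) => //.
  + by rewrite /so_rel !in_planes_kd !so_kd_coord; lia.
  + by apply: contra kl => /eqP e'; have := congr1 so_kd e'; rewrite !so_kd_coord => -[->].
  + by rewrite !wt0.
- apply: (spin_top_mem p_le p_gt); move: g; case: (b) => /=; lia.
- by move=> I; exact: spin_set_sub.
move=> I TI; rewrite (spin_wt_cow p_le p_gt) // spin_set_pred //.
rewrite (bigD1 last_plane) //= big1 ?addr0 => [|k kp]; last first.
  by rewrite bdi_theta_one // (negbTE kp) !mulr0.
by rewrite bdi_theta_one // eqxx; case: (last_plane \in I) => /=; rewrite ?expr0 ?expr1; field.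
Qed.

(** The root of the node 1 is eps_1 - eps_2. The even half-spin representation of so(4) has weights
    proportional to eps_1 + eps_2, so the coweight acts by 0 and nothing is split off. The odd one
    has the eigenvalues 'i / 2 and - 'i / 2. *)
Lemma bdi_spin_minimal_four e : ~~ b -> p = 2%N ->
  let Tp := if e then spin_set (b := b) e 1 else spin_set (b := b) e 2 in
  phi_minimal D 1 spin (wspan B (spin_set (b := b) e p)) (wspan B Tp)
    (wspan B (fun I => spin_set (b := b) e p I && ~~ Tp I)) (if e then 'i / 2%:R else 0).
Proof.
move=> nb p2 Tp.
have m0 : (0 < m)%N by move: p_le; rewrite p2; lia.
have m1 : (1 < m)%N by move: p_le; rewrite p2; lia.
pose k0 := Ordinal m0; pose k1 := Ordinal m1.
have k01 : k1 != k0 by [].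
have th k : bdi_theta (R := R) (b := b) p 1 k =
    if k == k0 then - 2%:R^-1 else if k == k1 then 2%:R^-1 else 0.
  rewrite bdi_theta_four // -!val_eqE /=; case: k => -[|[|k]] hk //=.
have par I : spin_set (b := b) e p I -> ((k0 \in I) (+) (k1 \in I)) = e.
  move=> TI; have /andP[_] := TI; rewrite (negbTE nb) /= => /eqP <-.
  have eI : I = ([set k in [set k0; k1] | k \in I])%SET.
    apply/setP => k; rewrite !inE; have [kI|] := boolP (k \in I); rewrite ?andbF // andbT.
    have := spin_set_below TI kI; rewrite p2 -!val_eqE /=; case: (k : nat) => [|[|]] //.
  rewrite [in RHS]eI (cardsD1 k0) (cardsD1 k1) (_ : (_ :\ _ :\ _)%SET = finset.set0); last first.
    apply/setP => k; rewrite !inE; by case: eqVneq => //= _; case: eqVneq.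
  by rewrite cards0 addn0 !inE !eqxx k01 ?orbT /= ?orbT /= oddD !oddb.
have wI I : spin_wt (b := b) I (w 1%N) = 2%:R^-1 * ('i / 2%:R) * ((-1) ^+ (k1 \in I) - (-1) ^+ (k0 \in I)).
  rewrite (spin_wt_cow p_le p_gt) // (bigD1 k0) //= (bigD1 k1) //= big1 => [|k /andP[kk0 kk1]].
    by rewrite !th eqxx (negbTE k01) eqxx; ring.
  by rewrite th (negbTE kk0) (negbTE kk1) !mulr0.
apply: (bdi_spin_minimal p_le p_gt).
- rewrite /Tp; have [he|he] : e = true \/ e = false by case: (e); [left|right].
    rewrite he => Q _ I J; have uniq I' : spin_set (b := b) true 1 I' -> I' = [set k0]%SET.
      move=> /andP[/forall_inP hI]; rewrite (negbTE nb) /= => /eqP oI.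
      have sub : (I' \subset [set k0])%SET.
        by apply/fintype.subsetP => k /hI; rewrite inE -val_eqE /=; case: (k : nat).
      by move: oI; have := sub; rewrite subset1 => /orP[/eqP ->//|/eqP ->]; rewrite cards0.
    by move=> /uniq -> /uniq ->.
  rewrite he; apply: spin_connected => [|I k v hb|I k l _ kl kp lp TI]; first by rewrite -p2.
    by rewrite hb in nb.
  rewrite -p2 in TI kp lp.
  have ek : (k \notin I) = (l \notin I).
    have := par I; rewrite he => /(_ TI) /eqP; rewrite addbC.
    have kk (k' : 'I_m) : (k' < p)%N -> k' = k0 \/ k' = k1.
      rewrite p2 => k2; have [->|nk] := eqVneq k' k0; [by left|right; apply/val_inj].
      by move: k2 nk; rewrite -val_eqE /=; lia.
    case: (kk k kp) => ->; case: (kk l lp) => -> //; case: (k0 \in I); by case: (k1 \in I).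
  apply: (rvec_k_phi ad) => //.
  + by rewrite /so_rel !in_planes_kd !so_kd_coord kp lp.
  + by apply: contra kl => /eqP e'; have := congr1 so_kd e'; rewrite !so_kd_coord => -[->].
  rewrite !wt_bdi_cow !so_kd_coord !bdi_theta_four // -p2 kp lp ek signrN.
  have nk : (k == 0%N :> nat) = ~~ (l == 0%N :> nat).
    by move: kl kp lp; rewrite p2 -val_eqE /=; case: (k : nat) (l : nat) => [|[|?]] [|[|?]].
  by rewrite nk; case: (l == 0%N :> nat) => /=; ring.
- have top q := @spin_top_mem b m p p_le p_gt e q.
  by rewrite /Tp; case: (e) top => top; apply: top.
- rewrite /Tp => I; case: (e); last by rewrite p2.
  by rewrite (_ : 1%N = p.-1) ?p2 //; rewrite -p2; exact: spin_set_sub.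
move=> I TI; have := par I TI; rewrite wI /Tp; case he: (e) TI => TI; last first.
  rewrite -p2 TI; case: (k0 \in I); case: (k1 \in I) => //= _; by rewrite subrr mulr0.
have -> : spin_set (b := b) true 1 I = (last_plane \notin I) by rewrite -(spin_set_pred TI) p2.
have -> : last_plane = k1 by apply/val_inj; rewrite /= p2.
by case: (k0 \in I); case: (k1 \in I) => //= _; rewrite ?expr0 ?expr1; field.
Qed.

End NodeOne.

Lemma ad_tor_commute (R : realType) (N : nat) (f : frame R N) D r S w H X :
  adapted f D r S w -> tor D H ->
  lie H X = 0 <-> (forall u v, tw f X u v != 0 -> wt f u H = wt f v H).
Proof.
move=> ad tH; split=> [h u v Xuv|h].
  have := ad_tw_lie ad X u v tH; rewrite h tw0 mxE => /esym/eqP.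
  by rewrite mulf_eq0 (negbTE Xuv) orbF subr_eq0 => /eqP.
apply: (@tw_inj _ _ f); apply/matrixP => u v; rewrite (ad_tw_lie ad X u v tH) tw0 mxE.
by have [->|/h ->] := eqVneq (tw f X u v) 0; rewrite ?mulr0 ?subrr ?mul0r.
Qed.

Lemma sub_complexification (R : realType) (N : nat) (k : set 'M[R[i]]_N) X :
  real_subspace k -> k X -> complexification k X.
Proof. by move=> [k0 _ _] kX; exists X, 0; split; rewrite ?scaler0 ?addr0. Qed.

(** * The chain of orthogonal algebras obtained by splitting off planes *)

Section OrthogonalChain.
Context {R : realType} {b : bool} {m : nat}.
Local Notation N := (b + (m + m))%N.
Local Notation f := (so_frame (R := R) (b := b) (m := m)).
Local Notation D := (so_bdi R b m).
Local Notation w := (bdi_cow (R := R) (b := b) (m := m)).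
Implicit Types (u v : 'I_N) (k l : 'I_m) (X : 'M[R[i]]_N).

Lemma wt_bdi_cow_one p u : (p <= m)%N -> (2 <= p + b)%N -> b || (2 < p)%N ->
  wt f u (w p 1) = if so_kd u is Some (k, s) then 'i * ((-1) ^+ s * (k == p.-1 :> nat)%:R) else 0.
Proof.
move=> pm pb g; rewrite wt_bdi_cow //; case: (so_kd u) => [[k s]|] //.
by rewrite (bdi_theta_one pm pb).
Qed.

(** The coweight of the vector node is the rotation of the last plane: it has the values 'i and - 'i
    on the two vectors of that plane and 0 elsewhere, so each of these vectors is alone in its
    eigenspace. *)
Lemma wt_bdi_cow_last p u v k s : (p <= m)%N -> (2 <= p + b)%N -> b || (2 < p)%N ->
  so_kd u = Some (k, s) -> k = p.-1 :> nat -> wt f u (w p 1) = wt f v (w p 1) -> u = v.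
Proof.
move=> pm pb g eu kp; rewrite !wt_bdi_cow_one // eu kp eqxx mulr1.
have i0 := neq0Ci R[i].
case ev: (so_kd v) => [[l t]|]; last by move/eqP; rewrite mulf_eq0 (negbTE i0) signr_eq0.
have [lp|lp] := eqVneq (l : nat) p.-1; last first.
  by move/eqP; rewrite !mulr0 mulf_eq0 (negbTE i0) signr_eq0.
rewrite mulr1 => e; apply: so_kd_inj; rewrite eu ev; congr (Some (_, _)).
  by apply: val_inj; rewrite /= kp lp.
move/(mulfI i0): e; case: s {eu}; case: t {ev} => // /eqP; rewrite expr0 expr1.
  by rewrite eq_sym -subr_eq0 opprK -mulr2n pnatr_eq0.
by rewrite -subr_eq0 opprK -mulr2n pnatr_eq0.
Qed.

Lemma in_planes_le p q u : (p <= q)%N -> in_planes p u -> in_planes q u.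
Proof. by move=> pq; rewrite !in_planes_kd; case: (so_kd u) => [[k s]|] // /leq_trans; apply. Qed.

Lemma so_rel_le p q u v : (p <= q)%N -> so_rel p u v -> so_rel q u v.
Proof. by move=> pq /andP[hu hv]; rewrite /so_rel !(in_planes_le pq). Qed.

Lemma so_bdi_sub p q : (p <= q)%N -> alg (D p) `<=` alg (D q).
Proof.
move=> pq X [sX hX]; split=> // u v nuv; apply: hX; apply: contra nuv.
exact: so_rel_le.
Qed.

Lemma so_bdi_semisimple_part p : (p <= m)%N -> (2 <= p.-1 + b)%N ->
  semisimple_part (D p) 1 (D p.-1).
Proof.
move=> pm pb'.
have p1 : (0 < p)%N by move: pb'; case: (p) => //=; case: (b).
have pb : (2 <= p + b)%N by lia.
have pm' : (p.-1 <= m)%N by lia.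
have g : b || (2 < p)%N by move: pb'; case: (b) => //=; lia.
have ad := so_bdi_adapted (R := R) pm pb; have ad' := so_bdi_adapted (R := R) pm' pb'.
have h1 : (1 <= 1 <= rnk (D p))%N by rewrite /= p1.
have wt0 u : in_planes p.-1 u -> wt f u (w p 1) = 0.
  rewrite in_planes_kd wt_bdi_cow_one //; case: (so_kd u) => [[k s]|] // kp.
  by rewrite (_ : (k == p.-1 :> nat) = false) ?mulr0 //; lia.
have last u v : so_rel p u v -> wt f u (w p 1) = wt f v (w p 1) -> so_rel p.-1 u v \/ u = v.
  move=> /andP[hu hv] e; have [|] := boolP (so_rel p.-1 u v); first by left.
  rewrite negb_and => /orP[nu|nv]; right.
    move: nu hu; rewrite !in_planes_kd; case eu: (so_kd u) => [[k s]|] // k1 k2.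
    by apply: (wt_bdi_cow_last pm pb g eu _ e); lia.
  move: nv hv; rewrite !in_planes_kd; case ev: (so_kd v) => [[k s]|] // k1 k2.
  by apply/esym; apply: (wt_bdi_cow_last pm pb g ev _ (esym e)); lia.
apply: (ad_semisimple_part ad ad' h1).
- move=> u v /[dup] ruv /andP[hu hv]; split; first by apply: so_rel_le ruv; exact: leq_pred.
  by rewrite !wt0.
- move=> u v x rux e /andP[hx hv]; have [/andP[hu _]|->] := last u x rux e; by rewrite /so_rel ?hx ?hu hv.
- by [].
- by apply: so_bdi_sub; exact: leq_pred.
- move=> X aX /(ad_tor_commute X ad (ad_cow_tor ad h1)) cX.
  have caX := sub_complexification (ad_subspace ad) aX.
  have [sX _] := aX; pose k := last_plane pm pb.
  have [rX _] := sX.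
  (* The coweight is the generator of the rotation of the last plane, so t is the rate at which X
     rotates this plane. *)
  have [t et] : exists t : R, X (xcoord b k) (ycoord b k) = (t%:C)%C.
    by exists (complex.Re (X (xcoord b k) (ycoord b k))); rewrite RRe_real.
  exists t; have tB : alg (D p) (X - (t%:C)%C *: w p 1%N).
    apply: (real_subspaceB (ad_subspace ad)) => //.
    case: (ad_subspace ad) => _ _; apply; apply: (ad_tor_sub ad); exact: (ad_cow_tor ad h1).
  have wdiag u v : u != v -> tw f (w p 1) u v = 0.
    have /(ad_torP ad)[_ h] := ad_cow_tor ad h1; exact: h.
  split; first by case: tB.
  have := so_support (R := R) (b := b) (m := m) (P := so_rel p.-1) (X - (t%:C)%C *: w p 1%N).
  move=> sup; apply/sup.
    by move=> a a' c c' ea ec; rewrite /so_rel /in_planes ea ec.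
  move=> u v nuv; rewrite twD twN twZ !mxE.
  have [uv|uv] := eqVneq u v; last first.
    rewrite wdiag // mulr0 subr0; apply/eqP; apply: contraNT nuv => Xuv.
    have ruv : so_rel p u v.
      by have := ad_complexP ad caX Xuv => -[].
    by have [//|e] := last u v ruv (cX u v Xuv); rewrite e eqxx in uv.
  rewrite -uv in nuv *; rewrite -![tw f _ u u]/(wt f u _).
  rewrite wt_bdi_cow_one //; case eu: (so_kd u) => [[l s]|]; last first.
    by move: nuv; rewrite /so_rel !in_planes_kd eu.
  have [lp|lp] := eqVneq (l : nat) p.-1; last first.
    rewrite !mulr0 subr0; apply/eqP; apply: contraNT nuv => Xuu.
    have [] : so_rel p u u /\ nz f u u by exact: (ad_complexP ad caX Xuu).
    rewrite /so_rel !in_planes_kd eu !andbb => l1 _; lia.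
  have lk : l = k by apply: val_inj.
  rewrite (so_kdP eu) (wt_so _ _ sX) lk plane_eps_ord et /=; ring.
- move=> j /= hj; exists j.+1; split=> [|//|H tH]; first by lia.
    by apply/eqP => -[j0]; rewrite j0 in hj.
  have e j' : (p.-1 - j')%N = (p - j'.+1)%N by lia.
  rewrite (_ : (j.+1 < p)%N = (j < p.-1)%N); last by lia.
  rewrite !e; case: ifP => // jn; have [hb|hb] : b = true \/ b = false by case: (b); [left|right].
    by rewrite !(ifT _ _ hb) prednK.
  rewrite !(ifF _ _ hb) !prednK //.
  by move: pb'; rewrite hb; lia.
Qed.

Lemma so_bdi_full X : alg (D m) X <-> so_alg R N X.
Proof.
split=> [[]//|sX]; split=> // u v; rewrite !in_planes_kd.
by case: (so_kd u) => [[k s]|]; case: (so_kd v) => [[l t]|]; rewrite ?ltn_ord.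
Qed.

Lemma so_blockP p X : so_block R b m p X <->
  so_alg R N X /\ forall u v, tw f X u v != 0 -> so_rel p u v \/ u = v.
Proof.
pose P u v := (plane_of u == plane_of v) || so_rel p u v.
have cP a a' c c' : plane_of a = plane_of a' -> plane_of c = plane_of c' -> P a c = P a' c'.
  by move=> ea ec; rewrite /P /so_rel /in_planes ea ec.
split=> -[sX hX]; split=> //.
  have [sup _] := so_support (R := R) X cP.
  have /sup h : forall u v, ~~ P u v -> X u v = 0.
    by move=> u v; rewrite negb_or => /andP[h1 h2]; exact: hX.
  move=> u v Xuv; have : P u v by apply: contraNT Xuv => /h ->.
  case/orP => [|ruv]; [|by left]; rewrite !plane_of_kd => e; right.
  have /so_algP[_ st] := sX.
  apply/eqP; apply: contraNT Xuv => uv; apply/eqP; apply: (star_sym_nz st).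
  rewrite negbK; apply/and3P; split=> //; last by rewrite /= mulr1.
  apply/eqP/so_kd_inj; rewrite so_kd_star; move: uv e.
  case eu: (so_kd u) => [[k s]|]; case ev: (so_kd v) => [[l t]|] //= uv.
  move=> /eqP[kl]; rewrite -kl; congr (Some (_, _)).
  have : s != t by apply: contra uv => /eqP st'; apply/eqP/so_kd_inj; rewrite eu ev kl st'.
  by case: s t {eu ev} => [] [].
have [_ sup] := so_support (R := R) X cP.
move=> u v h1 h2; apply: sup; last by rewrite negb_or h1.
move=> u' v' nP; apply/eqP; apply: contraNT nP => /hX[ruv|->]; first by rewrite /P ruv orbT.
by rewrite /P eqxx.
Qed.

Lemma so_block_commute j X : (j <= m)%N -> (forall i, (i < j)%N -> b || (2 < m - i)%N) ->
  so_block R b m (m - j) X <->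
  so_alg R N X /\ forall i, (i < j)%N -> lie (w (m - i) 1) X = 0.
Proof.
move=> jm g.
have mi i : (i < j)%N -> (m - i <= m)%N /\ (2 <= (m - i) + b)%N.
  by move=> ij; have := g i ij; case: (b) => /=; lia.
have com i : (i < j)%N -> lie (w (m - i) 1) X = 0 <->
    (forall u v, tw f X u v != 0 -> wt f u (w (m - i) 1) = wt f v (w (m - i) 1)).
  move=> ij; have [m1 m2] := mi i ij; have ad := so_bdi_adapted (R := R) m1 m2.
  apply: (ad_tor_commute X ad); apply: (ad_cow_tor ad).
  by rewrite /=; lia.
rewrite so_blockP; split=> -[sX hX]; split=> //.
  move=> i ij; apply/com => // u v /hX[/andP[hu hv]|->] //.
  have wt0 x : in_planes (m - j) x -> wt f x (w (m - i) 1) = 0.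
    have [m1 m2] := mi i ij; rewrite in_planes_kd wt_bdi_cow_one ?g //.
    case: (so_kd x) => [[k s]|] // kj.
    by rewrite (_ : (k == (m - i).-1 :> nat) = false) ?mulr0 //; lia.
  by rewrite !wt0.
move=> u v Xuv; have [ruv|] := boolP (so_rel (m - j) u v); first by left.
move=> nruv; right; move: nruv.
have big x y : ~~ in_planes (m - j) x -> (forall i, (i < j)%N -> wt f x (w (m - i) 1) = wt f y (w (m - i) 1)) -> x = y.
  rewrite in_planes_kd; case ex: (so_kd x) => [[k s]|] // kj h.
  (* The plane k is split off at the step m - k - 1, where it is the last plane of so(2(k + 1) +
     b). *)
  have kj' : (m - k.+1 < j)%N by have := ltn_ord k; lia.
  have [m1 m2] := mi _ kj'; apply: (wt_bdi_cow_last m1 m2 (g _ kj') ex _ (h _ kj')).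
  by have := ltn_ord k; lia.
rewrite /so_rel negb_and => /orP[nu|nv].
  by apply: big => // i ij; have /(com i ij) := hX i ij; apply.
by apply/esym; apply: big => // i ij; have /(com i ij) h := hX i ij; apply/esym; exact: h.
Qed.

Lemma so_bdi_hermitian : b || (2 < m)%N -> (0 < m)%N ->
  hermitian_pair (D m) 1 (so_block R b m (m - 1)).
Proof.
move=> g m0; have pb : (2 <= m + b)%N by move: g; case: (b) => /=; lia.
have ad := so_bdi_adapted (R := R) (leqnn m) pb.
split; [exact: (ad_well_formed ad)|exact: so_bdi_noncompact|].
have g1 i : (i < 1)%N -> b || (2 < m - i)%N by case: i => // _; rewrite subn0.
have sbc X := so_block_commute X m0 g1.
rewrite (ad_k_phi ad) //; apply/seteqP; split=> X.
  move=> [/so_bdi_full sX c]; apply/sbc; split; first exact: sX.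
  by move=> i; rewrite ltnS leqn0 => /eqP ->; rewrite subn0; exact: c.
move=> /sbc[sX /(_ 0%N isT)]; rewrite subn0 => h; split; last exact: h.
exact/so_bdi_full.
Qed.

(** On the fundamental representation the coweight has the eigenvalues 'i and - 'i, at distance 2
    'i, whereas minimality leaves room for two eigenvalues at distance 'i only. *)
Lemma so_std_not_minimal : b || (2 < m)%N -> (0 < m)%N ->
  ~ is_phi_minimal (D m) 1 (@std_rep R N) fullv.
Proof.
move=> g m0 [Up [Um [lam [L [rho [[hr _ _] [eUp eUm [full _] _]]]]]]].
have pb : (2 <= m + b)%N by move: g; case: (b) => /=; lia.
have ad := so_bdi_adapted (R := R) (leqnn m) pb.
have h1 : (1 <= 1 <= rnk (D m))%N by rewrite /= m0.
have er := ad_rho_unique ad h1 hr; rewrite er in eUp eUm.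
have full' : (fullv : {vspace 'cV[R[i]]_N}) =
    (passmx.leigenspace (std_rep (w m 1)) (lam - 'i * 0%:R) +
     passmx.leigenspace (std_rep (w m 1)) (lam - 'i * 1%:R))%VS.
  apply/eqP; rewrite eqEsubv subvf andbT [X in (X <= _)%VS]full eUp eUm /graded_piece.
  exact: addvS (capvSr _ _) (capvSr _ _).
have ev u mu : wt f u (w m 1) = mu -> mu = lam \/ mu = lam - 'i.
  move=> e; have := dsum_eigenvalue (mu := mu) (v := wvec (std_wb f) u) full'.
  rewrite mulr0 subr0 mulr1; apply.
    by rewrite -e; apply: (std_diag ad); exact: (ad_cow_tor ad h1).
  apply/eqP => z; have := wcoord_vec (std_wb f) u u; rewrite z wcoord0 eqxx => /esym/eqP.
  by rewrite oner_eq0.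
pose k := last_plane (leqnn m) pb.
have w1 s : wt f (so_coord k s) (w m 1) = (-1) ^+ s * 'i.
  by rewrite wt_bdi_cow_one // so_kd_coord eqxx mulr1 mulrC.
have i0 := neq0Ci R[i].
have c := ev _ _ (w1 false); have d := ev _ _ (w1 true).
rewrite expr0 expr1 mul1r mulN1r in c d.
have neq (x y : R[i]) : x = lam \/ x = lam - 'i -> y = lam \/ y = lam - 'i -> x <> y -> y = x - 'i \/ x = y - 'i.
  by move=> [->|->] [->|->] // _; [left|right].
have ni' : 'i <> - 'i :> R[i].
  by move=> e; move/eqP: e; rewrite -subr_eq0 opprK -mulr2n mulrn_eq0 (negbTE i0).
have [e|e] := neq _ _ c d ni'.
  by move: e; rewrite subrr => /eqP; rewrite oppr_eq0 (negbTE i0).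
have : 3%:R * 'i = 'i - (- 'i - 'i) :> R[i] by ring.
by rewrite -e subrr => /eqP; rewrite mulf_eq0 pnatr_eq0 (negbTE i0).
Qed.

End OrthogonalChain.

(* [so 4] is the sum of two copies of [su 2]; the one left over by the node 1 has the root
   [eps_1 + eps_2] and acts on the coordinates of weights [eps_1] and [- eps_2]. *)
Section EvenEnd.
Context {R : realType} {m : nat}.
Hypothesis m2 : (2 <= m)%N.
Local Notation N := (false + (m + m))%N.
Local Notation f := (so_frame (R := R) (b := false) (m := m)).
Local Notation spin := (@spin_rep R false m).
Local Notation B := (ext_wb (R := R) (m := m)).
Local Notation D2 := (so_bdi R false m 2).
Local Notation w2 := (bdi_cow (R := R) (b := false) (m := m) 2).
Implicit Types (u v : 'I_N) (k l : 'I_m) (I J : {set 'I_m}) (X : 'M[R[i]]_N).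

Let m0 : (0 < m)%N. Proof. by lia. Qed.
Definition plane0 : 'I_m := Ordinal m0.
Definition plane1 : 'I_m := Ordinal m2.

Definition end_kd u : option ('I_2 * bool) :=
  if so_kd u is Some (k, s) then
    if k == plane0 then Some (ord_max, ~~ s) else if k == plane1 then Some (ord0, s) else None
  else None.

Definition end_ku (a : 'I_2) : 'I_N :=
  if a == ord0 then so_coord plane1 false else so_coord plane0 true.

Definition end_in (Y : 'M[R[i]]_2) : 'M[R[i]]_N :=
  utw f (\matrix_(u, v) unitary_entry end_kd Y u v).

Definition end_out X : 'M[R[i]]_2 := \matrix_(a, c) tw f X (end_ku a) (end_ku c).

Lemma ord2P (a : 'I_2) : a = ord0 \/ a = ord_max.
Proof. by case: a => -[|[|]] // h; [left|right]; apply: val_inj. Qed.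

Lemma plane10 : plane1 == plane0 = false. Proof. by []. Qed.

Lemma end_kdP u a t : end_kd u = Some (a, t) ->
  u = (if a == ord0 then so_coord plane1 t else so_coord plane0 (~~ t)).
Proof.
rewrite /end_kd; case eu: (so_kd u) => [[k s]|] //.
have [k0|k0] := eqVneq k plane0; first by move=> -[<- <-]; rewrite negbK -k0; exact: (so_kdP eu).
by have [k1|k1] := eqVneq k plane1; rewrite // => -[<- <-] /=; rewrite -k1; exact: (so_kdP eu).
Qed.

Lemma end_kd_coord k s : end_kd (so_coord k s) =
  if k == plane0 then Some (ord_max, ~~ s) else if k == plane1 then Some (ord0, s) else None.
Proof. by rewrite /end_kd so_kd_coord. Qed.

Lemma end_embedding : unitary_embedding f end_kd end_ku end_in end_out.
Proof.
have ku a : end_kd (end_ku a) = Some (a, false).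
  by case: (ord2P a) => ->; [exact: (end_kd_coord plane1 false)|exact: (end_kd_coord plane0 true)].
have twE Y u v : tw f (end_in Y) u v = unitary_entry end_kd Y u v.
  by rewrite /end_in utwK mxE.
split=> //.
- by move=> u v [a t] /end_kdP -> /end_kdP ->.
- move=> _ u; rewrite /end_kd so_kd_star; case: (so_kd u) => [[k s]|] //=.
  by case: ifP => // _; case: ifP.
- by move=> u v a c s _ _; rewrite /= mulr1.
by move=> Y; apply/matrixP => a c; rewrite mxE twE /unitary_entry !ku.
Qed.
Let ue := end_embedding.

Lemma end_planes u : in_planes 2 u = (end_kd u != None).
Proof.
rewrite in_planes_kd /end_kd; case eu: (so_kd u) => [[k s]|]; last first.
  by move: eu; rewrite /so_kd; case: (fintype.split u) => // -[].
rewrite -!val_eqE /=; case: k eu => -[|[|k]] hk //=.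
Qed.

Let pg : (2 <= 2 + false)%N. Proof. by []. Qed.
Let ad2 := so_bdi_adapted (R := R) m2 pg.

Lemma wt_end_cow2 u a t : end_kd u = Some (a, t) -> wt f u (w2 1%N) = (-1) ^+ t * ('i / 2%:R).
Proof.
move=> /end_kdP ->; rewrite wt_bdi_cow //.
by case: ifP => _; rewrite so_kd_coord (bdi_theta_four m2 pg) //= ?signrN; ring.
Qed.

Lemma sgn_half_inj (s t : bool) : (-1) ^+ s * ('i / 2%:R) = (-1) ^+ t * ('i / 2%:R) :> R[i] -> s = t.
Proof.
have i0 : 'i / 2%:R != 0 :> R[i] by rewrite mulf_neq0 ?neq0Ci ?invr_eq0 ?pnatr_eq0.
move/(mulIf i0) => /eqP; case: s; case: t; rewrite // expr0 expr1 -subr_eq0.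
  by rewrite -opprD oppr_eq0 -mulr2n pnatr_eq0.
by rewrite opprK -mulr2n pnatr_eq0.
Qed.

Lemma end_rel_wt u v : so_rel 2 u v -> wt f u (w2 1%N) = wt f v (w2 1%N) -> su_rel end_kd 2 u v.
Proof.
rewrite /so_rel !end_planes /su_rel => /andP[].
case eu: (end_kd u) => [[a s]|] // _; case ev: (end_kd v) => [[c t]|] // _.
by rewrite (wt_end_cow2 eu) (wt_end_cow2 ev) => /sgn_half_inj ->; rewrite eqxx !ltn_ord.
Qed.

Lemma end_rel_sub u v : su_rel end_kd 2 u v -> so_rel 2 u v /\ wt f u (w2 1%N) = wt f v (w2 1%N).
Proof.
rewrite /so_rel !end_planes /su_rel.
case eu: (end_kd u) => [[a s]|] //; case ev: (end_kd v) => [[c t]|] // /and3P[/eqP st _ _].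
by rewrite (wt_end_cow2 eu) (wt_end_cow2 ev) st.
Qed.

Local Notation E2 := (mapD end_in end_out (suD R 2 2)).
Let ad' := su_adapted ue (isT : (0 < 2)%N) (leqnn 2).

Lemma end_alg_sub : alg E2 `<=` alg D2.
Proof.
move=> X; rewrite (ad_alg ad') (ad_alg ad2) => -[h1 h2 h3 _]; split=> //; last by rewrite big_pred0.
move=> u v nuv; apply: h3; apply: contra nuv => h.
by have [] := end_rel_sub h.
Qed.

Lemma wt_end_pair X : so_alg R N X ->
  \sum_(u | su_plus end_kd 2 u) tw f X u u = plane_eps plane1 X - plane_eps plane0 X.
Proof.
move=> sX; rewrite (sum_su_plus ue) big_mkcond !big_ord_recl big_ord0.
transitivity (wt f (so_coord plane1 false) X + (wt f (so_coord plane0 true) X + 0)); first by [].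
by rewrite addr0 !wt_so // expr0 expr1; ring.
Qed.

(** On so(4) the coweight distinguishes exactly the two copies of [end_kd], so its centralizer is a
    copy of u(2), and the trace condition removes the line of the coweight. *)
Lemma end_semisimple_part : semisimple_part D2 1 E2.
Proof.
apply: (ad_semisimple_part ad2 ad') => //.
- by move=> u v /end_rel_sub.
- move=> u v x rux e rxv; exact: (su_rel_trans (end_rel_wt rux e) rxv).
- move=> u v ruv e; exact: (su_rel_plus (end_rel_wt ruv e)).
- exact: end_alg_sub.
- move=> X aX /(ad_tor_commute X ad2 (ad_cow_tor ad2 (isT : (1 <= 1 <= 2)%N))) cX.
  have caX := sub_complexification (ad_subspace ad2) aX.
  have [sX _] := aX; have [rX _] := sX.
  have tw1 := ad_cow_tor ad2 (isT : (1 <= 1 <= rnk D2)%N).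
  have real k : exists t : R, X (xcoord false k) (ycoord false k) = (t%:C)%C.
    by exists (complex.Re (X (xcoord false k) (ycoord false k))); rewrite RRe_real.
  have [t1 e1] := real plane1; have [t0 e0] := real plane0.
  (* The partial trace is eps_1 - eps_2, which equals 'i on the coweight and 'i (t1 - t0) on X. *)
  exists (t1 - t0); have aB : alg D2 (X - ((t1 - t0)%:C)%C *: w2 1%N).
    apply: (real_subspaceB (ad_subspace ad2)) => //.
    by case: (ad_subspace ad2) => _ _; apply; exact: (ad_tor_sub ad2).
  have [sB _] := aB; move: (aB); rewrite (ad_alg ad2) => -[h1 h2 h3 _].
  rewrite (ad_alg ad'); split=> //.
    move=> u v nuv; rewrite twD twN twZ !mxE.
    have w0 : tw f (w2 1%N) u v = 0.
      have [uv|uv] := eqVneq u v; last by have /(ad_torP ad2)[_ h] := tw1; exact: h.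
      rewrite -uv in nuv *; have := end_planes u; case eu: (end_kd u) => [[a t]|].
        by move: nuv; rewrite /su_rel eu eqxx !ltn_ord.
      move=> /negbT npu; apply/eqP; apply: contraNT npu => h.
      have aw := sub_complexification (ad_subspace ad2) (ad_tor_sub ad2 tw1).
      by have [/andP[]] := ad_complexP ad2 aw h.
    rewrite w0 mulr0 subr0; apply/eqP; apply: contraNT nuv => Xuv.
    apply: end_rel_wt (cX u v Xuv); by have [] := ad_complexP ad2 caX Xuv.
  rewrite wt_end_pair // !plane_eps_ord.
  have ew k s : wt f (so_coord k s) (w2 1%N) = (-1) ^+ s * plane_eps k (w2 1%N).
    by apply: wt_so; case: tw1.
  have := ew plane1 false; rewrite expr0 mul1r plane_eps_ord (wt_end_cow2 (a := ord0) (t := false)); last first.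
    by rewrite end_kd_coord.
  have := ew plane0 true; rewrite expr1 mulN1r plane_eps_ord (wt_end_cow2 (a := ord_max) (t := false)); last first.
    by rewrite end_kd_coord.
  rewrite expr0 mul1r => q0 q1.
  have i0 := neq0Ci R[i].
  have q0' : w2 1%N (xcoord false plane0) (ycoord false plane0) = - 2%:R^-1.
    by apply: (mulfI i0); rewrite -[LHS]opprK -q0; ring.
  have q1' : w2 1%N (xcoord false plane1) (ycoord false plane1) = 2%:R^-1.
    by apply: (mulfI i0); rewrite -q1.
  rewrite !mxE e1 e0 q0' q1' rmorphB /=; by field.
(* The difference of the weights eps_1 and - eps_2 is the simple root eps_1 + eps_2 of the node
   2. *)
move=> j /= hj; exists 2%N; split=> // H tH; have {hj} -> : j = 1%N by lia.
have /end_alg_sub[sH _] : alg E2 H by exact: (ad_tor_sub ad').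
have -> : diag_eps 1 (end_out H) = wt f (so_coord plane1 false) H.
  have := diag_eps_ord (end_out H) (ord0 : 'I_2); rewrite /= => ->.
  by rewrite mxE.
have -> : diag_eps 2 (end_out H) = wt f (so_coord plane0 true) H.
  have := diag_eps_ord (end_out H) (ord_max : 'I_2); rewrite /= => ->.
  by rewrite mxE.
by rewrite !wt_so // expr0 expr1 mul1r mulN1r opprK.
Qed.

(** The monomials of V_+ after the node 1 of so(4), as found in [bdi_spin_minimal_four]. *)
Definition end_set (e : bool) : pred {set 'I_m} :=
  if e then spin_set (b := false) e 1 else spin_set (b := false) e 2.

Lemma spin_set_one e I : spin_set (b := false) e 1 I -> I = if e then [set plane0]%SET else finset.set0.
Proof.
move=> /andP[/forall_inP hI /eqP oI].
have sub : (I \subset [set plane0])%SET.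
  by apply/fintype.subsetP => k /hI; rewrite inE -val_eqE /=; case: (k : nat).
move: oI sub; rewrite subset1 => <- /orP[/eqP ->|/eqP ->]; first by rewrite cards1.
by rewrite cards0.
Qed.

Lemma spin_set_two I : spin_set (b := false) false 2 I -> ~~ spin_set (b := false) false 1 I ->
  I = [set plane0; plane1]%SET.
Proof.
move=> TI nI; have /andP[/forall_inP h /eqP oI] := TI.
have p1 : plane1 \in I.
  apply: contraNT nI => n1; rewrite /spin_set oI andbT; apply/forall_inP => k kI.
  have := h k kI; have : k != plane1 by apply: contraNneq n1 => <-.
  by rewrite -val_eqE /=; case: (k : nat) => [|[|]].
have p0 : plane0 \in I.
  apply: contraFT oI => n0; have -> : I = [set plane1]%SET; last by rewrite cards1.
  apply/setP => k; rewrite inE; apply/idP/eqP => [kI|-> //]; apply/val_inj.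
  have := h k kI; have : k != plane0 by apply: contraNneq n0 => <-.
  by rewrite -val_eqE /=; case: (k : nat) => [|[|]].
apply/setP => k; rewrite !inE; apply/idP/orP => [kI|[/eqP ->|/eqP ->] //].
have := h k kI; rewrite -!val_eqE /=; case: (k : nat) => [|[|]] // _; by [left|right].
Qed.

(** The roles of the two parities are exchanged with respect to the node 1. For odd parity a single
    monomial is left and su(2) acts trivially; for even parity the empty monomial and the product of
    both variables form the two-dimensional representation. Either way one monomial remains in the
    end. *)
Lemma end_spin_minimal e :
  phi_minimal E2 1 spin (wspan B (end_set e)) (wspan B (spin_set (b := false) e 1))
    (wspan B (fun I => end_set e I && ~~ spin_set (b := false) e 1 I)) (if e then 0 else 'i / 2%:R).
Proof.
have antis X : alg E2 X -> X^T = - X by move=> /end_alg_sub; exact: so_bdi_antisym.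
have rep : is_rep (alg E2) spin by exact: spin_is_rep antis.
have [_ ideal _ torE _] := end_semisimple_part.
have diag : diag_on B spin (spin_wt (R := R) (b := false) (m := m)) (tor E2).
  by move=> H I tH; apply: (spin_diag m2 pg); move: tH; rewrite torE => -[].
have pe k H : tor E2 H -> plane_eps k H = wt f (so_coord k false) H.
  by move=> tH; rewrite wt_so ?expr0 ?mul1r //; move: tH; rewrite torE => -[[]].
have h1 : (1 <= 1 <= rnk E2)%N by [].
pose w s := end_in (su_cow 2 s).
have tw1 : tor E2 (w 1%N) := ad_cow_tor ad' h1.
have wp1 : wt f (so_coord plane1 false) (w 1%N) = (-1) ^+ false * ('i * (1%:R - 1%:R / 2%:R)).
  have k1 : end_kd (so_coord plane1 false) = Some (ord0, false) by rewrite end_kd_coord.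
  by rewrite /w (su_cow_wt ue (isT : (0 < 2)%N) (leqnn 2) k1).
have wp0 : wt f (so_coord plane0 false) (w 1%N) = (-1) ^+ true * ('i * (0%:R - 1%:R / 2%:R)).
  have k0 : end_kd (so_coord plane0 false) = Some (ord_max, true) by rewrite end_kd_coord.
  by rewrite /w (su_cow_wt ue (isT : (0 < 2)%N) (leqnn 2) k0).
have wI I : spin_wt (b := false) I (w 1%N) = 2%:R^-1 * ('i / 2%:R) * ((-1) ^+ (plane0 \in I) + (-1) ^+ (plane1 \in I)).
  rewrite /spin_wt (bigD1 plane0) // (bigD1 plane1) // big1 => [|k /andP[/andP[_ k0] k1]].
    by rewrite !pe // wp1 wp0 expr0 expr1 /=; field.
  have -> : plane_eps k (w 1%N) = 0; last by rewrite mulr0.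
  rewrite pe //; by rewrite /wt (ue_tw ue) /unitary_entry end_kd_coord (negbTE k0) (negbTE k1).
have sub1 I : spin_set (b := false) e 1 I -> end_set e I.
  rewrite /end_set; case: (e) => // /andP[/forall_inP h h2]; apply/andP; split; last exact: h2.
  by apply/forall_inP => k /h; case: (k : nat).
pose top : {set 'I_m} := if e then [set plane0]%SET else finset.set0.
have Ttop : spin_set (b := false) e 1 top.
  rewrite /top /spin_set; case: (e); rewrite ?cards1 ?cards0 andbT; apply/forall_inP => k; rewrite inE //.
  by move=> /eqP ->.
(* Invariance is inherited from the preceding step: its V_+ is stable under k_phi, which contains
   [alg E2]. *)
have inv : invariant_sub (alg E2) spin (wspan B (end_set e)).
  have pm : phi_minimal D2 1 spin (wspan B (spin_set (b := false) e 2)) (wspan B (end_set e))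
      (wspan B (fun I => spin_set (b := false) e 2 I && ~~ end_set e I)) (if e then 'i / 2%:R else 0).
    exact: (bdi_spin_minimal_four m2 pg e isT erefl).
  have [L [rho [_ [_ _ _ [_ hinv _]]]]] := pm.
  case: ideal => _ sub _ X aX; exact: (hinv X (sub X aX)).
have wts I : end_set e I -> spin_wt (b := false) I (w 1%N) =
    if spin_set (b := false) e 1 I then (if e then 0 else 'i / 2%:R) else (if e then 0 else 'i / 2%:R) - 'i.
  rewrite wI /end_set; have [he|he] : e = true \/ e = false by case: (e); [left|right].
    rewrite he => hI; rewrite hI; have -> := spin_set_one hI.
    by rewrite !inE eqxx plane10 /= expr0 expr1; field.
  rewrite he => hI; case: ifP => h.
    by have -> := spin_set_one h; rewrite !inE /= expr0; field.
  have -> := spin_set_two hI (negbT h).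
  by rewrite !inE !eqxx orbT /= expr1; field.
have uniq1 I J : spin_set (b := false) e 1 I -> spin_set (b := false) e 1 J -> I = J.
  by move=> /spin_set_one -> /spin_set_one ->.
have sep : separated_on (spin_wt (R := R) (b := false) (m := m)) (tor E2) (end_set e).
  move=> I J TI TJ IJ; exists (w 1%N) => //; rewrite !wts //.
  have i0 := neq0Ci R[i].
  case hI: (spin_set e 1 I); case hJ: (spin_set e 1 J).
  - by rewrite (uniq1 _ _ hI hJ) eqxx in IJ.
  - by rewrite -subr_eq0 opprB addrCA subrr addr0.
  - by rewrite eq_sym -subr_eq0 opprB addrCA subrr addr0.
  move: TI TJ IJ hI hJ; rewrite /end_set; case: (e) => [TI TJ _ hI _|TI TJ IJ hI hJ].
    by rewrite TI in hI.
  by rewrite (spin_set_two TI (negbT hI)) (spin_set_two TJ (negbT hJ)) eqxx in IJ.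
have con : connected B spin (alg E2) (end_set e).
  rewrite /end_set; have [he|he] : e = true \/ e = false by case: (e); [left|right].
    by rewrite he => Q _ I J /spin_set_one -> /spin_set_one ->.
  rewrite he; apply: spin_connected => [//|//|I k l _ kl kp lp TI].
  have kk (x : 'I_m) : (x < 2)%N -> x = plane0 \/ x = plane1.
    by case: x => -[|[|x]] // h _; [left|right]; apply: val_inj.
  have io : I = finset.set0 \/ I = [set plane0; plane1]%SET.
    have [h|h] := boolP (spin_set (b := false) false 1 I); [left|right].
      exact: spin_set_one h.
    exact: spin_set_two.
  apply: (rvec_alg ad'); last first.
    by apply: contra kl => /eqP e'; have := congr1 so_kd e'; rewrite !so_kd_coord => -[->].
  by case: (kk k kp) kl => ->; case: (kk l lp) => -> //; case: io => -> _;
    rewrite /su_rel !end_kd_coord !inE.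
have conP : connected B spin (k_phi E2 1) (spin_set (b := false) e 1).
  by move=> Q _ I J /spin_set_one -> /spin_set_one ->.
have dom I j : end_set e I -> (1 <= j <= rnk E2)%N ->
    exists2 x : R[i], 0 <= x & spin_wt (b := false) top (w j) - spin_wt (b := false) I (w j) = x * 'i.
  move=> TI /= hj; have {hj} -> : j = 1%N by lia.
  rewrite !wts ?Ttop //; last exact: sub1.
  case: (spin_set e 1 I); first by exists 0; rewrite ?subrr ?mul0r.
  by exists 1; rewrite ?ler01 // mul1r opprB addrCA subrr addr0.
exact: (wspan_phi_minimal ad' spin_complex_linear rep diag h1 sep inv con conP Ttop sub1 wts dom).
Qed.

End EvenEnd.

Lemma lfun_add_scalar (K : fieldType) (V : vectType K) (f : 'End(V)) c v :
  (f + c *: \1%VF) v = f v + c *: v.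
Proof. by rewrite add_lfunE scale_lfunE id_lfunE. Qed.

(** * Restriction of the spin representation to so(N - 2j) and the split off rotations *)

Section SpinRestriction.
Context {R : realType} {b : bool} {m : nat}.
Variable j : nat.
Local Notation N := (b + (m + m))%N.
Local Notation n := (m - j)%N.
Local Notation spin := (@spin_rep R b m).
Implicit Types (u v : 'I_(b + (n + n))) (k : 'I_n) (I : {set 'I_m}) (g : ext R n) (X : 'M[R[i]]_N).

Let wd (k : 'I_n) : 'I_m := widen_ord (leq_subr j m) k.

Lemma so_kd_plane_incl u :
  so_kd (plane_incl (j := j) u) = omap (fun z => (wd z.1, z.2)) (so_kd u).
Proof.
rewrite /plane_incl [so_kd u]/so_kd; case: (fintype.split u) => [z|v]; first exact: so_kd_None.
by case: (fintype.split v) => k; [exact: (so_kd_coord (wd k) false)|exact: (so_kd_coord (wd k) true)].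
Qed.

Lemma in_planes_incl u : in_planes n (plane_incl (j := j) u).
Proof. by rewrite in_planes_kd so_kd_plane_incl; case: (so_kd u) => [[k s]|] //=. Qed.

Lemma sum_plane_incl (V : nmodType) (F : 'I_N -> V) : (forall c : 'I_N, ~~ in_planes n c -> F c = 0) ->
  \sum_(c : 'I_N) F c = \sum_u F (plane_incl (j := j) u).
Proof.
move=> F0; rewrite !sum_so_coord.
have narrow s : \sum_(l < m) F (so_coord l s) = \sum_(k < n) F (so_coord (wd k) s).
  rewrite (bigID (fun k : 'I_m => (k < n)%N)) /= [X in _ + X]big1 ?addr0 => [|k kn]; last first.
    by apply: F0; rewrite in_planes_kd so_kd_coord.
  exact: (big_ord_narrow (leq_subr j m)).
congr (_ + (_ + _)).
- apply: eq_bigr => z _; congr F; apply: so_kd_inj.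
  by rewrite so_kd_plane_incl !so_kd_None.
- rewrite (narrow false); apply: eq_bigr => k _; congr F; apply: so_kd_inj.
  by rewrite so_kd_plane_incl -[xcoord b k]/(so_coord k false) !so_kd_coord.
- rewrite (narrow true); apply: eq_bigr => k _; congr F; apply: so_kd_inj.
  by rewrite so_kd_plane_incl -[ycoord b k]/(so_coord k true) !so_kd_coord.
Qed.

(** The flag t tells whether the variables of the split off planes are all absent or all present in
    the image of K. Each rotation of such a plane then acts by the same scalar, with a sign given by
    t, while K intertwines the bivectors of the remaining coordinates. *)
Lemma spin_restrict (t : bool) (K : 'Hom(ext R n, ext R m)) X g :
  (forall u v g, gamma (plane_incl (j := j) u) (gamma (plane_incl (j := j) v) (K g)) = K (gamma u (gamma v g))) ->
  (forall g I, K g I != 0 :> R[i] -> forall k : 'I_m, (n <= k)%N -> (k \in I) = t) ->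
  so_block R b m n X -> spin X (K g) = K (spin_char (b := b) j ((-1) ^+ t * ('i / 2%:R)) X g).
Proof.
move=> hK hKt [sX hX].
(* [X1] is the component on the remaining coordinates. The difference [X - X1] only rotates the
   split off planes, so [spin_torus] applies to it. *)
pose X1 : 'M[R[i]]_N := \matrix_(a, c) (if so_rel n a c then X a c else 0).
have tX a c : X c a = - X a c.
  by case: sX => _ e; have := congr1 (fun Z : 'M_N => Z a c) e; rewrite !mxE.
have eX : spin X (K g) = spin X1 (K g) + spin (X - X1) (K g).
  have /lfunP/(_ (K g)) := complex_linearD (@spin_complex_linear R b m) X1 (X - X1).
  by rewrite add_lfunE addrC subrK.
set c := (-1) ^+ t * _.
have eC := lfun_add_scalar (spin_rep (so_sub j X))
  (c * \sum_(k < m | (n <= k)%N) X (xcoord b k) (ycoord b k)) g.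
have eK := etrans (congr1 K eC) (etrans (raddfD K _ _) (congr1 (+%R _) (linearZ_LR K _ _))).
apply: (etrans eX); apply: (etrans _ (esym eK)); congr (_ + _).
  apply: (etrans (spin_repE _ _)); apply: (etrans _ (esym (lfun_spin_rep K _ _))); congr (_ *: _).
  rewrite sum_plane_incl => [|u nu]; last first.
    by apply: big1 => v _; rewrite mxE /so_rel (negbTE nu) scale0r.
  apply: eq_bigr => u _; rewrite sum_plane_incl => [|v nv]; last first.
    by rewrite mxE /so_rel (negbTE nv) andbF scale0r.
  apply: eq_bigr => v _; rewrite !mxE /so_rel !in_planes_incl; congr (_ *: _).
  by rewrite (hK u v g) (hK v u g) linearB.
apply: ext_ext => I; rewrite ext_scaleE spin_torus.
- have [->|Kg] := eqVneq (K g I : R[i]) 0; first by rewrite !mulr0.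
  congr (_ * _); rewrite /spin_wt [in RHS]big_mkcond /= !mulr_sumr; apply: eq_bigr => k _.
  rewrite plane_eps_ord !mxE /so_rel !in_planes_kd.
  rewrite -[xcoord b k]/(so_coord k false) -[ycoord b k]/(so_coord k true) !so_kd_coord andbb.
  have [kn|kn] := ltnP k n; first by rewrite subrr !mulr0.
  rewrite (hKt _ _ Kg k kn) subr0 /c -[so_coord k false]/(xcoord b k) -[so_coord k true]/(ycoord b k).
  by move: (X _ _) => y; ring.
- apply/matrixP => u v; rewrite !mxE (tX u v) /so_rel [in_planes n v && _]andbC.
  by case: ifP => _; move: (X u v) => y; ring.
move=> u v uv; rewrite !mxE; case: ifP => ruv; first by rewrite subrr.
by rewrite subr0; apply: hX => //; rewrite -[_ && _]/(so_rel n u v) ruv.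
Qed.

Let pre I : {set 'I_n} := [set k : 'I_n | wd k \in I]%SET.
Let below I : bool := [forall k in I, (k < n)%N].

Let raw g : ext R m := [ffun I => if below I then g (pre I) else 0].

Definition ext_incl : 'Hom(ext R n, ext R m) := linfun raw.

Lemma ext_inclE g I : ext_incl g I = (if below I then g (pre I) else 0) :> R[i].
Proof.
rewrite /ext_incl linfunE; first by rewrite ffunE.
move=> c g1 g2; apply: ext_ext => I'; rewrite ext_addE ext_scaleE !ffunE.
by case: ifP => _; rewrite ?mulr0 ?addr0 // ext_addE ext_scaleE.
Qed.

Let wd_inj : injective wd.
Proof. by move=> k l /(congr1 val) /= /val_inj. Qed.

Let preK I : below I -> (wd @: pre I)%SET = I.
Proof.
move=> /forall_inP h; apply/setP => k; apply/imsetP/idP => [[l lI ->]|kI].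
  by move: lI; rewrite inE.
by exists (Ordinal (h k kI)); rewrite ?inE; [rewrite (_ : wd _ = k) //|]; apply: val_inj.
Qed.

Let imK (I' : {set 'I_n}) : pre (wd @: I')%SET = I' /\ below (wd @: I')%SET.
Proof.
split; last by apply/forall_inP => _ /imsetP[k _ ->]; exact: ltn_ord k.
apply/setP => k; rewrite inE; apply/imsetP/idP => [[l lI /wd_inj ->] //|kI].
by exists k.
Qed.

(** A Koszul sign counts only smaller variables, and these all belong to the first planes; for x_0
    the degree is unchanged by the inclusion. *)
Lemma gamma_ext_incl u g :
  gamma (plane_incl (j := j) u) (ext_incl g) = ext_incl (gamma u g).
Proof.
apply: ext_ext => I; rewrite gammaE !ext_inclE /gamma_phase /gamma_toggle so_kd_plane_incl.
case eu: (so_kd u) => [[k s]|] /=; last first.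
  case: ifP => // bI; last by rewrite mulr0.
  by rewrite gammaE /gamma_phase /gamma_toggle eu -{1}(preK bI) card_imset.
have bt : below (toggle (wd k) I) = below I by apply: below_toggle; exact: ltn_ord k.
rewrite bt; case: (boolP (below I)) => bI; last by rewrite mulr0.
rewrite gammaE /gamma_phase /gamma_toggle eu.
have -> : pre (toggle (wd k) I) = toggle k (pre I).
  by apply/setP => l; rewrite inE !in_toggle inE (inj_eq wd_inj).
have -> : koszul (wd k) I = koszul k (pre I) :> R[i].
  rewrite /koszul -(card_imset [set l in pre I | (l < k)%N]%SET wd_inj); congr (_ ^+ #|pred_of_set _|).
  apply/setP => l; rewrite inE; apply/andP/imsetP => [[lI lk]|[l' + ->]]; last by rewrite !inE => /andP[].
  have ln : (l < n)%N by apply: leq_trans lk _; exact: ltnW (ltn_ord k).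
  have el : l = wd (Ordinal ln) by apply: val_inj.
  by exists (Ordinal ln) => //; rewrite !inE -el lI.
by rewrite inE.
Qed.

Lemma ext_incl_inj : lker ext_incl = 0%VS.
Proof.
apply/eqP/lker0P => g1 g2 e; apply: ext_ext => I'.
have [pI bI] := imK I'.
by have := congr1 (fun h : ext R m => h (wd @: I')%SET : R[i]) e; rewrite /= !ext_inclE bI pI.
Qed.

Lemma limg_ext_incl : limg ext_incl = ext_first R m n.
Proof.
apply/vspaceP => /= h; apply/memv_imgP/idP => [[g _ ->]|hh].
  by apply/(mem_wspan ext_wb) => I nI /=; rewrite ext_inclE (negbTE (nI : ~~ below I)).
exists ([ffun I' : {set 'I_n} => h (wd @: I')%SET] : ext R n); first exact: memvf.
apply: ext_ext => I; rewrite ext_inclE; case: ifP => bI; first by rewrite ffunE (preK bI).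
by move/(mem_wspan ext_wb): hh => /(_ I (negbT bI)).
Qed.

Lemma ext_incl_below g I : ext_incl g I != 0 :> R[i] ->
  forall k : 'I_m, (n <= k)%N -> (k \in I) = false.
Proof.
rewrite ext_inclE; case: ifP => [/forall_inP h _ k nk|]; last by rewrite eqxx.
by apply/negP => /h; rewrite ltnNge nk.
Qed.

Lemma spin_first_iso : rep_iso (so_block R b m n) spin (ext_first R m n) (spin_char j ('i / 2%:R)).
Proof.
exists ext_incl; split; [exact: ext_incl_inj|exact: limg_ext_incl|move=> X g hX].
have := @spin_restrict false ext_incl X g _ ext_incl_below hX; rewrite expr0 mul1r; apply.
by move=> u v g'; rewrite (gamma_ext_incl v) (gamma_ext_incl u).
Qed.

End SpinRestriction.

Section SpinLast.
Context {R : realType} {b : bool} {m : nat}.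
Hypothesis m0 : (0 < m)%N.
Local Notation spin := (@spin_rep R b m).

Let hl : (m.-1 < m)%N. Proof. by rewrite prednK. Qed.
Let last : 'I_m := Ordinal hl.
Let x : 'I_(b + (m + m)) := so_coord last false.
Let kx : so_kd x = Some (last, false). Proof. exact: so_kd_coord. Qed.

(* Clifford multiplication by [x_m] maps the forms without [d\bar z_m] onto those with [d\bar z_m];
   it commutes with the bivectors of the other planes. *)
Lemma spin_last_iso : rep_iso (so_block R b m (m - 1)) spin (ext_last R m) (spin_char 1 (- ('i / 2%:R))).
Proof.
pose J := ext_incl (R := R) (m := m) 1.
pose K : 'Hom(ext R (m - 1), ext R m) := (gamma x \o J)%VF.
have KE g : K g = gamma x (J g) by rewrite comp_lfunE.
have lastP (k : 'I_m) : (m - 1 <= k)%N -> k = last.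
  by move=> mk; apply: val_inj => /=; have := ltn_ord k; lia.
have lastE (I : {set 'I_m}) : [exists k in I, k.+1 == m] = (last \in I) :> bool.
  apply/exists_inP/idP => [[k kI /eqP ek]|lI]; last by exists last => //=; rewrite prednK.
  by rewrite (_ : last = k) //; apply: val_inj => /=; lia.
have firstE (I : {set 'I_m}) : [forall k in I, (k < m - 1)%N] = (last \notin I) :> bool.
  apply/forall_inP/idP => [h|nl k kI]; first by apply/negP => /h /=; lia.
  by rewrite ltnNge; apply: contra nl => /lastP <-.
exists K; split.
- apply/eqP/lker0P => g1 g2; rewrite !KE => e.
  have /eqP/lker0P inj := ext_incl_inj (R := R) (m := m) 1; apply: inj.
  by rewrite -(gamma_sq x (ext_incl 1 g1)) -(gamma_sq x (ext_incl 1 g2)) e.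
- apply/vspaceP => h; apply/memv_imgP/idP => [[g _ ->]|hh].
    apply/(mem_wspan ext_wb) => I; rewrite lastE => nI /=.
    rewrite KE gammaE /gamma_toggle kx ext_inclE firstE in_toggle eqxx addbT negbK (negbTE nI).
    by rewrite mulr0.
  have : gamma x h \in ext_first R m (m - 1).
    apply/(mem_wspan ext_wb) => I /=; rewrite firstE negbK => lI.
    rewrite gammaE /gamma_toggle kx; move/(mem_wspan ext_wb): hh => /(_ (toggle last I)) /= -> //.
      by rewrite mulr0.
    by rewrite lastE in_toggle eqxx addbT lI.
  rewrite -limg_ext_incl => /memv_imgP[g _ eg]; exists g; first exact: memvf.
  by rewrite KE -[ext_incl 1 g]eg gamma_sq.
move=> X g hX; have := @spin_restrict R b m 1 true K X g _ _ hX; rewrite expr1 mulN1r; apply.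
  move=> u v g'; rewrite !KE.
  have neq u' : plane_incl (j := 1) u' != x.
    apply/eqP => e; have := in_planes_incl (b := b) (m := m) (j := 1) u'.
    by rewrite e in_planes_kd kx /=; lia.
  rewrite (gamma_anti _ (neq v)) linearN /= (gamma_anti _ (neq u)) opprK.
  by rewrite (gamma_ext_incl v) (gamma_ext_incl u).
move=> g' I; rewrite KE gammaE mulf_eq0 negb_or /gamma_toggle kx => /andP[_ h] k mk.
have := ext_incl_below h mk; rewrite in_toggle -(lastP k mk) eqxx addbT.
by case: (k \in I).
Qed.

End SpinLast.

(** * Spin components as spans of monomials, and the assembled chains *)

Section SpinSets.
Context {R : realType} {b : bool} {m : nat}.
Local Notation B := (ext_wb (R := R) (m := m)).
Implicit Types (I : {set 'I_m}) (U : {vspace ext R m}).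

Lemma spin_componentP U : spin_component b U -> exists e, U = wspan B (spin_set (b := b) e m).
Proof.
have full I : [forall k in I, (k < m)%N] by apply/forall_inP => k _; exact: ltn_ord.
have [hb|hb] : b = true \/ b = false by case: (b); [left|right].
  rewrite /spin_component (ifT _ _ hb) => ->; exists true; rewrite -(wspan_full B).
  by apply: eq_wspan => I; rewrite /spin_set full hb.
rewrite /spin_component (ifF _ _ hb) => -[e ->]; exists e.
by apply: (eq_wspan B) => I; rewrite /spin_set full hb.
Qed.

Lemma spin_set_le e p q I : (p <= q)%N -> spin_set (b := b) e p I -> spin_set (b := b) e q I.
Proof.
move=> pq /andP[/forall_inP h h2]; apply/andP; split; last exact: h2.
by apply/forall_inP => k /h /leq_trans; apply.
Qed.

Lemma ext_first_cap e p : (p <= m)%N ->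
  (ext_first R m p :&: wspan B (spin_set (b := b) e m))%VS = wspan B (spin_set (b := b) e p).
Proof.
move=> pm; apply: (etrans (wspan_cap B (fun I => [forall k in I, (k < p)%N]) _)); apply: eq_wspan => I /=.
apply/andP/idP => [[h /andP[_ h2]]|h]; first by apply/andP.
by split; [case/andP: h|exact: spin_set_le h].
Qed.

Lemma below_last I : (0 < m)%N ->
  [exists k in I, k.+1 == m] = ~~ [forall k in I, (k < m - 1)%N].
Proof.
move=> m0; rewrite negb_forall_in; apply/exists_inP/exists_inP => -[k kI h]; exists k => //;
  by move: h; have := ltn_ord k; lia.
Qed.

Lemma ext_last_cap e : (0 < m)%N ->
  (ext_last R m :&: wspan B (spin_set (b := b) e m))%VS =
  wspan B (fun I => spin_set (b := b) e m I && ~~ spin_set (b := b) e m.-1 I).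
Proof.
move=> m0; apply: (etrans (wspan_cap B (fun I => [exists k in I, k.+1 == m]) _)); apply: eq_wspan => I /=.
rewrite below_last // andbC; apply: andb_id2l => /andP[_ h2].
by rewrite /spin_set h2 andbT subn1.
Qed.

Lemma ext_dsum : (0 < m)%N -> is_dsum fullv (ext_first R m (m - 1)) (ext_last R m).
Proof.
move=> m0; rewrite -(wspan_full B).
have -> : ext_last R m = wspan B (fun I => predT I && ~~ [forall k in I, (k < m - 1)%N]).
  by apply: (eq_wspan B) => I; rewrite below_last.
exact: wspan_dsum.
Qed.

Lemma spin_node_minimal e p : (p <= m)%N -> (2 <= p + b)%N ->
  is_phi_minimal (so_bdi R b m p) 1 (@spin_rep R b m) (wspan B (spin_set (b := b) e p)).
Proof.
move=> pm pb; have [g|/norP[nb np]] := boolP (b || (2 < p)%N).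
  by do 3 eexists; exact: (bdi_spin_minimal_split pm pb e g).
have p2 : p = 2%N by move: pb; rewrite (negbTE nb); lia.
by do 3 eexists; exact: (bdi_spin_minimal_four pm pb e nb p2).
Qed.

Lemma spin_chain_minimal (E : nat -> rootDatum R (b + (m + m))) (s : nat -> nat) l
    (T : nat -> pred {set 'I_m}) :
  (forall i I, T i.+1 I -> T i I) ->
  (forall i, (i < l)%N -> exists lam, phi_minimal (E i) (s i) (@spin_rep R b m)
     (wspan B (T i)) (wspan B (T i.+1)) (wspan B (fun I => T i I && ~~ T i.+1 I)) lam) ->
  exists Vp Vm, [/\ chain_minimal E s l (@spin_rep R b m) (wspan B (T 0%N)) Vp Vm,
    forall i, Vp i = wspan B (T i) &
    forall i, is_dsum (wspan B (T 0%N)) (Vp i) (W_minus Vm i)].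
Proof.
move=> dec h; pose Vm i := wspan B (fun I => T i.-1 I && ~~ T i I).
exists (fun i => wspan B (T i)), Vm; split=> // i.
have -> : W_minus Vm i = wspan B (fun I => T 0%N I && ~~ T i I).
  exact: (W_minus_wspan dec (fun j _ => erefl (Vm j.+1)) (leqnn i)).
by apply: wspan_dsum => I; elim: i => // i IH /dec.
Qed.

End SpinSets.

Section OddChain.
Context {R : realType} {m : nat}.
Hypothesis m0 : (0 < m)%N.
Local Notation N := (true + (m + m))%N.
Local Notation B := (ext_wb (R := R) (m := m)).
Local Notation spin := (@spin_rep R true m).

Lemma odd_chain : exists (E : nat -> rootDatum R N) (s : nat -> nat),
  [/\ is_chain E s m.-1,
      forall j, (j + 2 <= m + true)%N -> E j = so_bdi R true m (m - j) /\ s j = 1%N,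
      forall j, (0 < j < m)%N -> chain_alg E s j = so_block R true m (m - j)
    & forall e, exists Vp Vm,
        chain_minimal E s m.-1 spin (wspan B (spin_set (b := true) e m)) Vp Vm /\
        forall j, (0 < j < m)%N ->
          Vp j = wspan B (spin_set (b := true) e (m - j)) /\
          is_dsum (wspan B (spin_set (b := true) e m)) (Vp j) (W_minus Vm j)].
Proof.
pose E i : rootDatum R N := so_bdi R true m (m - i); pose s (_ : nat) := 1%N.
have pm i : (m - i <= m)%N by lia.
have pb i : (i < m)%N -> (2 <= m - i + true)%N by rewrite /=; lia.
have ad i (im : (i < m)%N) := so_bdi_adapted (R := R) (pm i) (pb i im).
have rk i : (i < m)%N -> (1 <= 1 <= rnk (E i))%N by rewrite /=; lia.
have ch : is_chain E s m.-1.
  split=> [|i im]; first exact: (ad_well_formed (ad 0%N m0)).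
  have im' : (i < m)%N by lia.
  split; first exact: (so_bdi_noncompact (pm i) (pb i im')).
  by rewrite /E subnS; apply: so_bdi_semisimple_part => //=; lia.
exists E, s; split=> //.
- move=> j /andP[j0 jm]; have jl : (0 < j <= m.-1)%N by lia.
  pose om i : 'M[R[i]]_N := bdi_cow (b := true) (m - i) 1.
  have t1 i : (i < m.-1)%N -> tor (E i) (om i).
    move=> im; have im' : (i < m)%N by lia.
    exact: (ad_cow_tor (ad i im') (rk i im')).
  have t2 i : (i < m.-1)%N -> k_phi (E i) (s i) = [set X | alg (E i) X /\ lie (om i) X = 0].
    move=> im; have im' : (i < m)%N by lia.
    exact: (ad_k_phi (ad i im') (rk i im')).
  have t3 i : (i < m.-1)%N -> z_phi (E i) (s i) = [set X | exists t : R, X = (t%:C)%C *: om i].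
    move=> im; have im' : (i < m)%N by lia.
    exact: (ad_z_phi (ad i im') (rk i im')).
  rewrite (chain_algE ch t1 t2 t3 jl).
  have com X := so_block_commute (b := true) X (ltnW jm) (fun i _ => isT).
  rewrite /E subn0; apply/seteqP; split=> X.
    by move=> [/so_bdi_full sX h]; apply/com; split; [exact: sX|exact: h].
  by move=> /com[sX h]; split; [exact/so_bdi_full|exact: h].
move=> e; pose T i : pred {set 'I_m} := spin_set (b := true) e (m - i).
have dec i I : T i.+1 I -> T i I by apply: spin_set_le; lia.
have [|Vp [Vm [cm eV ds]]] := spin_chain_minimal (E := E) (s := s) (l := m.-1) dec.
  move=> i im; have im' : (i < m)%N by lia.
  exists ('i / 2%:R); rewrite /T subnS; exact: (bdi_spin_minimal_split (pm i) (pb i im') e isT).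
have eT : T 0%N = spin_set (b := true) e m by rewrite /T subn0.
rewrite eT in cm ds; exists Vp, Vm; split; first exact: cm.
move=> j _; split; [exact: eV|exact: ds].
Qed.

End OddChain.

Section EvenChain.
Context {R : realType} {m : nat}.
Hypothesis m3 : (2 < m)%N.
Local Notation N := (false + (m + m))%N.
Local Notation B := (ext_wb (R := R) (m := m)).
Local Notation f := (so_frame (R := R) (b := false) (m := m)).
Local Notation spin := (@spin_rep R false m).
Implicit Types (u v : 'I_N) (X : 'M[R[i]]_N).

Let m2 : (2 <= m)%N. Proof. by lia. Qed.
Let ue := end_embedding (R := R) m2.
Let Esu p : rootDatum R N := mapD (end_in m2) (end_out m2) (suD R 2 p).
Let om i : 'M[R[i]]_N :=
  if (i < m.-1)%N then bdi_cow (m - i) 1 else end_in m2 (su_cow 2 1).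

(** The two last coweights come from the two su(2) factors of so(4). Together they separate the four
    weight vectors of the first two planes, so only diagonal entries are left there. *)
Lemma end_torus X u v : so_alg R N X -> tw f X u v != 0 ->
  so_rel 2 u v -> lie (om m.-2) X = 0 -> lie (om m.-1) X = 0 -> u = v.
Proof.
move=> sX Xuv ruv; rewrite /om ltnn (_ : (m.-2 < m.-1)%N); last by lia.
rewrite (_ : (m - m.-2)%N = 2%N); last by lia.
have pg : (2 <= 2 + false)%N by [].
have ad2 := so_bdi_adapted (R := R) m2 pg.
have ad' := su_adapted ue (isT : (0 < 2)%N) (leqnn 2).
move=> /(ad_tor_commute X ad2 (ad_cow_tor ad2 (isT : (1 <= 1 <= 2)%N)))/(_ u v Xuv) e1.
move=> /(ad_tor_commute X ad' (ad_cow_tor ad' (isT : (1 <= 1 <= 2.-1)%N)))/(_ u v Xuv).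
have := end_rel_wt m2 ruv e1; rewrite /su_rel.
case eu: (end_kd m2 u) => [[a s]|] //; case ev: (end_kd m2 v) => [[c t]|] // /and3P[/eqP st am cm].
rewrite -st in ev *; move/(su_cow_wt_eq ue (isT : (0 < 2)%N) (leqnn 2) eu ev (isT : (1 <= 2)%N) am cm) => h.
apply: (ue_inj ue eu); rewrite ev; congr (Some (_, _)).
by move: h; case: (ord2P a) => ->; case: (ord2P c) => ->.
Qed.

Lemma end_block_commute X : so_block R false m 1 X <->
  so_alg R N X /\ forall i, (i < m)%N -> lie (om i) X = 0.
Proof.
have pg : (2 <= 2 + false)%N by [].
have j2 : (m - m.-2)%N = 2%N by lia.
have g i : (i < m.-2)%N -> false || (2 < m - i)%N by rewrite /=; lia.
have com := so_block_commute X (leq_trans (leq_pred _) (leq_pred m)) g.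
rewrite so_blockP; split=> -[sX hX]; split=> //.
  have diag u v : tw f X u v != 0 -> u = v.
    move=> Xuv; have [/andP[hu hv]|//] := hX u v Xuv.
    have /so_algP[_ st] := sX; apply/eqP; apply: contraNT Xuv => uv; apply/eqP.
    apply: (star_sym_nz st); rewrite negbK; apply/and3P; split=> //; last by rewrite /= mulr1.
    apply/eqP/so_kd_inj; rewrite so_kd_star; move: hu hv uv; rewrite !in_planes_kd.
    case eu: (so_kd u) => [[k s]|]; last first.
      by move: eu; rewrite /so_kd; case: (fintype.split u) => // -[].
    case ev: (so_kd v) => [[l t]|]; last first.
      by move: ev; rewrite /so_kd; case: (fintype.split v) => // -[].
    move=> k1 l1 uv /=; have kl : k = l by apply: val_inj => /=; lia.
    rewrite -kl; congr (Some (_, _)).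
    have : s != t by apply: contra uv => /eqP st'; apply/eqP/so_kd_inj; rewrite eu ev kl st'.
    by case: s t {eu ev} => [] [].
  move=> i im; rewrite /om; case: ifP => i1.
    have pb : (2 <= m - i + false)%N by lia.
    have ad := so_bdi_adapted (R := R) (leq_subr i m) pb.
    apply/(ad_tor_commute X ad); last by move=> u v /diag ->.
    by apply: (ad_cow_tor ad); rewrite /=; lia.
  have ad' := su_adapted ue (isT : (0 < 2)%N) (leqnn 2).
  apply/(ad_tor_commute X ad'); last by move=> u v /diag ->.
  exact: (ad_cow_tor ad' (isT : (1 <= 1 <= 2.-1)%N)).
have /com : so_alg R N X /\ forall i, (i < m.-2)%N -> lie (bdi_cow (b := false) (m := m) (m - i) 1) X = 0.
  split=> // i im; have im' : (i < m)%N by lia.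
  by have := hX i im'; rewrite /om (_ : (i < m.-1)%N) //; lia.
rewrite j2 => /so_blockP[_ h] u v Xuv; right; have [ruv|//] := h u v Xuv.
by apply: (end_torus sX Xuv ruv); apply: hX; lia.
Qed.

(** Up to so(4) one plane is split off at each step. The node 1 of so(4) leaves an su(2), whose node
    leaves the zero algebra su(1). The intermediate algebra between so(4) and so(2)^2 is skipped by
    the displayed chain, and the index jumps from m - 2 to m. *)
Lemma even_chain : exists (E : nat -> rootDatum R N) (s : nat -> nat),
  [/\ is_chain E s m,
      forall j, (j + 2 <= m + false)%N -> E j = so_bdi R false m (m - j) /\ s j = 1%N,
      forall j, (0 < j < m)%N ->
        chain_alg E s (if j == m.-1 then m else j) = so_block R false m (m - j)
    & forall e, exists Vp Vm,
        chain_minimal E s m spin (wspan B (spin_set (b := false) e m)) Vp Vm /\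
        forall j, (0 < j < m)%N ->
          Vp (if j == m.-1 then m else j) = wspan B (spin_set (b := false) e (m - j)) /\
          is_dsum (wspan B (spin_set (b := false) e m)) (Vp (if j == m.-1 then m else j))
            (W_minus Vm (if j == m.-1 then m else j))].
Proof.
pose E i : rootDatum R N := if (i < m.-1)%N then so_bdi R false m (m - i)
  else if i == m.-1 then Esu 2 else Esu 1.
pose s (_ : nat) := 1%N.
have pm i : (m - i <= m)%N by lia.
have pb i : (i < m.-1)%N -> (2 <= m - i + false)%N by lia.
have ad i (im : (i < m.-1)%N) := so_bdi_adapted (R := R) (pm i) (pb i im).
have ad' := su_adapted ue (isT : (0 < 2)%N) (leqnn 2).
have E1 i : (i < m.-1)%N -> E i = so_bdi R false m (m - i) by rewrite /E => ->.
have E2 : E m.-1 = Esu 2 by rewrite /E ltnn eqxx.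
have after i : (m.-1 < i)%N -> ((i < m.-1)%N = false) * ((i == m.-1) = false).
  by move=> h; split; lia.
have E3 : E m = Esu 1.
  have mm : (m.-1 < m)%N by lia.
  by rewrite /E !(after _ mm).
have om1 i : (i < m.-1)%N -> om i = bdi_cow (m - i) 1 by rewrite /om => ->.
have om2 : om m.-1 = end_in m2 (su_cow 2 1) by rewrite /om ltnn.
have rk i : (i < m.-1)%N -> (1 <= 1 <= rnk (so_bdi R false m (m - i)))%N by rewrite /=; lia.
have rk' : (1 <= 1 <= rnk (Esu 2))%N by [].
have cases i : (i < m)%N -> (i < m.-1)%N \/ i = m.-1 by lia.
have i0 : (0 < m.-1)%N by lia.
have ch : is_chain E s m.
  split=> [|i /cases[im|->]]; first by rewrite (E1 _ i0); exact: (ad_well_formed (ad 0%N i0)).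
    rewrite (E1 i im); split; first exact: (so_bdi_noncompact (pm i) (pb i im)).
    have [im'|im'] := ltnP i.+1 m.-1.
      by rewrite (E1 _ im') subnS; apply: so_bdi_semisimple_part => //=; lia.
    have -> : i.+1 = m.-1 by lia.
    by rewrite E2 (_ : (m - i)%N = 2%N); [exact: end_semisimple_part|lia].
  rewrite E2 prednK; last by lia.
  rewrite E3; split; first exact: (su_noncompact ue (isT : (0 < 2)%N) (leqnn 2) (isT : (1 <= 1 <= 2.-1)%N)).
  exact: (su_semisimple_part ue (isT : (2 <= 2 <= 2)%N)).
exists E, s; split=> //.
- by move=> j hj; rewrite E1 //; lia.
- have cA i : (0 < i <= m)%N -> chain_alg E s i =
      [set X | alg (E 0%N) X /\ forall j, (j < i)%N -> lie (om j) X = 0].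
    apply: (chain_algE ch); move=> i' /cases[im|->].
    + by rewrite (E1 _ im) (om1 _ im); exact: (ad_cow_tor (ad i' im) (rk i' im)).
    + by rewrite E2 om2; exact: (ad_cow_tor ad' rk').
    + by rewrite (E1 _ im) (om1 _ im); exact: (ad_k_phi (ad i' im) (rk i' im)).
    + by rewrite E2 om2; exact: (ad_k_phi ad' rk').
    + by rewrite (E1 _ im) (om1 _ im); exact: (ad_z_phi (ad i' im) (rk i' im)).
    + by rewrite E2 om2; exact: (ad_z_phi ad' rk').
  move=> j /andP[j0 jm]; have [ej|nj] := eqVneq j m.-1.
    rewrite cA; last by lia.
    rewrite (_ : (m - j)%N = 1%N); last by lia.
    rewrite (E1 _ i0) subn0; apply/seteqP; split=> X.
      by move=> [/so_bdi_full sX h]; apply/end_block_commute.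
    by move=> /end_block_commute[sX h]; split=> //; exact/so_bdi_full.
  have jm' : (j < m.-1)%N by lia.
  have g i : (i < j)%N -> false || (2 < m - i)%N by rewrite /=; lia.
  have com X := so_block_commute X (ltnW jm) g.
  rewrite cA; last by lia.
  rewrite (E1 _ i0) subn0; apply/seteqP; split=> X.
    move=> [/so_bdi_full sX h]; apply/com; split; first exact: sX.
    by move=> i ij; rewrite -om1; [exact: h|lia].
  move=> /com[sX h]; split; first exact/so_bdi_full.
  by move=> i ij; rewrite om1; [exact: h|lia].
move=> e; pose T i : pred {set 'I_m} := if (i < m.-1)%N then spin_set (b := false) e (m - i)
  else if i == m.-1 then end_set e else spin_set (b := false) e 1.
have T1 i : (i < m.-1)%N -> T i = spin_set (b := false) e (m - i) by rewrite /T => ->.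
have T2 : T m.-1 = end_set e by rewrite /T ltnn eqxx.
have T3 i : (m.-1 < i)%N -> T i = spin_set (b := false) e 1.
  by move=> h; rewrite /T !(after _ h).
have dec i I : T i.+1 I -> T i I.
  have [im|im] := ltnP i.+1 m.-1.
    by rewrite (T1 _ im) T1; [apply: spin_set_le; lia|lia].
  have [im'|im'] := ltnP i m.-1.
    have -> : i.+1 = m.-1 by lia.
    rewrite T2 T1 // (_ : (m - i)%N = 2%N); last by lia.
    by rewrite /end_set; case: (e) => //; apply: spin_set_le.
  rewrite T3 //; have [->|ni] := eqVneq i m.-1; last by rewrite T3 //; lia.
  by rewrite T2 /end_set; case: (e) => //; apply: spin_set_le.
have [|Vp [Vm [cm eV ds]]] := spin_chain_minimal (E := E) (s := s) (l := m) dec.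
  move=> i /cases[im|->]; last first.
    rewrite E2 T2 T3; last by lia.
    by eexists; exact: (end_spin_minimal m2 e).
  rewrite (E1 _ im) (T1 _ im); have [im'|im'] := ltnP i.+1 m.-1.
    rewrite (T1 _ im') subnS; eexists.
    by apply: (bdi_spin_minimal_split (pm i) (pb i im) e); rewrite /=; lia.
  have e2 : (m - i)%N = 2%N by lia.
  have -> : i.+1 = m.-1 by lia.
  rewrite T2 e2; eexists; exact: (bdi_spin_minimal_four m2 (isT : (2 <= 2 + false)%N) e isT erefl).
rewrite (T1 _ i0) subn0 in cm ds; exists Vp, Vm; split; first exact: cm.
move=> j /andP[j0 jm]; split; last exact: ds.
rewrite eV; have [->|nj] := eqVneq j m.-1; last by rewrite T1 //; lia.
by rewrite T3; [congr (wspan _ (spin_set _ _)); lia|lia].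
Qed.

End EvenChain.

(** The index function is abstracted so that the two parities of the dimension can be separated
    before it is unfolded. *)
Lemma spin_chain (R : realType) (b : bool) (m : nat) (idx : nat -> nat) :
  b || (2 < m)%N -> (0 < m)%N -> (forall j, idx j = if b then j else if j == m.-1 then m else j) ->
  exists (E : nat -> rootDatum R (b + (m + m))) (s : nat -> nat),
  [/\ is_chain E s (idx m.-1),
      forall j, (j + 2 <= m + b)%N -> E j = so_bdi R b m (m - j) /\ s j = 1%N,
      forall j, (0 < j < m)%N -> chain_alg E s (idx j) = so_block R b m (m - j)
    & forall e, exists Vp Vm,
        chain_minimal E s (idx m.-1) (@spin_rep R b m)
          (wspan (ext_wb (R := R) (m := m)) (spin_set (b := b) e m)) Vp Vm /\
        forall j, (0 < j < m)%N ->
          Vp (idx j) = wspan (ext_wb (R := R) (m := m)) (spin_set (b := b) e (m - j)) /\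
          is_dsum (wspan (ext_wb (R := R) (m := m)) (spin_set (b := b) e m)) (Vp (idx j))
            (W_minus Vm (idx j))].
Proof.
move=> + m0 hidx; have -> : idx = (fun j => if b then j else if j == m.-1 then m else j).
  by apply/funext.
case: b {hidx} => [_|m3]; first exact: odd_chain.
by have := even_chain (R := R) m3; rewrite eqxx.
Qed.

Lemma typeBDI_minimal (R : realType) (n m : nat) (b : bool) :
  (0 < n)%N -> n != 2%N -> (n + 2 = b + (m + m))%N ->
  let N := (b + (m + m))%N in
  let D := so_bdi R b m in
  let spin := @spin_rep R b m in
  let Wp j := ext_first R m (m - j) in
  let h j := so_block R b m (m - j) in
  [/\ hermitian_pair (D m) 1 (h 1%N),
      ~ is_phi_minimal (D m) 1 (@std_rep R N) fullv,
      is_dsum fullv (Wp 1%N) (ext_last R m) /\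
      (forall U, spin_component b U ->
         phi_minimal (D m) 1 spin U (Wp 1%N :&: U)%VS (ext_last R m :&: U)%VS ('i / 2%:R)),
      rep_iso (h 1%N) spin (Wp 1%N) (spin_char 1 ('i / 2%:R)) /\
      rep_iso (h 1%N) spin (ext_last R m) (spin_char 1 (- ('i / 2%:R)))
    & forall j, (0 < j < m)%N -> rep_iso (h j) spin (Wp j) (spin_char j ('i / 2%:R))]
  /\
  (forall j, (j + 2 <= m + b)%N -> forall U, spin_component b U ->
     is_phi_minimal (D (m - j)%N) 1 spin (Wp j :&: U)%VS)
  /\
  let idx (j : nat) := if b then j else if j == m.-1 then m else j in
  exists (E : nat -> rootDatum R N) (s : nat -> nat),
    [/\ is_chain E s (idx m.-1),
        forall j, (j + 2 <= m + b)%N -> E j = D (m - j)%N /\ s j = 1%N,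
        forall j, (0 < j < m)%N -> chain_alg E s (idx j) = h j
      & forall U, spin_component b U -> exists Vp Vm,
          chain_minimal E s (idx m.-1) spin U Vp Vm /\
          forall j, (0 < j < m)%N ->
            Vp (idx j) = (Wp j :&: U)%VS /\ is_dsum U (Vp (idx j)) (W_minus Vm (idx j))].
Proof.
move=> n0 n2 hN N D spin Wp h.
have m0 : (0 < m)%N by move: hN; case: (b) => /=; lia.
(* The condition that n is not 2 excludes so(4), where the node 1 would be a spinor node. *)
have g : b || (2 < m)%N by move: hN; case: (b) => //= hN; lia.
have pb : (2 <= m + b)%N by move: g; case: (b) => /=; lia.
split; first split.
- exact: so_bdi_hermitian.
- exact: so_std_not_minimal.
- split; first exact: ext_dsum.
  move=> U /spin_componentP[e ->].
  have q1 := ext_first_cap (R := R) (b := b) e (leq_subr 1 m).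
  have q2 := ext_last_cap (R := R) (b := b) e m0.
  rewrite /Wp q1 q2 subn1; exact: bdi_spin_minimal_split (leqnn m) pb e g.
- by split; [exact: spin_first_iso|exact: spin_last_iso].
- by move=> j _; exact: spin_first_iso.
split.
  move=> j hj U /spin_componentP[e ->].
  have q1 := ext_first_cap (R := R) (b := b) e (leq_subr j m).
  rewrite /Wp q1; apply: spin_node_minimal; first exact: leq_subr.
  by move: hj; case: (b) => /=; lia.
move=> idx; have [E [s [h1 h2 h3 h4]]] := @spin_chain R b m idx g m0 (fun _ => erefl).
exists E, s; split; [exact: h1|exact: h2|exact: h3|move=> U /spin_componentP[e ->]].
have [Vp [Vm [cm hj]]] := h4 e; exists Vp, Vm; split; first exact: cm.
move=> j jm; have [eV ds] := hj j jm; split; last exact: ds.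
by rewrite eV /Wp (ext_first_cap (R := R) (b := b) e (leq_subr j m)).
Qed.

Theorem mainTheorem4 (R : realType) :
  (* AIII *)
  ((forall k l : nat, (0 < k)%N -> (0 < l)%N ->
      let D := suD R (k + l) (k + l) in
      hermitian_pair D k (s_uu R k l) /\
      exists Vp Vm,
        [/\ phi_minimal D k (@std_rep R (k + l)) fullv Vp Vm
              ('i * (l%:R / (k + l)%:R)),
            rep_iso (s_uu R k l) (@std_rep R (k + l)) Vp
              (fun X => std_rep (ulsubmx X))
          & rep_iso (s_uu R k l) (@std_rep R (k + l)) Vm
              (fun X => std_rep (drsubmx X))])
   /\
   (forall n : nat, (2 <= n)%N ->
      let D i := suD R n (n - i) in
      let s i := (n - 1 - i)%N in
      [/\ is_chain D s n.-1,
          forall i, (0 < i < n)%N -> chain_alg D s i = su_block R n (n - i)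
        & exists Vp Vm,
          [/\ chain_minimal D s n.-1 (@std_rep R n) fullv Vp Vm,
              forall i, (0 < i < n)%N ->
                [/\ is_dsum fullv (Vp i) (W_minus Vm i),
                    Vp i = first_coords R n (n - i)
                  & rep_iso (su_block R n (n - i)) (@std_rep R n) (Vp i)
                      (fun X => std_rep (ul_block i X))]
            & forall i, (0 < i < n.-1)%N ->
                is_phi_minimal (D i) (n - 1 - i) (@std_rep R n) (Vp i)]]))
  /\
  (* BDI *)
  (forall (n m : nat) (b : bool), (0 < n)%N -> n != 2%N -> (n + 2 = b + (m + m))%N ->
     let N := (b + (m + m))%N in
     let D := so_bdi R b m in
     let spin := @spin_rep R b m in
     let Wp j := ext_first R m (m - j) in
     let h j := so_block R b m (m - j) in
     [/\ hermitian_pair (D m) 1 (h 1%N),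
         ~ is_phi_minimal (D m) 1 (@std_rep R N) fullv,
         is_dsum fullv (Wp 1%N) (ext_last R m) /\
         (forall U, spin_component b U ->
            phi_minimal (D m) 1 spin U (Wp 1%N :&: U)%VS (ext_last R m :&: U)%VS
              ('i / 2%:R)),
         rep_iso (h 1%N) spin (Wp 1%N) (spin_char 1 ('i / 2%:R)) /\
         rep_iso (h 1%N) spin (ext_last R m) (spin_char 1 (- ('i / 2%:R)))
       & forall j, (0 < j < m)%N ->
           rep_iso (h j) spin (Wp j) (spin_char j ('i / 2%:R))]
     /\
     (* so(2p + b) is semisimple for p = m - j as long as 2 <= p + b *)
     (forall j, (j + 2 <= m + b)%N -> forall U, spin_component b U ->
        is_phi_minimal (D (m - j)%N) 1 spin (Wp j :&: U)%VS)
     /\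
     (* The inclusion so(4) > so(2)^2 closing the even chain is obtained from two
        successive non compact roots of so(4) = su(2) + su(2), so that the chain
        index of the last algebra so(2)^m is m, and not m - 1 *)
     let idx (j : nat) := if b then j else if j == m.-1 then m else j in
     exists (E : nat -> rootDatum R N) (s : nat -> nat),
       [/\ is_chain E s (idx m.-1),
           forall j, (j + 2 <= m + b)%N -> E j = D (m - j)%N /\ s j = 1%N,
           forall j, (0 < j < m)%N -> chain_alg E s (idx j) = h j
         & forall U, spin_component b U -> exists Vp Vm,
             chain_minimal E s (idx m.-1) spin U Vp Vm /\
             forall j, (0 < j < m)%N ->
               Vp (idx j) = (Wp j :&: U)%VS /\
               is_dsum U (Vp (idx j)) (W_minus Vm (idx j))])
  /\
  (* DIII *)
  (forall n : nat, (3 <= n)%N ->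
     let std := @std_rep R (n + n) in
     let D := unchain (so_diii R n) u_to_so so_to_u in
     let s := unchain_root n in
     hermitian_pair (so_diii R n) n (u_to_so @` u_alg R n) /\
     (exists Vm, phi_minimal (so_diii R n) n std fullv (limg diii_incl) Vm
        ('i / 2%:R)) /\
     rep_iso (u_to_so @` u_alg R n) std (limg diii_incl)
       (fun X => std_rep (so_to_u X)) /\
     [/\ is_chain D s n,
         forall i, (i < n)%N ->
           chain_alg D s i.+1 = u_to_so @` u_block R n (n - i)
       & exists Vp Vm,
         [/\ chain_minimal D s n std fullv Vp Vm,
             forall i, (i < n)%N ->
               [/\ is_dsum fullv (Vp i.+1) (W_minus Vm i.+1),
                   Vp i.+1 = (diii_incl @: first_coords R n (n - i))%VS
                 & rep_iso (u_to_so @` u_block R n (n - i)) std (Vp i.+1)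
                     (fun X => std_rep (ul_block i (so_to_u X)))]
           & forall i, (i < n.-1)%N ->
               is_phi_minimal (D i.+1) (n - i - 1) std (Vp i.+1)]])
  /\
  (* CI *)
  (forall n : nat, (1 <= n)%N ->
     let std := @std_rep R (n + n) in
     let D := unchain (spD R n) u_to_sp sp_to_u in
     let s := unchain_root n in
     hermitian_pair (spD R n) n (u_to_sp @` u_alg R n) /\
     (exists Vm, phi_minimal (spD R n) n std fullv (limg ci_incl) Vm
        ('i / 2%:R)) /\
     rep_iso (u_to_sp @` u_alg R n) std (limg ci_incl)
       (fun X => std_rep (sp_to_u X)) /\
     [/\ is_chain D s n,
         forall i, (i < n)%N ->
           chain_alg D s i.+1 = u_to_sp @` u_block R n (n - i)
       & exists Vp Vm,
         [/\ chain_minimal D s n std fullv Vp Vm,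
             forall i, (i < n)%N ->
               [/\ is_dsum fullv (Vp i.+1) (W_minus Vm i.+1),
                   Vp i.+1 = (ci_incl @: first_coords R n (n - i))%VS
                 & rep_iso (u_to_sp @` u_block R n (n - i)) std (Vp i.+1)
                     (fun X => std_rep (ul_block i (sp_to_u X)))]
           & forall i, (i < n.-1)%N ->
               is_phi_minimal (D i.+1) (n - i - 1) std (Vp i.+1)]]).
Proof.
split; first by split; [exact: typeA_hermitian|exact: typeA_chain].
split; first exact: typeBDI_minimal.
by split=> n n_ge; [exact: (@typeDIII_minimal R n n_ge)|exact: (@typeCI_minimal R n n_ge)].
Qed.
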